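(* Let $m\ge 1$, $T>0$, let $\nu_1\ge\nu_2\ge\dots\ge\nu_m>0$ be real numbers with $\nu_q\notin\mathbb N$ for all $q$, let $\omega=\mathrm{diag}\{\omega_1,\dots,\omega_m\}$ with $\omega_q=\nu_q^2-\tfrac14$, and let $Q(x)$ be an $m\times m$ matrix function such that $x^{1-2\nu_1}Q(x)$ is integrable on $(0,T)$. Put $\beta:=\min\{1,2\nu_1\}$. Consider the equation $$-Y''+\Big(\frac{\omega}{x^2}+Q(x)\Big)Y=\lambda Y,\quad x\in(0,T),\qquad \lambda=\rho^2 .$$ For $\rho^*>0$ let $\Omega_0=\{\rho:\arg\rho\in(0,\pi/2),\ |\rho|>\rho^*\}$ and $\Omega_{-1}=\{\rho:\arg\rho\in(-\pi/2,0),\ |\rho|>\rho^*\}$. Then, for sufficiently large $\rho^*$, in each fixed sector $\Omega_{k_0}$ ($k_0\in\{0,-1\}$) there exist $m\times m$ matrix functions $Y_k(x,\rho)$, $k=1,2$, whose columns form a fundamental system of solutions of the equation and which satisfy the following conditions: ($i_1$) For each fixed $x\in(0,T)$, the matrix functions $Y_k^{(r)}(x,\rho)$, $k=1,2$, $r=0,1$, are analytic in $\rho\in\Omega_{k_0}$ and continuous in $\overline{\Omega_{k_0}}$. ($i_2$) For $x\in(0,T]$, $\rho\in\overline{\Omega_{k_0}}$, $|\rho x|\ge 1$, $r=0,1$, the following asymptotic formulas are valid: $$Y_1^{(r)}(x,\rho)=(i\rho)^{r}\exp(i\rho x)\big(I+O(\rho^{-\beta})\big),\qquad Y_2^{(r)}(x,\rho)=(-i\rho)^{r}\exp(-i\rho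 x)\big(I+O(\rho^{-\beta})\big),\qquad |\rho|\to\infty.$$
   Context: $\mathbb N=\{1,2,\dots\}$; $I$ is the $m\times m$ identity matrix; the superscript $(r)$ denotes the $r$-th derivative in $x$; $\overline{\Omega_{k_0}}$ is the closure of $\Omega_{k_0}$. $O(\rho^{-\beta})$ denotes an $m\times m$ matrix whose norm (maximum modulus of the entries) is $O(|\rho|^{-\beta})$. *)

(* Defs.v *)
From HB Require Import structures.
From mathcomp Require Import all_boot all_order all_algebra.
From mathcomp Require Import complex.
From mathcomp Require Import all_classical all_reals all_analysis.

Set Implicit Arguments.
Unset Strict Implicit.
Unset Printing Implicit Defensive.

Import Order.TTheory GRing.Theory Num.Theory.
Import numFieldNormedType.Exports.
Local Open Scope classical_set_scope.
Local Open Scope ring_scope.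
Local Open Scope complex_scope.

(* R[i] under a name whose head is a [numClosedFieldType], so that the topology
   and the norm which the library puts on every [numFieldType] are inferred. *)
Definition Cplx (R : realType) : numClosedFieldType := R[i].

Section Defs.
Context {R : realType}.
Local Notation C := (Cplx R).
Implicit Types (x T : R) (z rho lam : C).

Definition toC x : C := x%:C.

Definition imunit : C := 'i%C.

Definition cexp z : C :=
  toC (expR (complex.Re z)) * (cos (complex.Im z) +i* sin (complex.Im z)).

(* [xderiv D f x L]: the matrix function [f] of a real variable has derivative
   [L] at [x], with difference quotients taken inside [D].  For [x] interior to
   [D] this is the ordinary derivative; for D = ]0, T] and x = T it is the
   left derivative. *)
Definition xderiv (m n : nat) (D : set R) (f : R -> 'M[C]_(m, n)) x
    (L : 'M[C]_(m, n)) : Prop :=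
  forall i j,
    (fun h : R => toC h^-1 * (f (x + h) i j - f x i j)) @
      within [set h | D (x + h)] (0 : R)^' --> L i j.

Definition abs_continuous (a b : R) (f : R -> C) : Prop :=
  forall e : R, 0 < e -> exists2 d : R, 0 < d &
    forall (n : nat) (u v : 'I_n -> R),
      (forall i, a <= u i /\ u i <= v i /\ v i <= b) ->
      trivIset [set: 'I_n] (fun i => `]u i, v i[%classic) ->
      \sum_i (v i - u i) < d ->
      \sum_i `|f (v i) - f (u i)| < toC e.

(* Solutions of - y'' + (omega / x^2 + Q(x)) y = lam y on ]0, T[ in the sense of
   Caratheodory, as Q is only integrable: y' is locally absolutely continuous
   and the equation holds almost everywhere.  Values of [y] outside ]0, T[ are
   irrelevant. *)
Definition is_solution (m : nat) T (omega : 'M[C]_m) (Q : R -> 'M[C]_m) lam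
    (y : R -> 'cV[C]_m) : Prop :=
  exists dy : R -> 'cV[C]_m,
  [/\ forall x, x \in `]0, T[ -> xderiv `]0, T[ y x (dy x),
      forall a b : R, 0 < a -> a < b -> b < T ->
        forall i, abs_continuous a b (fun x => dy x i 0) &
      {ae (@lebesgue_measure R), forall x, x \in `]0, T[ ->
        exists2 ddy : 'cV[C]_m, xderiv `]0, T[ dy x ddy &
          - ddy + (toC (x ^- 2) *: omega + Q x) *m y x = lam *: y x}].

(* The columns of [Y] form a basis of the space of solutions on ]0, T[. *)
Definition fundamental_system (m n : nat) T (omega : 'M[C]_m)
    (Q : R -> 'M[C]_m) lam (Y : R -> 'M[C]_(m, n)) : Prop :=
  [/\ forall j, is_solution T omega Q lam (fun x => col j (Y x)),
      forall c : 'cV[C]_n,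
        (forall x, x \in `]0, T[ -> Y x *m c = 0) -> c = 0 &
      forall y, is_solution T omega Q lam y ->
        exists c : 'cV[C]_n, forall x, x \in `]0, T[ -> y x = Y x *m c].

Definition cintegrable (D : set R) (f : R -> C) : Prop :=
  (@lebesgue_measure R).-integrable D (EFin \o (fun x => complex.Re (f x))) /\
  (@lebesgue_measure R).-integrable D (EFin \o (fun x => complex.Im (f x))).

(* { rho : arg rho in (k0 pi/2, (k0 + 1) pi/2), |rho| > rhos }, in polar form. *)
Definition sector (k0 : int) (rhos : R) : set C :=
  [set rho | exists r theta : R,
    [/\ rhos < r, k0%:~R * (pi / 2) < theta < (k0 + 1)%:~R * (pi / 2) &
        rho = toC r * (cos theta +i* sin theta)]].

Definition analytic_on (D : set C) (f : C -> C) : Prop :=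
  forall z, D z -> derivable (f : C -> C^o) z 1.

(* Y^(r)(x, rho) = (c rho)^r exp(c rho x) (I + O(rho^(-beta))) as |rho| -> oo,
   for x in (0, T], rho in D, |rho x| >= 1.  The constant of the O-term is
   uniform for x in [x0, T], for every x0 in (0, T]; it cannot be uniform over
   the whole region |rho x| >= 1, since the correction coming from omega / x^2
   has size 1 / |rho x|.  [Y r] stands for Y^(r), and the norm of [E], which the
   library defines as the maximum of the moduli of the entries, lives in C. *)
Definition exp_asymptotics (m : nat) T (beta : R) (D : set C) (c : C)
    (Y : nat -> R -> C -> 'M[C]_m.+1) (r : nat) : Prop :=
  forall x0 : R, x0 \in `]0, T] ->
  exists K rho1 : R, forall (x : R) (rho : C),
    x \in `[x0, T] -> D rho -> 1 <= `|rho * toC x| -> toC rho1 <= `|rho| ->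
    exists E : 'M[C]_m.+1,
      Y r x rho = ((c * rho) ^+ r * cexp (c * rho * toC x)) *: (1%:M + E) /\
      `|E| <= toC (K * complex.Re `|rho| `^ (- beta)).

End Defs.

(* Main.v *)
(* Each unperturbed scalar equation h'' = ((nu^2 - 1/4) / z^2 - 1) h has solutions
   h_s, s = +-1, on the closed right half plane without 0 with h_s(z) ~ exp(i s z)
   at infinity and h_s(z) = O(z^(1/2 - nu)) at 0.  They come from a Volterra
   equation on horizontal rays and an energy estimate near 0, so that no theory of
   Bessel functions enters.  Variation of constants turns the perturbed equation
   into Y(x) = h_s(rho x) + int G(x, t) Q(t) Y(t) dt, the integral being taken over
   the side of x on which |exp(i s rho t)| <= |exp(i s rho x)|.  In the sup norm
   with weight x^(1/2 - nu_1) |exp(i s rho x)| the operator has norm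
   O(|rho|^(-beta)), hence is a contraction for large rho and gives (i_2); second
   order expansions of the kernel in rho pass through the fixed point, and the
   solution is complex differentiable in rho relative to the closed quarter plane,
   which gives (i_1).

   Wronskians of a solution with solutions of the equation for the transpose of Q
   are absolutely continuous with derivative 0 almost everywhere, hence constant.
   For large rho the matrix of the Wronskians of the constructed solutions is close
   to an antidiagonal one, hence invertible; this yields both linear independence
   and completeness. *)
Require Import Defs.
From HB Require Import structures.
From mathcomp Require Import all_boot all_order all_algebra.
From mathcomp Require Import complex.
From mathcomp Require Import all_classical all_reals all_analysis.
From mathcomp Require Import measurable_realfun.
From mathcomp Require Import ring lra.

Set Implicit Arguments.
Unset Strict Implicit.
Unset Printing Implicit Defensive.

Import Order.TTheory GRing.Theory Num.Theory.
Import numFieldNormedType.Exports.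
Local Open Scope classical_set_scope.
Local Open Scope ring_scope.
Local Open Scope complex_scope.

(** As [Q] is only integrable, second derivatives exist almost everywhere only. Function and
    derivative are therefore separate unknowns, told apart by a boolean, of one integral system, and
    that the second is the derivative of the first is proved afterwards. Differentiability in [rho]
    cannot be read off the integral equation, because the unknown occurs on both sides. But
    difference quotients solve an equation with the same contraction, and a quadratic remainder
    makes two of them differ by [O(|h| + |h'|)], which is a Cauchy condition. All components share
    one weight although the [nu q] differ: [nu ord0] gives the worst singularity at 0. The exponent
    [beta] has this origin: in the weighted norm each of the two factors of the Green function grows
    like [|rho|^g] with [g = max 0 (1/2 - nu ord0)], the Wronskian contributes [1 / |rho|], and
    [2 g - 1 = - beta]. The transposed equation is forced by the lack of symmetry of [Q]: in the
    derivative of [sum (g' f - g f')] the terms with the potential cancel only if [g] is driven by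
    the transpose. *)

Lemma sum_bool_pair (V : nmodType) (J : finType) (F : bool * J -> V) :
  \sum_p F p = \sum_q F (true, q) + \sum_q F (false, q).
Proof.
transitivity (\sum_p F (p.1, p.2)); first by apply: eq_bigr; case.
by rewrite -(pair_bigA _ (fun b q => F (b, q))) /= big_bool.
Qed.

Lemma powRN_small (R : realType) (b d : R) : 0 < b -> 0 < d -> exists2 r1 : R, 1 <= r1 & forall r : R,
  r1 <= r -> r `^ (- b) <= d.
Proof.
move=> b0 d0; pose A := 1 + d^-1.
have di : 0 < d^-1 by rewrite invr_gt0.
have A1 : 1 <= A by rewrite lerDl ltW.
have A0 : 0 < A by lra.
exists (A `^ b^-1) => [|r rA].
  by rewrite -[leLHS](powRr0 A) ler_powR// invr_ge0 ltW.
have r0 : 0 < r by apply: lt_le_trans rA; exact: powR_gt0.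
have Ar : A <= r `^ b.
  rewrite -[A in A <= _]powRr1 ?(ltW A0)// -(mulVf (lt0r_neq0 b0)) powRrM.
  by apply: ge0_ler_powR; rewrite ?nnegrE ?powR_ge0 ?(ltW b0) ?(ltW r0).
rewrite powRN invf_ple ?posrE//; last exact: lt_le_trans Ar.
by apply: le_trans Ar; rewrite lerDr.
Qed.


(** * Real-valued modulus and the complex exponential *)

Section Modulus.
Context {R : realType}.
Local Notation C := (Cplx R).
Implicit Types (z w : C) (x y : R).

(** The norm of a complex number is itself an element of [C]. Its real part is used instead, so that
    estimates live in [R], where linear arithmetic is automatic. *)
Definition cm z : R := complex.Re `|z|.

Lemma cmE z : `|z| = toC (cm z).
Proof. by rewrite /cm /toC RRe_real // normr_real. Qed.

Lemma toC_inj : injective (@toC R).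
Proof. exact: complexI. Qed.
Lemma toC0 : toC (0 : R) = 0. Proof. by []. Qed.
Lemma toC1 : toC (1 : R) = 1. Proof. by []. Qed.
Lemma toCD x y : toC (x + y) = toC x + toC y.
Proof. exact: (rmorphD (real_complex R)). Qed.
Lemma toCN x : toC (- x) = - toC x.
Proof. exact: (rmorphN (real_complex R)). Qed.
Lemma toCB x y : toC (x - y) = toC x - toC y.
Proof. exact: (rmorphB (real_complex R)). Qed.
Lemma toCM x y : toC (x * y) = toC x * toC y.
Proof. exact: (rmorphM (real_complex R)). Qed.
Lemma toCV x : toC x^-1 = (toC x)^-1.
Proof. exact: (fmorphV (real_complex R)). Qed.
Lemma toCX x n : toC (x ^+ n) = toC x ^+ n.
Proof. exact: (rmorphXn (real_complex R)). Qed.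
Lemma toC_nat n : toC (n%:R : R) = n%:R.
Proof. exact: (rmorph_nat (real_complex R)). Qed.
Lemma toC_eq0 x : (toC x == 0) = (x == 0).
Proof. exact: (fmorph_eq0 (real_complex R)). Qed.
Lemma toC_le x y : (toC x <= toC y) = (x <= y).
Proof. exact: lecR. Qed.
Lemma toC_lt x y : (toC x < toC y) = (x < y).
Proof. exact: ltcR. Qed.

Lemma cm_ge0 z : 0 <= cm z.
Proof. by rewrite -toC_le -cmE normr_ge0. Qed.
Lemma cm0 : cm 0 = 0.
Proof. by apply: toC_inj; rewrite -cmE normr0. Qed.
Lemma cm1 : cm 1 = 1.
Proof. by apply: toC_inj; rewrite -cmE normr1. Qed.
Lemma cm_eq0 z : (cm z == 0) = (z == 0).
Proof. by rewrite -toC_eq0 -cmE normr_eq0. Qed.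
Lemma cm_gt0 z : (0 < cm z) = (z != 0).
Proof. by rewrite lt_def cm_eq0 cm_ge0 andbT. Qed.
Lemma cmM z w : cm (z * w) = cm z * cm w.
Proof. by apply: toC_inj; rewrite toCM -!cmE normrM. Qed.
Lemma cmV z : cm z^-1 = (cm z)^-1.
Proof. by apply: toC_inj; rewrite toCV -!cmE normfV. Qed.
Lemma cmX z n : cm (z ^+ n) = cm z ^+ n.
Proof. by apply: toC_inj; rewrite toCX -!cmE normrX. Qed.
Lemma cmN z : cm (- z) = cm z.
Proof. by apply: toC_inj; rewrite -!cmE normrN. Qed.
Lemma cmBC z w : cm (z - w) = cm (w - z).
Proof. by rewrite -cmN opprB. Qed.
Lemma cmD z w : cm (z + w) <= cm z + cm w.
Proof. by rewrite -toC_le toCD -!cmE ler_normD. Qed.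
Lemma cmB z w : cm (z - w) <= cm z + cm w.
Proof. by rewrite -(cmN w) cmD. Qed.
Lemma cmB3 z w u : cm (z - u) <= cm (z - w) + cm (w - u).
Proof. by have := cmD (z - w) (w - u); rewrite addrA subrK. Qed.
Lemma cm_ge z w : cm z - cm w <= cm (z - w).
Proof. by have := cmD (z - w) w; rewrite subrK; lra. Qed.
Lemma cm_toC x : cm (toC x) = `|x|.
Proof.
by apply: toC_inj; rewrite -cmE /toC normc_def /= expr0n addr0 sqrtr_sqr.
Qed.
Lemma cm_toC_ge0 x : 0 <= x -> cm (toC x) = x.
Proof. by move=> x0; rewrite cm_toC ger0_norm. Qed.
Lemma cm_nat n : cm (n%:R : C) = n%:R.
Proof. by rewrite -toC_nat cm_toC ger0_norm. Qed.
Lemma cm_sqr z : cm z ^+ 2 = complex.Re z ^+ 2 + complex.Im z ^+ 2.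
Proof. by apply: toC_inj; rewrite toCX -cmE /toC (add_Re2_Im2 z). Qed.
Lemma cm_Re z : `|complex.Re z| <= cm z.
Proof. by rewrite -toC_le -cmE; exact: normc_ge_Re. Qed.
Lemma cm_Im z : `|complex.Im z| <= cm z.
Proof.
rewrite -[leRHS]ger0_norm ?cm_ge0// -ler_sqr ?nnegrE// !real_normK ?num_real//.
by rewrite cm_sqr lerDr sqr_ge0.
Qed.
Lemma cm_leD z : cm z <= `|complex.Re z| + `|complex.Im z|.
Proof.
rewrite -ler_sqr ?nnegrE ?cm_ge0 ?addr_ge0// cm_sqr sqrrD !real_normK ?num_real//.
by rewrite lerD2r lerDl mulrn_wge0 ?mulr_ge0.
Qed.
Lemma cm_sum (I : Type) (r : seq I) (P : pred I) (F : I -> C) :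
  cm (\sum_(i <- r | P i) F i) <= \sum_(i <- r | P i) cm (F i).
Proof.
elim/big_rec2: _ => [|i y1 y2 _ IH]; first by rewrite cm0.
by rewrite (le_trans (cmD _ _))// lerD2l.
Qed.
Lemma cm_imunit : cm (@imunit R) = 1.
Proof.
by apply/eqP; rewrite -(eqrXn2 (n := 2))// ?cm_ge0// cm_sqr /= expr0n expr1n add0r.
Qed.
Lemma imunit2 : (@imunit R) ^+ 2 = -1.
Proof. exact: sqr_i. Qed.
Lemma ReCD z w : complex.Re (z + w) = complex.Re z + complex.Re w.
Proof. by case: z w => [a b] [c d]. Qed.
Lemma ImCD z w : complex.Im (z + w) = complex.Im z + complex.Im w.
Proof. by case: z w => [a b] [c d]. Qed.
Lemma ReCN z : complex.Re (- z) = - complex.Re z.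
Proof. by case: z. Qed.
Lemma ImCN z : complex.Im (- z) = - complex.Im z.
Proof. by case: z. Qed.
Lemma ReCM z w : complex.Re (z * w) =
  complex.Re z * complex.Re w - complex.Im z * complex.Im w.
Proof. by case: z w => [a b] [c d]. Qed.
Lemma ImCM z w : complex.Im (z * w) =
  complex.Re z * complex.Im w + complex.Im z * complex.Re w.
Proof. by case: z w => [a b] [c d]. Qed.
Lemma ReCZ x z : complex.Re (toC x * z) = x * complex.Re z.
Proof. by rewrite ReCM /= mul0r subr0. Qed.
Lemma ImCZ x z : complex.Im (toC x * z) = x * complex.Im z.
Proof. by rewrite ImCM /= mul0r addr0. Qed.
Lemma ReImE z : z = toC (complex.Re z) + imunit * toC (complex.Im z).
Proof. exact: complexE. Qed.
Lemma ReIm_inj z w : complex.Re z = complex.Re w -> complex.Im z = complex.Im w ->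
  z = w.
Proof. by case: z w => [a b] [c d] /= -> ->. Qed.
Lemma cm_small0 z : (forall e : R, 0 < e -> cm z <= e) -> z = 0.
Proof.
move=> h; apply/eqP; rewrite -cm_eq0; apply/eqP/le_anti; rewrite cm_ge0 andbT.
by apply/ler_addgt0Pr => e e0; rewrite add0r h.
Qed.

Lemma cexpD z w : cexp (z + w) = cexp z * cexp w.
Proof.
rewrite /cexp ReCD ImCD expRD toCM cosD sinD.
rewrite [RHS]mulrACA; congr (_ * _); apply: ReIm_inj; rewrite ?ReCM ?ImCM//=.
by rewrite addrC [sin _ * cos _]mulrC.
Qed.
Lemma cexp0 : cexp (0 : C) = 1.
Proof. by rewrite /cexp expR0 cos0 sin0 toC1 mul1r. Qed.
Lemma cm_cexp z : cm (cexp z) = expR (complex.Re z).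
Proof.
rewrite /cexp cmM cm_toC_ge0 ?expR_ge0// -[RHS]mulr1; congr (_ * _).
by apply/eqP; rewrite -(eqrXn2 (n := 2))// ?cm_ge0// cm_sqr /= cos2Dsin2 expr1n.
Qed.
Lemma cexp_neq0 z : cexp z != 0.
Proof. by rewrite -cm_gt0 cm_cexp expR_gt0. Qed.
Lemma cexpN z : cexp (- z) = (cexp z)^-1.
Proof.
apply: (mulfI (cexp_neq0 z)); rewrite -cexpD subrr cexp0.
by rewrite mulfV// cexp_neq0.
Qed.
End Modulus.

(** * Derivatives relative to a subset *)

Section RelDeriv.
Context {R : realType}.
Local Notation C := (Cplx R).

(* Derivative relative to [S], with [io] the embedding of the variable in C:
   [T] is R or C, so that complex derivatives along a subset of the plane and
   derivatives in a real variable follow the same rules. *)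
Definition gd (T : Type) (io : T -> C) (S : set T) (f : T -> C) (x : T) (L : C) :=
  forall e : R, 0 < e -> exists2 d : R, 0 < d & forall y, S y ->
    cm (io y - io x) < d -> cm (f y - f x - L * (io y - io x)) <= e * cm (io y - io x).

Definition gc (T : Type) (io : T -> C) (S : set T) (f : T -> C) (x : T) :=
  forall e : R, 0 < e -> exists2 d : R, 0 < d & forall y, S y ->
    cm (io y - io x) < d -> cm (f y - f x) <= e.

(** Dividing an epsilon by [c + 1] instead of [c] avoids a separate case for a vanishing factor; the
    rules below do this repeatedly. *)
Lemma div_succ_le (e c t : R) : 0 <= e -> 0 <= c -> 0 <= t ->
  c * (e / (c + 1) * t) <= e * t.
Proof.
move=> e0 c0 t0; rewrite mulrA ler_wpM2r// mulrCA ler_piMr//.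
by rewrite ler_pdivrMr ?mul1r ?lerDl ?ltr_wpDl.
Qed.

Section Rules.
Variables (T : Type) (io : T -> C).
Implicit Types (S : set T) (f g : T -> C).

Lemma gd_cst S (c : C) x : gd io S (fun=> c) x 0.
Proof.
move=> e e0; exists 1 => // y _ _; rewrite subrr mul0r subr0 cm0.
by rewrite mulr_ge0 ?cm_ge0// ltW.
Qed.

Lemma gd_io S x : gd io S io x 1.
Proof.
by move=> e e0; exists 1 => // y _ _; rewrite mul1r subrr cm0 mulr_ge0 ?cm_ge0// ltW.
Qed.

Lemma gd_eq S f x L L' : L = L' -> gd io S f x L -> gd io S f x L'.
Proof. by move=> ->. Qed.

Lemma gd_ext S f g x L : (forall y, S y -> f y = g y) -> f x = g x ->
  gd io S f x L -> gd io S g x L.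
Proof.
move=> fg fgx h e e0; have [d d0 H] := h e e0.
by exists d => // y Sy; rewrite -fg// -fgx; exact: H.
Qed.

Lemma gd_sub S S' f x L : S' `<=` S -> gd io S f x L -> gd io S' f x L.
Proof.
move=> SS h e e0; have [d d0 H] := h e e0.
by exists d => // y /SS; exact: H.
Qed.

Lemma gd_loc S S' f x L (r : R) : 0 < r ->
  (forall y, S' y -> cm (io y - io x) < r -> S y) -> gd io S f x L -> gd io S' f x L.
Proof.
move=> r0 SS h e e0; have [d d0 H] := h e e0.
exists (Num.min d r); first by rewrite lt_min d0.
by move=> y S'y; rewrite lt_min => /andP[yd yr]; apply: H => //; apply: SS.
Qed.

Lemma gd_lip S f x L : gd io S f x L -> exists2 d : R, 0 < d & forall y, S y ->
    cm (io y - io x) < d -> cm (f y - f x) <= (cm L + 1) * cm (io y - io x).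
Proof.
move=> h; have [d d0 H] := h 1 ltr01; exists d => // y Sy yd.
have := H y Sy yd; have := cmD (f y - f x - L * (io y - io x)) (L * (io y - io x)).
by rewrite subrK cmM; lra.
Qed.

Lemma gd_gc S f x L : gd io S f x L -> gc io S f x.
Proof.
move=> /gd_lip[d d0 H] e e0; exists (Num.min d (e / (cm L + 1))).
  by rewrite lt_min d0 divr_gt0// ltr_wpDl// cm_ge0.
move=> y Sy; rewrite lt_min => /andP[yd ye]; rewrite (le_trans (H y Sy yd))//.
by rewrite mulrC -ler_pdivlMr ?ltW// ltr_wpDl// cm_ge0.
Qed.

Lemma gc_bounded S f x : gc io S f x -> exists2 d : R, 0 < d & forall y, S y ->
  cm (io y - io x) < d -> cm (f y) <= cm (f x) + 1.
Proof.
move=> h; have [d d0 H] := h 1 ltr01; exists d => // y Sy yd.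
by have := cm_ge (f y) (f x); have := H y Sy yd; lra.
Qed.

Lemma gdD S f g x L M : gd io S f x L -> gd io S g x M ->
  gd io S (fun y => f y + g y) x (L + M).
Proof.
move=> hf hg e e0.
have [d1 d10 H1] := hf (e / 2) (divr_gt0 e0 (ltr0Sn _ _)).
have [d2 d20 H2] := hg (e / 2) (divr_gt0 e0 (ltr0Sn _ _)).
exists (Num.min d1 d2); first by rewrite lt_min d10.
move=> y Sy; rewrite lt_min => /andP[yd1 yd2].
have h1 := H1 y Sy yd1; have h2 := H2 y Sy yd2.
rewrite (_ : _ - _ - _ = (f y - f x - L * (io y - io x)) +
  (g y - g x - M * (io y - io x))); last by ring.
by rewrite (le_trans (cmD _ _))//; lra.
Qed.

Lemma gdZ S (c : C) f x L : gd io S f x L -> gd io S (fun y => c * f y) x (c * L).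
Proof.
move=> hf e e0.
have c0 : 0 < cm c + 1 by rewrite ltr_wpDl// cm_ge0.
have [d d0 H] := hf (e / (cm c + 1)) (divr_gt0 e0 c0).
exists d => // y Sy yd; have h := H y Sy yd.
rewrite (_ : _ - _ - _ = c * (f y - f x - L * (io y - io x))); last by ring.
rewrite cmM; apply: (le_trans (ler_wpM2l (cm_ge0 _) h)).
by rewrite div_succ_le ?cm_ge0// ltW.
Qed.

Lemma gdN S f x L : gd io S f x L -> gd io S (fun y => - f y) x (- L).
Proof.
move=> h; apply: (gd_eq (mulN1r L)).
by apply: gd_ext (gdZ (-1) h) => [y _|]; rewrite mulN1r.
Qed.

Lemma gdB S f g x L M : gd io S f x L -> gd io S g x M ->
  gd io S (fun y => f y - g y) x (L - M).
Proof. by move=> hf hg; apply: gdD => //; exact: gdN. Qed.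

Lemma gdM S f g x L M : gd io S f x L -> gd io S g x M ->
  gd io S (fun y => f y * g y) x (L * g x + f x * M).
Proof.
move=> hf hg e e0.
set A := cm (g x) + 1; set B := cm (f x) + 1; set K := cm L + 1.
have A0 : 0 < A by rewrite /A ltr_wpDl// cm_ge0.
have B0 : 0 < B by rewrite /B ltr_wpDl// cm_ge0.
have K0 : 0 < K by rewrite /K ltr_wpDl// cm_ge0.
have [d1 d10 H1] := hf (e / 3 / A) (divr_gt0 (divr_gt0 e0 (ltr0Sn _ _)) A0).
have [d2 d20 H2] := hg (e / 3 / B) (divr_gt0 (divr_gt0 e0 (ltr0Sn _ _)) B0).
have [d3 d30 H3] := gd_lip hf.
have [d4 d40 H4] := gd_gc hg (divr_gt0 (divr_gt0 e0 (ltr0Sn _ 2)) K0).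
exists (Num.min (Num.min d1 d2) (Num.min d3 d4)).
  by rewrite !lt_min d10 d20 d30.
move=> y Sy; rewrite !lt_min => /andP[/andP[yd1 yd2] /andP[yd3 yd4]].
have h1 := H1 y Sy yd1; have h2 := H2 y Sy yd2.
have h3 := H3 y Sy yd3; have h4 := H4 y Sy yd4.
rewrite (_ : _ - _ - _ = (f y - f x - L * (io y - io x)) * g x +
  f x * (g y - g x - M * (io y - io x)) + (f y - f x) * (g y - g x)); last by ring.
set t := cm (io y - io x) in h1 h2 h3 *.
have t0 : 0 <= t by exact: cm_ge0.
have e3 : 0 <= e / 3 by rewrite divr_ge0// ltW.
have q1 : cm ((f y - f x - L * (io y - io x)) * g x) <= e / 3 * t.
  by rewrite cmM (le_trans (ler_wpM2r (cm_ge0 _) h1))// mulrC div_succ_le ?cm_ge0.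
have q2 : cm (f x * (g y - g x - M * (io y - io x))) <= e / 3 * t.
  by rewrite cmM (le_trans (ler_wpM2l (cm_ge0 _) h2))// div_succ_le ?cm_ge0.
have q3 : cm ((f y - f x) * (g y - g x)) <= e / 3 * t.
  rewrite cmM (le_trans (ler_pM (cm_ge0 _) (cm_ge0 _) h3 h4))//.
  by rewrite (_ : K * t * (e / 3 / K) = e / 3 * t)//; field; rewrite gt_eqF.
have := cmD ((f y - f x - L * (io y - io x)) * g x +
  f x * (g y - g x - M * (io y - io x))) ((f y - f x) * (g y - g x)).
have := cmD ((f y - f x - L * (io y - io x)) * g x)
  (f x * (g y - g x - M * (io y - io x))).
by lra.
Qed.

Lemma gd_sum S (I : Type) (r : seq I) (P : pred I) (F : I -> T -> C) (L : I -> C) x :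
  (forall i, P i -> gd io S (F i) x (L i)) ->
  gd io S (fun y => \sum_(i <- r | P i) F i y) x (\sum_(i <- r | P i) L i).
Proof.
move=> h; elim: r => [|i r IH].
  rewrite big_nil; apply: gd_ext (gd_cst S 0 x) => [y _|]; by rewrite big_nil.
rewrite big_cons; case: ifPn => Pi.
  apply: gd_ext (gdD (h i Pi) IH) => [y _|]; by rewrite big_cons Pi.
by apply: gd_ext IH => [y _|]; rewrite big_cons (negbTE Pi).
Qed.

Lemma gc_ext S f g x : (forall y, S y -> f y = g y) -> f x = g x ->
  gc io S f x -> gc io S g x.
Proof.
move=> fg fgx H e e0; have [d d0 Hd] := H e e0.
by exists d => // y Sy yd; rewrite -fg// -fgx; exact: Hd.
Qed.

Lemma gc_sub S S' f x : S' `<=` S -> gc io S f x -> gc io S' f x.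
Proof. by move=> SS H e e0; have [d d0 Hd] := H e e0; exists d => // y /SS; exact: Hd. Qed.

Lemma gc_cst S (c : C) x : gc io S (fun=> c) x.
Proof. by move=> e e0; exists 1 => // y _ _; rewrite subrr cm0 ltW. Qed.

Lemma gcD S f g x : gc io S f x -> gc io S g x -> gc io S (fun y => f y + g y) x.
Proof.
move=> Hg Hh e e0; have [k1 k10 H1] := Hg _ (divr_gt0 e0 (ltr0Sn _ 1)).
have [k2 k20 H2] := Hh _ (divr_gt0 e0 (ltr0Sn _ 1)).
exists (Num.min k1 k2); first by rewrite lt_min k10.
move=> y Sy; rewrite lt_min => /andP[y1 y2].
rewrite (_ : _ - _ = (f y - f x) + (g y - g x)); last by ring.
by have := cmD (f y - f x) (g y - g x); have := H1 y Sy y1; have := H2 y Sy y2; lra.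
Qed.

Lemma gcM S f g x : gc io S f x -> gc io S g x -> gc io S (fun y => f y * g y) x.
Proof.
move=> Hg Hh e e0; have [k1 k10 H1] := gc_bounded Hh.
pose A := cm (g x) + 1; pose B := cm (f x) + 1.
have A0 : 0 < A by rewrite ltr_wpDl ?cm_ge0.
have B0 : 0 < B by rewrite ltr_wpDl ?cm_ge0.
have [k2 k20 H2] := Hg _ (divr_gt0 (divr_gt0 e0 (ltr0Sn _ 1)) A0).
have [k3 k30 H3] := Hh _ (divr_gt0 (divr_gt0 e0 (ltr0Sn _ 1)) B0).
exists (Num.min k1 (Num.min k2 k3)); first by rewrite !lt_min k10 k20.
move=> y Sy; rewrite !lt_min => /andP[y1 /andP[y2 y3]].
rewrite (_ : _ - _ = (f y - f x) * g y + f x * (g y - g x)); last by ring.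
have h1 := H1 y Sy y1; have h2 := H2 y Sy y2; have h3 := H3 y Sy y3.
apply: (le_trans (cmD _ _)); rewrite !cmM.
have e1 : cm (f y - f x) * cm (g y) <= e / 2 / A * A by apply: ler_pM; rewrite ?cm_ge0.
have e2 : cm (f x) * cm (g y - g x) <= B * (e / 2 / B).
  by apply: ler_pM; rewrite ?cm_ge0// /B lerDl.
move: e1 e2; rewrite divfK ?gt_eqF// [B * _]mulrC divfK ?gt_eqF// => e1 e2.
lra.
Qed.

Lemma gcN S f x : gc io S f x -> gc io S (fun y => - f y) x.
Proof.
by move=> /(gcM (gc_cst S (-1) x)); apply: gc_ext => [y _|]; rewrite mulN1r.
Qed.

Lemma gcB S f g x : gc io S f x -> gc io S g x -> gc io S (fun y => f y - g y) x.
Proof. by move=> hf hg; apply: gcD => //; exact: gcN. Qed.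

Lemma gd_comp S (P : set C) f (F : C -> C) x L M : (forall y, S y -> P (f y)) ->
  gd io S f x L -> gd id P F (f x) M -> gd io S (fun y => F (f y)) x (M * L).
Proof.
move=> SP hf hF e e0.
set K := cm L + 1; set N := cm M + 1.
have K0 : 0 < K by rewrite /K ltr_wpDl// cm_ge0.
have N0 : 0 < N by rewrite /N ltr_wpDl// cm_ge0.
have [d1 d10 H1] := hF (e / 2 / K) (divr_gt0 (divr_gt0 e0 (ltr0Sn _ _)) K0).
have [d2 d20 H2] := hf (e / 2 / N) (divr_gt0 (divr_gt0 e0 (ltr0Sn _ _)) N0).
have [d3 d30 H3] := gd_lip hf.
exists (Num.min (d1 / K) (Num.min d2 d3)).
  by rewrite !lt_min d20 d30 divr_gt0.
move=> y Sy; rewrite !lt_min => /andP[yd1 /andP[yd2 yd3]].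
have h3 := H3 y Sy yd3; have h2 := H2 y Sy yd2.
have fd : cm (f y - f x) < d1.
  by rewrite (le_lt_trans h3)// mulrC -ltr_pdivlMr.
have h1 := H1 (f y) (SP y Sy) fd; rewrite /= in h1.
rewrite (_ : _ - _ - _ = (F (f y) - F (f x) - M * (f y - f x)) +
  M * (f y - f x - L * (io y - io x))); last by ring.
set t := cm (io y - io x) in h2 h3 *.
have t0 : 0 <= t by exact: cm_ge0.
have q1 : cm (F (f y) - F (f x) - M * (f y - f x)) <= e / 2 * t.
  rewrite (le_trans h1)//; have := ler_wpM2l (ltW (divr_gt0 (divr_gt0 e0 (ltr0Sn _ 1)) K0)) h3.
  by rewrite mulrA divfK// gt_eqF.
have q2 : cm (M * (f y - f x - L * (io y - io x))) <= e / 2 * t.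
  by rewrite cmM (le_trans (ler_wpM2l (cm_ge0 _) h2))// div_succ_le ?cm_ge0 ?divr_ge0 ?(ltW e0).
by rewrite (le_trans (cmD _ _))//; lra.
Qed.

(** The two remainders differ by [(L - M) * (io y - io x)], so points of [S] other than [x] are
    needed at arbitrarily small distance. *)
Lemma gd_unique S f x L M :
  (forall d : R, 0 < d -> exists y, [/\ S y, cm (io y - io x) < d & io y != io x]) ->
  gd io S f x L -> gd io S f x M -> L = M.
Proof.
move=> acc hL hM; apply/eqP; rewrite -subr_eq0; apply/eqP/cm_small0 => e e0.
have [d1 d10 H1] := hL (e / 2) (divr_gt0 e0 (ltr0Sn _ _)).
have [d2 d20 H2] := hM (e / 2) (divr_gt0 e0 (ltr0Sn _ _)).
have [|y [Sy]] := acc (Num.min d1 d2); first by rewrite lt_min d10.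
rewrite lt_min => /andP[yd1 yd2] yx.
have h1 := H1 y Sy yd1; have h2 := H2 y Sy yd2.
have t0 : 0 < cm (io y - io x) by rewrite cm_gt0 subr_eq0.
rewrite -(ler_pM2r t0) -cmM.
rewrite (_ : _ * _ = (f y - f x - M * (io y - io x)) -
  (f y - f x - L * (io y - io x))); last by ring.
by rewrite (le_trans (cmB _ _))//; lra.
Qed.

End Rules.

Lemma gd_inv (P : set C) (z : C) : z != 0 -> gd id P (fun w => w^-1) z (- z^-2).
Proof.
move=> z0 e e0; have mz : 0 < cm z by rewrite cm_gt0.
exists (Num.min (cm z / 2) (e * cm z ^+ 3 / 2)).
  by rewrite lt_min !divr_gt0// mulr_gt0// exprn_gt0.
move=> w _ /=; rewrite lt_min => /andP[h1 h2].
have wz : cm z / 2 < cm w by have := cm_ge z w; rewrite cmBC; lra.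
have w0 : w != 0 by rewrite -cm_gt0; lra.
rewrite (_ : _ - _ = (w - z) ^+ 2 * (w^-1 * z ^- 2)); last first.
  by field; rewrite z0 w0.
have cw0 : 0 < cm w by lra.
have h : cm (w - z) <= e * (cm w * cm z ^+ 2).
  have : cm z / 2 * (e * cm z ^+ 2) <= cm w * (e * cm z ^+ 2).
    by rewrite ler_wpM2r ?(ltW wz)// mulr_ge0 ?(ltW e0)// sqr_ge0.
  by move: h2; rewrite exprS expr2; lra.
rewrite !cmM !cmV !cmX; set t := cm (w - z) in h *.
have -> : t ^+ 2 * ((cm w)^-1 * (cm z ^+ 2)^-1) = t / (cm w * cm z ^+ 2) * t.
  by field; rewrite !gt_eqF.
by rewrite ler_wpM2r ?cm_ge0// ler_pdivrMr// mulr_gt0// exprn_gt0.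
Qed.

(** Cousin's lemma, the form in which compactness of [[a, b]] enters. The supremum of the right ends
    reachable from [a] can be passed by the local hypothesis at it, unless it is [b]. It serves for
    mean values, for boundedness and for absolutely continuous functions. *)
Lemma cousin (P : R -> R -> Prop) a b : a <= b ->
  (forall x, a <= x -> x <= b -> exists2 d : R, 0 < d & forall u v,
     a <= u -> u <= x -> x <= v -> v <= b -> v - u < d -> P u v) ->
  (forall u v w, a <= u -> u <= v -> v <= w -> w <= b -> P u v -> P v w -> P u w) ->
  P a b.
Proof.
move=> ab loc add.
pose E := [set x | a <= x /\ x <= b /\ P a x].
have Ea : E a.
  split=> //; split => //; have [d d0 H] := loc a (lexx _) ab.
  by apply: H => //; rewrite subrr.
have ubE : ubound E b by move=> x [_ []].
have hsE : has_sup E by split; [exists a | exists b].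
have as_ : a <= sup E by exact: sup_upper_bound.
have sb : sup E <= b by exact: ge_sup hsE.1 ubE.
have [d d0 H] := loc _ as_ sb.
have [x [ax [xb Pax]] sx] := sup_adherent (divr_gt0 d0 (ltr0Sn _ 2)) hsE.
have xs : x <= sup E by exact: sup_upper_bound.
(* A margin [d / 3] on either side of the supremum keeps the interval from [x] to [v] shorter than
   [d]. *)
pose v := Num.min b (sup E + d / 3).
have sv : sup E <= v by rewrite /v le_min sb lerDl divr_ge0// ltW.
have vb : v <= b by rewrite /v ge_min lexx.
have vd : v <= sup E + d / 3 by rewrite /v ge_min lexx orbT.
have Pxv : P x v by apply: H => //; lra.
have Ev : E v.
  split; first by exact: le_trans as_ sv.
  split=> //; apply: (add a x v) => //.
  exact: le_trans xs sv.
have vs : v <= sup E by exact: sup_upper_bound.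
move: Ev => [_ [_]]; suff -> : v = b by [].
move: vs; rewrite {1}/v ge_min => /orP[bs|]; last by lra.
by apply/le_anti; rewrite vb (le_trans bs).
Qed.

(** For complex values there is no intermediate point to work with. The inequality holds with a
    slack on short intervals, where both remainders are small, and [cousin] adds up. *)
Lemma mean_value_le (f : R -> C) (g : R -> R) (f' : R -> C) (g' : R -> R) a b :
  a <= b ->
  (forall x, a <= x -> x <= b -> gd (@toC R) `[a, b] f x (f' x)) ->
  (forall x, a <= x -> x <= b -> gd (@toC R) `[a, b] (fun y => toC (g y)) x (toC (g' x))) ->
  (forall x, a <= x -> x <= b -> cm (f' x) <= g' x) ->
  cm (f b - f a) <= g b - g a.
Proof.
move=> ab hf hg fg; apply/ler_addgt0Pr => e e0.
have [ba|ba] := leP b a.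
  by rewrite (le_anti (introT andP (conj ab ba))) !subrr cm0 add0r ltW.
(* The remainders of [f] and of [g] each cost [e1 * (v - u)]; over [[a, b]] this amounts to [e]. *)
pose e1 := e / (b - a) / 2.
have e10 : 0 < e1 by rewrite !divr_gt0// subr_gt0.
suff : cm (f b - f a) <= g b - g a + 2 * e1 * (b - a).
  by rewrite /e1 mulrC [2 * _]mulrC divfK// mulrC divfK// subr_eq0 gt_eqF.
apply: (@cousin (fun u v => cm (f v - f u) <= g v - g u + 2 * e1 * (v - u))) => //.
- move=> x ax xb.
  have [d1 d10 H1] := hf x ax xb _ e10.
  have [d2 d20 H2] := hg x ax xb _ e10.
  exists (Num.min d1 d2); first by rewrite lt_min d10.
  move=> u v au ux xv vb; rewrite lt_min => /andP[vu1 vu2].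
  have key y : a <= y -> y <= b -> `|y - x| < Num.min d1 d2 ->
      [/\ cm (f y - f x - f' x * toC (y - x)) <= e1 * `|y - x| &
      `|g y - g x - g' x * (y - x)| <= e1 * `|y - x|].
    move=> ay yb; rewrite lt_min => /andP[y1 y2].
    have Sy : `[a, b]%classic y by rewrite /= in_itv /= ay.
    have := H1 y Sy; have := H2 y Sy; rewrite -!toCB -!toCM -toCB !cm_toC.
    by move=> /(_ y2) ? /(_ y1) ?; split.
  have [||ku1 ku2] := key u au; first by lra.
    by rewrite ler0_norm ?lt_min; [apply/andP; split; lra|lra].
  have [|||kv1 kv2] := key v; [lra|lra| |].
    by rewrite ger0_norm ?lt_min; [apply/andP; split; lra|lra].
  rewrite ler0_norm in ku1 ku2; last by lra.
  rewrite (@ger0_norm _ (v - x)) in kv1 kv2; last by lra.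
  move: ku2 kv2; rewrite !ler_norml => /andP[ku2 ku3] /andP[kv2 kv3].
  have h1 : cm (f v - f u) <= cm (f v - f x - f' x * toC (v - x)) +
     (cm (f u - f x - f' x * toC (u - x)) + cm (f' x) * (v - u)).
    rewrite -(@cm_toC_ge0 _ (v - u)); last by lra.
    rewrite -cmM (_ : f v - f u = (f v - f x - f' x * toC (v - x)) -
     ((f u - f x - f' x * toC (u - x)) - f' x * toC (v - u))); last first.
      by rewrite !toCB; ring.
    by apply: (le_trans (cmB _ _)); rewrite lerD2l; exact: cmB.
  have h2 : cm (f' x) * (v - u) <= g' x * (v - u).
    by rewrite ler_wpM2r ?fg//; lra.
  lra.
- move=> u v w au uv vw wb h1 h2.
  have := cmB3 (f w) (f v) (f u); lra.
Qed.

Lemma mean_value_bound (f : R -> C) (f' : R -> C) (M : R) a b :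
  a <= b ->
  (forall x, a <= x -> x <= b -> gd (@toC R) `[a, b] f x (f' x)) ->
  (forall x, a <= x -> x <= b -> cm (f' x) <= M) ->
  cm (f b - f a) <= M * (b - a).
Proof.
move=> ab hf fM.
have := @mean_value_le f (fun x => M * x) f' (fun=> M) a b ab hf.
rewrite mulrBr; apply => // x ax xb.
apply: (gd_eq (mulr1 (toC M))).
by apply: gd_ext (gdZ (toC M) (gd_io _ _ _)) => [y _|]; rewrite toCM.
Qed.

Lemma gd_mono (g g' : R -> R) a b : a <= b ->
  (forall x, a <= x -> x <= b -> gd (@toC R) `[a, b] (fun y => toC (g y)) x (toC (g' x))) ->
  (forall x, a <= x -> x <= b -> 0 <= g' x) -> g a <= g b.
Proof.
move=> ab hg g0.
have := @mean_value_le (fun=> 0) g (fun=> 0) g' a b ab.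
rewrite subrr cm0 subr_ge0; apply => // x ax xb; exact: gd_cst.
Qed.

Lemma gd_const (f : R -> C) a b : a <= b ->
  (forall x, a <= x -> x <= b -> gd (@toC R) `[a, b] f x 0) -> f a = f b.
Proof.
move=> ab hf; apply/esym/eqP; rewrite -subr_eq0 -cm_eq0; apply/eqP/le_anti.
rewrite cm_ge0 andbT; have := @mean_value_bound f (fun=> 0) 0 a b ab hf.
by rewrite mul0r; apply => // x _ _; rewrite cm0.
Qed.

(** The mean value bound is used twice along the segment, for [F1] and then for [F] minus its linear
    part. Estimating [s] by 1 in the first use gives [M] where integration would give [M / 2].
    Derivatives are relative to [P], so the segment may run along the boundary of [P]. *)
Lemma taylor2 (P : set C) (F F1 F2 : C -> C) (z w : C) (M : R) :
  (forall s : R, 0 <= s -> s <= 1 -> P (z + toC s * (w - z))) ->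
  (forall u, P u -> gd id P F u (F1 u)) -> (forall u, P u -> gd id P F1 u (F2 u)) ->
  (forall s : R, 0 <= s -> s <= 1 -> cm (F2 (z + toC s * (w - z))) <= M) ->
  cm (F w - F z - (w - z) * F1 z) <= M * cm (w - z) ^+ 2.
Proof.
move=> seg dF dF1 bF2.
have M0 : 0 <= M by apply: le_trans (bF2 0 _ _) => //; exact: cm_ge0.
pose ga (s : R) := z + toC s * (w - z).
have dga S x : gd (@toC R) S ga x (w - z).
  apply: (@gd_eq _ _ _ _ _ (0 + (w - z) * 1)); first by rewrite add0r mulr1.
  apply: gd_ext (gdD (gd_cst _ _ z _) (gdZ (w - z) (gd_io _ S x))) => [y _|];
    by rewrite /ga mulrC.
have ga0 : ga 0 = z by rewrite /ga toC0 mul0r addr0.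
have ga1 : ga 1 = w by rewrite /ga toC1 mul1r addrC subrK.
have gaP (t : R) : 0 <= t -> t <= 1 -> forall y, `[0, t]%classic y -> P (ga y).
  by move=> t0 t1 y /=; rewrite in_itv/= => /andP[y0 yt]; apply: seg => //; lra.
have hF1 (s : R) : 0 <= s -> s <= 1 -> cm (F1 (ga s) - F1 z) <= M * cm (w - z).
  move=> s0 s1.
  have := @mean_value_bound (fun t => F1 (ga t)) (fun t => F2 (ga t) * (w - z))
    (M * cm (w - z)) 0 s s0.
  rewrite /= ga0 => H; apply: (le_trans (H _ _)).
  - move=> x x0 xs; apply: (@gd_comp _ _ _ P) (dga _ _) (dF1 _ _); first exact: gaP.
    by apply: (gaP s) => //; rewrite /= in_itv/= x0.
  - by move=> x x0 xs; rewrite cmM ler_wpM2r ?cm_ge0// bF2//; lra.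
  - by rewrite subr0 ler_piMr// mulr_ge0// cm_ge0.
have := @mean_value_bound (fun t => F (ga t) - toC t * ((w - z) * F1 z))
  (fun t => F1 (ga t) * (w - z) - 1 * ((w - z) * F1 z)) (M * cm (w - z) ^+ 2) 0 1 ler01.
rewrite ga0 ga1 toC0 toC1 mul0r mul1r !subr0 mulr1.
rewrite (_ : F w - (w - z) * F1 z - F z = F w - F z - (w - z) * F1 z); last by ring.
apply=> [x x0 x1|x x0 x1].
  apply: gdB.
    apply: (@gd_comp _ _ _ P) (dga _ _) (dF _ _); first exact: gaP.
    by apply: (gaP 1) => //; rewrite /= in_itv/= x0.
  have := gdM (gd_io (@toC R) `[0, 1] x) (gd_cst _ `[0, 1] ((w - z) * F1 z) x).
  by rewrite mulr0 addr0 mul1r.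
rewrite [_ * (w - z)]mulrC -mulrBr cmM expr2 mulrA mulrC ler_wpM2r ?cm_ge0//.
exact: hF1.
Qed.
End RelDeriv.

(** * Relative derivatives compared with limits and derivatives of the library *)

Section Convert.
Context {R : realType}.
Local Notation C := (Cplx R).

Lemma toC_gt0P (e : C) : 0 < e -> exists2 r : R, 0 < r & e = toC r.
Proof.
move=> e0; have er : e \is Num.real by rewrite ger0_real// ltW.
exists (complex.Re e); last by rewrite /toC RRe_real.
by rewrite -toC_lt /toC RRe_real.
Qed.

Lemma nearCP (z : C) (P : set C) :
  (\forall w \near z, P w) <-> exists2 d : R, 0 < d & forall w, cm (w - z) < d -> P w.
Proof.
split.
  move=> /nbhs_ballP[e /= e0 H]; have [d d0 ed] := toC_gt0P e0; exists d => // w wd.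
  by apply: H; rewrite -ball_normE /= distrC cmE ed toC_lt.
move=> [d d0 H]; apply/nbhs_ballP; exists (toC d) => /=; first by rewrite -toC0 toC_lt.
by move=> w; rewrite -ball_normE /= distrC cmE toC_lt; exact: H.
Qed.

Lemma nearRP (x : R) (P : set R) :
  (\forall y \near x, P y) <-> exists2 d : R, 0 < d & forall y, `|y - x| < d -> P y.
Proof.
split.
  move=> /nbhs_ballP[d /= d0 H]; exists d => // y yd.
  by apply: H; rewrite -ball_normE /= distrC.
move=> [d d0 H]; apply/nbhs_ballP; exists d => //.
by move=> y; rewrite -ball_normE /= distrC; exact: H.
Qed.

Lemma real_quotient_gd (f : R -> R) (x l : R) :
  (fun h => h^-1 *: (f (h + x) - f x)) @ (0 : R)^' --> l ->
  gd (@toC R) setT (fun y => toC (f y)) x (toC l).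
Proof.
move=> /cvgrPdist_le H e e0; have /nearRP[d d0 {}H] := H e e0; exists d => // y _.
rewrite -!toCB -toCM -toCB !cm_toC => yd.
have [->|yx] := eqVneq y x; first by rewrite !subrr mulr0 subrr normr0 mulr0.
have yx0 : y - x != 0 by rewrite subr_eq0.
have := H (y - x); rewrite subr0 subrK => /(_ yd yx0).
rewrite /GRing.scale /= => h.
have -> : f y - f x - l * (y - x) = - ((l - (y - x)^-1 * (f y - f x)) * (y - x)).
  by field.
by rewrite normrN normrM ler_wpM2r.
Qed.

Lemma is_derive_gd (f : R -> R) (x l : R) :
  is_derive x 1 f l -> gd (@toC R) setT (fun y => toC (f y)) x (toC l).
Proof.
move=> [df fl]; apply: real_quotient_gd.
have : (fun h => h^-1 *: ((f \o shift x) (h *: 1) - f x)) @ (0 : R)^' --> 'D_1 f x.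
  exact: df.
rewrite fl; under eq_fun do rewrite /= /GRing.scale /= mulr1.
exact.
Qed.

Lemma gd_xderiv (m n : nat) (D : set R) (f : R -> 'M[C]_(m, n)) x (L : 'M[C]_(m, n)) :
  (forall i j, gd (@toC R) D (fun y => f y i j) x (L i j)) -> xderiv D f x L.
Proof.
move=> H i j; apply/cvgrPdist_le => e /toC_gt0P[r r0 ->].
have [d d0 {}H] := H i j r r0.
apply/nearRP; exists d => // h; rewrite subr0 => hd h0 Dxh.
rewrite cmE toC_le.
have := H (x + h) Dxh; rewrite -toCB addrAC subrr add0r cm_toC => /(_ hd).
have h0' : toC h != 0 by rewrite toC_eq0.
have -> : L i j - toC h^-1 * (f (x + h) i j - f x i j) =
  - ((f (x + h) i j - f x i j - L i j * toC h) * toC h^-1).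
  by rewrite toCV; field.
by rewrite cmN cmM cm_toC normfV ler_pdivrMr// normr_gt0.
Qed.

Lemma xderiv_gd (m n : nat) (D : set R) (f : R -> 'M[C]_(m, n)) x (L : 'M[C]_(m, n)) :
  xderiv D f x L -> forall i j, gd (@toC R) D (fun y => f y i j) x (L i j).
Proof.
move=> H i j e e0; have /cvgrPdist_le {}H := H i j.
have e0' : 0 < toC e by rewrite -toC0 toC_lt.
have /nearRP[d d0 {}H] := H _ e0'.
exists d => // y Dy; rewrite -toCB cm_toC => yd.
have [->|yx] := eqVneq y x.
  by rewrite !subrr toC0 mulr0 subrr cm0 normr0 mulr0.
have yx0 : y - x != 0 by rewrite subr_eq0.
have := H (y - x); rewrite subr0 => /(_ yd yx0) /=.
rewrite addrC subrK => /(_ Dy); rewrite cmE toC_le.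
have h0' : toC (y - x) != 0 by rewrite toC_eq0.
have -> : f y i j - f x i j - L i j * toC (y - x) =
  - ((L i j - toC (y - x)^-1 * (f y i j - f x i j)) * toC (y - x)).
  by rewrite toCV; move: (toC (y - x)) h0' => t t0; field.
by move=> h; rewrite cmN cmM cm_toC ler_wpM2r.
Qed.

Lemma gd_derivable (P : set C) (f : C -> C) (z L : C) :
  (exists2 d : R, 0 < d & forall w, cm (w - z) < d -> P w) ->
  gd id P f z L -> derivable (f : C -> C^o) z 1.
Proof.
move=> [d0 d00 Pz] H; apply/cvg_ex; exists L; apply/cvgrPdist_le => e /toC_gt0P[r r0 ->].
have [d dd {}H] := H r r0.
apply/nearCP; exists (Num.min d0 d); first by rewrite lt_min d00.
move=> h; rewrite subr0 lt_min => /andP[hd0 hd] h0.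
rewrite cmE toC_le /= /GRing.scale /= mulr1.
have hz : h + z - z = h by rewrite addrK.
have := H (h + z); rewrite hz => /(_ (Pz _ _) hd); rewrite hz => /(_ hd0) h1.
have -> : L - h^-1 * (f (h + z) - f z) = - ((f (h + z) - f z - L * h) * h^-1).
  by field.
by rewrite cmN cmM cmV ler_pdivrMr// cm_gt0.
Qed.

Lemma gc_within_continuous (P : set C) (f : C -> C) :
  (forall z, P z -> gc id P f z) -> {within P, continuous f}.
Proof.
move=> H; apply/subspace_continuousP => z Pz.
apply/cvgrPdist_le => e /toC_gt0P[r r0 ->].
have [d d0 {}H] := H z Pz r r0; apply/nearCP; exists d => // w wd Pw.
by rewrite distrC cmE toC_le; exact: H.
Qed.

(** At 0 the complex derivative follows from the real derivatives of [expR], [cos] and [sin]; the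
    addition formula carries it to every other point. *)
Lemma gd_cexp0 : gd id setT (@cexp R) 0 1.
Proof.
(* The remainders below add up to at most [9 * q * t], whence [e / 16]. As [q] also bounds the
   modulus of [w], the quadratic term [(expR a - 1) * b] is small too. *)
move=> e e0; pose q := Num.min 1 (e / 16).
have q0 : 0 < q by rewrite lt_min ltr01 divr_gt0.
have q1 : q <= 1 by rewrite ge_min lexx.
have qe : q <= e / 16 by rewrite ge_min lexx orbT.
clearbody q.
have [d1 d10 H1] := is_derive_gd (is_derive_expR (0 : R)) q0.
have [d2 d20 H2] := is_derive_gd (is_derive_cos (0 : R)) q0.
have [d3 d30 H3] := is_derive_gd (is_derive_sin (0 : R)) q0.
exists (Num.min q (Num.min d1 (Num.min d2 d3))); first by rewrite !lt_min d10 d20 d30 q0.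
move=> w _; rewrite /= subr0 mul1r !lt_min => /andP[wq /andP[w1 /andP[w2 w3]]].
have Rw := cm_Re w; have Iw := cm_Im w.
have K y : cm (toC y - toC 0) = `|y| :> R by rewrite toC0 subr0 cm_toC.
have {}H1 : `|expR (complex.Re w) - 1 - complex.Re w| <= q * `|complex.Re w|.
  have := H1 (complex.Re w) I; rewrite K => /(_ (le_lt_trans Rw w1)).
  by rewrite expR0 toC0 subr0 -toCM -!toCB cm_toC mul1r.
have {}H2 : `|cos (complex.Im w) - 1| <= q * `|complex.Im w|.
  have := H2 (complex.Im w) I; rewrite K => /(_ (le_lt_trans Iw w2)).
  by rewrite cos0 sin0 toC0 subr0 -toCM -!toCB cm_toC oppr0 mul0r subr0.
have {}H3 : `|sin (complex.Im w) - complex.Im w| <= q * `|complex.Im w|.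
  have := H3 (complex.Im w) I; rewrite K => /(_ (le_lt_trans Iw w3)).
  by rewrite sin0 cos0 toC0 !subr0 -toCM -!toCB cm_toC mul1r.
rewrite cexp0; apply: (le_trans (cm_leD _)).
rewrite /cexp !ReCD !ImCD !ReCN !ImCN ReCZ ImCZ /= oppr0 addr0.
set a := complex.Re w in Rw H1 *; set b := complex.Im w in Iw H2 H3 *.
set t := cm w in wq Rw Iw *.
have t0 : 0 <= t by exact: cm_ge0.
have qt : q * `|a| <= q * t by rewrite ler_wpM2l// ltW.
have qt' : q * `|b| <= q * t by rewrite ler_wpM2l// ltW.
have qqt : q * t <= t by rewrite ler_piMl.
have tt : t * t <= q * t by rewrite ler_wpM2r// ltW.
have qet : q * t <= e / 16 * t by rewrite ler_wpM2r.
have et0 : 0 <= e * t by rewrite mulr_ge0// ltW.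
have e2 : `|expR a| <= 3.
  have := ler_normD (expR a - 1 - a) (1 + a).
  rewrite (_ : _ + (1 + a) = expR a); last by ring.
  by have := ler_normD 1 a; rewrite normr1; lra.
have e3 : `|expR a - 1| <= 2 * t.
  have := ler_normD (expR a - 1 - a) a; rewrite subrK; lra.
have r1 : `|expR a * (cos b - 1)| <= 3 * (q * t).
  by rewrite normrM ler_pM//; lra.
have r2 : `|expR a * (sin b - b)| <= 3 * (q * t).
  by rewrite normrM ler_pM//; lra.
have r3 : `|(expR a - 1) * b| <= 2 * (q * t).
  rewrite normrM; apply: le_trans (ler_pM _ _ e3 Iw) _ => //; lra.
have -> : expR a * cos b - 1 - a = (expR a - 1 - a) + expR a * (cos b - 1) by ring.
have -> : expR a * sin b - b = expR a * (sin b - b) + (expR a - 1) * b by ring.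
have := ler_normD (expR a - 1 - a) (expR a * (cos b - 1)).
have := ler_normD (expR a * (sin b - b)) ((expR a - 1) * b).
lra.
Qed.

Lemma gd_cexp (P : set C) (z : C) : gd id P (@cexp R) z (cexp z).
Proof.
apply: (@gd_sub _ _ _ setT) => //.
have h := @gd_comp R C id setT setT (fun w => w - z) (@cexp R) z 1 1 (fun _ _ => I).
have {}h : gd id setT (fun w => cexp (w - z)) z (1 * 1).
  apply: h; last by rewrite subrr; exact: gd_cexp0.
  by rewrite -[X in gd _ _ _ _ X]subr0; apply: gdB (gd_io _ _ _) (gd_cst _ _ _ _).
have {}h := gdZ (cexp z) h; rewrite !mulr1 in h.
by apply: gd_ext h => [y _|]; rewrite -cexpD addrC subrK.
Qed.

End Convert.

(** * Integrals of complex-valued functions *)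

Section ComplexIntegral.
Context {R : realType}.
Local Notation C := (Cplx R).
Local Notation mu := (@lebesgue_measure R).
Local Notation Re := complex.Re.
Local Notation Im := complex.Im.
Local Notation MR := (measurableTypeR R).
Implicit Types (D A B : set MR) (f g : R -> C).

Definition cmeas D f :=
  measurable_fun D (fun x => Re (f x)) /\ measurable_fun D (fun x => Im (f x)).

Definition rint D (g : R -> R) := mu.-integrable D (EFin \o g).

Definition CI D f : C :=
  toC (\int[mu]_(x in D) Re (f x)) + imunit * toC (\int[mu]_(x in D) Im (f x)).

Lemma Re_CI D f : Re (CI D f) = \int[mu]_(x in D) Re (f x).
Proof. by rewrite ReCD ReCM /= !mul0r mul1r subr0 addr0. Qed.
Lemma Im_CI D f : Im (CI D f) = \int[mu]_(x in D) Im (f x).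
Proof. by rewrite ImCD ImCM /= !mul0r mul1r !add0r. Qed.

Lemma cmeas_ext D f g : (forall x, D x -> f x = g x) -> cmeas D f -> cmeas D g.
Proof.
move=> fg [h1 h2]; split.
  apply: eq_measurable_fun h1 => x xD; rewrite fg//; exact: set_mem.
apply: eq_measurable_fun h2 => x xD; rewrite fg//; exact: set_mem.
Qed.
Lemma cmeasS D D' f : measurable D -> D' `<=` D -> cmeas D f -> cmeas D' f.
Proof. by move=> mD DD [h1 h2]; split; apply: measurable_funS mD DD _. Qed.
Lemma cmeas_cst D (c : C) : cmeas D (fun=> c).
Proof. by split; exact: measurable_cst. Qed.
Lemma cmeasD D f g : cmeas D f -> cmeas D g -> cmeas D (fun x => f x + g x).
Proof.
move=> [f1 f2] [g1 g2]; split.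
  under eq_fun do rewrite ReCD; exact: measurable_funD.
under eq_fun do rewrite ImCD; exact: measurable_funD.
Qed.
Lemma cmeasM D f g : cmeas D f -> cmeas D g -> cmeas D (fun x => f x * g x).
Proof.
move=> [f1 f2] [g1 g2]; split.
  under eq_fun do rewrite ReCM; apply: measurable_funB; exact: measurable_funM.
under eq_fun do rewrite ImCM; apply: measurable_funD; exact: measurable_funM.
Qed.
Lemma cmeasZ D (c : C) f : cmeas D f -> cmeas D (fun x => c * f x).
Proof. by apply: cmeasM; exact: cmeas_cst. Qed.
Lemma cmeasN D f : cmeas D f -> cmeas D (fun x => - f x).
Proof. by move=> /(cmeasZ (-1)); apply: cmeas_ext => x _; rewrite mulN1r. Qed.
Lemma cmeasB D f g : cmeas D f -> cmeas D g -> cmeas D (fun x => f x - g x).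
Proof. by move=> hf hg; apply: cmeasD => //; exact: cmeasN. Qed.
Lemma cmeas_sum D (I : Type) (r : seq I) (P : pred I) (F : I -> R -> C) :
  (forall i, P i -> cmeas D (F i)) -> cmeas D (fun x => \sum_(i <- r | P i) F i x).
Proof.
move=> h; elim: r => [|i r IH].
  by apply: cmeas_ext (cmeas_cst D 0) => x _; rewrite big_nil.
case: (boolP (P i)) => Pi.
  by apply: cmeas_ext (cmeasD (h i Pi) IH) => x _; rewrite big_cons Pi.
by apply: cmeas_ext IH => x _; rewrite big_cons (negbTE Pi).
Qed.
Lemma cmeas_cm D f : cmeas D f -> measurable_fun D (fun x => cm (f x)).
Proof.
move=> [f1 f2].
have -> : (fun x => cm (f x)) = (fun x => Num.sqrt (Re (f x) ^+ 2 + Im (f x) ^+ 2)).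
  by apply/funext => x; rewrite -cm_sqr sqrtr_sqr ger0_norm ?cm_ge0.
apply: measurableT_comp; first exact: (continuous_measurable_fun (@sqrt_continuous R)).
by apply: measurable_funD; exact: measurable_funX.
Qed.
Lemma cmeas_lim D (F : nat -> R -> C) f : (forall n, cmeas D (F n)) ->
  (forall x, D x -> forall e : R, 0 < e -> exists N, forall n, (N <= n)%N ->
     cm (F n x - f x) <= e) -> cmeas D f.
Proof.
move=> mF cF; split.
- apply: (@measurable_fun_cvg _ _ _ D (fun n x => Re (F n x))) => [m|x Dx].
    by case: (mF m).
  apply/cvgrPdist_le => e e0; have [N H] := cF x Dx e e0.
  near=> n; rewrite distrC -ReCN -ReCD (le_trans (cm_Re _))// H//.
  by near: n; exact: nbhs_infty_ge.
- apply: (@measurable_fun_cvg _ _ _ D (fun n x => Im (F n x))) => [m|x Dx].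
    by case: (mF m).
  apply/cvgrPdist_le => e e0; have [N H] := cF x Dx e e0.
  near=> n; rewrite distrC -ImCN -ImCD (le_trans (cm_Im _))// H//.
  by near: n; exact: nbhs_infty_ge.
Unshelve. all: by end_near. Qed.

Lemma rint_le D (f g : R -> R) : measurable D -> measurable_fun D f ->
  (forall x, D x -> `|f x| <= g x) -> rint D g -> rint D f.
Proof.
move=> mD mf fg ig; have mf' : measurable_fun D (EFin \o f) by exact/measurable_EFinP.
apply: (@le_integrable _ _ _ mu D mD _ (EFin \o g)) => //.
by move=> x Dx /=; rewrite lee_fin (le_trans (fg x Dx))// ler_norm.
Qed.
Lemma rintS D D' (f : R -> R) : measurable D -> measurable D' -> D' `<=` D ->
  rint D f -> rint D' f.
Proof. by move=> mD mD' DD; exact: integrableS. Qed.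
Lemma rintD D (f g : R -> R) : measurable D -> rint D f -> rint D g ->
  rint D (fun x => f x + g x).
Proof.
by move=> mD hf hg; have := integrableD mD hf hg; apply: eq_integrable.
Qed.
Lemma rintZ D c (f : R -> R) : measurable D -> rint D f -> rint D (fun x => c * f x).
Proof.
by move=> mD hf; have := integrableZl mD c hf; apply: eq_integrable.
Qed.
Lemma rint_ext D (f g : R -> R) : measurable D -> (forall x, D x -> f x = g x) ->
  rint D f -> rint D g.
Proof.
move=> mD fg; apply: eq_integrable => // x xD /=; rewrite fg//; exact: set_mem.
Qed.
Lemma rint_sum D (I : Type) (r : seq I) (P : pred I) (F : I -> R -> R) :
  measurable D -> (forall i, P i -> rint D (F i)) ->
  rint D (fun x => \sum_(i <- r | P i) F i x).
Proof.
move=> mD h.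
elim: r => [|i r IH].
  by apply: rint_ext (integrable0 mu D) => // x _; rewrite big_nil.
case: (boolP (P i)) => Pi.
  by apply: rint_ext (rintD mD (h i Pi) IH) => // x _; rewrite big_cons Pi.
by apply: rint_ext IH => // x _; rewrite big_cons (negbTE Pi).
Qed.

Lemma cint_cmeas D f : cintegrable D f -> cmeas D f.
Proof.
by move=> [/measurable_int/measurable_EFinP h1 /measurable_int/measurable_EFinP h2].
Qed.
Lemma cint_ext D f g : measurable D -> (forall x, D x -> f x = g x) ->
  cintegrable D f -> cintegrable D g.
Proof.
move=> mD fg [h1 h2]; split.
  by apply: rint_ext h1 => // x Dx; rewrite fg.
by apply: rint_ext h2 => // x Dx; rewrite fg.
Qed.
Lemma cint_dom D f (g : R -> R) : measurable D -> cmeas D f -> rint D g ->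
  (forall x, D x -> cm (f x) <= g x) -> cintegrable D f.
Proof.
move=> mD [f1 f2] ig fg; split; apply: rint_le ig => // x Dx.
  exact: le_trans (cm_Re _) (fg x Dx).
exact: le_trans (cm_Im _) (fg x Dx).
Qed.
Lemma cint_norm D f : measurable D -> cintegrable D f -> rint D (fun x => cm (f x)).
Proof.
move=> mD hf; have [h1 h2] := hf.
have := rintD mD (integrable_norm h1) (integrable_norm h2).
apply: (rint_le mD (cmeas_cm (cint_cmeas hf))).
by move=> x Dx /=; rewrite ger0_norm ?cm_ge0 ?cm_leD.
Qed.
Lemma cintS D D' f : measurable D -> measurable D' -> D' `<=` D ->
  cintegrable D f -> cintegrable D' f.
Proof. by move=> mD mD' DD [h1 h2]; split; apply: rintS mD mD' DD _. Qed.
Lemma cintD D f g : measurable D -> cintegrable D f -> cintegrable D g ->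
  cintegrable D (fun x => f x + g x).
Proof.
move=> mD hf hg.
apply: (cint_dom mD _ (rintD mD (cint_norm mD hf) (cint_norm mD hg))).
  by apply: cmeasD; exact: cint_cmeas.
by move=> x _; exact: cmD.
Qed.
Lemma cintZ D (c : C) f : measurable D -> cintegrable D f ->
  cintegrable D (fun x => c * f x).
Proof.
move=> mD hf; apply: (cint_dom mD _ (rintZ (cm c) mD (cint_norm mD hf))).
  by apply: cmeasZ; exact: cint_cmeas.
by move=> x _; rewrite cmM.
Qed.
Lemma cintN D f : measurable D -> cintegrable D f -> cintegrable D (fun x => - f x).
Proof.
by move=> mD /(cintZ (-1) mD); apply: cint_ext => // x _; rewrite mulN1r.
Qed.
Lemma cintB D f g : measurable D -> cintegrable D f -> cintegrable D g ->
  cintegrable D (fun x => f x - g x).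
Proof. by move=> mD hf hg; apply: cintD => //; exact: cintN. Qed.
Lemma cint0 D : measurable D -> cintegrable D (fun=> 0).
Proof. by move=> mD; split; apply: integrable0. Qed.
Lemma cint_sum D (I : Type) (r : seq I) (P : pred I) (F : I -> R -> C) :
  measurable D -> (forall i, P i -> cintegrable D (F i)) ->
  cintegrable D (fun x => \sum_(i <- r | P i) F i x).
Proof.
move=> mD h; elim: r => [|i r IH].
  by apply: cint_ext (cint0 mD) => // x _; rewrite big_nil.
case: (boolP (P i)) => Pi.
  by apply: cint_ext (cintD mD (h i Pi) IH) => // x _; rewrite big_cons Pi.
by apply: cint_ext IH => // x _; rewrite big_cons (negbTE Pi).
Qed.

Lemma CI_ext D f g : (forall x, D x -> f x = g x) -> CI D f = CI D g.
Proof.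
move=> fg; rewrite /CI; congr (toC _ + _ * toC _); apply: eq_Rintegral => x xD;
  rewrite fg//; exact: set_mem.
Qed.
Lemma CID D f g : measurable D -> cintegrable D f -> cintegrable D g ->
  CI D (fun x => f x + g x) = CI D f + CI D g.
Proof.
move=> mD [f1 f2] [g1 g2]; apply: ReIm_inj.
  rewrite ReCD !Re_CI -RintegralD//; apply: eq_Rintegral => x _; exact: ReCD.
rewrite ImCD !Im_CI -RintegralD//; apply: eq_Rintegral => x _; exact: ImCD.
Qed.
Lemma CIZ D (c : C) f : measurable D -> cintegrable D f ->
  CI D (fun x => c * f x) = c * CI D f.
Proof.
move=> mD [f1 f2]; apply: ReIm_inj.
  rewrite ReCM !Re_CI Im_CI -!RintegralZl// -RintegralB//; last 2 first.
  - exact: rintZ.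
  - exact: rintZ.
  by apply: eq_Rintegral => x _; exact: ReCM.
rewrite ImCM !Im_CI Re_CI -!RintegralZl// -RintegralD//; last 2 first.
- exact: rintZ.
- exact: rintZ.
by apply: eq_Rintegral => x _; exact: ImCM.
Qed.
Lemma CIN D f : measurable D -> cintegrable D f -> CI D (fun x => - f x) = - CI D f.
Proof.
move=> mD hf; rewrite -mulN1r -CIZ//; apply: CI_ext => x _; by rewrite mulN1r.
Qed.
Lemma CIB D f g : measurable D -> cintegrable D f -> cintegrable D g ->
  CI D (fun x => f x - g x) = CI D f - CI D g.
Proof. by move=> mD hf hg; rewrite CID ?CIN//; exact: cintN. Qed.
Lemma CI0 D : CI D (fun=> 0) = 0.
Proof. by apply: ReIm_inj; rewrite ?Re_CI ?Im_CI /Rintegral integral0. Qed.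
Lemma CI_sum D (I : Type) (r : seq I) (P : pred I) (F : I -> R -> C) :
  measurable D -> (forall i, P i -> cintegrable D (F i)) ->
  CI D (fun x => \sum_(i <- r | P i) F i x) = \sum_(i <- r | P i) CI D (F i).
Proof.
move=> mD h; elim: r => [|i r IH].
  by rewrite big_nil -[RHS](CI0 D); apply: CI_ext => x _; rewrite big_nil.
rewrite big_cons -IH; case: ifPn => Pi.
  rewrite -CID//; [|exact: h|exact: cint_sum].
  by apply: CI_ext => x _; rewrite big_cons Pi.
by apply: CI_ext => x _; rewrite big_cons (negbTE Pi).
Qed.
(** The factor 2 comes from estimating real and imaginary parts separately. It reappears in [kerbd],
    where it is absorbed into the operator bound. *)
Lemma CI_le D f (g : R -> R) : measurable D -> cmeas D f -> rint D g ->
  (forall x, D x -> cm (f x) <= g x) -> cm (CI D f) <= 2 * \int[mu]_(x in D) g x.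
Proof.
move=> mD mf ig fg; have [h1 h2] := cint_dom mD mf ig fg.
apply: (le_trans (cm_leD _)); rewrite Re_CI Im_CI mulrDl !mul1r lerD//.
  apply: (le_trans (le_normr_Rintegral mD h1)); apply: le_Rintegral => //.
    exact: integrable_norm.
  by move=> x Dx; apply: le_trans (cm_Re _) (fg x Dx).
apply: (le_trans (le_normr_Rintegral mD h2)); apply: le_Rintegral => //.
  exact: integrable_norm.
by move=> x Dx; apply: le_trans (cm_Im _) (fg x Dx).
Qed.
Lemma CI_setU A B f : measurable A -> measurable B -> cintegrable (A `|` B) f ->
  [disjoint A & B] -> CI (A `|` B) f = CI A f + CI B f.
Proof.
move=> mA mB [h1 h2] AB; apply: ReIm_inj.
  by rewrite ReCD !Re_CI Rintegral_setU.
by rewrite ImCD !Im_CI Rintegral_setU.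
Qed.

End ComplexIntegral.

(** * Fixed points of weighted integral operators *)

Section Limits.
Context {R : realType}.
Local Notation C := (Cplx R).

Lemma pow2_small (A e : R) : 0 <= A -> 0 < e -> exists n, A / 2 ^+ n <= e.
Proof.
move=> A0 e0; exists (Num.bound (A / e)).
have := archi_boundP (divr_ge0 A0 (ltW e0)); set n := Num.bound _ => h.
have hn : (n%:R : R) <= 2 ^+ n by rewrite -natrX ler_nat ltnW// ltn_expl.
have p0 : 0 < 2 ^+ n :> R by rewrite exprn_gt0.
rewrite ler_pdivrMr// mulrC -ler_pdivrMr//; lra.
Qed.

Lemma pow2_zero (a A : R) : 0 <= A -> (forall n, a <= A / 2 ^+ n) -> a <= 0.
Proof.
move=> A0 h; apply/ler_addgt0Pr => e e0; have [n hn] := pow2_small A0 e0.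
by rewrite add0r (le_trans (h n)).
Qed.

Lemma pow2_le (c : R) m n : 0 <= c -> (n <= m)%N -> c / 2 ^+ m <= c / 2 ^+ n.
Proof.
by move=> c0 nm; rewrite ler_wpM2l// lef_pV2 ?posrE ?exprn_gt0// ler_weXn2l// ler1n.
Qed.

(** The limit is the supremum of the lower ends [u n - c / 2 ^+ n], for which each upper end
    [u n + c / 2 ^+ n] is an upper bound. *)
Lemma real_pow2_cauchy (u : nat -> R) (c : R) : 0 <= c ->
  (forall n m, (n <= m)%N -> `|u m - u n| <= c / 2 ^+ n) ->
  exists l, forall n, `|u n - l| <= c / 2 ^+ n.
Proof.
move=> c0 h; pose E := [set u n - c / 2 ^+ n | n in [set: nat]].
have ubE n : ubound E (u n + c / 2 ^+ n).
  move=> _ [k _ <-].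
  have [nk|/ltnW kn] := leqP n k.
    have := h n k nk; rewrite ler_norml => /andP[_]; have := divr_ge0 c0 (exprn_ge0 k (ler0n R 2)); lra.
  have := h k n kn; rewrite ler_norml => /andP[+ _]; have := divr_ge0 c0 (exprn_ge0 n (ler0n R 2)); lra.
have hsE : has_sup E by split; [exists (u 0 - c / 2 ^+ 0), 0%N | exists (u 0 + c / 2 ^+ 0)].
exists (sup E) => n; rewrite ler_norml.
have h1 : sup E <= u n + c / 2 ^+ n by exact: ge_sup hsE.1 (ubE n).
have h2 : u n - c / 2 ^+ n <= sup E by apply: sup_upper_bound => //; exists n.
by apply/andP; split; lra.
Qed.

Lemma cplx_pow2_cauchy (u : nat -> C) (c : R) : 0 <= c ->
  (forall n m, (n <= m)%N -> cm (u m - u n) <= c / 2 ^+ n) ->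
  exists l, forall n, cm (u n - l) <= 2 * c / 2 ^+ n.
Proof.
move=> c0 h.
have [a ha] : exists l, forall n, `|complex.Re (u n) - l| <= c / 2 ^+ n.
  apply: real_pow2_cauchy => // n m nm; rewrite -ReCN -ReCD.
  exact: le_trans (cm_Re _) (h n m nm).
have [b hb] : exists l, forall n, `|complex.Im (u n) - l| <= c / 2 ^+ n.
  apply: real_pow2_cauchy => // n m nm; rewrite -ImCN -ImCD.
  exact: le_trans (cm_Im _) (h n m nm).
exists (a +i* b) => n; apply: (le_trans (cm_leD _)).
rewrite ReCD ImCD ReCN ImCN /=; have := ha n; have := hb n; rewrite -mulrA; lra.
Qed.

(** Cauchy's criterion for [h] tending to 0 inside [Q], to be applied to difference quotients. The
    limit is taken along one sequence and then compared with an arbitrary [h]. *)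
Lemma quotient_limit (Q : set C) (q : C -> C) (c : R) : 0 <= c ->
  (forall h h', Q h -> Q h' -> cm (q h - q h') <= c * (cm h + cm h')) ->
  exists L, exists2 r : R, 0 < r & forall h, Q h -> cm h < r -> cm (q h - L) <= c * cm h.
Proof.
move=> c0 H.
(* If [Q] does not come close to 0, a small radius makes the conclusion void and any [L] serves. *)
have [[N HN]|HN] := pselect (exists N, forall h, Q h -> ~ cm h <= 1 / 2 ^+ N).
  exists 0, (1 / 2 ^+ N); first by rewrite divr_gt0// exprn_gt0.
  by move=> h Qh hr; case: (HN h Qh); exact: ltW.
have /choice[hs hhs] : forall n, exists h, Q h /\ cm h <= 1 / 2 ^+ n.
  move=> n; apply: contrapT => hn; apply: HN; exists n => h Qh hh.
  by apply: hn; exists h.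
have [L HL] : exists L, forall n, cm (q (hs n) - L) <= 2 * (2 * c) / 2 ^+ n.
  apply: cplx_pow2_cauchy; first by rewrite mulr_ge0.
  move=> n m nm; apply: (le_trans (H _ _ (hhs m).1 (hhs n).1)).
  have h1 := (hhs m).2; have h2 := (hhs n).2.
  have h3 := pow2_le (@ler01 R) nm.
  have : cm (hs m) + cm (hs n) <= 2 * (1 / 2 ^+ n) by lra.
  move=> h4; have := ler_wpM2l c0 h4.
  by rewrite (_ : c * (2 * (1 / 2 ^+ n)) = 2 * c / 2 ^+ n)//; ring.
exists L, 1 => // h Qh _; rewrite -subr_le0.
apply: (@pow2_zero _ (5 * c)); first by rewrite mulr_ge0.
move=> n; have := cmB3 (q h) (q (hs n)) L; have := HL n.
have := H h _ Qh (hhs n).1; have := ler_wpM2l c0 (hhs n).2.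
by rewrite !mulrDr mul1r -!mulrA; lra.
Qed.

End Limits.

Section FixedPoint.
Context {R : realType}.
Local Notation C := (Cplx R).
Local Notation mu := (@lebesgue_measure R).
Local Notation MR := (measurableTypeR R).
Variables (I : finType) (X : set R) (D : set MR) (Dx : R -> set MR) (v : I -> R -> R).
Hypothesis mD : measurable D.
Hypothesis mDx : forall x, measurable (Dx x).
Hypothesis DxD : forall x, Dx x `<=` D.
Hypothesis DX : D `<=` X.
Hypothesis v0 : forall i x, X x -> 0 <= v i x.
Implicit Types (K : I -> I -> R -> R -> C) (kv : I -> I -> R -> R -> R)
  (f g : I -> R -> C) (M b : R).

Definition iop K f (i : I) (x : R) : C :=
  \sum_j CI (Dx x) (fun t => K i j x t * f j t).

(** The ball of radius [M] in the sup norm weighted by [v]. Measurability concerns the domain of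
    integration [D], the bound all of [X], where the equation is to hold. *)
Definition bnd M f := (forall j, cmeas D (f j)) /\
  forall j t, X t -> cm (f j t) <= M * v j t.

(** This makes the norm of [iop K] at most [b] in the weighted sup norm. A dominating function [kv]
    is exhibited so that concrete kernels need only be compared with functions of known integral;
    the factor 2 is that of [CI_le]. *)
Definition kerbd b K := exists kv, [/\ forall i j x, X x -> cmeas (Dx x) (K i j x),
  forall i j x t, X x -> Dx x t -> cm (K i j x t) * v j t <= kv i j x t,
  forall i j x, X x -> rint (Dx x) (kv i j x) &
  forall i x, X x -> 2 * \sum_j \int[mu]_(t in Dx x) kv i j x t <= b * v i x].

Lemma iop_int b K M f i j x : 0 <= M -> kerbd b K -> bnd M f -> X x ->
  cintegrable (Dx x) (fun t => K i j x t * f j t).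
Proof.
move=> M0 [kv [km kb ki ks]] [mf fM] Xx.
apply: (cint_dom (mDx x) _ (rintZ M (mDx x) (ki i j x Xx))).
  by apply: cmeasM; [exact: km|exact: cmeasS mD (@DxD x) (mf j)].
move=> t Dt; rewrite cmM.
apply: (le_trans (ler_wpM2l (cm_ge0 _) (fM j t (DX (DxD Dt))))).
by rewrite mulrCA ler_wpM2l// kb.
Qed.

Lemma iop_le_int K (kv : I -> R -> R) M f i x : 0 <= M -> (forall j, cmeas (Dx x) (K i j x)) ->
  (forall j t, Dx x t -> cm (K i j x t) * v j t <= kv j t) ->
  (forall j, rint (Dx x) (kv j)) -> bnd M f ->
  cm (iop K f i x) <= M * (2 * \sum_j \int[mu]_(t in Dx x) kv j t).
Proof.
move=> M0 km kb ki [mf fM].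
rewrite /iop; apply: (le_trans (cm_sum _ _ _)).
rewrite !mulr_sumr; apply: ler_sum => j _.
rewrite mulrCA -RintegralZl//; last exact: ki.
apply: CI_le => //.
- by apply: cmeasM; [exact: km|exact: cmeasS mD (@DxD x) (mf j)].
- by apply: rintZ => //; exact: ki.
move=> t Dt; rewrite cmM.
apply: (le_trans (ler_wpM2l (cm_ge0 _) (fM j t (DX (DxD Dt))))).
by rewrite mulrCA ler_wpM2l// kb.
Qed.

Lemma iop_le b K M f i x : 0 <= M -> kerbd b K -> bnd M f -> X x ->
  cm (iop K f i x) <= b * M * v i x.
Proof.
move=> M0 [kv [km kb ki ks]] bf Xx.
have := iop_le_int (i := i) (x := x) (kv := kv i ^~ x) M0 (fun j => km i j x Xx)
  (fun j t => kb i j x t Xx) (fun j => ki i j x Xx) bf.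
move=> h; apply: (le_trans h); rewrite [b * M]mulrC -mulrA ler_wpM2l//.
exact: ks.
Qed.

Lemma bnd_lin (c1 c2 : C) M1 M2 f1 f2 : bnd M1 f1 -> bnd M2 f2 ->
  bnd (cm c1 * M1 + cm c2 * M2) (fun i x => c1 * f1 i x + c2 * f2 i x).
Proof.
move=> [m1 b1] [m2 b2]; split=> [j|j t Xt].
  by apply: cmeasD; exact: cmeasZ.
apply: (le_trans (cmD _ _)); rewrite !cmM mulrDl -!mulrA.
by apply: lerD; rewrite ler_wpM2l ?cm_ge0 ?b1 ?b2.
Qed.

Lemma iop_lin b K M (c1 c2 : C) f1 f2 i x : 0 <= M -> kerbd b K ->
  bnd M f1 -> bnd M f2 -> X x ->
  iop K (fun i x => c1 * f1 i x + c2 * f2 i x) i x = c1 * iop K f1 i x + c2 * iop K f2 i x.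
Proof.
move=> M0 kK b1 b2 Xx; rewrite /iop !mulr_sumr -big_split; apply: eq_bigr => j _ /=.
have i1 := iop_int i j M0 kK b1 Xx; have i2 := iop_int i j M0 kK b2 Xx.
rewrite -!CIZ// -CID//; [|exact: cintZ|exact: cintZ].
by apply: CI_ext => t _; ring.
Qed.

Lemma iop_linK b1 b2 K1 K2 M (c1 c2 : C) f i x : 0 <= M -> kerbd b1 K1 -> kerbd b2 K2 ->
  bnd M f -> X x ->
  iop (fun i j x t => c1 * K1 i j x t + c2 * K2 i j x t) f i x =
  c1 * iop K1 f i x + c2 * iop K2 f i x.
Proof.
move=> M0 k1 k2 bf Xx; rewrite /iop !mulr_sumr -big_split; apply: eq_bigr => j _ /=.
have i1 := iop_int i j M0 k1 bf Xx; have i2 := iop_int i j M0 k2 bf Xx.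
rewrite -!CIZ// -CID//; [|exact: cintZ|exact: cintZ].
by apply: CI_ext => t _; ring.
Qed.

Lemma bnd_le M M' f : M <= M' -> bnd M f -> bnd M' f.
Proof.
move=> MM [m1 b1]; split=> // j t Xt; apply: (le_trans (b1 j t Xt)).
by rewrite ler_wpM2r ?v0.
Qed.

(** Inserting a bound [2 * M + M'] into the equation halves the excess over [2 * M]; iteration
    removes the unspecified [M']. Uniqueness, the final bound on the fixed point and
    differentiability in a parameter all rest on this estimate. *)
Lemma fixpoint_apriori K M M' f : kerbd 2^-1 K -> 0 <= M -> 0 <= M' -> bnd M' f ->
  (forall i x, X x -> cm (f i x - iop K f i x) <= M * v i x) ->
  forall i x, X x -> cm (f i x) <= 2 * M * v i x.
Proof.
move=> kK M0 M'0 bf H i x Xx; rewrite -subr_le0.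
have [vi0|vi0] := leP (v i x) 0.
  have e : v i x = 0 by apply/le_anti; rewrite vi0 v0.
  by have := bf.2 i x Xx; rewrite e !mulr0 subr0.
have step n : bnd (2 * M + M' / 2 ^+ n) f.
  elim: n => [|n IH].
    by rewrite expr0 divr1; apply: bnd_le bf; rewrite lerDr mulr_ge0.
  split=> [j|j t Xt]; first exact: bf.1.
  have n0 : 0 <= 2 * M + M' / 2 ^+ n.
    by rewrite addr_ge0 ?mulr_ge0// ?invr_ge0 ?exprn_ge0.
  have := cmD (f j t - iop K f j t) (iop K f j t); rewrite subrK => h.
  apply: (le_trans h); apply: (le_trans (lerD (H j t Xt) (iop_le j n0 kK IH Xt))).
  rewrite -mulrDl ler_wpM2r ?v0// exprS invfM; lra.
apply: (@pow2_zero _ _ (M' * v i x)); first by rewrite mulr_ge0// v0.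
move=> n; have := (step n).2 i x Xx; rewrite mulrDl; lra.
Qed.

Lemma fixpoint_unique K M f g1 g2 : kerbd 2^-1 K -> 0 <= M -> bnd M g1 -> bnd M g2 ->
  (forall i x, X x -> g1 i x = f i x + iop K g1 i x) ->
  (forall i x, X x -> g2 i x = f i x + iop K g2 i x) ->
  forall i x, X x -> g1 i x = g2 i x.
Proof.
move=> kK M0 b1 b2 e1 e2 i x Xx.
have b3 := bnd_lin 1 (-1) b1 b2.
apply/eqP; rewrite -subr_eq0 -cm_eq0; apply/eqP/le_anti; rewrite cm_ge0 andbT.
have M'0 : 0 <= cm (1 : C) * M + cm (-1 : C) * M.
  by rewrite addr_ge0 ?mulr_ge0 ?cm_ge0.
have := fixpoint_apriori kK (lexx 0) M'0 b3 _ i Xx.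
rewrite mulr0 mul0r mul1r mulN1r; apply => j y Xy.
rewrite (iop_lin _ _ _ M0 kK b1 b2 Xy) mul0r [g1 j y]e1// [g2 j y]e2//.
by rewrite (_ : _ - _ = 0) ?cm0//; ring.
Qed.

(** Picard iteration: consecutive iterates differ by at most [M / 2 ^+ n] in the weighted norm, so
    they converge pointwise and the limit is measurable. That [iop K] preserves measurability is
    checked for concrete kernels, since the set of integration varies with [x]. *)
Lemma fixpoint_exists K M g : kerbd 2^-1 K -> 0 <= M -> bnd M g ->
  (forall f M, bnd M f -> forall i, cmeas D (iop K f i)) ->
  exists2 f, bnd (2 * M) f & forall i x, X x -> f i x = g i x + iop K f i x.
Proof.
move=> kK M0 bg mop.
pose F := fix F (n : nat) : I -> R -> C :=
  if n is n'.+1 then fun i x => g i x + iop K (F n') i x else g.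
have M20 : 0 <= 2 * M by rewrite mulr_ge0.
have FS n i x : F n.+1 i x = g i x + iop K (F n) i x by [].
have bF n : bnd (2 * M) (F n).
  elim: n => [|n IH]; first by apply: bnd_le bg; lra.
  split=> [j|j t Xt].
    by apply: cmeasD; [exact: bg.1|exact: mop IH j].
  apply: (le_trans (cmD _ _)).
  apply: (le_trans (lerD (bg.2 j t Xt) (iop_le j M20 kK IH Xt))).
  by rewrite -mulrDl ler_wpM2r ?v0//; lra.
have dF n : bnd (M / 2 ^+ n) (fun i x => 1 * F n.+1 i x + (-1) * F n i x).
  elim: n => [|n IH].
    split=> [j|j t Xt].
      by apply: cmeasD; apply: cmeasZ; exact: (bF _).1.
    rewrite FS mul1r mulN1r addrAC subrr add0r expr0 divr1.
    apply: (le_trans (iop_le j M0 kK bg Xt)).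
    by rewrite ler_wpM2r ?v0//; lra.
  split=> [j|j t Xt].
    by apply: cmeasD; apply: cmeasZ; exact: (bF _).1.
  rewrite FS [F n.+1 j t]FS.
  rewrite (_ : _ + _ = 1 * iop K (F n.+1) j t + (-1) * iop K (F n) j t); last by ring.
  rewrite -(iop_lin _ _ _ M20 kK (bF _) (bF _) Xt).
  have n0 : 0 <= M / 2 ^+ n by rewrite mulr_ge0// ?invr_ge0 ?exprn_ge0.
  apply: (le_trans (iop_le j n0 kK IH Xt)).
  by rewrite exprS invfM mulrCA.
have cF i x n m : X x -> (n <= m)%N -> cm (F m i x - F n i x) <= 2 * M * v i x / 2 ^+ n.
  move=> Xx /subnK <-.
  have w0 : 0 <= M * v i x by rewrite mulr_ge0// v0.
  suff : cm (F (m - n + n)%N i x - F n i x) <=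
      2 * (M * v i x) / 2 ^+ n - 2 * (M * v i x) / 2 ^+ (m - n + n).
    have : 0 <= 2 * (M * v i x) / 2 ^+ (m - n + n).
      by apply: divr_ge0; [exact: (mulr_ge0 (ler0n R 2) w0)|exact: exprn_ge0].
    by rewrite !mulrA; lra.
  elim: (m - n)%N => [|k IH]; first by rewrite add0n !subrr cm0.
  rewrite addSn.
  have := (dF (k + n)%N).2 i x Xx; rewrite mul1r mulN1r => h.
  have := cmB3 (F (k + n).+1 i x) (F (k + n)%N i x) (F n i x).
  move: IH h; rewrite exprS invfM; set a := (2 ^+ (k + n))^-1.
  by move: (_ / 2 ^+ n) => b; rewrite -!mulrA [a * v i x]mulrC !mulrA; lra.
have /choice[f hf] : forall p : I * R, exists l, X p.2 ->
    forall n, cm (F n p.1 p.2 - l) <= 4 * M * v p.1 p.2 / 2 ^+ n.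
  move=> [i x]; have [Xx|nXx] := pselect (X x); last by exists 0.
  have [|l hl] := @cplx_pow2_cauchy _ (fun n => F n i x) (2 * M * v i x) _
     (fun n m => @cF i x n m Xx); first by rewrite !mulr_ge0// v0.
  by exists l => _ n /=; rewrite (le_trans (hl n))// !mulrA; lra.
pose f' i x := f (i, x).
have {hf}cf i x n : X x -> cm (F n i x - f' i x) <= 4 * M * v i x / 2 ^+ n.
  by move=> Xx; exact: (hf (i, x) Xx n).
(* A crude bound, [2 * M] for the start and [4 * M] for its distance to the limit;
   [fixpoint_apriori] improves it to [2 * M] at the end. *)
have bf : bnd (6 * M) f'.
  split=> [j|j t Xt].
    apply: (cmeas_lim (F := fun n => F n j)) => [n|x Dx' e e0]; first exact: (bF n).1.
    have w0 : 0 <= 4 * M * v j x by rewrite !mulr_ge0// v0//; exact: DX.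
    have [N hN] := pow2_small w0 e0.
    exists N => n Nn; apply: (le_trans (cf j x n (DX Dx'))).
    by apply: le_trans hN; exact: pow2_le.
  have := cf j t 0%N Xt; have := (bF 0%N).2 j t Xt.
  have := cm_ge (f' j t) (F 0%N j t); rewrite cmBC expr0 divr1; lra.
have M60 : 0 <= 6 * M by rewrite mulr_ge0.
have ff i x : X x -> f' i x = g i x + iop K f' i x.
  move=> Xx; apply/eqP; rewrite -subr_eq0 -cm_eq0; apply/eqP/le_anti.
  rewrite cm_ge0 andbT; apply: (@pow2_zero _ _ (4 * M * v i x)).
    by rewrite !mulr_ge0// v0.
  move=> n.
  have M620 : 0 <= 6 * M by [].
  have bFn : bnd (6 * M) (F n) by apply: bnd_le (bF n); lra.
  have h1 := cf i x n.+1 Xx.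
  have db : bnd (4 * M / 2 ^+ n) (fun i x => 1 * F n i x + (-1) * f' i x).
    split=> [j|j t Xt]; first by apply: cmeasD; apply: cmeasZ; [exact: (bF _).1|exact: bf.1].
    by rewrite mul1r mulN1r mulrAC; exact: cf.
  have n0 : 0 <= 4 * M / 2 ^+ n by rewrite !mulr_ge0// ?invr_ge0 ?exprn_ge0.
  have := iop_le i n0 kK db Xx.
  rewrite (iop_lin _ _ _ M60 kK bFn bf Xx) => h2.
  have := cmB (1 * iop K (F n) i x + (-1) * iop K f' i x) (F n.+1 i x - f' i x).
  rewrite FS (_ : _ - (_ - _) = f' i x - (g i x + iop K f' i x)); last by ring.
  move=> h3; apply: (le_trans h3); apply: (le_trans (lerD h2 h1)).
  rewrite exprS invfM; set a := (2 ^+ n)^-1; rewrite -!mulrA [a * _]mulrC; lra.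
exists f' => //; split=> [j|j t Xt]; first exact: bf.1.
apply: (fixpoint_apriori kK M0 M60 bf) => // i x Xx.
by rewrite {1}ff// addrK; exact: bg.2.
Qed.

Lemma kerbd_lin b1 b2 (c1 c2 : C) K1 K2 : kerbd b1 K1 -> kerbd b2 K2 ->
  kerbd (cm c1 * b1 + cm c2 * b2) (fun i j x t => c1 * K1 i j x t + c2 * K2 i j x t).
Proof.
move=> [kv1 [m1 e1 i1 s1]] [kv2 [m2 e2 i2 s2]].
exists (fun i j x t => cm c1 * kv1 i j x t + cm c2 * kv2 i j x t); split.
- by move=> i j x Xx; apply: cmeasD; apply: cmeasZ; [exact: m1|exact: m2].
- move=> i j x t Xx Dt; have vt : 0 <= v j t by apply: v0; exact: DX (DxD Dt).
  apply: (le_trans (ler_wpM2r vt (cmD _ _))); rewrite !cmM mulrDl -!mulrA.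
  by apply: lerD; rewrite ler_wpM2l ?cm_ge0 ?e1 ?e2.
- by move=> i j x Xx; apply: rintD => //; apply: rintZ => //; [exact: i1|exact: i2].
- move=> i x Xx.
  under eq_bigr => j _.
    rewrite RintegralD//; last 2 first.
    + by apply: rintZ => //; exact: i1.
    + by apply: rintZ => //; exact: i2.
    rewrite !RintegralZl//; [|exact: i2|exact: i1]; over.
  rewrite big_split /= -!mulr_sumr.
  have := ler_wpM2l (cm_ge0 c1) (s1 i x Xx); have := ler_wpM2l (cm_ge0 c2) (s2 i x Xx).
  by move: (\sum_j _) (\sum_j _) => S1 S2; lra.
Qed.

Lemma kerbd_le b b' K : b <= b' -> kerbd b K -> kerbd b' K.
Proof.
move=> bb [kv [h1 h2 h3 h4]]; exists kv; split=> // i x Xx.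
by apply: (le_trans (h4 i x Xx)); rewrite ler_wpM2r ?v0.
Qed.

(* Second-order expansion in [rho] at [rho0], relative to [P], the error being
   measured by [kd] resp. by the weights. *)
Definition kertay (P : set C) (rho0 : C) (B : R) (K : C -> I -> I -> R -> R -> C) :=
  exists K1 : I -> I -> R -> R -> C, exists kd : I -> I -> R -> R -> R,
  [/\ forall i j x t, X x -> Dx x t -> cm (K1 i j x t) * v j t <= kd i j x t,
      forall rho i j x t, P rho -> X x -> Dx x t ->
        cm (K rho i j x t - K rho0 i j x t - (rho - rho0) * K1 i j x t) * v j t <=
        cm (rho - rho0) ^+ 2 * kd i j x t,
      forall i j x, X x -> rint (Dx x) (kd i j x) &
      forall i x, X x -> 2 * \sum_j \int[mu]_(t in Dx x) kd i j x t <= B * v i x].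

Definition funtay (P : set C) (rho0 : C) (B : R) (g : C -> I -> R -> C) :=
  exists2 g1 : I -> R -> C, (forall i x, X x -> cm (g1 i x) <= B * v i x) &
    forall rho i x, P rho -> X x ->
      cm (g rho i x - g rho0 i x - (rho - rho0) * g1 i x) <=
      cm (rho - rho0) ^+ 2 * (B * v i x).

(** Both quotients approximate the same coefficient [k1], with errors [cm h * kd] and [cm h' * kd].
    The coefficient drops out of the difference. *)
Lemma quotient_expansion (f f0 h h' f' k1 : C) (kd : R) : h != 0 -> h' != 0 ->
  cm (f - f0 - h * k1) <= cm h ^+ 2 * kd -> cm (f' - f0 - h' * k1) <= cm h' ^+ 2 * kd ->
  cm (h^-1 * (f - f0) - h'^-1 * (f' - f0)) <= (cm h + cm h') * kd.
Proof.
move=> h0 h'0 e1 e2.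
have q (a : C) F : a != 0 -> cm (F - f0 - a * k1) <= cm a ^+ 2 * kd ->
    cm (a^-1 * (F - f0) - k1) <= cm a * kd.
  move=> a0; rewrite (_ : a^-1 * (F - f0) - k1 = a^-1 * (F - f0 - a * k1)); last by field.
  by rewrite cmM cmV ler_pdivrMl ?cm_gt0// mulrA -expr2.
have := cmB (h^-1 * (f - f0) - k1) (h'^-1 * (f' - f0) - k1).
rewrite (_ : _ - _ - (_ - _) = h^-1 * (f - f0) - h'^-1 * (f' - f0)); last by ring.
by have := q h f h0 e1; have := q h' f' h'0 e2; rewrite mulrDl; lra.
Qed.

Lemma quotient_expansion1 (f f0 h k1 : C) (kd : R) : h != 0 -> cm h <= 1 -> 0 <= kd ->
  cm k1 <= kd -> cm (f - f0 - h * k1) <= cm h ^+ 2 * kd ->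
  cm (h^-1 * (f - f0)) <= 2 * kd.
Proof.
move=> h0 h1 kd0 hk e1.
rewrite (_ : h^-1 * (f - f0) = h^-1 * (f - f0 - h * k1) + k1); last by field.
apply: (le_trans (cmD _ _)); rewrite cmM cmV.
have : (cm h)^-1 * cm (f - f0 - h * k1) <= kd.
  rewrite ler_pdivrMl ?cm_gt0//; apply: (le_trans e1).
  by rewrite ler_wpM2r// expr2 ler_piMl ?cm_ge0.
lra.
Qed.

(** The difference quotients of [f] at [rho0] solve the equation with kernel [K rho0] and a free
    term built from the quotients of [g] and [K]. Subtracting two such equations leaves a free term
    of size [O(|rho - rho0| + |rho' - rho0|)]; [fixpoint_apriori] transfers this to the quotients,
    and [quotient_limit] yields the derivative. *)
Lemma fixpoint_deriv (P : set C) (rho0 : C) (M B : R) (K : C -> I -> I -> R -> R -> C)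
  (g f : C -> I -> R -> C) : 0 <= M -> 0 <= B -> P rho0 ->
  (forall rho, P rho -> cm (rho - rho0) <= 1) ->
  kerbd 2^-1 (K rho0) -> (forall rho, P rho -> exists b, kerbd b (K rho)) ->
  kertay P rho0 B K -> funtay P rho0 B g ->
  (forall rho, P rho -> bnd M (f rho)) ->
  (forall rho i x, P rho -> X x -> f rho i x = g rho i x + iop (K rho) (f rho) i x) ->
  forall i x, X x -> exists L, gd id P (fun rho => f rho i x) rho0 L.
Proof.
move=> M0 B0 P0 P1 k0 kK [K1 [kd [t1 t2 t3 t4]]] [g1 u1 u2] bf ff i x Xx.
have kK0 := kK _ P0.
pose dK rho i j x t := (rho - rho0)^-1 * K rho i j x t + - (rho - rho0)^-1 * K rho0 i j x t.
pose ddK rho rho' i j x t := 1 * dK rho i j x t + (-1) * dK rho' i j x t.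
have kd0 k j y t : X y -> Dx y t -> 0 <= kd k j y t.
  move=> Xy Dt; apply: (le_trans _ (t1 k j y t Xy Dt)).
  by rewrite mulr_ge0 ?cm_ge0// v0//; exact: DX (DxD Dt).
have mul_v (z : C) (w : R) : 0 <= w -> cm z * w = cm (z * toC w).
  by move=> w0; rewrite cmM cm_toC_ge0.
have edK rho j j' y t w : dK rho j j' y t * w =
    (rho - rho0)^-1 * (K rho j j' y t * w - K rho0 j j' y t * w).
  by rewrite /dK; ring.
have bdK rho : P rho -> rho != rho0 -> kerbd (2 * B) (dK rho).
  move=> Pr rr; have [b kb] := kK rho Pr.
  have [_ [m1 _ _ _]] := kerbd_lin (rho - rho0)^-1 (- (rho - rho0)^-1) kb k0.
  exists (fun i j x t => 2 * kd i j x t); split.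
  - exact: m1.
  - move=> j j' y t Xy Dt; have vt : 0 <= v j' t by apply: v0; exact: DX (DxD Dt).
    rewrite mul_v// edK.
    apply: (@quotient_expansion1 _ _ _ (K1 j j' y t * toC (v j' t))).
    + by rewrite subr_eq0.
    + exact: P1.
    + exact: kd0.
    + by rewrite -mul_v// t1.
    + rewrite mulrA -!mulrBl -mul_v//; exact: t2.
  - by move=> j j' y Xy; apply: rintZ => //; exact: t3.
  - move=> j y Xy; under eq_bigr => j' _ do rewrite (@RintegralZl _ _ _ mu _ _ _ (mDx y) (t3 _ _ _ Xy)).
    rewrite -mulr_sumr -mulrA ler_wpM2l//; exact: t4.
have bddK rho rho' : P rho -> rho != rho0 -> P rho' -> rho' != rho0 ->
    kerbd ((cm (rho - rho0) + cm (rho' - rho0)) * B) (ddK rho rho').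
  move=> Pr rr Pr' rr'.
  have [_ [m1 _ _ _]] := kerbd_lin 1 (-1) (bdK rho Pr rr) (bdK rho' Pr' rr').
  set s := cm (rho - rho0) + cm (rho' - rho0).
  have s0 : 0 <= s by rewrite addr_ge0 ?cm_ge0.
  exists (fun i j x t => s * kd i j x t); split.
  - exact: m1.
  - move=> j j' y t Xy Dt; have vt : 0 <= v j' t by apply: v0; exact: DX (DxD Dt).
    rewrite mul_v// /ddK mulrDl -!mulrA mul1r !edK mulN1r.
    apply: (@quotient_expansion _ _ _ _ _ (K1 j j' y t * toC (v j' t))).
    + by rewrite subr_eq0.
    + by rewrite subr_eq0.
    + rewrite mulrA -!mulrBl -mul_v//; exact: t2.
    + rewrite mulrA -!mulrBl -mul_v//; exact: t2.
  - by move=> j j' y Xy; apply: rintZ => //; exact: t3.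
  - move=> j y Xy; under eq_bigr => j' _ do rewrite (@RintegralZl _ _ _ mu _ _ _ (mDx y) (t3 _ _ _ Xy)).
    by rewrite -mulr_sumr mulrCA -mulrA ler_wpM2l//; exact: t4.
pose df rho i x := (rho - rho0)^-1 * f rho i x + - (rho - rho0)^-1 * f rho0 i x.
(* Bound of the free term in [edf] below: [2 * B] from the quotient of [g], [2 * B * M] from the
   quotient of [K] acting on [f]. *)
pose B1 := 2 * B + 2 * B * M.
have B10 : 0 <= B1 by rewrite addr_ge0 ?mulr_ge0.
have bdf' rho : P rho -> exists2 M' : R, 0 <= M' & bnd M' (df rho).
  move=> Pr; have := bnd_lin (rho - rho0)^-1 (- (rho - rho0)^-1) (bf _ Pr) (bf _ P0).
  by move=> h; eexists; [|exact: h]; rewrite addr_ge0 ?mulr_ge0 ?cm_ge0.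
have edf rho j y : P rho -> rho != rho0 -> X y -> df rho j y - iop (K rho0) (df rho) j y =
    (rho - rho0)^-1 * (g rho j y - g rho0 j y) + iop (dK rho) (f rho) j y.
  move=> Pr rr Xy; have [b kb] := kK rho Pr.
  rewrite /df (iop_lin _ _ _ M0 k0 (bf _ Pr) (bf _ P0) Xy).
  rewrite (iop_linK _ _ _ M0 kb k0 (bf _ Pr) Xy).
  rewrite [f rho j y]ff// [f rho0 j y]ff//; ring.
have bdf rho : P rho -> rho != rho0 -> bnd (2 * B1) (df rho).
  move=> Pr rr; have [M' M'0 bM'] := bdf' rho Pr.
  split=> [j|j y Xy]; first exact: bM'.1.
  apply: (fixpoint_apriori k0 B10 M'0 bM') => // {Xy} {}j {}y Xy.
  rewrite edf//; apply: (le_trans (cmD _ _)); rewrite /B1 [X in _ <= X]mulrDl.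
  apply: lerD; last exact: (iop_le j M0 (bdK _ Pr rr) (bf _ Pr) Xy).
  rewrite -mulrA; apply: (@quotient_expansion1 _ _ _ (g1 j y)).
  - by rewrite subr_eq0.
  - exact: P1.
  - by rewrite mulr_ge0// v0.
  - exact: u1.
  - exact: u2.
(* Three contributions to the free term of a difference of quotients: [g]; the difference of kernel
   quotients acting on [f rho]; one kernel quotient acting on [f rho - f rho'], which is itself of
   first order. *)
pose B2 := B + B * M + 2 * B * (2 * B1).
have B20 : 0 <= B2 by rewrite !addr_ge0 ?mulr_ge0.
have key rho rho' j y : P rho -> rho != rho0 -> P rho' -> rho' != rho0 -> X y ->
    cm (df rho j y - df rho' j y) <=
    2 * ((cm (rho - rho0) + cm (rho' - rho0)) * B2) * v j y.
  move=> Pr rr Pr' rr' Xy.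
  set s := cm (rho - rho0) + cm (rho' - rho0).
  have s0 : 0 <= s by rewrite addr_ge0 ?cm_ge0.
  have B120 : 0 <= 2 * B1 by rewrite mulr_ge0.
  have b1 := bdf _ Pr rr; have b2 := bdf _ Pr' rr'.
  have b3 := bnd_lin 1 (-1) b1 b2.
  have M'0 : 0 <= cm (1 : C) * (2 * B1) + cm (-1 : C) * (2 * B1).
    by rewrite addr_ge0 ?mulr_ge0 ?cm_ge0.
  have := fixpoint_apriori k0 (mulr_ge0 s0 B20) M'0 b3 _ j Xy.
  rewrite mul1r mulN1r; apply => {Xy} {}j {}y Xy.
  rewrite (iop_lin _ _ _ B120 k0 b1 b2 Xy).
  have bff : bnd (s * (2 * B1)) (fun i x => 1 * f rho i x + (-1) * f rho' i x).
    split=> [k|k w Xw].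
      by apply: cmeasD; apply: cmeasZ; [exact: (bf _ Pr).1|exact: (bf _ Pr').1].
    have e a : a != rho0 -> f a k w = (a - rho0) * df a k w + f rho0 k w.
      by move=> ar; rewrite /df; field; rewrite subr_eq0.
    rewrite (e rho)// (e rho')// mul1r mulN1r (_ : _ - _ =
      (rho - rho0) * df rho k w - (rho' - rho0) * df rho' k w); last by ring.
    apply: (le_trans (cmB _ _)); rewrite !cmM /s.
    have := ler_wpM2l (cm_ge0 (rho - rho0)) (b1.2 k w Xw).
    by have := ler_wpM2l (cm_ge0 (rho' - rho0)) (b2.2 k w Xw); lra.
  have eqn : 1 * df rho j y + -1 * df rho' j y -
     (1 * iop (K rho0) (df rho) j y + -1 * iop (K rho0) (df rho') j y) =
     ((rho - rho0)^-1 * (g rho j y - g rho0 j y) -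
      (rho' - rho0)^-1 * (g rho' j y - g rho0 j y)) +
     (iop (ddK rho rho') (f rho) j y +
      iop (dK rho') (fun i x => 1 * f rho i x + (-1) * f rho' i x) j y).
    rewrite (iop_linK _ _ _ M0 (bdK _ Pr rr) (bdK _ Pr' rr') (bf _ Pr) Xy).
    rewrite (iop_lin _ _ _ M0 (bdK _ Pr' rr') (bf _ Pr) (bf _ Pr') Xy).
    have := edf rho j y Pr rr Xy; have := edf rho' j y Pr' rr' Xy.
    move=> /eqP; rewrite subr_eq => /eqP -> /eqP; rewrite subr_eq => /eqP ->; ring.
  rewrite eqn; apply: (le_trans (cmD _ _)).
  have sB1 : 0 <= s * (2 * B1) by rewrite mulr_ge0.
  have e1 := cmD (iop (ddK rho rho') (f rho) j y)
    (iop (dK rho') (fun i x => 1 * f rho i x + (-1) * f rho' i x) j y).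
  have e2 := iop_le j M0 (bddK _ _ Pr rr Pr' rr') (bf _ Pr) Xy.
  have e3 := iop_le j sB1 (bdK _ Pr' rr') bff Xy.
  have r0 : rho - rho0 != 0 by rewrite subr_eq0.
  have r0' : rho' - rho0 != 0 by rewrite subr_eq0.
  have e4 := quotient_expansion r0 r0' (u2 rho j y Pr Xy) (u2 rho' j y Pr' Xy).
  rewrite -/s in e2 e4.
  apply: (le_trans (lerD e4 (le_trans e1 (lerD e2 e3)))).
  by rewrite /B2 le_eqVlt; apply/orP; left; apply/eqP; ring.
pose Q := [set h : C | P (h + rho0) /\ h != 0].
have [|h h' [Ph h0] [Ph' h'0]|L [r r0 HL]] :=
    @quotient_limit R Q (fun h => df (h + rho0) i x) (2 * B2 * v i x).
- by rewrite !mulr_ge0// v0.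
- have n0 a : a != 0 -> a + rho0 != rho0.
    by move=> a0; rewrite -subr_eq0 addrK.
  have := key (h + rho0) (h' + rho0) i x Ph (n0 _ h0) Ph' (n0 _ h'0) Xx.
  rewrite !addrK => H; apply: (le_trans H).
  by rewrite le_eqVlt; apply/orP; left; apply/eqP; ring.
exists L => e e0; set c := 2 * B2 * v i x in HL.
have c0 : 0 <= c by rewrite !mulr_ge0// v0.
exists (Num.min r (e / (c + 1))); first by rewrite lt_min r0 divr_gt0// ltr_wpDl.
move=> rho Pr /=; rewrite lt_min => /andP[hr he].
have [->|rr] := eqVneq rho rho0.
  by rewrite !subrr mulr0 subrr cm0 mulr0.
have rn : rho - rho0 != 0 by rewrite subr_eq0.
have Qr : Q (rho - rho0) by split=> //; rewrite subrK.
have := HL _ Qr hr; rewrite subrK /df => H.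
rewrite (_ : _ - _ - _ = (rho - rho0) *
  ((rho - rho0)^-1 * f rho i x + - (rho - rho0)^-1 * f rho0 i x - L)); last by field.
rewrite cmM mulrC ler_wpM2r ?cm_ge0//; apply: (le_trans H).
move: he; rewrite ltr_pdivlMr ?ltr_wpDl// mulrDr mulr1 mulrC => he.
by have := cm_ge0 (rho - rho0); lra.
Qed.

End FixedPoint.

(** * Indefinite integrals and absolute continuity *)

Section Indefinite.
Context {R : realType}.
Local Notation C := (Cplx R).
Local Notation mu := (@lebesgue_measure R).
Local Notation MR := (measurableTypeR R).
Variable D : set MR.
Hypothesis mD : measurable D.

(** The point [x] belongs to the right side only, so the two sides partition [D]; [indef_false] then
    reduces every statement to the left side. *)
Definition side (dir : bool) (x : R) : set MR :=
  D `&` (if dir then `]-oo, x[%classic else `[x, +oo[%classic).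

(** The sign with which the integrand enters the derivative of [indef]; it is reused as the sign of
    the exponent in [tau]. *)
Definition sgd (dir : bool) : C := if dir then 1 else -1.

Lemma measurable_side dir x : measurable (side dir x).
Proof. by apply: measurableI => //; case: dir; exact: measurable_itv. Qed.

Lemma side_sub dir x : side dir x `<=` D.
Proof. by move=> t []. Qed.

Definition indef dir (phi : R -> C) x : C := CI (side dir x) phi.

Definition ico (x y : R) : set MR := D `&` `[x, y[%classic.

Lemma measurable_ico x y : measurable (ico x y).
Proof. by apply: measurableI => //; exact: measurable_itv. Qed.

Lemma indef_false phi x : cintegrable D phi ->
  indef false phi x = CI D phi - indef true phi x.
Proof.
move=> iphi; have e : D = side true x `|` side false x.
  rewrite /side -setIUr; apply/esym/setIidPl => t _ /=.
  by rewrite !in_itv/= andbT; case: (ltP t x) => h; [left|right].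
rewrite {1}e CI_setU -?e//.
- by rewrite addrAC subrr add0r.
- exact: measurable_side.
- exact: measurable_side.
- rewrite disj_set2E; apply/eqP/seteqP; split=> t //= [[_] /= + [_ /=]].
  by rewrite !in_itv/= andbT ltNge => /negP.
Qed.

Lemma indef_true_incr phi x y : cintegrable D phi -> x <= y ->
  indef true phi y - indef true phi x = CI (ico x y) phi.
Proof.
move=> iphi xy; have e : side true y = side true x `|` ico x y.
  rewrite /side /ico -setIUr; congr (_ `&` _); apply/seteqP; split=> t /=.
    by rewrite !in_itv/=; case: (ltP t x) => h ty; [left|right].
  by rewrite !in_itv/= => -[tx|/andP[]//]; exact: lt_le_trans xy.
rewrite /indef e CI_setU -?e.
- by rewrite addrAC subrr add0r.
- exact: measurable_side.
- exact: measurable_ico.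
- by apply: cintS iphi => //; [exact: measurable_side|exact: side_sub].
- rewrite disj_set2E; apply/eqP/seteqP; split=> t //= [[_] /= + [_ /=]].
  by rewrite !in_itv/= ltNge => /negP h /andP[].
Qed.

(** Absolute continuity of the Lebesgue integral, for the extension of [g] by 0 to the line. *)
Lemma rint_small (g : R -> R) : rint D g -> (forall x, D x -> 0 <= g x) ->
  forall e : R, 0 < e -> exists2 d : R, 0 < d & forall A : set MR, measurable A ->
    A `<=` D -> (mu A < d%:E)%E -> \int[mu]_(x in A) g x < e.
Proof.
move=> ig g0 e e0.
have ig' : mu.-integrable setT (EFin \o (g \_ D)).
  by rewrite -restrict_EFin; apply/integrable_restrict => //=; rewrite setTI.
have [d [d0 /= H]] := integral_normr_continuous ig' e0.
exists d => // A mA AD Ad; rewrite (_ : \int[mu]_(x in A) g x =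
  \int[mu]_(x in A) `|(g \_ D) x|); first exact: H.
apply: eq_Rintegral => x /set_mem Ax; rewrite patchE mem_set ?ger0_norm//; last exact: AD.
by apply: g0; exact: AD.
Qed.

Lemma ico_measure x y : x <= y -> (mu (ico x y) <= (y - x)%:E)%E.
Proof.
move=> xy; have h : (mu (ico x y) <= mu `[x, y[%classic)%E.
  apply: le_measure; rewrite ?inE; [exact: measurable_ico|exact: measurable_itv|].
  by move=> t [].
apply: (le_trans h); rewrite lebesgue_measure_itv/= lte_fin.
by case: ifP => _; rewrite ?lee_fin ?subr_ge0.
Qed.

Lemma indef_true_le phi x y : cintegrable D phi -> x <= y ->
  cm (indef true phi y - indef true phi x) <= 2 * \int[mu]_(t in ico x y) cm (phi t).
Proof.
move=> iphi xy; rewrite indef_true_incr//.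
have ii : cintegrable (ico x y) phi.
  by apply: cintS iphi => //; [exact: measurable_ico|move=> t []].
apply: CI_le => //; [exact: measurable_ico|exact: cint_cmeas|].
by apply: cint_norm => //; exact: measurable_ico.
Qed.

Lemma indef_cont dir phi x : cintegrable D phi -> gc (@toC R) setT (indef dir phi) x.
Proof.
move=> iphi.
suff {dir} H : gc (@toC R) setT (indef true phi) x.
  case: dir => // e e0; have [d d0 Hd] := H e e0; exists d => // y _ yd.
  rewrite !indef_false// (_ : _ - _ = - (indef true phi y - indef true phi x)); last by ring.
  by rewrite cmN Hd.
move=> e e0; have e20 : 0 < e / 2 by rewrite divr_gt0.
have [d d0 H] := rint_small (cint_norm mD iphi) (fun x _ => cm_ge0 _) e20.
exists d => // y _; rewrite -toCB cm_toC => yd.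
have key a b : a <= b -> b - a < d -> cm (indef true phi b - indef true phi a) <= e.
  move=> ab bad; apply: (le_trans (indef_true_le iphi ab)).
  have := H (ico a b) (measurable_ico _ _) (fun t h => h.1).
  move=> /(_ (le_lt_trans (ico_measure ab) _)); rewrite lte_fin => /(_ bad); lra.
have [xy|/ltW yx] := leP x y.
  by apply: key => //; move: yd; rewrite ger0_norm ?subr_ge0.
by rewrite cmBC; apply: key => //; move: yd; rewrite ler0_norm ?subr_le0// opprB.
Qed.

Lemma gc_cmeas (A : set MR) (f : R -> C) : measurable A ->
  (forall x, A x -> gc (@toC R) A f x) -> cmeas A f.
Proof.
move=> mA H; split; apply: subspace_continuous_measurable_fun => //.
- apply/subspace_continuousP => x Ax; apply/cvgrPdist_le => e e0.
  have [d d0 Hd] := H x Ax e e0; apply/nearRP; exists d => // y yd Ay.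
  rewrite distrC -ReCN -ReCD (le_trans (cm_Re _))// Hd//.
  by rewrite -toCB cm_toC.
- apply/subspace_continuousP => x Ax; apply/cvgrPdist_le => e e0.
  have [d d0 Hd] := H x Ax e e0; apply/nearRP; exists d => // y yd Ay.
  rewrite distrC -ImCN -ImCD (le_trans (cm_Im _))// Hd//.
  by rewrite -toCB cm_toC.
Qed.

Lemma indef_meas dir phi : cintegrable D phi -> cmeas D (indef dir phi).
Proof.
move=> iphi; apply: gc_cmeas => // x Dx e e0.
by have [d d0 H] := indef_cont dir x iphi e0; exists d => // y _; exact: H.
Qed.

Hypothesis Dconv : forall x y z, D x -> D y -> x <= z -> z <= y -> D z.

(** Meant for continuous integrands, as in the unperturbed equation. Order convexity of [D] makes
    [ico a b] a full interval of length [b - a], on which the constant [phi x] integrates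
    exactly. *)
Lemma indef_deriv_pt dir phi x : cintegrable D phi -> D x -> gc (@toC R) D phi x ->
  gd (@toC R) D (indef dir phi) x (sgd dir * phi x).
Proof.
move=> iphi Dx cphi.
suff {dir} H : gd (@toC R) D (indef true phi) x (phi x).
  case: dir; first by rewrite mul1r.
  apply: (gd_eq (L := 0 - phi x)); first by rewrite sub0r mulN1r.
  apply: gd_ext (gdB (gd_cst _ _ (CI D phi) _) H) => [y Dy|]; by rewrite indef_false.
move=> e e0; have [d d0 H] := cphi (e / 2) (divr_gt0 e0 (ltr0Sn _ _)).
exists d => // y Dy; rewrite -toCB cm_toC => yd.
have key a b : D a -> D b -> a <= b -> (forall t, a <= t -> t <= b -> `|t - x| < d) ->
    cm (indef true phi b - indef true phi a - phi x * toC (b - a)) <= e * (b - a).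
  move=> Da Db ab near_; rewrite indef_true_incr//.
  have eab : ico a b = `[a, b[%classic.
    apply/setIidPr => t /=; rewrite in_itv/= => /andP[at_ tb].
    exact: (Dconv Da Db at_ (ltW tb)).
  have mab : mu (ico a b) = (b - a)%:E.
    rewrite eab lebesgue_measure_itv/= lte_fin; case: ltP => ba; first by rewrite EFinB.
    by rewrite (_ : b = a) ?subrr//; apply/le_anti; rewrite ba.
  have mI : measurable (ico a b) by exact: measurable_ico.
  have ii : cintegrable (ico a b) phi by apply: cintS iphi => // t [].
  have ic (c : R) : rint (ico a b) (fun=> c).
    apply: measurable_bounded_integrable => //.
      by rewrite [X in (X < _)%E]mab ltry.
    by exists `|c|; split; [exact: num_real|move=> M cM t _ /=; exact: ltW].
  have icC (c : C) : cintegrable (ico a b) (fun=> c) by split; exact: ic.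
  have -> : phi x * toC (b - a) = CI (ico a b) (fun=> phi x).
    apply: ReIm_inj; rewrite ?Re_CI ?Im_CI Rintegral_cst// [X in _ * fine X]mab /=.
      by rewrite ReCM /= mulr0 subr0.
    by rewrite ImCM /= mulr0 add0r.
  rewrite -CIB//.
  have := @CI_le _ (ico a b) (fun t => phi t - phi x) (fun=> e / 2) mI.
  rewrite Rintegral_cst//.
  rewrite [X in _ * fine X]mab /= (_ : 2 * (e / 2 * (b - a)) = e * (b - a)); last by field.
  apply.
  - by apply: cmeasB; exact: cint_cmeas.
  - exact: ic.
  move=> t [Dt] /=; rewrite in_itv/= => /andP[at_ tb]; apply: H => //.
  by rewrite -toCB cm_toC near_// ltW.
have [xy|yx] := leP x y.
  move: yd; rewrite ger0_norm ?subr_ge0// => yd.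
  by apply: key => // t xt ty; rewrite ger0_norm ?subr_ge0//; lra.
move: yd; rewrite ler0_norm ?subr_le0 ?(ltW yx)// opprB => yd.
have := key y x Dy Dx (ltW yx).
rewrite cmBC => h; rewrite cmBC (_ : _ - (_ - _) = phi x * toC (y - x) - (indef true phi y -
   indef true phi x))//.
rewrite (_ : _ - _ = indef true phi x - indef true phi y - phi x * toC (x - y)).
  by rewrite cmBC; apply: h => t yt tx; rewrite ler0_norm ?subr_le0//; lra.
by rewrite !toCB; ring.
Qed.

Lemma indef_ac dir phi a b : cintegrable D phi ->
  (forall x, a <= x -> x <= b -> D x) -> abs_continuous a b (indef dir phi).
Proof.
move=> iphi abD.
suff {dir} H : abs_continuous a b (indef true phi).
  case: dir => // e e0; have [d d0 Hd] := H e e0; exists d => // n u v h1 h2 h3.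
  have := Hd n u v h1 h2 h3; congr (_ < _); apply: eq_bigr => i _.
  by rewrite !indef_false// distrC; congr (`| _ |); ring.
move=> e e0; have e20 : 0 < e / 2 by rewrite divr_gt0.
have [d d0 H] := rint_small (cint_norm mD iphi) (fun x _ => cm_ge0 _) e20.
exists d => // n u v uv triv suv.
under eq_bigr do rewrite cmE.
have -> : \sum_i toC (cm (indef true phi (v i) - indef true phi (u i))) =
    toC (\sum_i cm (indef true phi (v i) - indef true phi (u i))).
  by rewrite /toC (rmorph_sum (real_complex R)).
rewrite toC_lt.
pose F (i : 'I_n) : set MR := `]u i, v i[%classic.
have mF i : measurable (F i) by exact: measurable_itv.
have FD i : F i `<=` D.
  move=> t; rewrite /F /= in_itv/= => /andP[ut tv]; have [h1 [h2 h3]] := uv i.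
  by apply: abD; [exact: le_trans h1 (ltW ut)|exact: le_trans (ltW tv) h3].
pose A : set MR := \big[setU/set0]_(i < n) F i.
have mA : measurable A by exact: bigsetU_measurable.
have AD : A `<=` D.
  by rewrite /A -bigcup_seq => t [i _ /FD].
have muF i : (mu (F i) <= (v i - u i)%:E)%E.
  rewrite /F lebesgue_measure_itv/= lte_fin.
  by case: ifP => _; rewrite ?lee_fin ?subr_ge0; have [_ []] := uv i.
have muA : (mu A < d%:E)%E.
  rewrite /A measure_bigsetU_ord//.
  apply: le_lt_trans (_ : ((\sum_(i < n) (v i - u i))%:E < _)%E); last by rewrite lte_fin.
  by rewrite -sumEFin; apply: lee_sum => i _; exact: muF.
have := H A mA AD muA => h.
apply: le_lt_trans (_ : 2 * \int[mu]_(x in A) cm (phi x) < e); last by lra.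
have -> : \int[mu]_(x in A) cm (phi x) = \sum_i \int[mu]_(x in F i) cm (phi x).
  rewrite /Rintegral /A ge0_integral_bigsetU//=.
  - rewrite sum_fine//.
    by move=> i _; apply: integrable_fin_num => //; apply: rintS (cint_norm mD iphi).
  - exact: index_enum_uniq.
  - by apply: sub_trivIset triv.
  - apply/measurable_EFinP; apply: measurable_funS (cmeas_cm (cint_cmeas iphi)) => //.
  - by move=> x _; rewrite lee_fin cm_ge0.
rewrite mulr_sumr; apply: ler_sum => i _; have [h1 [h2 h3]] := uv i.
apply: (le_trans (indef_true_le iphi h2)); rewrite ler_wpM2l//.
rewrite le_eqVlt; apply/orP; left; apply/eqP.
have -> : ico (u i) (v i) = `[u i, v i[%classic.
  apply/setIidPr => t /=; rewrite in_itv/= => /andP[ut tv].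
  by apply: abD; [exact: le_trans h1 ut|exact: le_trans (ltW tv) h3].
have iF : rint (F i) (fun x => cm (phi x)).
  by apply: rintS (cint_norm mD iphi) => //; exact: FD.
by rewrite -Rintegral_itv_obnd_cbnd.
Qed.

End Indefinite.

Section Indefinite2.
Context {R : realType}.
Local Notation C := (Cplx R).
Local Notation mu := (@lebesgue_measure R).
Local Notation MR := (measurableTypeR R).
Variable D : set MR.
Hypothesis mD : measurable D.

(** Lebesgue's differentiation theorem for the extension of [g] by 0, whose integral up to [y] is
    the one over [side D true y]. *)
Lemma primitive_ae (g : R -> R) : rint D g ->
  {ae mu, forall x, D x ->
    gd (@toC R) setT (fun y => toC (\int[mu]_(t in side D true y) g t)) x (toC (g x))}.
Proof.
move=> ig; pose f := g \_ D.
have fT : mu.-integrable setT (EFin \o f).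
  by rewrite /f -restrict_EFin; apply/integrable_restrict => //=; rewrite setTI.
have fy (a b : itv_bound R) : mu.-integrable [set` Interval a b] (EFin \o f).
  by apply: integrableS fT => //; exact: measurable_itv.
have lf : locally_integrable [set: R] f.
  by apply: open_integrable_locally => //; exact: openT.
have ? := ae_filter_ringOfSetsType mu.
have := FTC1Ny (fun y => fy _ _) lf.
apply: filterS => x [df fx] Dx.
have E y : \int[mu]_(t in side D true y) g t =
    \int[mu]_(t in [set` `]-oo, y]]) f t.
  rewrite /side setIC Rintegral_mkcondr -Rintegral_itv_bndo_bndc//; exact: fy.
apply: gd_ext (is_derive_gd (_ : is_derive x 1 (fun y => \int[mu]_(t in [set` `]-oo, y]]) f t)
   (g x))) => [y _||]; rewrite ?E//.
apply: DeriveDef => //.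
by rewrite -derive1E fx /f patchE mem_set.
Qed.

Lemma indef_ae dir (phi : R -> C) : cintegrable D phi ->
  {ae mu, forall x, D x -> gd (@toC R) setT (indef D dir phi) x (sgd dir * phi x)}.
Proof.
move=> iphi; have [h1 h2] := iphi.
have ? := ae_filter_ringOfSetsType mu.
have := primitive_ae h1; apply: filterS2 (primitive_ae h2) => x H2 H1 Dx.
have {H1}H1 := H1 Dx; have {H2}H2 := H2 Dx.
have H := gdD H1 (gdZ imunit H2); rewrite -(ReImE (phi x)) in H.
case: dir; first by rewrite mul1r; exact: H.
rewrite mulN1r -sub0r.
apply: gd_ext (gdB (gd_cst _ _ (CI D phi) x) H) => [y _|]; by rewrite indef_false.
Qed.

(** With [psi] only integrable, neither integral need be differentiable at [x]. But the increment of
    the combination with frozen [u x], [w x] is the integral of [(u x * w t - w x * u t) * psi t]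
    between [x] and [y]: the bracket vanishes at [t = x], hence is [O(|y - x|)], and the integral of
    the modulus of [psi] over a short interval tends to 0. This is why first derivatives of
    solutions exist at every point. *)
Lemma vp_deriv (X : set R) dir (u w psi : R -> C) (u' w' : C) x : D `<=` X ->
  X x ->
  gd (@toC R) X u x u' -> gd (@toC R) X w x w' -> 0 < cm (u x) + cm (w x) ->
  cintegrable D (fun t => w t * psi t) -> cintegrable D (fun t => u t * psi t) ->
  gd (@toC R) X
    (fun y => u y * indef D dir (fun t => w t * psi t) y - w y * indef D dir (fun t => u t * psi t) y)
    x (u' * indef D dir (fun t => w t * psi t) x - w' * indef D dir (fun t => u t * psi t) x).
Proof.
move=> DX Xx du dw uw iw iu.
set al := indef D dir _; set be := indef D dir _.
have cal : gc (@toC R) X al x.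
  by move=> e e0; have [d d0 H] := indef_cont mD dir x iw e0; exists d => // y _; exact: H.
have cbe : gc (@toC R) X be x.
  by move=> e e0; have [d d0 H] := indef_cont mD dir x iu e0; exists d => // y _; exact: H.
(* the increments of the two integrals are combined before being estimated *)
have main : gd (@toC R) X (fun y => u x * (al y - al x) - w x * (be y - be x)) x 0.
  have [d1 d10 H1] := gd_lip du; have [d2 d20 H2] := gd_lip dw.
  pose s := cm (u x) + cm (w x).
  have [d3 d30 H3] := gd_gc du (divr_gt0 uw (ltr0Sn R 3)).
  have [d4 d40 H4] := gd_gc dw (divr_gt0 uw (ltr0Sn R 3)).
  pose L := cm (u x) * (cm w' + 1) + cm (w x) * (cm u' + 1).
  have L0 : 0 <= L.
    have := cm_ge0 u'; have := cm_ge0 w'; have := cm_ge0 (u x); have := cm_ge0 (w x).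
    by move=> *; rewrite addr_ge0 ?mulr_ge0//; lra.
  pose g t := cm (w t * psi t) + cm (u t * psi t).
  have ig : rint D g by apply: rintD => //; apply: cint_norm.
  have g0 t : D t -> 0 <= g t by move=> _; rewrite addr_ge0 ?cm_ge0.
  move=> e e0.
  pose c := 8 * (L + 1) / s.
  have c0 : 0 < c by rewrite divr_gt0// mulr_gt0//; lra.
  have [d5 d50 H5] := rint_small mD ig g0 (divr_gt0 e0 c0).
  exists (Num.min (Num.min (Num.min d1 d2) (Num.min d3 d4)) d5).
    by rewrite !lt_min d10 d20 d30 d40 d50.
  move=> y Xy; rewrite !lt_min => /andP[/andP[/andP[y1 y2] /andP[y3 y4]] y5].
  rewrite (_ : _ - _ - _ = u x * (al y - al x) - w x * (be y - be x)); last first.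
    by move: (al y) (al x) (be y) (be x) => a1 a2 b1 b2; ring.
  rewrite -toCB cm_toC.
  rewrite -toCB cm_toC in y5.
  have near_ t : D t -> `|t - x| <= `|y - x| ->
     cm ((u x * w t - w x * u t) * psi t) <= (4 * L / s * `|y - x|) * g t.
    move=> Dt tx; have Xt := DX _ Dt.
    have tl d : cm (toC y - toC x) < d -> cm (toC t - toC x) < d.
      by rewrite -!toCB !cm_toC; exact: le_lt_trans.
    have h1 := H1 t Xt (tl _ y1); have h2 := H2 t Xt (tl _ y2).
    have h3 := H3 t Xt (tl _ y3); have h4 := H4 t Xt (tl _ y4).
    have a1 : cm (u x * w t - w x * u t) <= L * `|y - x|.
      rewrite (_ : _ - _ = u x * (w t - w x) - w x * (u t - u x)); last by ring.
      apply: (le_trans (cmB _ _)); rewrite !cmM /L mulrDl -!mulrA.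
      rewrite -toCB cm_toC in h1 h2.
      have := cm_ge0 u'; have := cm_ge0 w' => p1 p2.
      apply: lerD; apply: ler_wpM2l; rewrite ?cm_ge0//.
        by apply: (le_trans h2); rewrite ler_wpM2l//; lra.
      by apply: (le_trans h1); rewrite ler_wpM2l//; lra.
    (* Near [x] one has [cm (u t) + cm (w t) >= s / 2], which recovers [psi] from the two products
       that are known to be integrable. *)
    have a2 : s * cm (psi t) <= 4 * g t.
      rewrite /g !cmM -mulrDl mulrA ler_wpM2r ?cm_ge0//.
      have := cm_ge (u x) (u t); rewrite cmBC; have := cm_ge (w x) (w t); rewrite cmBC.
      rewrite /s in uw *; move: h3 h4; lra.
    have a3 : cm (psi t) <= 4 * g t / s by rewrite ler_pdivlMr// mulrC.
    rewrite cmM; apply: (le_trans (ler_pM (cm_ge0 _) (cm_ge0 _) a1 a3)).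
    by rewrite le_eqVlt; apply/orP; left; apply/eqP; ring.
  have key a b : a <= b -> b - a <= `|y - x| ->
      (forall t, a <= t -> t <= b -> `|t - x| <= `|y - x|) ->
      cm (u x * (indef D true (fun t => w t * psi t) b - indef D true (fun t => w t * psi t) a) -
          w x * (indef D true (fun t => u t * psi t) b - indef D true (fun t => u t * psi t) a))
      <= e * `|y - x|.
    move=> ab bay abx; rewrite !indef_true_incr//.
    have mI := measurable_ico mD a b.
    have sub : ico D a b `<=` D by move=> t [].
    have iu' := cintS mD mI sub iu; have iw' := cintS mD mI sub iw.
    rewrite -!CIZ// -CIB//; [|exact: cintZ|exact: cintZ].
    have ig' : rint (ico D a b) g by apply: rintS ig.
    have := @CI_le _ (ico D a b) (fun t => u x * (w t * psi t) - w x * (u t * psi t))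
      (fun t => (4 * L / s * `|y - x|) * g t) mI.
    rewrite RintegralZl// => H; apply: (le_trans (H _ _ _)).
    - by apply: cmeasB; apply: cmeasZ; apply: cint_cmeas.
    - exact: rintZ.
    - move=> t [Dt] /=; rewrite in_itv/= => /andP[at_ tb].
      rewrite (_ : _ - _ = (u x * w t - w x * u t) * psi t); last by ring.
      by apply: near_ => //; apply: abx => //; exact: ltW.
    have muI : (mu (ico D a b) < d5%:E)%E.
      by apply: (le_lt_trans (ico_measure mD ab)); rewrite lte_fin; lra.
    have := H5 _ mI sub muI; set J := \int[mu]_(x0 in _) _ => hJ.
    have J0 : 0 <= J by apply: Rintegral_ge0 => t [Dt _]; exact: g0.
    have cJ : J * c <= e by rewrite -ler_pdivlMr// ltW.
    have cE : 2 * (4 * L / s) <= c.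
      rewrite /c !mulrA ler_wpM2r ?invr_ge0 ?(ltW uw)//; lra.
    have := ler_wpM2r J0 cE => h.
    rewrite (_ : 2 * _ = 2 * (4 * L / s) * J * `|y - x|); last by ring.
    by rewrite ler_wpM2r// (le_trans h)// mulrC.
  have [xy|/ltW yx] := leP x y.
    have sx : `|y - x| = y - x by rewrite ger0_norm ?subr_ge0.
    have h := key x y xy.
    case: dir @al @be cal cbe => al be cal cbe.
      by apply: h; rewrite sx// => t xt ty; rewrite ger0_norm ?subr_ge0//; lra.
    rewrite /al /be !(indef_false mD)// (_ : _ - _ = - (u x * (indef D true (fun t => w t * psi t) y -
      indef D true (fun t => w t * psi t) x) - w x * (indef D true (fun t => u t * psi t) y -
      indef D true (fun t => u t * psi t) x))); last by ring.
    by rewrite cmN; apply: h; rewrite sx// => t xt ty; rewrite ger0_norm ?subr_ge0//; lra.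
  have sx : `|y - x| = x - y by rewrite ler0_norm ?subr_le0// opprB.
  have h := key y x yx.
  case: dir @al @be cal cbe => al be cal cbe.
    rewrite -cmN (_ : - _ = u x * (al x - al y) - w x * (be x - be y)); last by ring.
    by apply: h; rewrite sx// => t xt ty; rewrite ler0_norm ?subr_le0//; lra.
  rewrite /al /be !(indef_false mD)// (_ : _ - _ = (u x * (indef D true (fun t => w t * psi t) x -
      indef D true (fun t => w t * psi t) y) - w x * (indef D true (fun t => u t * psi t) x -
      indef D true (fun t => u t * psi t) y))); last by ring.
  by apply: h; rewrite sx// => t xt ty; rewrite ler0_norm ?subr_le0//; lra.
have p1 := gdM (gdB du (gd_cst (@toC R) X (u x) x)) (gd_cst (@toC R) X (al x) x).
have p2 := gdM (gdB dw (gd_cst (@toC R) X (w x) x)) (gd_cst (@toC R) X (be x) x).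
(* The increment of a differentiable function times that of a continuous one is of smaller order
   than [y - x]. *)
have q (f : R -> C) f' (a : R -> C) : gd (@toC R) X f x f' -> gc (@toC R) X a x ->
    gd (@toC R) X (fun y => (f y - f x) * (a y - a x)) x 0.
  move=> df ca e e0; have [d1 d10 H1] := gd_lip df.
  have l0 : 0 < cm f' + 1 by rewrite ltr_wpDl ?cm_ge0.
  have [d2 d20 H2] := ca _ (divr_gt0 e0 l0).
  exists (Num.min d1 d2); first by rewrite lt_min d10.
  move=> y Xy; rewrite lt_min => /andP[y1 y2].
  rewrite mul0r subr0 !subrr mulr0 subr0 cmM.
  apply: (le_trans (ler_pM (cm_ge0 _) (cm_ge0 _) (H1 y Xy y1) (H2 y Xy y2))).
  by rewrite le_eqVlt; apply/orP; left; apply/eqP; field; rewrite gt_eqF.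
have r1 := q _ _ _ du cal; have r2 := q _ _ _ dw cbe.
have c0 := gd_cst (@toC R) X (u x * al x - w x * be x) x.
have := gdD (gdD main (gdB p1 p2)) (gdD (gdB r1 r2) c0).
rewrite !subr0 !mulr0 !addr0 add0r => H.
apply: gd_ext H => [y _|].
  by move: (al y) (al x) (be y) (be x) => a1 a2 b1 b2; ring.
by move: (al x) (be x) => a1 b1; ring.
Qed.
End Indefinite2.

(** * Absolutely continuous functions *)

Section AbsolutelyContinuous.
Context {R : realType}.
Local Notation C := (Cplx R).
Local Notation mu := (@lebesgue_measure R).
Local Notation MR := (measurableTypeR R).
Variables (a b : R).
Implicit Types (f g : R -> C).

Definition family n (u v : 'I_n -> R) := (forall i, a <= u i /\ u i <= v i /\ v i <= b) /\
  trivIset [set: 'I_n] (fun i => `]u i, v i[%classic).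

Lemma sum_norm n (F : 'I_n -> C) : \sum_i `|F i| = toC (\sum_i cm (F i)).
Proof.
by under eq_bigr do rewrite cmE; rewrite /toC (rmorph_sum (real_complex R)).
Qed.

Lemma acP f : abs_continuous a b f <-> forall e : R, 0 < e -> exists2 d : R, 0 < d &
  forall n (u v : 'I_n -> R), family u v -> \sum_i (v i - u i) < d ->
  \sum_i cm (f (v i) - f (u i)) < e.
Proof.
split=> H e e0; have [d d0 Hd] := H e e0; exists d => // n u v.
  by move=> [h1 h2] h3; have := Hd n u v h1 h2 h3; rewrite sum_norm toC_lt.
by move=> h1 h2 h3; rewrite sum_norm toC_lt Hd.
Qed.

Lemma ac_gc f : abs_continuous a b f -> forall x, a <= x -> x <= b -> gc (@toC R) `[a, b] f x.
Proof.
move=> /acP H x ax xb e e0; have [d d0 Hd] := H e e0; exists d => // y /=.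
rewrite in_itv/= => /andP[ay yb]; rewrite -toCB cm_toC => yd.
have key u v : a <= u -> u <= v -> v <= b -> v - u < d -> cm (f v - f u) <= e.
  move=> au uv vb vu; have := Hd 1%N (fun=> u) (fun=> v); rewrite !big_ord1 => h.
  apply: ltW; apply: h => //; split=> // i j _ _ _; by rewrite !ord1.
have [xy|/ltW yx] := leP x y.
  by apply: key => //; rewrite ger0_norm ?subr_ge0// in yd.
by rewrite cmBC; apply: key => //; rewrite ler0_norm ?subr_le0// opprB in yd.
Qed.

Lemma gc_itv_bounded f : a <= b -> (forall x, a <= x -> x <= b -> gc (@toC R) `[a, b] f x) ->
  exists2 M : R, 0 < M & forall x, a <= x -> x <= b -> cm (f x) <= M.
Proof.
move=> ab H.
have [M HM] : exists M : R, forall x, a <= x -> x <= b -> cm (f x) <= M.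
  apply: (@cousin _ (fun u v => exists M : R, forall x, u <= x -> x <= v -> cm (f x) <= M)) => //.
    move=> x ax xb; have [d d0 Hd] := gc_bounded (H x ax xb); exists d => // u v au ux xv vb vu.
    exists (cm (f x) + 1) => y uy yv; apply: Hd.
      by rewrite /= in_itv/=; apply/andP; split; lra.
    by rewrite -toCB cm_toC ltr_norml; apply/andP; split; lra.
  move=> u v w _ _ _ _ [M1 H1] [M2 H2]; exists (Num.max M1 M2) => x ux xw; rewrite le_max.
  by have [xv|/ltW vx] := leP x v; [rewrite H1|rewrite H2// orbT].
exists (Num.max 1 M); first by rewrite lt_max ltr01.
by move=> x ax xb; rewrite le_max HM// orbT.
Qed.

Lemma acD f g : abs_continuous a b f -> abs_continuous a b g ->
  abs_continuous a b (fun x => f x + g x).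
Proof.
move=> /acP F /acP G; apply/acP => e e0; have e2 : 0 < e / 2 by rewrite divr_gt0.
have [d1 d10 H1] := F _ e2; have [d2 d20 H2] := G _ e2.
exists (Num.min d1 d2) => [|n u v uv]; first by rewrite lt_min d10.
rewrite lt_min => /andP[l1 l2]; have := H1 n u v uv l1; have := H2 n u v uv l2 => h2 h1.
apply: (@le_lt_trans _ _ (\sum_i (cm (f (v i) - f (u i)) + cm (g (v i) - g (u i))))).
  apply: ler_sum => i _; have := cmD (f (v i) - f (u i)) (g (v i) - g (u i)).
  by apply: le_trans; rewrite le_eqVlt; apply/orP; left; apply/eqP; congr cm; ring.
by rewrite big_split /=; lra.
Qed.

Lemma acM f g : abs_continuous a b f -> abs_continuous a b g ->
  abs_continuous a b (fun x => f x * g x).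
Proof.
move=> F G; have [ab|/lt_geF ba] := leP a b; last first.
  apply/acP => e e0; exists 1 => // n u v [uv _] _; case: n u v uv => [|n] u v uv.
    by rewrite big_ord0.
  by have [h1 [h2 h3]] := uv ord0; move: ba; rewrite (le_trans h1 (le_trans h2 h3)).
have [A A0 fA] := gc_itv_bounded ab (ac_gc F); have [B B0 gB] := gc_itv_bounded ab (ac_gc G).
move: F G => /acP F /acP G; apply/acP => e e0.
have e2 : 0 < e / 2 by rewrite divr_gt0.
have [d1 d10 H1] := F _ (divr_gt0 e2 B0); have [d2 d20 H2] := G _ (divr_gt0 e2 A0).
exists (Num.min d1 d2) => [|n u v uv]; first by rewrite lt_min d10.
rewrite lt_min => /andP[l1 l2]; have := H1 n u v uv l1; have := H2 n u v uv l2.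
rewrite (ltr_pdivlMr _ _ A0) => h2; rewrite (ltr_pdivlMr _ _ B0) => h1.
apply: (@le_lt_trans _ _ (\sum_i (cm (f (v i) - f (u i)) * B + cm (g (v i) - g (u i)) * A))).
  apply: ler_sum => i _; have [hu [huv hv]] := uv.1 i.
  rewrite (_ : _ - _ = (f (v i) - f (u i)) * g (v i) + (g (v i) - g (u i)) * f (u i)); last by ring.
  apply: (le_trans (cmD _ _)); rewrite !cmM; apply: lerD; rewrite ler_wpM2l ?cm_ge0//.
    by apply: gB => //; exact: le_trans huv.
  by apply: fA => //; exact: le_trans hv.
by rewrite big_split /= -!mulr_suml; lra.
Qed.

Lemma ac_cst (c : C) : abs_continuous a b (fun=> c).
Proof.
apply/acP => e e0; exists 1 => // n u v _ _.
by rewrite big1// => i _; rewrite subrr cm0.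
Qed.

Lemma acZ (c : C) f : abs_continuous a b f -> abs_continuous a b (fun x => c * f x).
Proof. by apply: acM; exact: ac_cst. Qed.

Lemma acB f g : abs_continuous a b f -> abs_continuous a b g ->
  abs_continuous a b (fun x => f x - g x).
Proof.
move=> F G; have := acD F (acZ (-1) G).
by congr abs_continuous; apply/funext => x; rewrite mulN1r.
Qed.

Lemma ac_sum (J : Type) (r : seq J) (F : J -> R -> C) : (forall j, abs_continuous a b (F j)) ->
  abs_continuous a b (fun x => \sum_(j <- r) F j x).
Proof.
move=> H; elim: r => [|j r IH].
  by have := ac_cst 0; congr abs_continuous; apply/funext => x; rewrite big_nil.
by have := acD (H j) IH; congr abs_continuous; apply/funext => x; rewrite big_cons.
Qed.

Lemma ac_eq f g : (forall x, a <= x -> x <= b -> f x = g x) ->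
  abs_continuous a b f -> abs_continuous a b g.
Proof.
move=> fg /acP H; apply/acP => e e0; have [d d0 Hd] := H e e0; exists d => // n u v uv l.
have := Hd n u v uv l; congr (_ < _); apply: eq_bigr => i _; have [hu [huv hv]] := uv.1 i.
by rewrite !fg//; [exact: le_trans hv|exact: le_trans hu _].
Qed.

Lemma ac_gd f f' : (forall x, a <= x -> x <= b -> gd (@toC R) `[a, b] f x (f' x)) ->
  (forall x, a <= x -> x <= b -> gc (@toC R) `[a, b] f' x) -> abs_continuous a b f.
Proof.
move=> Hf Hf'; have [ab|/lt_geF ba] := leP a b; last first.
  apply/acP => e e0; exists 1 => // n u v [uv _] _; case: n u v uv => [|n] u v uv.
    by rewrite big_ord0.
  by have [h1 [h2 h3]] := uv ord0; move: ba; rewrite (le_trans h1 (le_trans h2 h3)).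
have [M M0 fM] := gc_itv_bounded ab Hf'.
apply/acP => e e0; exists (e / M); first exact: divr_gt0.
move=> n u v [uv _]; rewrite ltr_pdivlMr// mulr_suml; apply: le_lt_trans.
apply: ler_sum => i _; have [h1 [h2 h3]] := uv i.
have sub : `[u i, v i] `<=` `[a, b].
  by move=> t /=; rewrite !in_itv/= => /andP[ut tv]; rewrite (le_trans h1 ut) (le_trans tv h3).
rewrite mulrC; apply: (@mean_value_bound _ _ f') => // x xu xv.
  by apply: gd_sub sub _; apply: Hf; [exact: le_trans xu|exact: le_trans h3].
by apply: fM; [exact: le_trans xu|exact: le_trans h3].
Qed.

Lemma family_seq (s : seq (R * R)) : (forall p, p \in s -> a <= p.1 /\ p.1 <= p.2 /\ p.2 <= b) ->
  pairwise (fun p q => p.2 <= q.1) s ->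
  family (fun i : 'I_(size s) => (nth (0, 0) s i).1) (fun i : 'I_(size s) => (nth (0, 0) s i).2).
Proof.
move=> hs /(pairwiseP (0, 0)) ps; split=> [i|]; first by apply: hs; rewrite mem_nth.
move=> i j _ _ [t /=]; rewrite !in_itv/= => -[/andP[i1 i2] /andP[j1 j2]].
apply/val_inj => /=; have [ij|ji|//] := ltngtP i j.
  by have := lt_trans (lt_le_trans i2 (ps i j (ltn_ord i) (ltn_ord j) ij)) j1; rewrite ltxx.
by have := lt_trans (lt_le_trans j2 (ps j i (ltn_ord j) (ltn_ord i) ji)) i1; rewrite ltxx.
Qed.

(** The exceptional null set lies in an open [U] of measure below the [d] of absolute continuity.
    [cousin] cuts [[a, b]] into short intervals: those around points of [N] lie in [U] and together
    contribute less than [e], the others have increments of at most [e] times their length. *)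
Lemma ac_const f : a <= b -> abs_continuous a b f ->
  {ae mu, forall x, a <= x -> x <= b -> gd (@toC R) `[a, b] f x 0} -> f b = f a.
Proof.
move=> ab /acP F [N [mN N0 NS]].
apply/eqP; rewrite -subr_eq0 -cm_eq0; apply/eqP/le_anti; rewrite cm_ge0 andbT.
apply/ler_addgt0Pr => e0 e00; rewrite add0r.
pose e := e0 / (1 + (b - a)).
have ba : 0 < 1 + (b - a) by lra.
have e_gt0 : 0 < e by rewrite divr_gt0.
have [d d0 Hd] := F e e_gt0.
have N0lt : (mu N < +oo)%E by rewrite N0 ltry.
have [U [oU NU muU]] := lebesgue_regularity_outer mN N0lt d0.
have mU : measurable (U : set MR) by exact: open_measurable.
have {}muU : (mu U < d%:E)%E.
  have -> : U = N `|` (U `\` N) by rewrite setDUK.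
  apply: (le_lt_trans (@measureU2 _ _ _ mu _ _ mN (measurableD mU mN))).
  by rewrite [X in (X + _)%E]N0 add0e.
(* The list [s] collects only the intervals around points of the null set. Carrying it along makes
   the property additive, and its ordering gives the disjointness that absolute continuity asks
   for. *)
pose P u v := exists s : seq (R * R), [/\
  forall p, p \in s -> u <= p.1 /\ p.1 <= p.2 /\ p.2 <= v,
  pairwise (fun p q : R * R => p.2 <= q.1) s,
  forall p, p \in s -> `]p.1, p.2[ `<=` U &
  cm (f v - f u) <= \sum_(p <- s) cm (f p.2 - f p.1) + e * (v - u)].
have [s [s1 s2 s3 s4]] : P a b.
  apply: cousin => //.
    move=> x ax xb; have [Nx|nN] := pselect (N x).
      have /nearRP[r r0 Hr] : \forall y \near x, U y by apply: open_nbhs_nbhs; split => //; exact: NU.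
      exists r => // u v au ux xv vb vu; exists [:: (u, v)]; split=> //.
      - by move=> p; rewrite inE => /eqP -> /=; split=> //; split=> //; exact: le_trans xv.
      - move=> p; rewrite inE => /eqP -> t /=; rewrite in_itv/= => /andP[ut tv].
        by apply: Hr; rewrite ltr_norml; apply/andP; split; lra.
      - by rewrite big_seq1 /= lerDl mulr_ge0 ?subr_ge0 ?(ltW e_gt0)//; exact: le_trans xv.
    have /(_ ax xb) dx : a <= x -> x <= b -> gd (@toC R) `[a, b] f x 0.
      by apply: contrapT => h; apply: nN; exact: NS.
    have [r r0 Hr] := dx e e_gt0; exists r => // u v au ux xv vb vu; exists [::]; split=> //.
    have hx y : u <= y -> y <= v -> cm (f y - f x) <= e * `|y - x|.
      move=> uy yv; have := Hr y; rewrite mul0r subr0 -toCB cm_toC; apply.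
        by rewrite /= in_itv/=; apply/andP; split; lra.
      by rewrite ltr_norml; apply/andP; split; lra.
    rewrite big_nil add0r; have := cmB3 (f v) (f x) (f u); rewrite [cm (f x - _)]cmBC.
    have := hx v (le_trans ux xv) (lexx v); have := hx u (lexx u) (le_trans ux xv).
    rewrite ler0_norm ?subr_le0// ger0_norm ?subr_ge0// opprB => h1 h2 h3.
    by move: h1 h2 h3; rewrite !mulrBr; lra.
  move=> u v w au uv vw wb [s [h1 h2 h3 h4]] [t [k1 k2 k3 k4]]; exists (s ++ t); split.
  - move=> p; rewrite mem_cat => /orP[/h1|/k1] [l1 [l2 l3]]; split=> //; try split=> //.
      exact: le_trans vw.
    exact: le_trans l1.
  - rewrite pairwise_cat h2 k2 !andbT; apply/allrelP => p q /h1[_ [_ l3]] /k1[l1 _].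
    exact: le_trans l1.
  - by move=> p; rewrite mem_cat => /orP[/h3|/k3].
  - by rewrite big_cat /=; have := cmB3 (f w) (f v) (f u); lra.
have fam := family_seq s1 s2; set u := fun i => _ in fam; set v := fun i : 'I_ _ => (nth _ _ _).2 in fam.
have uvd : \sum_i (v i - u i) < d.
  pose G (i : 'I_(size s)) : set MR := `]u i, v i[%classic.
  have mG i : measurable (G i) by exact: measurable_itv.
  have muG i : mu (G i) = (v i - u i)%:E.
    rewrite /G lebesgue_measure_itv/= lte_fin; have [_ [h _]] := fam.1 i.
    case: ifP => [//|/negbT]; rewrite -leNgt => h'.
    by rewrite (_ : v i = u i) ?subrr//; apply: le_anti; rewrite h h'.
  rewrite -lte_fin; apply: le_lt_trans muU.
  rewrite -sumEFin (eq_bigr (fun i => mu (G i))) => [|i _]; last by rewrite muG.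
  rewrite -(measure_bigsetU_ord mu xpredT mG fam.2).
  apply: le_measure; rewrite ?inE//; first exact: bigsetU_measurable.
  by rewrite -bigcup_seq => t [i _ Gt]; apply: s3 Gt; rewrite mem_nth.
have := Hd _ u v fam uvd; rewrite /u /v -(big_mkord xpredT (fun i => cm (f (nth (0, 0) s i).2 - f (nth (0, 0) s i).1))).
rewrite -(big_nth (0, 0) xpredT (fun p => cm (f p.2 - f p.1))) => hs.
apply: (le_trans s4); rewrite -[e0](@divfK _ (1 + (b - a))) ?gt_eqF// -/e.
by rewrite [leRHS]mulrDr mulr1; lra.
Qed.

End AbsolutelyContinuous.

(** * An explicit weighted integral, and translation of integrals *)

Section Translation.
Context {R : realType}.
Local Notation C := (Cplx R).
Local Notation mu := (@lebesgue_measure R).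


Lemma gc_within_real (A : set R) (f : R -> R) :
  (forall x, A x -> gc (@toC R) A (fun y => toC (f y)) x) -> {within A, continuous f}.
Proof.
move=> H; apply/subspace_continuousP => x Ax; apply/cvgrPdist_le => e e0.
have [d d0 Hd] := H x Ax e e0; apply/nearRP; exists d => // y yd Ay.
by have := Hd y Ay; rewrite distrC -!toCB !cm_toC; exact.
Qed.

Lemma gc_cvg_right (a : R) (f : R -> R) :
  gc (@toC R) `[a, +oo[ (fun y => toC (f y)) a -> f x @[x --> a^'+] --> f a.
Proof.
move=> H; apply/cvgrPdist_le => e e0.
have [d d0 Hd] := H e e0; apply/nearRP; exists d => // y yd ay.
have := Hd y; rewrite distrC -!toCB !cm_toC; apply => //.
by rewrite /= in_itv/= andbT ltW.
Qed.

Lemma gd_derive1 (F : R -> R) (x l : R) :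
  gd (@toC R) setT (fun y => toC (F y)) x (toC l) ->
  derivable F x 1 /\ derive1 F x = l.
Proof.
move=> H; have cv : (fun h => h^-1 *: ((F \o shift x) (h *: 1) - F x)) @ (0 : R)^' --> l.
  apply/cvgrPdist_le => e e0; have [d d0 Hd] := H e e0.
  apply/nearRP; exists d => // h; rewrite subr0 => hd h0.
  have := Hd (h + x) I; rewrite -!toCB -toCM -toCB !cm_toC addrK => /(_ hd) h1.
  rewrite /= /GRing.scale /= mulr1.
  rewrite (_ : l - _ = - ((F (h + x) - F x - l * h) * h^-1)); last by field.
  by rewrite normrN normrM normfV ler_pdivrMr// normr_gt0.
split; first by apply/cvg_ex; exists l.
by rewrite derive1E /derive; apply/cvg_lim.
Qed.

Lemma exp_sub1_small (c d : R) : 0 < c -> 0 < d ->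
  expR (c / (d + t)) @[t --> +oo] --> (1 : R).
Proof.
move=> c0 d0; apply/cvgrPdist_le => e e0.
have [k k0 Hk] := gd_lip (is_derive_gd (is_derive_expR (0 : R))).
near=> t.
have t0 : 0 < t by near: t; exact: nbhs_pinfty_gt.
have dt : 0 < d + t by lra.
have small (q : R) : 0 < q -> c / q <= t -> c / (d + t) < q.
  move=> q0; rewrite ler_pdivrMr// ltr_pdivrMr// => h; nra.
have y0 : 0 < c / (d + t) by rewrite divr_gt0.
have h1 : c / (d + t) < k.
  by apply: small => //; near: t; apply: nbhs_pinfty_ge; exact: num_real.
have h2 : c / (d + t) < e / 2.
  apply: small; first by rewrite divr_gt0.
  by near: t; apply: nbhs_pinfty_ge; exact: num_real.
have := Hk (c / (d + t)) I; rewrite -!toCB !cm_toC expR0 subr0 normr1.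
rewrite gtr0_norm// => /(_ h1); rewrite distrC; lra.
Unshelve. all: by end_near. Qed.

Lemma gd_real (f : R -> C) (F : R -> R) S x L (l : R) : (forall y, f y = toC (F y)) -> L = toC l ->
  gd (@toC R) S f x L -> gd (@toC R) S (fun y => toC (F y)) x (toC l).
Proof. by move=> fF ->; apply: gd_ext => [y _|]; rewrite fF. Qed.

(** A primitive is [- c^-1 * expR (c / (d + t))]. A kernel of size [(d + t) ^- 2] thus costs only a
    factor [c^-1] against the weight [expR (c / (d + t))], and [c] is at one's disposal. *)
Lemma exp_weight_integral (c d x : R) : 0 < c -> 0 < d -> 0 <= x ->
  rint `[x, +oo[ (fun t => (d + t) ^- 2 * expR (c / (d + t))) /\
  \int[mu]_(t in `[x, +oo[) ((d + t) ^- 2 * expR (c / (d + t))) =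
    (expR (c / (d + x)) - 1) / c.
Proof.
move=> c0 d0 x0.
pose f t := (d + t) ^- 2 * expR (c / (d + t)).
pose F t := - (c^-1 * expR (c / (d + t))).
have dlin t : gd (@toC R) setT (fun t => toC (d + t)) t 1.
  apply: (gd_eq (add0r 1)).
  by apply: gd_ext (gdD (gd_cst _ _ (toC d) _) (gd_io _ _ _)) => [y _|]; rewrite toCD.
have dinv t : 0 <= t ->
    gd (@toC R) setT (fun t => toC (c / (d + t))) t (toC (- c / (d + t) ^+ 2)).
  move=> t0; have dt : toC (d + t) != 0 by rewrite toC_eq0 gt_eqF//; lra.
  have := gdZ (toC c) (gd_comp (P := setT) (fun _ _ => I) (dlin t) (gd_inv setT dt)).
  apply: gd_real => [y|]; first by rewrite toCM toCV.
  by rewrite mulr1 mulrN mulNr toCN toCM toCV toCX.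
have dexp t : 0 <= t ->
    gd (@toC R) setT (fun t => toC (expR (c / (d + t)))) t
      (toC (expR (c / (d + t)) * (- c / (d + t) ^+ 2))).
  move=> t0; have := gd_comp (P := setT) (fun _ _ => I) (dinv t t0) (gd_cexp setT _).
  have e (y : R) : cexp (toC y) = toC (expR y).
    by rewrite /cexp /= cos0 sin0 -[RHS]mulr1.
  apply: gd_real => [y|]; first by rewrite e.
  by rewrite e toCM.
have dF t : 0 <= t -> gd (@toC R) setT (fun t => toC (F t)) t (toC (f t)).
  move=> t0; have := gdN (gdZ (toC c^-1) (dexp t t0)).
  apply: gd_real => [y|]; first by rewrite /F toCN toCM.
  rewrite -toCM -toCN; congr toC; rewrite /f; field.
  by rewrite !gt_eqF//; lra.
have cf t : 0 <= t -> gc (@toC R) setT (fun t => toC (f t)) t.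
  move=> t0; have dt : toC (d + t) != 0 by rewrite toC_eq0 gt_eqF//; lra.
  have g1 := gd_comp (P := setT) (fun _ _ => I) (dlin t) (gd_inv setT dt).
  have := gd_gc (gdM (gdM g1 g1) (dexp t t0)).
  move=> H e e0; have [k k0 Hk] := H e e0; exists k => // y _ yk.
  have := Hk y I yk; rewrite -!toCV -!toCM /f !expr2 !invfM; exact.
have f0 t : x <= t -> 0 <= f t.
  by move=> _; rewrite mulr_ge0 ?invr_ge0 ?sqr_ge0 ?expR_ge0.
have sub (A : set R) (g : R -> C) y : gc (@toC R) setT g y -> gc (@toC R) A g y.
  by move=> H e e0; have [k k0 Hk] := H e e0; exists k => // z _; exact: Hk.
have E := @ge0_continuous_FTC2y R f F x (- c^-1) f0.
have {}E : (\int[mu]_(t in `[x, +oo[) (f t)%:E)%E = ((expR (c / (d + x)) - 1) / c)%:E.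
  rewrite E.
  - rewrite -EFinB; congr EFin; rewrite /F; field; by rewrite !gt_eqF//; lra.
  - apply: gc_within_real => t /=; rewrite in_itv/= andbT => xt.
    by apply: sub; apply: cf; exact: le_trans xt.
  - rewrite /F -[X in _ --> - X]mulr1; apply: cvgN; apply: cvgM; first exact: cvg_cst.
    exact: exp_sub1_small.
  - by move=> t xt; have [] := gd_derive1 (dF t (ltW (le_lt_trans x0 xt))).
  - by apply: gc_cvg_right; apply: sub; apply: gd_gc (dF x x0).
  - move=> t; rewrite in_itv/= andbT => xt.
    by have [] := gd_derive1 (dF t (ltW (le_lt_trans x0 xt))).
split; last by rewrite /Rintegral E.
apply/integrableP; split.
  apply/measurable_EFinP; apply: subspace_continuous_measurable_fun => //.
  apply: gc_within_real => t /=; rewrite in_itv/= andbT => xt.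
  by apply: sub; apply: cf; exact: le_trans xt.
rewrite (_ : (\int[mu]_(t in _) _)%E = (\int[mu]_(t in `[x, +oo[) (f t)%:E)%E).
  by rewrite E ltry.
apply: eq_integral => t /set_mem /=; rewrite in_itv/= andbT => xt.
by rewrite ger0_norm//; exact: f0.
Qed.

(** Substitution is applied to the nonnegative functions [|g|] and [|g| + g], and the results are
    subtracted. *)
Lemma real_translation (g : R -> R) (r s : R) :
  {within `[s + r, +oo[, continuous g} -> rint `[s + r, +oo[ g ->
  rint `[s, +oo[ (fun t => g (t + r)) ->
  \int[mu]_(t in `[s + r, +oo[) g t = \int[mu]_(t in `[s, +oo[) g (t + r).
Proof.
move=> cg ig ig'.
have dF x : derivable (fun t : R => t + r) x 1 /\ derive1 (fun t : R => t + r) x = 1.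
  apply: gd_derive1; rewrite toC1.
  apply: (gd_eq (addr0 1)).
  by apply: gd_ext (gdD (gd_io _ _ _) (gd_cst _ _ (toC r) _)) => [y _|]; rewrite toCD.
have D1 : derive1 (fun t : R => t + r) = fun=> 1 by apply/funext => x; have [] := dF x.
have pos (G : R -> R) : {within `[s + r, +oo[, continuous G} -> (forall x, 0 <= G x) ->
    (\int[mu]_(t in `[(s + r)%R, +oo[) (G t)%:E = \int[mu]_(t in `[s, +oo[) (G (t + r)%R)%:E)%E.
  move=> cG G0; have := @increasing_ge0_integration_by_substitutiony R (fun t => t + r) G s.
  rewrite D1 => -> //.
  - by apply: eq_integral => t _ /=; rewrite fctE mulr1.
  - by move=> x y _ _ xy; rewrite ltrD2r.
  - by move=> x _; exact: cvg_cst.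
  - exact: is_cvg_cst.
  - exact: is_cvg_cst.
  - split; first by move=> x _; have [] := dF x.
    apply: gc_cvg_right => e e0; exists e => // y _; rewrite -!toCB !cm_toC.
    by rewrite (_ : y + r - _ = y - s) => [/ltW//|]; ring.
  - by apply: cvg_addrr.
have cn : {within `[s + r, +oo[, continuous (fun x => `|g x|)}.
  by move=> x; apply: cvg_norm; exact: cg.
have e1 := pos (fun x => `|g x|) cn (fun x => normr_ge0 _).
have e2 := pos (fun x => `|g x| + g x) _ _.
have {}e1 : \int[mu]_(t in `[s + r, +oo[) `|g t| = \int[mu]_(t in `[s, +oo[) `|g (t + r)|.
  by rewrite /Rintegral e1.
have {}e2 : \int[mu]_(t in `[s + r, +oo[) (`|g t| + g t) =
    \int[mu]_(t in `[s, +oo[) (`|g (t + r)| + g (t + r)).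
  rewrite /Rintegral e2// => [x|x]; first by apply: cvgD; [exact: cn|exact: cg].
  by have := ler_norm (- g x); rewrite normrN; lra.
have n1 := integrable_norm ig; have n2 := integrable_norm ig'.
rewrite !RintegralD// in e2.
by apply: (addrI (\int[mu]_(t in `[s + r, +oo[) `|g t|)); rewrite e2 e1.
Qed.

Lemma CI_translation (phi : R -> C) (r s : R) :
  (forall t, s + r <= t -> gc (@toC R) `[s + r, +oo[ phi t) ->
  cintegrable `[s + r, +oo[ phi -> cintegrable `[s, +oo[ (fun t => phi (t + r)) ->
  CI `[s + r, +oo[ phi = CI `[s, +oo[ (fun t => phi (t + r)).
Proof.
move=> cp [i1 i2] [j1 j2]; apply: ReIm_inj.
  rewrite !Re_CI real_translation//.
  apply: gc_within_real => x /=; rewrite in_itv/= andbT => xs e e0.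
  have [d d0 H] := cp x xs e e0; exists d => // y ys yd.
  by rewrite -toCB cm_toC -ReCN -ReCD (le_trans (cm_Re _))// H.
rewrite !Im_CI real_translation//.
apply: gc_within_real => x /=; rewrite in_itv/= andbT => xs e e0.
have [d d0 H] := cp x xs e e0; exists d => // y ys yd.
by rewrite -toCB cm_toC -ImCN -ImCD (le_trans (cm_Im _))// H.
Qed.

End Translation.

(** * The unperturbed equation *)

Section HalfPlane.
Context {R : realType}.
Local Notation C := (Cplx R).

Definition hplane : set C := [set z : C | 0 <= complex.Re z /\ z != 0].

Lemma hplane_shift (z : C) (s : R) : hplane z -> 0 <= s -> hplane (z + toC s).
Proof.
move=> [z0 zn] s0; split; first by rewrite ReCD /= addr_ge0.
have [->|sn] := eqVneq s 0; first by rewrite toC0 addr0.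
have : 0 < complex.Re (z + toC s) by rewrite ReCD /= ltr_wpDl// lt_def sn.
by apply: contraTneq => ->; rewrite /= ltxx.
Qed.

(** As [Re z >= 0], the square of [|z + s|] is at least [|z|^2 + s^2]. Horizontal rays to the right
    thus keep away from 0, and the potential is integrable along them. *)
Lemma hplane_shift_cm (z : C) (s : R) : hplane z -> 0 <= s ->
  (cm z + s) / 2 <= cm (z + toC s).
Proof.
move=> [z0 zn] s0.
have h1 : cm z ^+ 2 + s ^+ 2 <= cm (z + toC s) ^+ 2.
  by rewrite !cm_sqr ReCD ImCD /= addr0; nra.
rewrite -ler_sqr ?nnegrE ?cm_ge0 ?divr_ge0 ?addr_ge0 ?cm_ge0//.
have := sqr_ge0 (cm z - s); have := cm_ge0 z; rewrite expr_div_n; nra.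
Qed.

Lemma hplane_segment (z w : C) (s : R) : hplane z -> hplane w -> cm (w - z) <= cm z / 2 ->
  0 <= s -> s <= 1 ->
  hplane (z + toC s * (w - z)) /\ cm z / 2 <= cm (z + toC s * (w - z)).
Proof.
move=> [z0 zn] [w0 wn] wz s0 s1.
have h : cm z / 2 <= cm (z + toC s * (w - z)).
  have := cm_ge z (- (toC s * (w - z))); rewrite opprK cmN cmM cm_toC_ge0//.
  have : s * cm (w - z) <= 1 * cm (w - z) by rewrite ler_wpM2r ?cm_ge0.
  lra.
split=> //; split.
  rewrite ReCD ReCZ ReCD ReCN; nra.
by rewrite -cm_gt0; apply: lt_le_trans h; rewrite divr_gt0// cm_gt0.
Qed.

End HalfPlane.

(** * Unperturbed solutions normalised at infinity, on horizontal rays *)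

Section Jost.
Context {R : realType}.
Local Notation C := (Cplx R).
Local Notation mu := (@lebesgue_measure R).
Local Notation MR := (measurableTypeR R).
Variables (om : C) (sg : bool).

Definition tau : C := sgd sg * imunit.

Lemma tau_sqr : tau * tau = -1.
Proof.
rewrite /tau mulrACA (_ : imunit * imunit = -1); last by rewrite -expr2 imunit2.
by case: sg => /=; ring.
Qed.
Lemma tau_neq0 : tau != 0.
Proof. by apply/eqP => t0; have := tau_sqr; rewrite t0 mul0r => /eqP; rewrite eq_sym oppr_eq0 oner_eq0. Qed.
Lemma cm_tau : cm tau = 1.
Proof. by rewrite cmM cm_imunit mulr1; case: sg; rewrite /= ?cmN cm1. Qed.
Lemma cm_cexp_tau (x : R) : cm (cexp (2 * tau * toC x)) = 1.
Proof.
rewrite cm_cexp -[RHS]expR0; congr expR.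
by rewrite mulrAC ReCM /tau; case: sg; rewrite /= !(mulr0, mul0r, mulr1, mul1r, subr0, oppr0, addr0, add0r, subrr).
Qed.

Definition pot (z : C) : C := om / z ^+ 2.

Let D : set MR := `[0, +oo[%classic.
Let X : set R := [set s | 0 <= s].
Let Dx := side D false.
Let mD : measurable D. Proof. exact: measurable_itv. Qed.
Let mDx x : measurable (Dx x). Proof. exact: measurable_side. Qed.
Let DxD x : Dx x `<=` D. Proof. exact: side_sub. Qed.
Let DE t : D t = (0 <= t) :> Prop.
Proof. by rewrite /D /= in_itv/= andbT. Qed.
Let DX : D `<=` X. Proof. by move=> t; rewrite DE. Qed.
Let DxE x : 0 <= x -> Dx x = `[x, +oo[%classic.
Proof.
move=> x0; apply/seteqP; split=> t; rewrite /Dx /side /= !in_itv/= !andbT; first by case.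
by move=> xt; split=> //; rewrite DE; exact: (le_trans x0 xt).
Qed.
Let Dconv x y z : D x -> D y -> x <= z -> z <= y -> D z.
Proof. by rewrite !DE => x0 _ xz _; exact: (le_trans x0 xz). Qed.

Let a := cm om.
Let c := 16 * (a + 1).
Let a0 : 0 <= a. Proof. exact: cm_ge0. Qed.
Let c0 : 0 < c. Proof. by rewrite mulr_gt0// ltr_wpDl. Qed.

(** A Bielecki weight: it decreases along the ray at a rate proportional to [c], so the Volterra
    operator is a contraction for every starting point, however close to 0. The value
    [c = 16 * (cm om + 1)] makes [2 * (4 * cm om) / c] at most one half. In use [d] is the modulus
    of a starting point. *)
Definition wgt (d : R) (i : bool) (s : R) := expR (c / (d + s)).
Let ew d t := (d + t) ^- 2 * expR (c / (d + t)).

Let wgt_ge1 d i s : 0 < d -> 0 <= s -> 1 <= wgt d i s.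
Proof. by move=> d0 s0; rewrite -expR0 ler_expR divr_ge0 ?(ltW c0)// addr_ge0// ltW. Qed.
Let wgt_le d i s : 0 < d -> 0 <= s -> wgt d i s <= expR (c / d).
Proof.
move=> d0 s0; rewrite ler_expR ler_wpM2l ?(ltW c0)// lef_pV2 ?posrE ?lerDl//.
by rewrite ltr_wpDr.
Qed.
Let v0 d i x : X x -> 0 <= wgt d i x. Proof. by rewrite expR_ge0. Qed.

(** With [h = exp (tau z) f] the equation for [h] becomes [f'' + 2 tau f' = pot f]. Integrated from
    infinity along the ray [z + t] it gives the row [false] for [f] and the row [true] for [f']. The
    exponentials have modulus 1, as [tau] is imaginary and [t - x] real. *)
Definition jker (z : C) (i j : bool) (x t : R) : C :=
  if j then 0 else
  (if i then - cexp (2 * tau * toC (t - x)) else (cexp (2 * tau * toC (t - x)) - 1) / (2 * tau))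
  * pot (z + toC t).

Definition jone (z : C) (i : bool) (x : R) : C := if i then 0 else 1.

Let factor_le i x t :
  cm (if i then - cexp (2 * tau * toC (t - x)) else (cexp (2 * tau * toC (t - x)) - 1) / (2 * tau)) <= 1.
Proof.
case: i; first by rewrite cmN cm_cexp_tau.
rewrite cmM cmV cmM cm_tau cm_nat mulr1 ler_pdivrMr// mul1r.
by have := cmB (cexp (2 * tau * toC (t - x))) 1; rewrite cm_cexp_tau cm1; lra.
Qed.

Let pot_le z t (d : R) : hplane z -> 0 <= t -> 0 < d -> d <= cm z ->
  cm (pot (z + toC t)) <= 4 * a * (d + t) ^- 2.
Proof.
move=> Hz t0 d0 dz; have h := hplane_shift_cm Hz t0.
rewrite cmM cmV cmX (mulrC 4) -mulrA ler_wpM2l//.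
have q : (d + t) / 2 <= cm (z + toC t) by lra.
have q0 : 0 < (d + t) / 2 by rewrite divr_gt0// ltr_wpDr.
rewrite (_ : 4 * (d + t) ^- 2 = ((d + t) / 2) ^- 2); last first.
  by field; rewrite gt_eqF// ltr_wpDr.
rewrite lef_pV2 ?posrE ?exprn_gt0//; last exact: lt_le_trans q.
by rewrite ler_sqr ?nnegrE ?(ltW q0) ?cm_ge0.
Qed.

Let pot_gc z t : hplane z -> 0 <= t -> gc (@toC R) D (fun t => pot (z + toC t)) t.
Proof.
move=> Hz t0; apply: gd_gc; apply: gdZ.
apply: (@gd_comp _ _ _ D setT (fun t => (z + toC t) ^+ 2) (fun w => w^-1)) => //.
  have h : gd (@toC R) D (fun t => z + toC t) t (0 + 1) by apply: gdD (gd_cst _ _ _ _) (gd_io _ _ _).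
  exact: (gdM h h).
by apply: gd_inv; rewrite expf_neq0//; have [] := hplane_shift Hz t0.
Qed.

Let pot_meas z : hplane z -> cmeas D (fun t => pot (z + toC t)).
Proof. by move=> Hz; apply: gc_cmeas => // t; rewrite DE; exact: pot_gc. Qed.

Let cexp_gc (k : C) (S : set R) x : gc (@toC R) S (fun t => cexp (k * toC t)) x.
Proof.
apply: gd_gc; apply: (@gd_comp _ _ _ S setT) => //; last exact: gd_cexp.
by apply: gdZ; exact: gd_io.
Qed.

Let cexp_meas (k : C) (A : set MR) : measurable A -> cmeas A (fun t => cexp (k * toC t)).
Proof. by move=> mA; apply: gc_cmeas => // x _; exact: cexp_gc. Qed.

Let expB x t : cexp (2 * tau * toC (t - x)) =
  cexp (- (2 * tau) * toC x) * cexp (2 * tau * toC t).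
Proof. by rewrite -cexpD toCB; congr cexp; ring. Qed.

Let jker_meas z i j x : hplane z -> X x -> cmeas (Dx x) (jker z i j x).
Proof.
move=> Hz Xx; rewrite /jker; case: j; first exact: cmeas_cst.
apply: cmeasM; last exact: cmeasS (mD) (@DxD x) (pot_meas Hz).
have me : cmeas (Dx x) (fun t => cexp (2 * tau * toC (t - x))).
  apply: cmeas_ext (cmeasZ (cexp (- (2 * tau) * toC x)) (cexp_meas (2 * tau) (mDx x))).
  by move=> t _; rewrite expB.
case: i; first exact: cmeasN.
apply: cmeasM; last exact: cmeas_cst.
by apply: cmeasB => //; exact: cmeas_cst.
Qed.

Let ew_int d x : 0 < d -> 0 <= x -> rint (Dx x) (ew d) /\
  \int[mu]_(t in Dx x) ew d t = (expR (c / (d + x)) - 1) / c.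
Proof. by move=> d0 x0; rewrite DxE//; exact: exp_weight_integral. Qed.

(* the dominating function of the kernel, up to a constant *)
Let kd (d k : R) (i j : bool) (x t : R) := if j then 0 else k * ew d t.

Let kd_int d k i j x : 0 < d -> 0 <= x -> rint (Dx x) (kd d k i j x).
Proof.
move=> d0 x0; rewrite /kd; case: j; first by apply: integrable0.
by apply: rintZ => //; exact: (ew_int d0 x0).1.
Qed.

Let kd_sum d k i x : 0 < d -> 0 <= x ->
  \sum_j \int[mu]_(t in Dx x) kd d k i j x t = k * ((expR (c / (d + x)) - 1) / c).
Proof.
move=> d0 x0; rewrite big_bool /= RintegralZl//; last exact: (ew_int d0 x0).1.
by rewrite (ew_int d0 x0).2 /Rintegral integral0 add0r.
Qed.

Let kd_sum_le d k i x : 0 <= k -> 0 < d -> 0 <= x ->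
  2 * \sum_j \int[mu]_(t in Dx x) kd d k i j x t <= (2 * k / c) * wgt d i x.
Proof.
move=> k0 d0 x0; rewrite kd_sum// /wgt.
rewrite (_ : 2 * (k * _) = 2 * k / c * (expR (c / (d + x)) - 1)); last by ring.
apply: ler_wpM2l; first by apply: divr_ge0; [exact: mulr_ge0|exact: ltW].
by rewrite gerBl.
Qed.

Let jker_le z d i j x t : hplane z -> 0 <= x -> Dx x t -> 0 < d -> d <= cm z ->
  cm (jker z i j x t) * wgt d j t <= kd d (4 * a) i j x t.
Proof.
move=> Hz x0; rewrite DxE//= in_itv/= andbT => xt d0 dz.
rewrite /jker /kd; case: j; first by rewrite cm0 mul0r.
rewrite cmM /ew /wgt [4 * a * _]mulrA ler_wpM2r ?expR_ge0//.
rewrite -[leRHS]mul1r ler_pM ?cm_ge0 ?factor_le// pot_le//.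
exact: le_trans xt.
Qed.

Let jker_bd z d : hplane z -> 0 < d -> d <= cm z -> kerbd X Dx (wgt d) 2^-1 (jker z).
Proof.
move=> Hz d0 dz; exists (kd d (4 * a)); split.
- by move=> i j x Xx; exact: jker_meas.
- by move=> i j x t Xx Dt; exact: (jker_le i j Hz Xx Dt d0 dz).
- by move=> i j x Xx; exact: (kd_int _ _ _ d0 Xx).
- move=> i x Xx; apply: (le_trans (kd_sum_le _ _ _ _)) => //; first by rewrite mulr_ge0.
  rewrite ler_wpM2r ?v0// ler_pdivrMr// /c; move: a0 => /= h.
  lra.
Qed.

Let potf_int z f M d : hplane z -> bnd X D (wgt d) M f -> 0 < d -> d <= cm z -> 0 <= M ->
  cintegrable D (fun t => pot (z + toC t) * f false t).
Proof.
move=> Hz [mf bf] d0 dz M0.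
have [ei _] := ew_int d0 (lexx 0); have DD : Dx 0 = D by rewrite DxE.
rewrite DD in ei.
apply: (cint_dom mD _ (rintZ (M * (4 * a)) mD ei)).
  by apply: cmeasM; [exact: pot_meas|exact: mf].
move=> t; rewrite DE => t0; rewrite cmM mulrC /ew -mulrA [4 * a * _]mulrA.
have := ler_pM (cm_ge0 _) (cm_ge0 _) (bf false t t0) (pot_le Hz t0 d0 dz).
by move=> h; apply: (le_trans h); rewrite /wgt le_eqVlt; apply/orP; left; apply/eqP; ring.
Qed.

Let cexp_int (k : bool) phi : cintegrable D phi ->
  cintegrable D (fun t => cexp (2 * tau * toC t) * phi t).
Proof.
move=> ip; apply: (cint_dom mD _ (cint_norm mD ip)).
  by apply: cmeasM; [exact: cexp_meas|exact: cint_cmeas].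
by move=> t _; rewrite cmM cm_cexp_tau mul1r.
Qed.

Let Aint z f := indef D false (fun t => cexp (2 * tau * toC t) * (pot (z + toC t) * f false t)).
Let Bint z f := indef D false (fun t => pot (z + toC t) * f false t).

(** Splitting the exponential separates [x] from [t], so that continuity, measurability and
    derivatives in [x] reduce to those of indefinite integrals. *)
Let iopE z f M d i x : hplane z -> bnd X D (wgt d) M f -> 0 < d -> d <= cm z -> 0 <= M ->
  iop Dx (jker z) f i x = if i then - (cexp (- (2 * tau) * toC x) * Aint z f x)
    else (cexp (- (2 * tau) * toC x) * Aint z f x - Bint z f x) / (2 * tau).
Proof.
move=> Hz bf d0 dz M0; have ip := potf_int Hz bf d0 dz M0.
have ip' := cintS mD (mDx x) (@DxD x) ip.
have ie' := cintS mD (mDx x) (@DxD x) (cexp_int true ip).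
rewrite /iop big_bool /= (_ : CI _ _ = 0) ?add0r; last first.
  by rewrite -[RHS](CI0 (Dx x)); apply: CI_ext => t _; rewrite /jker mul0r.
rewrite /Aint /Bint /indef -/Dx.
case: i.
  rewrite -CIZ// -CIN//; last exact: cintZ.
  by apply: CI_ext => t _; rewrite /jker expB; ring.
rewrite -CIZ// -CIB//; last exact: cintZ.
rewrite [_ / _]mulrC -CIZ//; last by apply: cintB => //; exact: cintZ.
by apply: CI_ext => t _; rewrite /jker expB; ring.
Qed.

Let gcT (f : R -> C) x : gc (@toC R) setT f x -> gc (@toC R) D f x.
Proof. exact: gc_sub. Qed.

Let iop_meas z d f M : hplane z -> 0 < d -> d <= cm z -> bnd X D (wgt d) M f ->
  forall i, cmeas D (iop Dx (jker z) f i).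
Proof.
move=> Hz d0 dz bf i.
have M0 : 0 <= M.
  have x0 : X 0 by rewrite /X /=.
  have w0 : 0 < wgt d false 0 by rewrite expR_gt0.
  by have := le_trans (cm_ge0 _) (bf.2 false 0 x0); rewrite (pmulr_lge0 _ w0).
have ip := potf_int Hz bf d0 dz M0.
have mA := indef_meas mD false (cexp_int true ip).
have mB := indef_meas mD false ip.
have mE := cexp_meas (- (2 * tau)) mD.
apply: (@cmeas_ext _ _ (fun x => if i then - (cexp (- (2 * tau) * toC x) * Aint z f x)
    else (cexp (- (2 * tau) * toC x) * Aint z f x - Bint z f x) / (2 * tau))).
  by move=> x; rewrite DE => x0; rewrite (iopE _ _ Hz bf d0 dz M0).
case: i; first by apply: cmeasN; exact: cmeasM.
apply: cmeasM; last exact: cmeas_cst.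
by apply: cmeasB => //; exact: cmeasM.
Qed.

Let cm_gt0H (z : C) : hplane z -> 0 < cm z.
Proof. by move=> [_]; rewrite cm_gt0. Qed.

Let jone_bnd d : 0 < d -> bnd X D (wgt d) 1 (jone 0).
Proof.
move=> d0; split=> [j|j t Xt]; first exact: cmeas_cst.
rewrite mul1r; apply: le_trans (wgt_ge1 j d0 Xt).
by case: j; rewrite /jone ?cm0 ?cm1.
Qed.

Lemma jost_exists : exists f : C -> bool -> R -> C, forall z, hplane z ->
  bnd X D (wgt (cm z)) 2 (f z) /\
  forall i x, 0 <= x -> f z i x = jone z i x + iop Dx (jker z) (f z) i x.
Proof.
suff /choice[f hf] : forall z : C, exists f : bool -> R -> C,
    hplane z -> bnd X D (wgt (cm z)) 2 f /\
    forall i x, 0 <= x -> f i x = jone z i x + iop Dx (jker z) f i x by exists f.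
move=> z.
have [Hz|nHz] := pselect (hplane z); last by exists (fun _ _ => 0).
have d0 := cm_gt0H Hz.
have [f bf ef] := fixpoint_exists mD mDx DxD DX (@v0 (cm z)) (jker_bd Hz d0 (lexx _))
  ler01 (jone_bnd d0) (fun f M bf => iop_meas Hz d0 (lexx _) bf).
by exists f => _; rewrite mulr1 in bf; split=> // i x x0; exact: ef.
Qed.

Section WithSolution.
Variable f : C -> bool -> R -> C.
Hypothesis fH : forall z, hplane z ->
  bnd X D (wgt (cm z)) 2 (f z) /\
  forall i x, 0 <= x -> f z i x = jone z i x + iop Dx (jker z) (f z) i x.

Let fE z i x : hplane z -> 0 <= x -> f z i x = jone z i x +
  if i then - (cexp (- (2 * tau) * toC x) * Aint z (f z) x)
  else (cexp (- (2 * tau) * toC x) * Aint z (f z) x - Bint z (f z) x) / (2 * tau).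
Proof.
move=> Hz x0; have [bf ef] := fH Hz.
by rewrite {1}ef// (iopE _ _ Hz bf (cm_gt0H Hz) (lexx _)).
Qed.

Let Icint z : hplane z -> cintegrable D (fun t => pot (z + toC t) * f z false t).
Proof.
by move=> Hz; have [bf _] := fH Hz; exact: (potf_int Hz bf (cm_gt0H Hz) (lexx _)).
Qed.

Let fcont z i x : hplane z -> 0 <= x -> gc (@toC R) D (f z i) x.
Proof.
move=> Hz x0; have ip := Icint Hz.
have cA := gcT (indef_cont mD false x (cexp_int true ip)).
have cB := gcT (indef_cont mD false x ip).
have cE := cexp_gc (- (2 * tau)) D x.
have cEA := gcM cE cA.
apply: (gc_ext (f := fun x => jone z i x +
  if i then - (cexp (- (2 * tau) * toC x) * Aint z (f z) x)
  else (cexp (- (2 * tau) * toC x) * Aint z (f z) x - Bint z (f z) x) / (2 * tau))).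
- by move=> y; rewrite DE => y0; rewrite [RHS]fE.
- by rewrite [RHS]fE.
apply: gcD; first exact: gc_cst.
case: i; first exact: gcN.
by apply: gcM; [exact: gcB|exact: gc_cst].
Qed.

Let pf_cont z x : hplane z -> 0 <= x -> gc (@toC R) D (fun t => pot (z + toC t) * f z false t) x.
Proof. by move=> Hz x0; apply: gcM; [exact: pot_gc|exact: fcont]. Qed.

Let dexp (k : C) S x : gd (@toC R) S (fun t => cexp (k * toC t)) x (cexp (k * toC x) * (k * 1)).
Proof.
apply: (@gd_comp _ _ _ S setT) => //; last exact: gd_cexp.
by apply: gdZ; exact: gd_io.
Qed.

Let expN x : cexp (- (2 * tau) * toC x) * cexp (2 * tau * toC x) = 1.
Proof. by rewrite -cexpD mulNr addrC subrr cexp0. Qed.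

Lemma jost_deriv z x : hplane z -> 0 <= x ->
  gd (@toC R) D (f z false) x (f z true x) /\
  gd (@toC R) D (f z true) x (- (2 * tau) * f z true x + pot (z + toC x) * f z false x).
Proof.
move=> Hz x0; have ip := Icint Hz; have Dx0 : D x by rewrite DE.
have dB := indef_deriv_pt mD Dconv false ip Dx0 (pf_cont Hz x0).
have dA := indef_deriv_pt mD Dconv false (cexp_int true ip) Dx0
  (gcM (cexp_gc (2 * tau) D x) (pf_cont Hz x0)).
have dE := dexp (- (2 * tau)) D x.
have dEA := gdM dE dA.
have t2 : 2 * tau != 0 by rewrite mulf_neq0 ?tau_neq0 ?pnatr_eq0.
have eN := expN x.
have eq1 : cexp (- (2 * tau) * toC x) * (-1 * (cexp (2 * tau * toC x) *
   (pot (z + toC x) * f z false x))) = - (pot (z + toC x) * f z false x).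
  transitivity ((cexp (- (2 * tau) * toC x) * cexp (2 * tau * toC x)) *
    - (pot (z + toC x) * f z false x)); first by ring.
  by rewrite eN mul1r.
split.
- have h := gdD (gd_cst (@toC R) D 1 x) (gdZ (2 * tau)^-1 (gdB dEA dB)).
  apply: gd_eq (gd_ext _ _ h); last 2 first.
  + by move=> y; rewrite DE => y0; rewrite fE// /jone mulrC.
  + by rewrite fE// /jone mulrC.
  rewrite eq1 [in RHS]fE//= /jone /sgd /Aint; field; exact: tau_neq0.
- have h := gdN dEA.
  apply: gd_eq (gd_ext _ _ h); last 2 first.
  + by move=> y; rewrite DE => y0; rewrite fE// /jone add0r.
  + by rewrite fE// /jone add0r.
  rewrite eq1 [f z true x]fE//= /jone /Aint; ring.
Qed.

(** The translate of [f z] by [r] satisfies the integral equation at [z + r], whose bounded solution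
    is unique. Hence [f z i s] depends on [z + s] only, and [f z i 0] is a function on the half
    plane whose restriction to each ray is known. *)
Lemma jost_shift z r i s : hplane z -> 0 <= r -> 0 <= s -> f z i (s + r) = f (z + toC r) i s.
Proof.
move=> Hz r0 s0; have Hzr := hplane_shift Hz r0.
have dr := cm_gt0H Hzr; have d0 := cm_gt0H Hz.
have [bf ef] := fH Hz; have [bf' ef'] := fH Hzr.
(* A bound valid for both functions in the weight of [z + r]: all weights are at least 1, and that
   of [z] is at most [expR (c / cm z)]. *)
pose M := 2 * expR (c / cm z).
have M2 : 2 <= M.
  have := wgt_ge1 true d0 (lexx 0); have := wgt_le true d0 (lexx 0); rewrite /M; lra.
have M0 : 0 <= M by lra.
have b1 : bnd X D (wgt (cm (z + toC r))) M (f (z + toC r)).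
  exact: (bnd_le (@v0 _) M2 bf').
have g_ i' x : 0 <= x -> gc (@toC R) D (fun t => f z i' (t + r)) x.
  move=> x0 e e0; have := @fcont z i' (x + r) Hz (addr_ge0 x0 r0) e e0.
  move=> [k k0 Hk]; exists k => // y; rewrite DE => y0 yk; apply: Hk.
    by rewrite DE addr_ge0.
  by move: yk; rewrite -!toCB !cm_toC (_ : y + r - _ = y - x)//; ring.
have b2 : bnd X D (wgt (cm (z + toC r))) M (fun i s => f z i (s + r)).
  split=> [j|j t Xt]; first by apply: gc_cmeas => // x; rewrite DE; exact: g_.
  apply: (le_trans (bf.2 j (t + r) (addr_ge0 Xt r0))).
  rewrite /M -mulrA ler_wpM2l//.
  apply: (le_trans (wgt_le j d0 (addr_ge0 Xt r0))).
  by rewrite ler_peMr ?expR_ge0 ?wgt_ge1.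
have := fixpoint_unique mD mDx DxD DX (@v0 (cm (z + toC r)))
  (jker_bd Hzr dr (lexx _)) M0 b2 b1 (f := jone z).
apply => // j x Xx.
have xr0 : 0 <= x + r by exact: addr_ge0.
rewrite {1}ef//; congr (_ + _); rewrite /iop; apply: eq_bigr => k _.
rewrite !DxE//.
have kE t : jker z j k (x + r) (t + r) = jker (z + toC r) j k x t.
  rewrite /jker; congr (if _ then _ else _); congr (_ * _).
    by congr (if _ then _ else _); rewrite (_ : t + r - _ = t - x)//; ring.
  by congr pot; rewrite toCD; ring.
have int1 : cintegrable (Dx (x + r)) (fun t => jker z j k (x + r) t * f z k t).
  exact: (iop_int mD mDx DxD DX _ _ _ (jker_bd Hz d0 (lexx _)) bf xr0).
have int2 : cintegrable (Dx x) (fun t => jker (z + toC r) j k x t * f z k (t + r)).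
  exact: (iop_int mD mDx DxD DX _ _ M0 (jker_bd Hzr dr (lexx _)) b2 Xx).
rewrite !DxE// in int1 int2.
rewrite CI_translation//.
- by apply: CI_ext => t _; rewrite kE.
- move=> t xt; have t0 : 0 <= t by exact: (le_trans xr0 xt).
  apply: (@gc_sub _ _ _ D).
    by move=> y /=; rewrite in_itv/= andbT => xy; rewrite DE; exact: (le_trans xr0 xy).
  apply: gcM; last exact: fcont.
  rewrite /jker; case: k {kE int1 int2} => /=; first exact: gc_cst.
  apply: gcM; last exact: pot_gc.
  have cE : gc (@toC R) D (fun t => cexp (2 * tau * toC (t - (x + r)))) t.
    apply: gc_ext (gcM (gc_cst (@toC R) D (cexp (- (2 * tau) * toC (x + r))) t)
      (cexp_gc (2 * tau) D t)) => [y _|]; by rewrite expB.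
  case: j; first exact: gcN.
  by apply: gcM; [apply: gcB => //; exact: gc_cst|exact: gc_cst].
- by apply: cint_ext int2 => // t _; rewrite kE.
Qed.

Let inv_shift_le (z : C) (t q : R) : hplane z -> 0 <= t -> 0 < q -> q <= (cm z + t) / 2 ->
  cm (z + toC t)^-1 <= q^-1.
Proof.
move=> Hz t0 q0 h; rewrite cmV lef_pV2 ?posrE//.
  exact: (le_trans h (hplane_shift_cm Hz t0)).
by rewrite cm_gt0; have [] := hplane_shift Hz t0.
Qed.

(** With [w = z + t] and [w0 = z0 + t] the remainder of [w^-2] is exactly
    [(w - w0)^2 (w^-2 w0^-2 + 2 w^-1 w0^-3)]. The inverses are bounded by [4 p] and [2 p] with
    [p = 1 / (d + t)], which gives [64 + 2 * 32 = 128]; two of the four factors [p] are then given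
    up for [1 / d]. *)
Let pot_taylor (z0 z : C) (t : R) : hplane z0 -> hplane z -> cm (z - z0) <= cm z0 / 2 -> 0 <= t ->
  cm (pot (z + toC t) - pot (z0 + toC t) - (z - z0) * (- 2 * om / (z0 + toC t) ^+ 3)) <=
  cm (z - z0) ^+ 2 * (128 / cm z0 ^+ 2 * a * (cm z0 + t) ^- 2).
Proof.
move=> Hz0 Hz zz t0; set d := cm z0; set q := d + t.
have d0 : 0 < d by exact: cm_gt0H.
have q0 : 0 < q by rewrite ltr_wpDr.
have zd : d / 2 <= cm z by have := cm_ge z0 z; rewrite cmBC; rewrite /d in zz *; lra.
have i0 : cm (z0 + toC t)^-1 <= 2 * q^-1.
  by rewrite -[2]invrK -invfM mulrC; apply: inv_shift_le => //; rewrite divr_gt0.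
have i1 : cm (z + toC t)^-1 <= 4 * q^-1.
  rewrite (_ : 4 * q^-1 = (q / 4)^-1); last by rewrite invfM invrK mulrC.
  by apply: inv_shift_le => //; [rewrite divr_gt0|rewrite /q; lra].
have n0 : z0 + toC t != 0 by have [] := hplane_shift Hz0 t0.
have n1 : z + toC t != 0 by have [] := hplane_shift Hz t0.
rewrite (_ : _ - _ - _ = (z - z0) ^+ 2 * (om * ((z + toC t)^-1 ^+ 2 * (z0 + toC t)^-1 ^+ 2 +
   2 * ((z + toC t)^-1 * (z0 + toC t)^-1 ^+ 3)))); last first.
  have -> : z - z0 = (z + toC t) - (z0 + toC t) by ring.
  rewrite /pot; move: (z + toC t) (z0 + toC t) n1 n0 => w w0 h1 h0.
  by field; rewrite h1 h0.
rewrite cmM cmX; apply: ler_wpM2l; first exact: sqr_ge0.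
rewrite cmM (_ : 128 / d ^+ 2 * a * q ^- 2 = a * (128 / d ^+ 2 * q ^- 2)); last by ring.
apply: ler_wpM2l => //.
set x := cm (z + toC t)^-1 in i1; set y := cm (z0 + toC t)^-1 in i0.
have x0 : 0 <= x by exact: cm_ge0.
have y0 : 0 <= y by exact: cm_ge0.
set p := q^-1 in i0 i1.
have p0 : 0 <= p by rewrite invr_ge0 ltW.
have -> : q ^- 2 = p ^+ 2 by rewrite exprVn.
apply: (le_trans (cmD _ _)).
have -> : cm ((z + toC t)^-1 ^+ 2 * (z0 + toC t)^-1 ^+ 2) = x ^+ 2 * y ^+ 2.
  by rewrite cmM !cmX.
have -> : cm (2 * ((z + toC t)^-1 * (z0 + toC t)^-1 ^+ 3)) = 2 * (x * y ^+ 3).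
  by rewrite cmM cmM cmX cm_nat.
have pd : p <= d^-1 by rewrite lef_pV2 ?posrE// lerDl.
have xx : x ^+ 2 <= 16 * p ^+ 2.
  have := ler_pM x0 x0 i1 i1; rewrite -!expr2; nra.
have yy : y ^+ 2 <= 4 * p ^+ 2.
  have := ler_pM y0 y0 i0 i0; rewrite -!expr2; nra.
have e1 : x ^+ 2 * y ^+ 2 <= 64 * p ^+ 4.
  have := ler_pM (sqr_ge0 _) (sqr_ge0 _) xx yy.
  by rewrite (_ : 16 * p ^+ 2 * (4 * p ^+ 2) = 64 * p ^+ 4)//; ring.
have e2 : x * y ^+ 3 <= 32 * p ^+ 4.
  have h1 := ler_pM x0 y0 i1 i0.
  have := ler_pM (mulr_ge0 x0 y0) (sqr_ge0 _) h1 yy.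
  by rewrite (_ : x * y * y ^+ 2 = x * y ^+ 3) 1?(_ : 4 * p * (2 * p) * (4 * p ^+ 2) = 32 * p ^+ 4)//; ring.
have e3 : p ^+ 4 <= d^-1 ^+ 2 * p ^+ 2.
  rewrite (_ : p ^+ 4 = p ^+ 2 * p ^+ 2); last by ring.
  by rewrite ler_wpM2r ?sqr_ge0// ler_sqr ?nnegrE// invr_ge0 ltW.
rewrite -exprVn; lra.
Qed.

Let wgt_cmp (d d' : R) i s : 0 < d' -> 0 <= s -> 0 < d -> 
  wgt d' i s <= expR (c / d') * wgt d i s.
Proof.
move=> d'0 s0 d0; apply: (le_trans (wgt_le i d'0 s0)).
by rewrite ler_peMr ?expR_ge0// wgt_ge1.
Qed.

(** An application of [fixpoint_deriv] with the weight frozen at [d = cm z0] while [z] runs through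
    the points of the half plane near [z0]. The free term is constant in [z]; only the kernel has to
    be expanded. *)
Lemma jost_analytic z0 i : hplane z0 -> exists L, gd id hplane (fun z => f z i 0) z0 L.
Proof.
move=> Hz0; set d := cm z0; have d0 : 0 < d by exact: cm_gt0H.
pose r := Num.min 1 (d / 2).
have r0 : 0 < r by rewrite lt_min ltr01 divr_gt0.
pose P := [set z : C | hplane z /\ cm (z - z0) <= r].
have Pd z : P z -> cm (z - z0) <= d / 2 by move=> [_ h]; apply: (le_trans h); rewrite ge_min lexx orbT.
have P1 z : P z -> cm (z - z0) <= 1 by move=> [_ h]; apply: (le_trans h); rewrite ge_min lexx.
have Pz z : P z -> d / 2 <= cm z.
  by move=> /Pd; have := cm_ge z0 z; rewrite cmBC -/d; lra.
have d20 : 0 < d / 2 by rewrite divr_gt0.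
(* The first summand controls the quadratic remainder of the potential, the second its first-order
   coefficient [- 2 * om / (z0 + t) ^+ 3]. *)
pose Cd := 128 / d ^+ 2 + 16 / d.
have Cd0 : 0 <= Cd by rewrite addr_ge0// divr_ge0// ?sqr_ge0// ltW.
pose B := 2 * (Cd * a) / c.
have B0 : 0 <= B by rewrite divr_ge0 ?(ltW c0)// !mulr_ge0.
pose M := 2 * expR (c / (d / 2)).
have M0 : 0 <= M by rewrite mulr_ge0// expR_ge0.
have Pz0 : P z0 by split=> //; rewrite subrr cm0 ltW.
have kK z : P z -> exists b, kerbd X Dx (wgt d) b (jker z).
  move=> Pz_; have [Hz _] := Pz_; exists (2 * (16 * a) / c), (kd d (16 * a)); split.
  - by move=> k j x Xx; exact: jker_meas.
  - move=> k j x t Xx; rewrite DxE//= in_itv/= andbT => xt.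
    have t0 : 0 <= t by exact: (le_trans Xx xt).
    rewrite /jker /kd; case: j; first by rewrite cm0 mul0r.
    rewrite cmM /ew /wgt [16 * a * _]mulrA ler_wpM2r ?expR_ge0//.
    rewrite -[leRHS]mul1r ler_pM ?cm_ge0 ?factor_le//.
    apply: (le_trans (pot_le Hz t0 d20 (Pz _ Pz_))).
    have q1 : 0 < d / 2 + t by rewrite ltr_wpDr.
    have q2 : 0 < d + t by rewrite ltr_wpDr.
    rewrite ler_pdivrMr ?exprn_gt0// mulrAC ler_pdivlMr ?exprn_gt0//.
    have : (d + t) ^+ 2 <= 4 * (d / 2 + t) ^+ 2 by nra.
    by move=> h; have := ler_wpM2l a0 h; lra.
  - by move=> k j x Xx; exact: (kd_int _ _ _ d0 Xx).
  - by move=> k x Xx; apply: kd_sum_le => //; rewrite mulr_ge0.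
have tay : kertay X Dx (wgt d) P z0 B jker.
  exists (fun k j x t => if j then 0 else
    (if k then - cexp (2 * tau * toC (t - x)) else (cexp (2 * tau * toC (t - x)) - 1) / (2 * tau)) *
    (- 2 * om / (z0 + toC t) ^+ 3)), (kd d (Cd * a)).
  split.
  - move=> k j x t Xx; rewrite DxE//= in_itv/= andbT => xt.
    have t0 : 0 <= t by exact: (le_trans Xx xt).
    rewrite /kd; case: j; first by rewrite cm0 mul0r.
    rewrite cmM /ew /wgt [Cd * a * _]mulrA ler_wpM2r ?expR_ge0//.
    rewrite -[leRHS]mul1r ler_pM ?cm_ge0 ?factor_le//.
    have q0 : 0 < d + t by rewrite ltr_wpDr.
    have i0 : cm (z0 + toC t)^-1 <= 2 * (d + t)^-1.
      rewrite (_ : 2 * (d + t)^-1 = ((d + t) / 2)^-1); last by rewrite invfM invrK mulrC.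
      by apply: inv_shift_le => //; rewrite divr_gt0.
    set y := cm (z0 + toC t)^-1 in i0 *; set p := (d + t)^-1 in i0 *.
    have -> : cm (- 2 * om / (z0 + toC t) ^+ 3) = 2 * a * y ^+ 3.
      by rewrite cmM cmM cmN cm_nat cmV cmX /y cmV exprVn.
    have p0 : 0 <= p by rewrite invr_ge0 ltW.
    have y0 : 0 <= y by exact: cm_ge0.
    have pd : p <= d^-1 by rewrite lef_pV2 ?posrE// lerDl.
    have y2 : y ^+ 2 <= 4 * p ^+ 2 by nra.
    have y3 : y ^+ 3 <= 8 * p ^+ 2 * p.
      have := ler_pM (sqr_ge0 y) y0 y2 i0.
      by rewrite (_ : y ^+ 2 * y = y ^+ 3) 1?(_ : 4 * p ^+ 2 * (2 * p) = 8 * p ^+ 2 * p)//; ring.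
    have y4 : 8 * p ^+ 2 * p <= 8 * p ^+ 2 * d^-1.
      by rewrite ler_wpM2l// mulr_ge0// sqr_ge0.
    have y5 : y ^+ 3 <= 8 * p ^+ 2 * d^-1 by exact: (le_trans y3 y4).
    have := ler_wpM2l a0 y5; rewrite -exprVn -/p /Cd -/a => h.
    have h2 : 0 <= 128 / d ^+ 2 * a * p ^+ 2.
      by rewrite !mulr_ge0 ?sqr_ge0// invr_ge0 sqr_ge0.
    lra.
  - move=> z k j x t Pz_ Xx; rewrite DxE//= in_itv/= andbT => xt.
    have t0 : 0 <= t by exact: (le_trans Xx xt).
    have [Hz _] := Pz_.
    rewrite /jker /kd; case: j; first by rewrite !mulr0 !subr0 cm0 mul0r.
    set F := (if k then _ else _); have F1 : cm F <= 1 by exact: factor_le.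
    rewrite (_ : _ - _ - _ = F * (pot (z + toC t) - pot (z0 + toC t) -
       (z - z0) * (- 2 * om / (z0 + toC t) ^+ 3))); last by ring.
    rewrite cmM /ew /wgt [Cd * a * _]mulrA [cm (z - z0) ^+ 2 * _]mulrA ler_wpM2r ?expR_ge0//.
    rewrite -[leRHS]mul1r ler_pM ?cm_ge0//.
    apply: (le_trans (pot_taylor Hz0 Hz (Pd _ Pz_) t0)).
    rewrite -/d ler_wpM2l ?sqr_ge0// ler_wpM2r ?invr_ge0 ?sqr_ge0// ler_wpM2r// /Cd lerDl.
    by rewrite divr_ge0// ltW.
  - by move=> k j x Xx; exact: (kd_int _ _ _ d0 Xx).
  - by move=> k x Xx; apply: kd_sum_le => //; rewrite mulr_ge0.
have ftay : funtay X (wgt d) P z0 B (fun z => jone z).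
  exists (fun _ _ => 0) => [k x Xx|z k x _ Xx].
    by rewrite cm0 mulr_ge0 ?v0.
  rewrite /jone subrr mulr0 subrr cm0; apply: mulr_ge0; first exact: sqr_ge0.
  by rewrite mulr_ge0 ?v0.
have bf z : P z -> bnd X D (wgt d) M (f z).
  move=> Pz_; have [Hz _] := Pz_; have [[mf b] _] := fH Hz; split=> // j t Xt.
  apply: (le_trans (b j t Xt)); rewrite /M -mulrA ler_wpM2l//.
  apply: (le_trans _ (wgt_cmp j d20 Xt d0)).
  rewrite ler_expR ler_wpM2l ?(ltW c0)// lef_pV2 ?posrE ?ltr_wpDr ?(cm_gt0H Hz)//.
  by rewrite lerD2r Pz.
have ef z k x : P z -> X x -> f z k x = jone z k x + iop Dx (jker z) (f z) k x.
  by move=> [Hz _] Xx; have [_ e] := fH Hz; exact: e.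
have X0 : X 0 by rewrite /X /=.
have [L HL] := fixpoint_deriv mD mDx DxD DX (@v0 d) M0 B0 Pz0 P1
  (jker_bd Hz0 d0 (lexx _)) kK tay ftay bf ef i X0.
exists L; apply: gd_loc r0 _ HL => z Hz /= h; split=> //; exact: ltW.
Qed.

(** By [jost_shift] the restriction of [f z i 0] to a horizontal ray is [f z i], whose real
    derivative [jost_deriv] computes. A complex derivative exists by [jost_analytic], and the chain
    rule along the ray leaves it only one possible value. *)
Lemma jost_gd z : hplane z ->
  gd id hplane (fun z => f z false 0) z (f z true 0) /\
  gd id hplane (fun z => f z true 0) z (- (2 * tau) * f z true 0 + pot z * f z false 0).
Proof.
move=> Hz.
have [d1 d2] := jost_deriv Hz (lexx 0); rewrite toC0 addr0 in d2.
have acc (d : R) : 0 < d -> exists y, [/\ D y, cm (toC y - toC 0) < d & toC y != toC 0].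
  move=> dp; exists (d / 2); rewrite DE -toCB cm_toC subr0 (inj_eq (@toC_inj R)).
  by split; [rewrite divr_ge0// ltW|rewrite gtr0_norm ?divr_gt0//; lra|rewrite gt_eqF// divr_gt0].
have dz : gd (@toC R) D (fun s => z + toC s) 0 (0 + 1).
  by apply: gdD (gd_cst _ _ _ _) (gd_io _ _ _).
have key i (l : C) : gd (@toC R) D (f z i) 0 l -> gd id hplane (fun z => f z i 0) z l.
  move=> dl; have [L HL] := jost_analytic i Hz.
  have HL' : gd id hplane (fun z => f z i 0) (z + toC 0) L by rewrite toC0 addr0.
  have sub s : D s -> hplane (z + toC s) by rewrite DE; exact: hplane_shift.
  have := gd_comp sub dz HL'; rewrite add0r mulr1 => dL.
  rewrite (gd_unique acc dl (gd_ext _ _ dL))// => [y|].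
    by rewrite DE => y0; rewrite -jost_shift// add0r.
  by rewrite toC0 addr0.
by split; apply: key.
Qed.

Lemma jost_bound : exists2 K : R, 0 <= K & forall z, hplane z -> 1 <= cm z ->
  cm (f z false 0 - 1) <= K / cm z /\ cm (f z true 0) <= K / cm z.
Proof.
pose K := 16 * a * expR c; exists K; first by rewrite !mulr_ge0// expR_ge0.
move=> z Hz z1; have [bf ef] := fH Hz; have d0 := cm_gt0H Hz.
set d := cm z in bf d0 z1 *.
have key i : cm (iop Dx (jker z) (f z) i 0) <= K / d.
  have := @iop_le_int _ _ X D Dx (wgt d) mD mDx DxD DX (jker z)
    (fun j t => kd d (4 * a) i j 0 t) 2 (f z) i 0 (ler0n _ _).
  move=> H; apply: (le_trans (H _ _ _ bf)).
  - by move=> j; apply: jker_meas => //; rewrite /X /=.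
  - by move=> j t Dt; exact: (jker_le i j Hz (lexx 0) Dt d0 (lexx _)).
  - by move=> j; exact: (kd_int _ _ _ d0 (lexx 0)).
  rewrite kd_sum// addr0.
  (* From [expR (- y) >= 1 - y] follows [expR y - 1 <= y * expR y]; here [y = c / d <= c], because
     [d >= 1]. *)
  have e1 : expR (c / d) - 1 <= c / d * expR c.
    have h1 := expR_ge1Dx (- (c / d)).
    have h2 : expR (c / d) * expR (- (c / d)) = 1 by rewrite expRN divff// gt_eqF// expR_gt0.
    have h3 := ler_wpM2l (expR_ge0 (c / d)) h1; rewrite h2 in h3.
    have cd0 : 0 <= c / d by rewrite divr_ge0 ?(ltW c0) ?(ltW d0).
    have cdc : c / d <= c by rewrite ler_pdivrMr// ler_peMr// ltW.
    have h4 : c / d * expR (c / d) <= c / d * expR c by rewrite ler_wpM2l// ler_expR.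
    lra.
  rewrite (_ : 2 * (2 * _) = 16 * a / c * (expR (c / d) - 1)); last by ring.
  rewrite (_ : K / d = 16 * a / c * (c / d * expR c)); last first.
    by rewrite /K; field; rewrite !gt_eqF.
  by rewrite ler_wpM2l// divr_ge0 ?(ltW c0)// mulr_ge0.
split.
  by rewrite ef// /jone addrAC subrr add0r key.
by rewrite ef// /jone add0r key.
Qed.

End WithSolution.

(** For [om = nu^2 - 1/4] these are, up to constant factors, [sqrt z] times the Hankel functions of
    order [nu]. The factor [cexp (tau * z)] restores the term [- h] because [tau * tau = -1]. *)
Lemma hankel_exists : exists h h1 : C -> C, exists2 K : R, 0 <= K &
  (forall z, hplane z -> gd id hplane h z (h1 z) /\
     gd id hplane h1 z ((pot z - 1) * h z)) /\
  forall z, hplane z -> 1 <= cm z ->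
    cm (h z - cexp (tau * z)) <= K / cm z * cm (cexp (tau * z)) /\
    cm (h1 z - tau * cexp (tau * z)) <= K / cm z * cm (cexp (tau * z)).
Proof.
have [f fH] := jost_exists; have [K K0 HK] := jost_bound fH.
exists (fun z => cexp (tau * z) * f z false 0).
exists (fun z => cexp (tau * z) * (tau * f z false 0 + f z true 0)).
exists (2 * K); first by rewrite mulr_ge0.
have dE z : gd id hplane (fun z => cexp (tau * z)) z (cexp (tau * z) * (tau * 1)).
  apply: (@gd_comp _ _ _ hplane setT (fun z => tau * z)) => //; last exact: gd_cexp.
  by apply: gdZ; exact: gd_io.
split=> [z Hz|z Hz z1].
  have [d1 d2] := jost_gd fH Hz; split.
    by apply: gd_eq (gdM (dE z) d1); ring.
  apply: gd_eq (gdM (dE z) (gdD (gdZ tau d1) d2)).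
  have -> : (pot z - 1) = pot z + tau * tau by rewrite tau_sqr.
  by ring.
have [h1 h2] := HK z Hz z1; set E := cexp (tau * z); split.
  rewrite (_ : _ - E = (f z false 0 - 1) * E); last by ring.
  rewrite cmM ler_wpM2r ?cm_ge0//; apply: (le_trans h1).
  by rewrite ler_wpM2r ?invr_ge0 ?cm_ge0//; lra.
rewrite (_ : _ - tau * E = (tau * (f z false 0 - 1) + f z true 0) * E); last by ring.
rewrite cmM ler_wpM2r ?cm_ge0//; apply: (le_trans (cmD _ _)).
by rewrite cmM cm_tau mul1r; lra.
Qed.

End Jost.

(** * Behaviour of the unperturbed solutions at 0 *)

Section NearZero.
Context {R : realType}.
Local Notation C := (Cplx R).
Local Notation Re := complex.Re.
Local Notation Im := complex.Im.

Lemma toC_expR (x : R) : toC (expR x) = cexp (toC x).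
Proof. by rewrite /cexp /= cos0 sin0 -[LHS]mulr1. Qed.

Lemma mul_conj (z : C) : z * conjc z = toC (cm z ^+ 2).
Proof. by rewrite toCX -cmE; exact/esym/sqr_normc. Qed.

Lemma cm_conj (z : C) : cm (conjc z) = cm z.
Proof. by apply: toC_inj; rewrite -!cmE; exact: normcJ. Qed.

Lemma gd_conj (S : set R) (f : R -> C) x L :
  gd (@toC R) S f x L -> gd (@toC R) S (fun y => conjc (f y)) x (conjc L).
Proof.
move=> H e e0; have [d d0 Hd] := H e e0; exists d => // y Sy yd.
have E (u v l : C) (r : R) : conjc u - conjc v - conjc l * toC r = conjc (u - v - l * toC r).
  by case: u v l => [? ?] [? ?] [? ?]; apply: ReIm_inj => /=; ring.
rewrite -toCB E.
by rewrite cm_conj toCB Hd.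
Qed.

Lemma gd_cmsqr (S : set R) (f : R -> C) x L :
  gd (@toC R) S f x L ->
  gd (@toC R) S (fun y => toC (cm (f y) ^+ 2)) x (toC (2 * Re (conjc (f x) * L))).
Proof.
move=> H; apply: gd_eq (gd_ext _ _ (gdM H (gd_conj H))); last 2 first.
- by move=> y _; rewrite mul_conj.
- by rewrite mul_conj.
by move: (f x) L {H} => [a b] [c d]; apply: ReIm_inj => /=; ring.
Qed.

(** An energy estimate on the radius from the unit circle to [z], in the variable [s = - ln |z|].
    Euler's equation [z^2 h'' = (nu^2 - 1/4) h] has the exponents [n1 = 1/2 - nu] and
    [n2 = 1/2 + nu]; the remaining term [- z^2 h] is a perturbation of relative size [exp (- 2 s)].
    The smaller exponent [n1] gives the power in the bound. *)
Lemma near_zero (nu M : R) (h h1 : C -> C) : 0 < nu -> 0 <= M ->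
  (forall z, hplane z -> gd id hplane h z (h1 z) /\
     gd id hplane h1 z ((pot (toC (nu ^+ 2 - 4^-1)) z - 1) * h z)) ->
  (forall z, hplane z -> cm z = 1 -> cm (h z) <= M /\ cm (h1 z) <= M) ->
  exists2 K : R, 0 <= K & forall z, hplane z -> cm z <= 1 ->
    cm (h z) <= K * cm z `^ (2^-1 - nu) /\ cm (z * h1 z) <= K * cm z `^ (2^-1 - nu).
Proof.
move=> nu0 M0 ode hM.
pose K1 := expR (nu^-1) * (2 * (M * (2 + nu))).
have K10 : 0 <= K1 by rewrite mulr_ge0 ?expR_ge0// !mulr_ge0//; lra.
exists (K1 / nu + K1 * (1 + nu^-1)).
  by rewrite addr_ge0 ?divr_ge0 ?mulr_ge0 ?addr_ge0 ?invr_ge0// ltW.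
move=> z Hz z1; have [z0 zn] := Hz; have cz : 0 < cm z by rewrite cm_gt0.
pose e := z / toC (cm z).
have czC : toC (cm z) != 0 by rewrite toC_eq0 gt_eqF.
have cme : cm e = 1 by rewrite cmM cmV cm_toC_ge0 ?cm_ge0// divff// gt_eqF.
pose S := - ln (cm z).
have S0 : 0 <= S by rewrite oppr_ge0 ln_le0.
pose Z s := e * cexp (- 1 * toC s).
have HZ s : hplane (Z s).
  split; last by rewrite mulf_neq0 ?cexp_neq0// -cm_gt0 cme.
  rewrite /Z mulN1r -toCN -toC_expR mulrC ReCZ mulr_ge0 ?expR_ge0//.
  by rewrite /e -toCV mulrC ReCZ mulr_ge0// invr_ge0 ltW.
have ZS : Z S = z.
  by rewrite /Z mulN1r -toCN opprK -toC_expR lnK ?posrE// /e divfK.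
have Z0 : Z 0 = e by rewrite /Z toC0 mulr0 cexp0 mulr1.
have cmZ s : cm (Z s) = expR (- s).
  by rewrite cmM cme mul1r mulN1r -toCN -toC_expR cm_toC_ge0 ?expR_ge0.
have dZ s (A : set R) : gd (@toC R) A Z s (- Z s).
  have := gdZ e (gd_comp (P := setT) (fun _ _ => I) (gdZ (-1) (gd_io (@toC R) A s))
     (gd_cexp setT _)).
  by apply: gd_eq; rewrite /Z; ring.
pose n1 := toC (2^-1 - nu); pose n2 := toC (2^-1 + nu).
(* These combinations diagonalise Euler's equation: [a] vanishes on [z^n1] and [b] on [z^n2]. Up to
   the perturbation they behave like [exp (- n2 s)] and [exp (- n1 s)], and [a - b = 2 nu h]
   recovers [h]. *)
pose a s := Z s * h1 (Z s) - n1 * h (Z s).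
pose b s := Z s * h1 (Z s) - n2 * h (Z s).
have om : toC (nu ^+ 2 - 4^-1) = - (n1 * n2).
  by rewrite /n1 /n2 -toCM -toCN; congr toC; field.
have n12 : n1 + n2 = 1.
  by rewrite /n1 /n2 -toCD -toC1; congr toC; field.
have n21 : toC (2 * nu) = n2 - n1 by rewrite /n1 /n2 -toCB; congr toC; ring.
have dh s (A : set R) : gd (@toC R) A (fun s => h (Z s)) s (h1 (Z s) * - Z s).
  by apply: (@gd_comp _ _ _ A hplane) (dZ s A) _ => //; have [] := ode _ (HZ s).
have dh1 s (A : set R) : gd (@toC R) A (fun s => h1 (Z s)) s
    ((pot (toC (nu ^+ 2 - 4^-1)) (Z s) - 1) * h (Z s) * - Z s).
  by apply: (@gd_comp _ _ _ A hplane) (dZ s A) _ => //; have [] := ode _ (HZ s).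
have Zn s : Z s != 0 by have [] := HZ s.
have da s (A : set R) : gd (@toC R) A a s (Z s ^+ 2 * h (Z s) - n2 * a s).
  apply: gd_eq (gdB (gdM (dZ s A) (dh1 s A)) (gdZ n1 (dh s A))).
  rewrite /a /pot om; have -> : n2 = 1 - n1 by rewrite -n12 addrAC subrr add0r.
  by field; rewrite Zn.
have db s (A : set R) : gd (@toC R) A b s (Z s ^+ 2 * h (Z s) - n1 * b s).
  apply: gd_eq (gdB (gdM (dZ s A) (dh1 s A)) (gdZ n2 (dh s A))).
  rewrite /b /pot om; have -> : n2 = 1 - n1 by rewrite -n12 addrAC subrr add0r.
  by field; rewrite Zn.
(* The term [(1 - 2 * nu) * s] compensates the exponent [2 * n1] of the squares. The derivative
   [- 2 * nu^-1 * expR (- 2 * s)] of the other term absorbs [z^2 h], as [|z|^2 = expR (- 2 * s)] and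
   [|h| <= (|a| + |b|) / (2 nu)]. So [g] does not increase. *)
pose ex s := expR ((1 - 2 * nu) * s + nu^-1 * expR (- 2 * s)).
pose g s := ex s * (cm (a s) ^+ 2 + cm (b s) ^+ 2).
pose ex' s := ex s * ((1 - 2 * nu) - nu^-1 * 2 * expR (- 2 * s)).
pose g' s := ex' s * (cm (a s) ^+ 2 + cm (b s) ^+ 2) +
  ex s * (2 * Re (conjc (a s) * (Z s ^+ 2 * h (Z s) - n2 * a s)) +
          2 * Re (conjc (b s) * (Z s ^+ 2 * h (Z s) - n1 * b s))).
have dex s (A : set R) : gd (@toC R) A (fun s => toC (ex s)) s (toC (ex' s)).
  have e1 := gd_comp (P := setT) (fun _ _ => I) (gdZ (toC (-2)) (gd_io (@toC R) A s)) (gd_cexp setT _).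
  have e2 := gdD (gdZ (toC (1 - 2 * nu)) (gd_io (@toC R) A s)) (gdZ (toC nu^-1) e1).
  have e3 := gd_comp (P := setT) (fun _ _ => I) e2 (gd_cexp setT _).
  have c2 (y : R) : cexp (toC (-2) * toC y) = toC (expR (-2 * y)) by rewrite toC_expR toCM.
  have c1 y : cexp (toC (1 - 2 * nu) * toC y + toC nu^-1 * cexp (toC (-2) * toC y)) = toC (ex y).
    by rewrite c2 -!toCM -toCD -toC_expR.
  apply: gd_eq (gd_ext _ _ e3); last 2 first.
  - by move=> y _; rewrite c1.
  - by rewrite c1.
  rewrite c1 c2 !mulr1 -!toCM -toCD -toCM /ex'.
  by congr toC; ring.
have dg s (A : set R) : gd (@toC R) A (fun s => toC (g s)) s (toC (g' s)).
  have := gdM (dex s A) (gdD (gd_cmsqr (da s A)) (gd_cmsqr (db s A))).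
  move=> H; apply: gd_eq (gd_ext _ _ H); last 2 first.
  - by move=> y _; rewrite /g -toCD -toCM.
  - by rewrite /g -toCD -toCM.
  by rewrite /g' -!toCD -!toCM -toCD.
have g'0 s : g' s <= 0.
  set A := cm (a s); set B := cm (b s); set H := cm (h (Z s)).
  have A0 : 0 <= A by exact: cm_ge0. have B0 : 0 <= B by exact: cm_ge0.
  have abh : 2 * nu * H <= A + B.
    rewrite -(@cm_toC_ge0 _ (2 * nu)); last by rewrite mulr_ge0// ltW.
    by rewrite -cmM (_ : _ * _ = a s - b s) ?cmB// /a /b n21; ring.
  set q := expR (- 2 * s).
  have zq : cm (Z s) ^+ 2 = q by rewrite cmZ -expRM_natl; congr expR; ring.
  have q0 : 0 <= q by exact: expR_ge0.
  have key (w : C) (n : R) : Re (conjc w * (Z s ^+ 2 * h (Z s) - toC n * w)) <=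
      cm w * (q * H) - n * cm w ^+ 2.
    rewrite (_ : conjc w * _ = conjc w * (Z s ^+ 2 * h (Z s)) - toC n * (w * conjc w)); last by ring.
    rewrite mul_conj -toCM ReCD ReCN /= lerD2r.
    apply: (le_trans (ler_norm _)); apply: (le_trans (cm_Re _)).
    by rewrite cmM cm_conj cmM cmX zq.
  have ka := key (a s) (2^-1 + nu); have kb := key (b s) (2^-1 - nu).
  rewrite -/A -/B in ka kb.
  have gE : g' s = ex s * ((1 - 2 * nu - nu^-1 * 2 * q) * (A ^+ 2 + B ^+ 2) +
      (2 * Re (conjc (a s) * (Z s ^+ 2 * h (Z s) - n2 * a s)) +
       2 * Re (conjc (b s) * (Z s ^+ 2 * h (Z s) - n1 * b s)))).
    by rewrite /g' /ex' -/A -/B -/q; ring.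
  rewrite gE pmulr_rle0 ?expR_gt0//.
  have k1 : H <= (A + B) / (2 * nu) by rewrite ler_pdivlMr ?mulr_gt0// mulrC.
  have k2 : q * (A + B) * H <= q * (A + B) * ((A + B) / (2 * nu)).
    by rewrite ler_wpM2l// mulr_ge0// addr_ge0.
  have k3 : q * (A + B) * ((A + B) / (2 * nu)) <= nu^-1 * q * (A ^+ 2 + B ^+ 2).
    rewrite (_ : q * (A + B) * _ = nu^-1 * q * ((A + B) ^+ 2 / 2)); last by field; rewrite gt_eqF.
    rewrite ler_wpM2l// ?mulr_ge0 ?invr_ge0 ?(ltW nu0)//.
    by have := sqr_ge0 (A - B); nra.
  have k4 : 0 <= nu * A ^+ 2 by rewrite mulr_ge0 ?sqr_ge0// ltW.
  by move: ka kb k2 k3 k4; rewrite /n1 /n2; lra.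
have mono : g S <= g 0.
  have := @gd_mono R (fun s => - g s) (fun s => - g' s) 0 S S0.
  rewrite lerN2; apply => // [x _ _|x _ _]; last by rewrite oppr_ge0.
  have := gdN (dg x `[0, S]%classic).
  by rewrite -toCN; apply: gd_ext => [y _|]; rewrite toCN.
have cZ0 : cm (Z 0) = 1 by rewrite cmZ oppr0 expR0.
have [hM0 hM1] := hM (Z 0) (HZ 0) cZ0.
have c1 (n : R) : `|n| <= 2^-1 + nu -> cm (Z 0 * h1 (Z 0) - toC n * h (Z 0)) <= M * (2 + nu).
  move=> hn; apply: (le_trans (cmB _ _)); rewrite cmM cZ0 mul1r cmM cm_toC.
  have := ler_pM (normr_ge0 n) (cm_ge0 _) hn hM0 => h2.
  rewrite (_ : M * (2 + nu) = M + (2^-1 + nu) * M + 2^-1 * M); last by field.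
  by have h3 : 0 <= 2^-1 * M; [exact: mulr_ge0|lra].
have a0 : cm (a 0) <= M * (2 + nu) by apply: c1; rewrite ler_norml; apply/andP; split; lra.
have b0 : cm (b 0) <= M * (2 + nu) by apply: c1; rewrite ler_norml; apply/andP; split; lra.
set Q := M * (2 + nu) in a0 b0.
have Q0 : 0 <= Q by rewrite mulr_ge0//; lra.
have g0 : g 0 <= expR nu^-1 * (2 * Q ^+ 2).
  rewrite /g /ex !mulr0 add0r expR0 mulr1 ler_wpM2l ?expR_ge0//.
  have := ler_pM (cm_ge0 _) (cm_ge0 _) a0 a0; have := ler_pM (cm_ge0 _) (cm_ge0 _) b0 b0.
  by rewrite -!expr2; lra.
set P := cm z `^ (2^-1 - nu).
have PE : P ^+ 2 = expR (- ((1 - 2 * nu) * S)).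
  rewrite /P -powR_mulrn ?powR_ge0// -powRrM /powR (gt_eqF cz); congr expR.
  by rewrite /S; field.
have P0 : 0 <= P by exact: powR_ge0.
have fin : cm (a S) ^+ 2 + cm (b S) ^+ 2 <= (K1 * P) ^+ 2.
  have e1 : expR ((1 - 2 * nu) * S) * (cm (a S) ^+ 2 + cm (b S) ^+ 2) <= g S.
    rewrite /g ler_wpM2r ?addr_ge0 ?sqr_ge0// ler_expR lerDl.
    by rewrite mulr_ge0 ?expR_ge0// invr_ge0 ltW.
  have e2 := le_trans e1 (le_trans mono g0).
  have e3 := ler_wpM2l (sqr_ge0 P) e2.
  have e4 : P ^+ 2 * expR ((1 - 2 * nu) * S) = 1 by rewrite PE -expRD addNr expR0.
  rewrite [X in X <= _]mulrA e4 mul1r in e3; apply: (le_trans e3).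
  rewrite (_ : (K1 * P) ^+ 2 = P ^+ 2 * K1 ^+ 2); last by ring.
  apply: ler_wpM2l; first exact: sqr_ge0.
  rewrite /K1 -/Q (_ : (expR nu^-1 * (2 * Q)) ^+ 2 = expR nu^-1 ^+ 2 * (4 * Q ^+ 2)); last by ring.
  have x1 : 1 <= expR nu^-1 by rewrite -expR0 ler_expR invr_ge0 ltW.
  have x2 : expR nu^-1 <= expR nu^-1 ^+ 2 by rewrite expr2 ler_peMr ?expR_ge0.
  have Q2 : 0 <= Q ^+ 2 by exact: sqr_ge0.
  have := ler_wpM2r Q2 x2 => y.
  by have := mulr_ge0 (sqr_ge0 (expR nu^-1)) Q2; lra.
have KP0 : 0 <= K1 * P by exact: mulr_ge0.
have aS : cm (a S) <= K1 * P.
  by rewrite -ler_sqr ?nnegrE ?cm_ge0//; have := sqr_ge0 (cm (b S)); lra.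
have bS : cm (b S) <= K1 * P.
  by rewrite -ler_sqr ?nnegrE ?cm_ge0//; have := sqr_ge0 (cm (a S)); lra.
have nuC : toC (2 * nu) != 0 by rewrite toC_eq0 mulf_neq0 ?gt_eqF.
have inv2 : cm (toC (2 * nu))^-1 = (2 * nu)^-1.
  by rewrite cmV cm_toC_ge0// mulr_ge0// ltW.
have t0 : 0 <= (2 * nu)^-1 by rewrite invr_ge0 mulr_ge0// ltW.
have hz : h z = (toC (2 * nu))^-1 * (a S - b S).
  by rewrite /a /b ZS; apply: (mulfI nuC); rewrite mulVKf// n21; ring.
have hz1 : z * h1 z = (toC (2 * nu))^-1 * (n2 * a S - n1 * b S).
  by rewrite /a /b ZS; apply: (mulfI nuC); rewrite mulVKf// n21; ring.
have hle : cm (h z) <= K1 / nu * P.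
  rewrite hz cmM inv2; have := cmB (a S) (b S) => w.
  have : cm (a S - b S) <= 2 * (K1 * P) by lra.
  move=> /(ler_wpM2l t0) h2; apply: (le_trans h2).
  by rewrite le_eqVlt; apply/orP; left; apply/eqP; field; rewrite gt_eqF.
have h1le : cm (z * h1 z) <= K1 * (1 + nu^-1) * P.
  rewrite hz1 cmM inv2.
  have w := cmB (n2 * a S) (n1 * b S).
  have w1 : cm (n2 * a S) <= (2^-1 + nu) * (K1 * P).
    rewrite cmM cm_toC_ge0; last by lra.
    by rewrite ler_wpM2l//; lra.
  have w2 : cm (n1 * b S) <= (2^-1 + nu) * (K1 * P).
    rewrite cmM cm_toC; apply: ler_pM; rewrite ?cm_ge0//.
    by rewrite ler_norml; apply/andP; split; lra.
  have : cm (n2 * a S - n1 * b S) <= 2 * (2^-1 + nu) * (K1 * P) by lra.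
  move=> /(ler_wpM2l t0) h2; apply: (le_trans h2).
  rewrite (_ : (2 * nu)^-1 * (2 * (2^-1 + nu) * (K1 * P)) = (nu^-1 * 2^-1 + 1) * (K1 * P)); last first.
    by field; rewrite gt_eqF.
  rewrite (_ : K1 * _ * P = (1 + nu^-1) * (K1 * P)); last by ring.
  by rewrite ler_wpM2r//; have nui : 0 < nu^-1; [rewrite invr_gt0|lra].
have s1 : 0 <= K1 / nu * P by apply: mulr_ge0 => //; apply: divr_ge0 => //; exact: ltW.
have s2 : 0 <= K1 * (1 + nu^-1) * P.
  apply: mulr_ge0 => //; apply: mulr_ge0 => //; apply: addr_ge0 => //.
  by rewrite invr_ge0 ltW.
by rewrite mulrDl; split; lra.
Qed.
End NearZero.

(** * Global bounds and the Wronskian of the unperturbed pair *)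

Section Hankel.
Context {R : realType}.
Local Notation C := (Cplx R).
Local Notation Re := complex.Re.
Local Notation Im := complex.Im.

(** Common envelope, at 0 and at infinity, of both unperturbed solutions once the exponential is
    split off. *)
Definition phi (nu r : R) : R := Num.min 1 r `^ (2^-1 - nu).

Definition eabs (sg : bool) (z : C) : R := cm (cexp (tau sg * z)).

Lemma eabs_gt0 sg z : 0 < eabs sg z.
Proof. by rewrite /eabs cm_cexp expR_gt0. Qed.

Lemma tauN sg : tau (~~ sg) = - tau sg :> C.
Proof. by case: sg; rewrite /tau /sgd /= ?mulN1r ?mul1r ?opprK. Qed.

Lemma eabsN sg z : eabs (~~ sg) z = (eabs sg z)^-1.
Proof. by rewrite /eabs tauN mulNr cexpN cmV. Qed.

Lemma eabs_le sg (z w : C) : eabs sg z <= eabs sg w * expR (cm (z - w)).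
Proof.
rewrite /eabs !cm_cexp -expRD ler_expR.
have -> : tau sg * z = tau sg * w + tau sg * (z - w) by ring.
rewrite ReCD lerD2l (le_trans (ler_norm _))// (le_trans (cm_Re _))//.
by rewrite cmM cm_tau mul1r.
Qed.

Lemma phi_gt0 nu r : 0 < r -> 0 < phi nu r.
Proof. by move=> r0; rewrite powR_gt0// lt_min ltr01. Qed.

(** All that is used later of the unperturbed solutions, with one constant for both signs. In the
    bound of the derivative, [1 + cm z] covers both regimes: [h1] is of size [phi / |z|] at 0 and
    [phi] at infinity, exponentials aside. *)
Definition hankel_spec (nu K : R) (h h1 : bool -> C -> C) :=
  [/\ forall sg z, hplane z -> gd id hplane (h sg) z (h1 sg z) /\
        gd id hplane (h1 sg) z ((pot (toC (nu ^+ 2 - 4^-1)) z - 1) * h sg z),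
      forall sg z, hplane z -> 1 <= cm z ->
        cm (h sg z - cexp (tau sg * z)) <= K / cm z * eabs sg z /\
        cm (h1 sg z - tau sg * cexp (tau sg * z)) <= K / cm z * eabs sg z,
      forall sg z, hplane z -> cm (h sg z) <= K * phi nu (cm z) * eabs sg z /\
        cm z * cm (h1 sg z) <= K * phi nu (cm z) * (1 + cm z) * eabs sg z &
      forall z, hplane z -> h true z * h1 false z - h1 true z * h false z = - (2 * imunit)].

Lemma hankel_pack nu : 0 < nu -> exists h h1, exists2 K : R, 0 <= K & hankel_spec nu K h h1.
Proof.
move=> nu0; set om := toC (nu ^+ 2 - 4^-1).
have /choice[h /choice[h1 hh]] : forall sg : bool, exists h h1 : C -> C, exists2 K : R, 0 <= K &
  (forall z, hplane z -> gd id hplane h z (h1 z) /\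
     gd id hplane h1 z ((pot om z - 1) * h z)) /\
  forall z, hplane z -> 1 <= cm z ->
    cm (h z - cexp (tau sg * z)) <= K / cm z * cm (cexp (tau sg * z)) /\
    cm (h1 z - tau sg * cexp (tau sg * z)) <= K / cm z * cm (cexp (tau sg * z)).
  by move=> sg; exact: hankel_exists.
have [Kt Kt0 [ot at_]] := hh true; have [Kf Kf0 [of_ af]] := hh false.
pose K0 := Kt + Kf.
have K00 : 0 <= K0 by exact: addr_ge0.
have ode sg z : hplane z -> gd id hplane (h sg) z (h1 sg z) /\
     gd id hplane (h1 sg) z ((pot om z - 1) * h sg z) by case: sg; [exact: ot|exact: of_].
have asy sg z : hplane z -> 1 <= cm z ->
    cm (h sg z - cexp (tau sg * z)) <= K0 / cm z * eabs sg z /\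
    cm (h1 sg z - tau sg * cexp (tau sg * z)) <= K0 / cm z * eabs sg z.
  move=> Hz z1.
  have le K : K <= K0 -> K / cm z * eabs sg z <= K0 / cm z * eabs sg z.
    by move=> KK; rewrite ler_wpM2r ?(ltW (eabs_gt0 _ _))// ler_wpM2r// invr_ge0 cm_ge0.
  case: sg le => le.
    have [p q] := at_ z Hz z1; split.
      by apply: le_trans p _; apply: le; rewrite lerDl.
    by apply: le_trans q _; apply: le; rewrite lerDl.
  have [p q] := af z Hz z1; split.
    by apply: le_trans p _; apply: le; rewrite lerDr.
  by apply: le_trans q _; apply: le; rewrite lerDr.
have big sg z : hplane z -> 1 <= cm z -> cm (h sg z) <= (1 + K0) * eabs sg z /\
    cm (h1 sg z) <= (1 + K0) * eabs sg z.
  move=> Hz z1; have [p q] := asy sg z Hz z1.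
  have E0 := ltW (eabs_gt0 sg z).
  have le : K0 / cm z * eabs sg z <= K0 * eabs sg z.
    by rewrite ler_wpM2r// ler_pdivrMr ?ler_peMr//; exact: lt_le_trans z1.
  have p' := cm_ge (h sg z) (cexp (tau sg * z)).
  have q' := cm_ge (h1 sg z) (tau sg * cexp (tau sg * z)).
  by rewrite cmM cm_tau mul1r -/(eabs sg z) in q'; rewrite -/(eabs sg z) in p'; split; lra.
have M0 : 0 <= (1 + K0) * expR 1 by rewrite mulr_ge0 ?expR_ge0// addr_ge0.
have nz sg := @near_zero R nu ((1 + K0) * expR 1) (h sg) (h1 sg) nu0 M0 (ode sg).
have Hnz sg : forall z, hplane z -> cm z = 1 -> cm (h sg z) <= (1 + K0) * expR 1 /\ cm (h1 sg z) <= (1 + K0) * expR 1.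
  move=> z Hz z1; have [|p q] := big sg z Hz; first by rewrite z1.
  have : eabs sg z <= expR 1.
    have := eabs_le sg z 0; rewrite subr0 z1 /eabs mulr0 cexp0 cm1 mul1r; exact.
  move=> e; have k : (1 + K0) * eabs sg z <= (1 + K0) * expR 1 by rewrite ler_wpM2l// addr_ge0.
  by split; [exact: le_trans p k|exact: le_trans q k].
have [Nt Nt0 nt] := nz true (Hnz true); have [Nf Nf0 nf] := nz false (Hnz false).
pose N := Nt + Nf.
have N0 : 0 <= N by exact: addr_ge0.
have near0 sg z : hplane z -> cm z <= 1 ->
    cm (h sg z) <= N * cm z `^ (2^-1 - nu) /\ cm (z * h1 sg z) <= N * cm z `^ (2^-1 - nu).
  move=> Hz z1; have P0 := powR_ge0 (cm z) (2^-1 - nu).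
  have lt : Nt * cm z `^ (2^-1 - nu) <= N * cm z `^ (2^-1 - nu) by rewrite ler_wpM2r// lerDl.
  have lf : Nf * cm z `^ (2^-1 - nu) <= N * cm z `^ (2^-1 - nu) by rewrite ler_wpM2r// lerDr.
  case: sg; [have [p q] := nt z Hz z1|have [p q] := nf z Hz z1]; split; lra.
pose K := 1 + K0 + N * expR 1.
have NE0 : 0 <= N * expR 1 by rewrite mulr_ge0 ?expR_ge0.
have K_0 : 0 <= K by rewrite !addr_ge0.
exists h, h1, K => //; split.
- exact: ode.
- move=> sg z Hz z1; have [p q] := asy sg z Hz z1.
  have le : K0 / cm z * eabs sg z <= K / cm z * eabs sg z.
    rewrite ler_wpM2r ?(ltW (eabs_gt0 _ _))// ler_wpM2r ?invr_ge0 ?cm_ge0//.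
    by rewrite /K; lra.
  by split; [exact: le_trans p le|exact: le_trans q le].
- move=> sg z Hz; have cz : 0 < cm z by rewrite cm_gt0; have [] := Hz.
  have E0 := ltW (eabs_gt0 sg z).
  have [z1|/ltW z1] := leP (cm z) 1.
    have [p q] := near0 sg z Hz z1.
    rewrite /phi (min_idPr z1); set P := cm z `^ _ in p q *.
    have P0 : 0 <= P by exact: powR_ge0.
    have e1 : 1 <= expR 1 * eabs sg z.
      have := eabs_le sg 0 z; rewrite sub0r cmN {1}/eabs mulr0 cexp0 cm1 => h2.
      apply: (le_trans h2); rewrite mulrC ler_wpM2r// ler_expR//.
    have k : N * P <= K * P * eabs sg z.
      have h3 : N * P <= (N * expR 1) * P * eabs sg z.
        rewrite (_ : N * expR 1 * P * _ = N * P * (expR 1 * eabs sg z)); last by ring.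
        by rewrite ler_peMr// mulr_ge0.
      apply: (le_trans h3); rewrite ler_wpM2r// ler_wpM2r// /K.
      by lra.
    split; first exact: le_trans p k.
    rewrite cmM in q; apply: (le_trans q); apply: (le_trans k).
    by rewrite ler_wpM2r// ler_peMr ?mulr_ge0// lerDl ltW.
  have [p q] := big sg z Hz z1.
  rewrite /phi (min_idPl z1) powR1 mulr1.
  have k : (1 + K0) * eabs sg z <= K * eabs sg z by rewrite ler_wpM2r// /K; lra.
  split; first exact: le_trans p k.
  have := ler_wpM2l (ltW cz) (le_trans q k) => h2; apply: (le_trans h2).
  rewrite (_ : K * (1 + cm z) * eabs sg z = (1 + cm z) * (K * eabs sg z)); last by ring.
  by rewrite ler_wpM2r ?lerDr// mulr_ge0.
(* The Wronskian is constant along the horizontal ray from [z]. The asymptotics give its limit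
   there, [- imunit - imunit], since the two exponentials cancel. *)
- move=> z Hz; apply/eqP; rewrite -subr_eq0; apply/eqP; apply: cm_small0 => e e0.
  pose W s := h true (z + toC s) * h1 false (z + toC s) - h1 true (z + toC s) * h false (z + toC s).
  have dsh x (S : set R) : gd (@toC R) S (fun s => z + toC s) x (0 + 1).
    by apply: gdD (gd_cst _ _ _ _) (gd_io _ _ _).
  have Wc s : 0 <= s -> W 0 = W s.
    move=> s0; apply: (gd_const s0) => x x0 xs.
    have sub y : `[0, s]%classic y -> hplane (z + toC y).
      by rewrite /= in_itv/= => /andP[y0 _]; exact: hplane_shift.
    have Hx := hplane_shift Hz x0.
    have d sg := gd_comp sub (dsh x _) (ode sg _ Hx).1.
    have d1 sg := gd_comp sub (dsh x _) (ode sg _ Hx).2.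
    by apply: gd_eq (gdB (gdM (d true) (d1 false)) (gdM (d1 true) (d false))); ring.
  rewrite [X in X - _](_ : _ = W 0); last by rewrite /W toC0 addr0.
  (* With [t = K0 / |z + s|] the error is at most [4 t + 2 t^2 <= (4 + 2 K0) t]; [s] is taken so
     large that this does not exceed [e]. *)
  pose A := 4 * K0 + 2 * K0 ^+ 2.
  have A0 : 0 <= A by rewrite addr_ge0 ?mulr_ge0 ?sqr_ge0.
  pose s := 2 * (1 + A / e).
  have s0 : 0 <= s by rewrite mulr_ge0// addr_ge0// divr_ge0// ltW.
  rewrite (Wc s s0) /W; set z' := z + toC s.
  have Hz' : hplane z' by exact: hplane_shift.
  have big' : 1 + A / e <= cm z'.
    apply: (le_trans _ (hplane_shift_cm Hz s0)).
    by rewrite /s; have := cm_ge0 z; lra.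
  have Ae : 0 <= A / e by rewrite divr_ge0// ltW.
  have z'1 : 1 <= cm z' by lra.
  have [p q] := asy true z' Hz' z'1; have [p' q'] := asy false z' Hz' z'1.
  set t := K0 / cm z' in p q p' q'.
  have z'0 : 0 < cm z' by lra.
  have t0 : 0 <= t by rewrite divr_ge0// ltW.
  have tK : t <= K0 by rewrite ler_pdivrMr// ler_peMr.
  set Et := cexp (tau true * z') in p q; set Ef := cexp (tau false * z') in p' q'.
  have EE : Et * Ef = 1 by rewrite /Et /Ef (tauN true) mulNr cexpN mulfV// cexp_neq0.
  have EE' : eabs true z' * eabs false z' = 1 by rewrite -cmM EE cm1.
  have tt : tau true = imunit :> C by rewrite /tau /= mul1r.
  have tf : tau false = - imunit :> C by rewrite /tau /= mulN1r.
  set a1 := h true z' - Et in p; set b1 := h1 true z' - tau true * Et in q.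
  set a2 := h false z' - Ef in p'; set b2 := h1 false z' - tau false * Ef in q'.
  have -> : h true z' * h1 false z' - h1 true z' * h false z' - - (2 * imunit) =
    a1 * b2 - b1 * a2 + (Et * b2 - imunit * (a1 * Ef)) - (b1 * Ef + imunit * (Et * a2)).
    have -> : 2 * imunit = 2 * imunit * (Et * Ef) :> C by rewrite EE mulr1.
    by rewrite /a1 /b1 /a2 /b2 tt tf; ring.
  have cEt : cm Et = eabs true z' by [].
  have cEf : cm Ef = eabs false z' by [].
  have g0 := ltW (eabs_gt0 true z'); have f0 := ltW (eabs_gt0 false z').
  have m1 : cm (a1 * b2) <= t * t.
    rewrite cmM; apply: (le_trans (ler_pM (cm_ge0 _) (cm_ge0 _) p q')).
    by rewrite mulrACA EE' mulr1.
  have m2 : cm (b1 * a2) <= t * t.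
    rewrite cmM; apply: (le_trans (ler_pM (cm_ge0 _) (cm_ge0 _) q p')).
    by rewrite mulrACA EE' mulr1.
  have m3 : cm (Et * b2) <= t.
    rewrite cmM cEt; apply: (le_trans (ler_wpM2l g0 q')).
    by rewrite mulrCA EE' mulr1.
  have m4 : cm (imunit * (a1 * Ef)) <= t.
    rewrite cmM cm_imunit mul1r cmM cEf; apply: (le_trans (ler_wpM2r f0 p)).
    by rewrite -mulrA EE' mulr1.
  have m5 : cm (b1 * Ef) <= t.
    rewrite cmM cEf; apply: (le_trans (ler_wpM2r f0 q)).
    by rewrite -mulrA EE' mulr1.
  have m6 : cm (imunit * (Et * a2)) <= t.
    rewrite cmM cm_imunit mul1r cmM cEt; apply: (le_trans (ler_wpM2l g0 p')).
    by rewrite mulrCA EE' mulr1.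
  have n1 := cmB (a1 * b2) (b1 * a2).
  have n2 := cmB (Et * b2) (imunit * (a1 * Ef)).
  have n3 := cmD (b1 * Ef) (imunit * (Et * a2)).
  have n4 := cmD (a1 * b2 - b1 * a2) (Et * b2 - imunit * (a1 * Ef)).
  have n5 := cmB (a1 * b2 - b1 * a2 + (Et * b2 - imunit * (a1 * Ef))) (b1 * Ef + imunit * (Et * a2)).
  have ttK : t * t <= K0 * t by rewrite ler_wpM2r.
  have fin : (4 + 2 * K0) * t <= e.
    rewrite /t mulrA ler_pdivrMr// -ler_pdivrMl//.
    apply: (@le_trans _ _ (A / e)); last by lra.
    by rewrite mulrC ler_wpM2r ?invr_ge0 ?(ltW e0)// /A; lra.
  lra.
Qed.

End Hankel.

(** * Calculus of second-order expansions *)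

Section SecondOrder.
Context {R : realType}.
Local Notation C := (Cplx R).
Variables (P : set C) (r0 : C).
Hypothesis P1 : forall r, P r -> cm (r - r0) <= 1.

(** A single constant bounds value, first coefficient and quadratic remainder. Sums and products
    then have explicit constants, and weights in [x] can be carried inside [B]. *)
Definition tay (B : R) (f : C -> C) := exists f1 : C,
  [/\ cm (f r0) <= B, cm f1 <= B &
   forall r, P r -> cm (f r - f r0 - (r - r0) * f1) <= cm (r - r0) ^+ 2 * B].

Lemma tay_ge0 B f : tay B f -> 0 <= B.
Proof. by move=> [f1 [h _ _]]; apply: le_trans h; exact: cm_ge0. Qed.

Lemma tay_le B B' f : B <= B' -> tay B f -> tay B' f.
Proof.
move=> BB [f1 [h1 h2 h3]]; exists f1; split; [exact: le_trans h1 BB|exact: le_trans h2 BB|].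
by move=> r Pr; apply: (le_trans (h3 r Pr)); rewrite ler_wpM2l ?sqr_ge0.
Qed.

Lemma tay_ext B f g : (forall r, f r = g r) -> tay B f -> tay B g.
Proof. by move=> fg; have -> : g = f by apply/funext => r; rewrite fg. Qed.

Lemma tay_id : tay (cm r0 + 1) id.
Proof.
exists 1; split=> [||r _] /=; first by rewrite lerDl.
  by rewrite cm1 lerDr cm_ge0.
by rewrite mulr1 subrr cm0 mulr_ge0 ?sqr_ge0// addr_ge0 ?cm_ge0.
Qed.

Lemma tayD B1 B2 f g : tay B1 f -> tay B2 g -> tay (B1 + B2) (fun r => f r + g r).
Proof.
move=> [f1 [a1 a2 a3]] [g1 [b1 b2 b3]]; exists (f1 + g1); split.
- exact: le_trans (cmD _ _) (lerD a1 b1).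
- exact: le_trans (cmD _ _) (lerD a2 b2).
move=> r Pr; rewrite [X in _ <= X]mulrDr; apply: le_trans (lerD (a3 r Pr) (b3 r Pr)).
rewrite (_ : _ - _ - _ = (f r - f r0 - (r - r0) * f1) + (g r - g r0 - (r - r0) * g1)).
  exact: cmD.
by ring.
Qed.

(** The factor is [6 = 1 + 3 + 2], from the three products in the remainder; [cm (r - r0) <= 1]
    turns the expansions into bounds of the values at [r]. *)
Lemma tayM B1 B2 f g : tay B1 f -> tay B2 g -> tay (6 * (B1 * B2)) (fun r => f r * g r).
Proof.
move=> tf tg; have B10 := tay_ge0 tf; have B20 := tay_ge0 tg.
have [f1 [a1 a2 a3]] := tf; have [g1 [b1 b2 b3]] := tg.
have B120 : 0 <= B1 * B2 by exact: mulr_ge0.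
exists (f1 * g r0 + f r0 * g1); split.
- by rewrite cmM; apply: (le_trans (ler_pM (cm_ge0 _) (cm_ge0 _) a1 b1)); lra.
- apply: (le_trans (cmD _ _)); rewrite !cmM.
  have := ler_pM (cm_ge0 _) (cm_ge0 _) a2 b1; have := ler_pM (cm_ge0 _) (cm_ge0 _) a1 b2.
  by lra.
move=> r Pr; set d := r - r0.
have d1 : cm d <= 1 by exact: P1.
have d0 : 0 <= cm d by exact: cm_ge0.
set Rf := f r - f r0 - d * f1; set Rg := g r - g r0 - d * g1.
have rf : cm Rf <= cm d ^+ 2 * B1 by exact: a3.
have rg : cm Rg <= cm d ^+ 2 * B2 by exact: b3.
have dd : cm d ^+ 2 <= 1 by rewrite expr2 mulr_ile1.
have rf' : cm Rf <= B1 by apply: (le_trans rf); rewrite ler_piMl.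
have df : cm (d * f1) <= B1 by rewrite cmM (le_trans (ler_wpM2l d0 a2))// ler_piMl.
have dg : cm (d * g1) <= B2 by rewrite cmM (le_trans (ler_wpM2l d0 b2))// ler_piMl.
have rg' : cm Rg <= B2 by apply: (le_trans rg); rewrite ler_piMl.
have gr : cm (g r) <= 3 * B2.
  rewrite (_ : g r = Rg + (g r0 + d * g1)); last by rewrite /Rg; ring.
  by have := cmD Rg (g r0 + d * g1); have := cmD (g r0) (d * g1); lra.
have fr : cm (f r0 + d * f1) <= 2 * B1.
  by have := cmD (f r0) (d * f1); lra.
rewrite (_ : _ - _ - _ = (d * f1) * (d * g1) + (Rf * g r + (f r0 + d * f1) * Rg)); last first.
  by rewrite /Rf /Rg; ring.
apply: (le_trans (cmD _ _)).
have e0 := cmD (Rf * g r) ((f r0 + d * f1) * Rg).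
have e1 : cm (d * f1 * (d * g1)) <= cm d ^+ 2 * (B1 * B2).
  rewrite (_ : d * f1 * (d * g1) = d ^+ 2 * (f1 * g1)); last by ring.
  rewrite cmM cmX ler_wpM2l ?sqr_ge0// cmM; exact: ler_pM (cm_ge0 _) (cm_ge0 _) a2 b2.
have e2 : cm (Rf * g r) <= cm d ^+ 2 * (3 * (B1 * B2)).
  rewrite cmM; have := ler_pM (cm_ge0 _) (cm_ge0 _) rf gr.
  by rewrite (_ : cm d ^+ 2 * B1 * (3 * B2) = cm d ^+ 2 * (3 * (B1 * B2)))//; ring.
have e3 : cm ((f r0 + d * f1) * Rg) <= cm d ^+ 2 * (2 * (B1 * B2)).
  rewrite cmM; have := ler_pM (cm_ge0 _) (cm_ge0 _) fr rg.
  by rewrite (_ : 2 * B1 * (cm d ^+ 2 * B2) = cm d ^+ 2 * (2 * (B1 * B2)))//; ring.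
by lra.
Qed.

Lemma tayZ B c f : tay B f -> tay (cm c * B) (fun r => c * f r).
Proof.
move=> [f1 [a1 a2 a3]]; exists (c * f1); split.
- by rewrite cmM ler_wpM2l ?cm_ge0.
- by rewrite cmM ler_wpM2l ?cm_ge0.
move=> r Pr; rewrite (_ : _ - _ - _ = c * (f r - f r0 - (r - r0) * f1)); last by ring.
by rewrite cmM [leRHS]mulrCA ler_wpM2l ?cm_ge0// a3.
Qed.

Lemma tayB B1 B2 f g : tay B1 f -> tay B2 g -> tay (B1 + B2) (fun r => f r - g r).
Proof.
move=> tf /(tayZ (-1)); rewrite cmN cm1 mul1r => tg.
by apply: tay_ext (tayD tf tg) => r; rewrite mulN1r.
Qed.

Lemma tay_inv : 1 <= cm r0 -> (forall r, P r -> 1 <= cm r) -> tay 1 (fun r => r^-1).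
Proof.
move=> h0 hP; have n0 : r0 != 0 by rewrite -cm_gt0; lra.
have i0 : (cm r0)^-1 <= 1 by rewrite invf_le1//; lra.
have p0 : 0 <= (cm r0)^-1 by rewrite invr_ge0 cm_ge0.
exists (- (r0^-1 * r0^-1)); split.
- by rewrite cmV.
- by rewrite cmN cmM cmV mulr_ile1.
move=> r Pr; have h1 := hP r Pr; have n1 : r != 0 by rewrite -cm_gt0; lra.
rewrite (_ : _ - _ - _ = (r - r0) ^+ 2 * (r^-1 * (r0^-1 * r0^-1))); last by field; rewrite n0 n1.
rewrite cmM cmX ler_wpM2l ?sqr_ge0// !cmM !cmV.
have i1 : (cm r)^-1 <= 1 by rewrite invf_le1//; lra.
have p1 : 0 <= (cm r)^-1 by rewrite invr_ge0 cm_ge0.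
by rewrite mulr_ile1 ?mulr_ge0// mulr_ile1.
Qed.

End SecondOrder.

(** * Unperturbed solutions as functions of the spectral parameter *)

Section HankelScaled.
Context {R : realType}.
Local Notation C := (Cplx R).
Variables (T : R) (nu1 nu K : R) (h h1 : bool -> C -> C).
Hypothesis T0 : 0 < T.
Hypothesis nu0 : 0 < nu.
Hypothesis nule : nu <= nu1.
Hypothesis K0 : 0 <= K.
Hypothesis H : hankel_spec nu K h h1.

Let a := 2^-1 - nu1.
Let om : C := toC (nu ^+ 2 - 4^-1).

Definition phi_const (r : R) := if 0 <= a then r `^ a else Num.max (T `^ (- a)) (r `^ a).

Lemma phi_const_ge0 r : 0 <= phi_const r.
Proof. by rewrite /phi_const; case: ifP => _; rewrite ?le_max ?powR_ge0. Qed.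

(** Replacing [nu] by the larger [nu1] enlarges a power of a number not exceeding 1, so one weight
    [x^a] serves all components. If [a < 0] and [r x > 1], the bound must still dominate 1; this is
    the purpose of [T^(- a)] in [phi_const]. *)
Lemma phi_le r x : 0 < r -> 0 < x -> x <= T -> phi nu (r * x) <= phi_const r * x `^ a.
Proof.
move=> r0 x0 xT; have rx0 : 0 < r * x by exact: mulr_gt0.
have m0 : 0 < Num.min 1 (r * x) by rewrite lt_min ltr01.
have m1 : Num.min 1 (r * x) <= 1 by rewrite ge_min lexx.
have mr : Num.min 1 (r * x) <= r * x by rewrite ge_min lexx orbT.
apply: (@le_trans _ _ (Num.min 1 (r * x) `^ a)).
  rewrite /phi /powR gt_eqF// ler_expR.
  by apply: ler_wnM2r; [exact: ln_le0|rewrite /a lerD2l lerN2].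
rewrite /phi_const; case: ifPn => [a0|].
  by rewrite -powRM ?(ltW r0) ?(ltW x0)// ge0_ler_powR ?nnegrE// ltW.
rewrite -ltNge => a0.
have [rx1|rx1] := leP (r * x) 1.
  rewrite powRM ?(ltW r0) ?(ltW x0)// ler_wpM2r ?powR_ge0//.
  by rewrite le_max lexx orbT.
rewrite powR1.
apply: (@le_trans _ _ (T `^ (- a) * x `^ a)); last first.
  by rewrite ler_wpM2r ?powR_ge0// le_max lexx.
have xa : 0 < x `^ (- a) by rewrite powR_gt0.
rewrite -(ler_pM2r xa) mul1r -mulrA -powRD; last by rewrite (gt_eqF x0) implybT.
rewrite subrr powRr0 mulr1 ge0_ler_powR ?nnegrE ?(ltW x0) ?(ltW T0)//.
by rewrite oppr_ge0 ltW.
Qed.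

(* derivatives of [h] of order up to three, from the differential equation *)
Definition hankel_dn (k : nat) (s : bool) (z : C) : C :=
  match k with
  | 0 => h s z
  | 1 => h1 s z
  | 2 => (pot om z - 1) * h s z
  | _ => (pot om z - 1) * h1 s z - 2 * om / z ^+ 3 * h s z
  end.

Lemma hankel_dn_gd k s z : (k < 3)%N -> hplane z -> gd id hplane (hankel_dn k s) z (hankel_dn k.+1 s z).
Proof.
move=> k3 Hz; have [ode _ _ _] := H; have [d0 d1] := ode s z Hz.
have zn : z != 0 by have [] := Hz.
case: k k3 => [|[|[|//]]] _ //=.
have di := gd_inv hplane zn.
have dp := gdZ om (gdM di di).
have dq := gdM (gdB dp (gd_cst id hplane 1 z)) d0.
apply: gd_eq (gd_ext _ _ dq).
- by rewrite /pot; field; rewrite zn.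
- by move=> w _; rewrite /pot -invfM -expr2.
- by rewrite /pot -invfM -expr2.
Qed.

(** The product of [z^2] and [pot om z - 1] is [om - z^2], bounded for [cm z <= L]. Hence each
    derivative costs one factor [1 / |z|], as for a power. *)
Lemma hankel_dn_bound (L : R) : 0 <= L -> exists2 K' : R, 0 <= K' & forall k s z, (k <= 3)%N ->
  hplane z -> cm z <= L -> cm z ^+ k * cm (hankel_dn k s z) <= K' * phi nu (cm z) * eabs s z.
Proof.
move=> L0; have [_ _ bd _] := H; set om' := cm om.
have om0 : 0 <= om' by exact: cm_ge0.
pose A := om' + L ^+ 2; pose K1 := K * (1 + L).
have A0 : 0 <= A by rewrite addr_ge0 ?sqr_ge0.
have K10 : 0 <= K1 by rewrite mulr_ge0// addr_ge0.
have KK1 : K <= K1 by rewrite /K1 ler_peMr// lerDl.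
exists (K1 * (1 + A + 2 * om')); first by rewrite mulr_ge0// !addr_ge0// mulr_ge0.
move=> k s z k3 Hz zL; have zn : z != 0 by have [] := Hz.
have z0 : 0 < cm z by rewrite cm_gt0.
have [b0 b1] := bd s z Hz; set e := eabs s z in b0 b1 *; set f := phi nu _ in b0 b1 *.
have e0 : 0 <= e by rewrite ltW// eabs_gt0.
have f0 : 0 <= f by rewrite ltW// phi_gt0.
have fe : 0 <= f * e by exact: mulr_ge0.
have c0 : cm (h s z) <= K1 * (f * e) by apply: (le_trans b0); rewrite -mulrA ler_wpM2r.
have c1 : cm z * cm (h1 s z) <= K1 * (f * e).
  apply: (le_trans b1); rewrite (_ : K * f * _ * e = K * (1 + cm z) * (f * e)); last by ring.
  by rewrite ler_wpM2r// ler_wpM2l// lerD2l.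
have zz : cm z ^+ 2 <= L ^+ 2 by rewrite ler_sqr ?nnegrE// ltW.
have cp : cm z ^+ 2 * cm (pot om z - 1) <= A.
  rewrite -cmX -cmM (_ : z ^+ 2 * (pot om z - 1) = om - z ^+ 2); last by rewrite /pot; field.
  by apply: (le_trans (cmB _ _)); rewrite cmX /A; rewrite -/om'; lra.
have Kfe : 0 <= K1 * (f * e) by exact: mulr_ge0.
have kA : 0 <= A * (K1 * (f * e)) by exact: mulr_ge0.
have ko : 0 <= om' * (K1 * (f * e)) by exact: mulr_ge0.
rewrite (_ : K1 * _ * f * e = (1 + A + 2 * om') * (K1 * (f * e))); last by ring.
case: k k3 => [|[|[|[|//]]]] _ /=.
- by rewrite expr0 mul1r; lra.
- by rewrite expr1; lra.
- rewrite cmM mulrA.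
  by have := ler_pM (mulr_ge0 (sqr_ge0 _) (cm_ge0 _)) (cm_ge0 _) cp c0; lra.
- have t1 := cmB ((pot om z - 1) * h1 s z) (2 * om / z ^+ 3 * h s z).
  have t2 : cm z ^+ 3 * cm ((pot om z - 1) * h1 s z) <= A * (K1 * (f * e)).
    rewrite cmM (_ : cm z ^+ 3 * _ = cm z ^+ 2 * cm (pot om z - 1) * (cm z * cm (h1 s z))); last by ring.
    by apply: ler_pM => //; rewrite ?mulr_ge0 ?sqr_ge0 ?cm_ge0.
  have t3 : cm z ^+ 3 * cm (2 * om / z ^+ 3 * h s z) <= 2 * om' * (K1 * (f * e)).
    rewrite -cmX -cmM (_ : _ * _ = 2 * om * h s z); last by field.
    rewrite cmM cmM cm_nat -/om'; apply: ler_wpM2l => //; exact: mulr_ge0.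
  have := ler_wpM2l (exprn_ge0 3 (ltW z0)) t1; rewrite mulrDr.
  by lra.
Qed.

Lemma hplane_scale (r : C) (x : R) : hplane r -> 0 < x -> hplane (r * toC x).
Proof.
move=> [r0 rn] x0; split; first by rewrite mulrC ReCZ mulr_ge0// ltW.
by rewrite mulf_neq0// toC_eq0 gt_eqF.
Qed.

Lemma cm_scale (r : C) (x : R) : 0 < x -> cm (r * toC x) = cm r * x.
Proof. by move=> x0; rewrite cmM cm_toC_ge0// ltW. Qed.

(** Two derivatives in [r] of the [k]-th derivative of [h] at [r x] bring a factor [x^2], while the
    derivative of order [k + 2] costs [x^-(k+2)]: the remainder has the same singularity [x^-k] as
    the function. With [k <= 1] this takes derivatives up to order three. *)
Lemma hankel_dn_tay (r0 : C) : hplane r0 -> 1 <= cm r0 -> exists2 B : R, 0 <= B &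
  forall (P : set C), (forall r, P r -> hplane r /\ cm (r - r0) <= 1 / 2) ->
  forall k s x, (k <= 1)%N -> 0 < x -> x <= T ->
    tay P r0 (B * x `^ a * x ^- k * eabs s (r0 * toC x)) (fun r => hankel_dn k s (r * toC x)).
Proof.
move=> Hr0 r01.
pose L := (cm r0 + 1) * T.
have L0 : 0 <= L by rewrite mulr_ge0 ?(ltW T0)// addr_ge0 ?cm_ge0.
have [K' K'0 bd] := hankel_dn_bound L0.
pose c1 := cm r0 / 2; pose c2 := cm r0 + 1.
pose B := (2 ^+ 3) * K' * (phi_const c1 + phi_const c2) * expR T * (1 + T).
have Cm r : c1 <= r -> r <= c2 -> phi_const r <= phi_const c1 + phi_const c2.
  move=> h1' h2; have c10 : 0 < c1 by rewrite /c1; lra.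
  have rr : 0 < r by lra.
  rewrite /phi_const; case: ifPn => [a0|].
    rewrite -[leLHS]add0r lerD ?powR_ge0// ge0_ler_powR ?nnegrE ?(ltW rr)//.
    by rewrite /c2 addr_ge0 ?cm_ge0.
  rewrite -ltNge => a0; rewrite -[leLHS]addr0; apply: lerD; last by rewrite le_max powR_ge0.
  rewrite ge_max; apply/andP; split; first by rewrite le_max lexx.
  rewrite le_max; apply/orP; right.
  rewrite /powR !gt_eqF// ler_expR; apply: ler_wnM2l; first exact: ltW.
  by rewrite ler_ln ?posrE.
have C0 : 0 <= phi_const c1 + phi_const c2 by rewrite addr_ge0 ?phi_const_ge0.
(* Uniform for [r] within [1/2] of [r0]: there [|r| >= 1/2] accounts for [2 ^+ 3], the exponentials
   change by at most [expR T], and [Cm] makes [phi_const] uniform. *)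
have main k s x (z : C) r : (k <= 3)%N -> 0 < x -> x <= T -> hplane z -> hplane r ->
    cm (r - r0) <= 1 / 2 -> z = r * toC x ->
    x ^+ k * cm (hankel_dn k s z) <= 2 ^+ 3 * K' * (phi_const c1 + phi_const c2) * expR T * x `^ a * eabs s (r0 * toC x).
  move=> k3 x0 xT Hz Hr rr ez.
  have q1 : c1 <= cm r by have := cm_ge r0 r; rewrite cmBC /c1; lra.
  have q2 : cm r <= c2 by have := cm_ge r r0; rewrite /c2; lra.
  have rp : 0 < cm r by rewrite cm_gt0; have [] := Hr.
  have zL : cm z <= L.
    by rewrite ez cm_scale//; apply: ler_pM => //; exact: ltW.
  have h2 := bd k s z k3 Hz zL.
  have h3 : phi nu (cm z) <= (phi_const c1 + phi_const c2) * x `^ a.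
    rewrite ez cm_scale//; apply: (le_trans (phi_le rp x0 xT)).
    by rewrite ler_wpM2r ?powR_ge0// Cm.
  have h4 : eabs s z <= eabs s (r0 * toC x) * expR T.
    apply: (le_trans (eabs_le s z (r0 * toC x))).
    rewrite ler_wpM2l ?(ltW (eabs_gt0 _ _))// ler_expR ez -mulrBl cm_scale//.
    by apply: (@le_trans _ _ (1 * x)); [rewrite ler_wpM2r ?(ltW x0)//; lra|rewrite mul1r].
  have h5 : x ^+ k <= 2 ^+ 3 * cm z ^+ k.
    have : x ^+ k <= (2 * cm z) ^+ k.
      rewrite lerXn2r ?nnegrE ?(ltW x0) ?mulr_ge0 ?cm_ge0// ez cm_scale//.
      by have : 1 * x <= 2 * cm r * x; [rewrite ler_wpM2r ?(ltW x0)//; rewrite /c1 in q1; lra|lra].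
    rewrite exprMn => h6; apply: (le_trans h6); rewrite ler_wpM2r ?exprn_ge0 ?cm_ge0//.
    by rewrite ler_weXn2l// ler1n.
  have h7 := ler_wpM2r (cm_ge0 (hankel_dn k s z)) h5; apply: (le_trans h7).
  rewrite -[X in X <= _]mulrA.
  have p8 : 0 <= phi nu (cm z) by rewrite ltW// phi_gt0// cm_gt0; have [] := Hz.
  have h8 := ler_pM p8 (ltW (eabs_gt0 s z)) h3 h4.
  have h9 := ler_wpM2l K'0 h8.
  have h10 : cm z ^+ k * cm (hankel_dn k s z) <=
     K' * ((phi_const c1 + phi_const c2) * x `^ a * (eabs s (r0 * toC x) * expR T)).
    by apply: (le_trans h2); rewrite -mulrA.
  have := ler_wpM2l (_ : 0 <= 2 ^+ 3 :> R) h10; rewrite exprn_ge0// => /(_ isT) h11.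
  apply: (le_trans h11).
  by rewrite le_eqVlt; apply/orP; left; apply/eqP; ring.
have B0 : 0 <= B by rewrite !mulr_ge0 ?expR_ge0 ?exprn_ge0// addr_ge0 ?(ltW T0).
exists B => // P hP k s x k1 x0 xT.
set W := 2 ^+ 3 * K' * (phi_const c1 + phi_const c2) * expR T * x `^ a * eabs s (r0 * toC x) in main *.
have W0 : 0 <= W.
  by rewrite !mulr_ge0 ?expR_ge0 ?exprn_ge0 ?powR_ge0 ?(ltW (eabs_gt0 _ _)).
have xk : 0 < x ^+ k by rewrite exprn_gt0.
have BW : B * x `^ a * x ^- k * eabs s (r0 * toC x) = x ^- k * W * (1 + T).
  by rewrite /B /W; ring.
have Hz0 := hplane_scale Hr0 x0.
have r00 : cm (r0 - r0) <= 1 / 2 :> R by rewrite subrr cm0; lra.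
have WT : x ^- k * W <= B * x `^ a * x ^- k * eabs s (r0 * toC x).
  rewrite BW ler_peMr ?lerDl ?(ltW T0)// mulr_ge0// invr_ge0 ltW//.
have b k' (z : C) r : (k' <= 3)%N -> hplane z -> hplane r -> cm (r - r0) <= 1 / 2 ->
    z = r * toC x -> cm (hankel_dn k' s z) <= W / x ^+ k'.
  move=> k3 Hz Hr rr ez; rewrite ler_pdivlMr ?exprn_gt0// mulrC.
  by have := main k' s x z r k3 x0 xT Hz Hr rr ez.
exists (hankel_dn k.+1 s (r0 * toC x) * toC x); split.
- apply: le_trans WT; rewrite [leRHS]mulrC.
  by apply: (b k _ r0) => //; exact: leq_trans k1 _.
- apply: le_trans WT; rewrite cmM cm_toC_ge0 ?(ltW x0)// [leLHS]mulrC -ler_pdivlMl//.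
  rewrite (_ : x^-1 * _ = W / x ^+ k.+1); last by rewrite exprS invfM; ring.
  by apply: (b k.+1 _ r0) => //; exact: leq_ltn_trans k1 _.
- move=> r Pr; have [Hr rr] := hP r Pr.
  have Hz := hplane_scale Hr x0.
  have wz : r * toC x - r0 * toC x = (r - r0) * toC x by ring.
  have seg t : 0 <= t -> t <= 1 -> hplane (r0 + toC t * (r - r0)) /\
      cm (r0 + toC t * (r - r0) - r0) <= 1 / 2.
    move=> t0 t1; split.
      have [] := @hplane_segment R r0 r t Hr0 Hr => //; lra.
    rewrite addrAC subrr add0r cmM cm_toC_ge0//.
    by apply: le_trans rr; rewrite ler_piMl ?cm_ge0.
  have es t : r0 * toC x + toC t * (r * toC x - r0 * toC x) = (r0 + toC t * (r - r0)) * toC x.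
    by ring.
  have := @taylor2 R hplane (hankel_dn k s) (hankel_dn k.+1 s) (hankel_dn k.+2 s) (r0 * toC x) (r * toC x)
     (W / x ^+ k.+2).
  rewrite wz cm_scale// [_ * toC x * hankel_dn _ _ _]mulrAC -mulrA => tl.
  apply: (le_trans (tl _ _ _ _)).
  + move=> t t0 t1; have [h2 _] := seg t t0 t1.
    by have := hplane_scale h2 x0; rewrite -es wz.
  + by move=> u Hu; apply: hankel_dn_gd => //; exact: leq_ltn_trans k1 _.
  + by move=> u Hu; apply: hankel_dn_gd => //; rewrite ltnS; exact: leq_ltn_trans k1 _.
  + move=> t t0 t1; have [h2 h3] := seg t t0 t1.
    have := es t; rewrite wz => ->.
    apply: (b k.+2 _ (r0 + toC t * (r - r0))) => //.
    exact: hplane_scale.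
  + rewrite BW exprMn (_ : W / x ^+ k.+2 * _ = cm (r - r0) ^+ 2 * (x ^- k * W)); last first.
      rewrite !exprS invfM invfM; field; rewrite gt_eqF//.
      by rewrite -?exprS ?exprn_eq0 ?(gt_eqF x0) ?gt_eqF.
    rewrite ler_wpM2l ?sqr_ge0// -BW; exact: WT.
Qed.

End HankelScaled.

(** * The perturbed equation *)

Section KernelWeights.
Context {R : realType}.
Local Notation C := (Cplx R).
Local Notation MR := (measurableTypeR R).
Variables (I : finType) (X : set R) (D : set MR) (Dx : R -> set MR) (v w : I -> R -> R).
Hypothesis mDx : forall x, measurable (Dx x).
Hypothesis DxX : forall x, Dx x `<=` X.

(** Each kernel is bounded in the weight of its own parameter, while a derivative at [rho0] is taken
    in the weight of [rho0]. For nearby parameters the weights are comparable. *)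
Lemma kerbd_weight (c b : R) (K : I -> I -> R -> R -> C) : 0 <= c -> 0 <= b ->
  (forall i x, X x -> v i x <= c * w i x) -> (forall i x, X x -> w i x <= c * v i x) ->
  kerbd X Dx v b K -> kerbd X Dx w (c * b * c) K.
Proof.
move=> c0 b0 vw wv [kv [h1 h2 h3 h4]]; exists (fun i j x t => c * kv i j x t); split=> //.
- move=> i j x t Xx Dt; apply: (le_trans (ler_wpM2l (cm_ge0 _) (wv j t (DxX Dt)))).
  by rewrite mulrCA ler_wpM2l// h2.
- by move=> i j x Xx; apply: rintZ => //; exact: h3.
- move=> i x Xx; under eq_bigr => j _ do
    rewrite (@RintegralZl _ _ _ _ _ _ c (mDx x) (h3 i j x Xx)).
  rewrite -mulr_sumr mulrCA -!mulrA ler_wpM2l//; apply: (le_trans (h4 i x Xx)).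
  by rewrite ler_wpM2l// vw.
Qed.
End KernelWeights.

(** * Solutions by variation of constants *)

Section Construct.
Context {R : realType}.
Local Notation C := (Cplx R).
Local Notation mu := (@lebesgue_measure R).
Local Notation MR := (measurableTypeR R).
Local Notation Re := complex.Re.
Local Notation Im := complex.Im.
Variables (m : nat) (T : R) (nu : 'I_m.+1 -> R) (Q : R -> 'M[C]_m.+1).
Variables (K : R) (h h1 : 'I_m.+1 -> bool -> C -> C).
Hypothesis T0 : 0 < T.
Hypothesis nu0 : forall q, 0 < nu q.
Hypothesis nule : forall q, nu q <= nu ord0.
Hypothesis Qint : forall i j, cintegrable `]0, T[
  (fun x => toC (x `^ (1 - 2 * nu ord0)) * Q x i j).
Hypothesis K0 : 0 <= K.
Hypothesis hH : forall q, hankel_spec (nu q) K (h q) (h1 q).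
Variables (s kap : bool).

Local Notation I := (bool * 'I_m.+1)%type.
Let a := 2^-1 - nu ord0.
Let ga := Num.max 0 a.
(* [kap] tells the upper from the lower quarter plane.  The integral equation
   runs over ]0, x[ if [dir] holds and over [x, T[ otherwise: the side of x on
   which exp (tau s * rho * t) is dominated by its value at x. *)
Definition dir : bool := s (+) kap.
Let D : set MR := `]0, T[%classic.
Let X : set R := [set x | 0 < x /\ x <= T].
Let Dx := side D dir.
Let mD : measurable D. Proof. exact: measurable_itv. Qed.
Let mDx x : measurable (Dx x). Proof. exact: measurable_side. Qed.
Let DxD x : Dx x `<=` D. Proof. exact: side_sub. Qed.
Let DE t : D t = (0 < t < T) :> Prop.
Proof. by rewrite /D /= in_itv. Qed.
Let DX : D `<=` X. Proof. by move=> t; rewrite DE => /andP[t0 /ltW]. Qed.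

Definition quarter (r1 : R) : set C := [set r | [/\ hplane r,
  (if kap then 0 <= Im r else Im r <= 0), 1 <= cm r & r1 <= cm r]].

Definition hankel_sol (b : bool) (q : 'I_m.+1) (sg : bool) (r : C) (x : R) : C :=
  if b then r * h1 q sg (r * toC x) else h q sg (r * toC x).

(** Size of the derivative relative to the function: of order [1 / x] near 0 and [r] away from 0. Up
    to a constant both are covered by [r / x], since [r >= 1] and [x <= T]. *)
Definition dweight (b : bool) (r x : R) : R := if b then r / x else 1.

Definition expw (sg : bool) (r : C) (x : R) : R := eabs sg (r * toC x).

Lemma expw_gt0 sg r x : 0 < expw sg r x. Proof. exact: eabs_gt0. Qed.
Let expw_ge0 sg r x : 0 <= expw sg r x. Proof. exact/ltW/expw_gt0. Qed.
Lemma expwN sg r x : expw (~~ sg) r x = (expw sg r x)^-1. Proof. exact: eabsN. Qed.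

Lemma eabsE sg (z : C) : eabs sg z = expR (if sg then - Im z else Im z).
Proof.
rewrite /eabs cm_cexp; congr expR; case: sg; rewrite /tau /sgd /= ?mulN1r ?mul1r.
  by rewrite ReCM /= mul0r mul1r sub0r.
by rewrite mulNr ReCN ReCM /= mul0r mul1r sub0r opprK.
Qed.

Lemma expw_causal r1 r x t : quarter r1 r -> Dx x t -> expw s r t <= expw s r x.
Proof.
move=> [_ ir _ _] [_]; rewrite /expw !eabsE ![r * toC _]mulrC !ImCZ ler_expR /dir.
case: s ir; case: kap => /= ir; rewrite /= !in_itv/= ?andbT => xt; rewrite ?lerN2; nra.
Qed.

Let CT := Num.max 1 (T `^ (- a)).
Let K2 := K * CT * (1 + T).
Let CT0 : 0 <= CT. Proof. by rewrite le_max ler01. Qed.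
Let T1 : 1 <= 1 + T. Proof. by rewrite lerDl ltW. Qed.
Let K20 : 0 <= K2. Proof. by rewrite !mulr_ge0// addr_ge0// ltW. Qed.

Let phi_const_le r : 1 <= r -> phi_const T (nu ord0) r <= CT * r `^ ga.
Proof.
move=> r1; have r0 : 0 < r by lra.
rewrite /phi_const -/a /ga; case: ifPn => [a0|].
  by rewrite (max_idPr a0) ler_peMl ?powR_ge0// le_max lexx.
rewrite -ltNge => a0; rewrite (max_idPl (ltW a0)) powRr0 mulr1 /CT ge_max.
rewrite le_max lexx orbT /= le_max; apply/orP; left.
rewrite /powR gt_eqF// -[leRHS]expR0 ler_expR; apply: mulr_le0_ge0; first exact: ltW.
exact: ln_ge0.
Qed.

Lemma hankel_sol_bound b q sg r x : hplane r -> 1 <= cm r -> X x ->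
  cm (hankel_sol b q sg r x) <= K2 * cm r `^ ga * (x `^ a * dweight b (cm r) x * expw sg r x).
Proof.
move=> Hr r1 [x0 xT]; have [_ _ bd _] := hH q.
have r0 : 0 < cm r by lra.
have [b0 b1] := bd sg _ (hplane_scale Hr x0); rewrite cm_scale// in b0 b1.
set e := expw sg r x; have e0 : 0 <= e by exact: expw_ge0.
rewrite -/(expw sg r x) -/e in b0 b1.
have ph : phi (nu q) (cm r * x) <= CT * cm r `^ ga * x `^ a.
  apply: (le_trans (phi_le T0 (nule q) r0 x0 xT)).
  by rewrite ler_wpM2r ?powR_ge0// phi_const_le.
set f := phi _ _ in b0 b1 ph; set A := cm r `^ ga in ph *; set B := x `^ a in ph *.
have A0 : 0 <= A by exact: powR_ge0.
have B0 : 0 <= B by exact: powR_ge0.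
have Kf : K * f * e <= K * (CT * A * B) * e by rewrite ler_wpM2r// ler_wpM2l.
have p0 : 0 <= K * (CT * A * B) * e by rewrite !mulr_ge0.
case: b; rewrite /hankel_sol /dweight.
  rewrite cmM -(ler_pM2r x0) (_ : cm r * _ * x = cm r * x * cm (h1 q sg (r * toC x))); last by ring.
  apply: (le_trans b1).
  rewrite (_ : K * f * _ * e = K * f * e * (1 + cm r * x)); last by ring.
  rewrite (_ : K2 * _ * _ * x = K * (CT * A * B) * e * ((1 + T) * cm r)); last first.
    by rewrite /K2; field; rewrite gt_eqF.
  apply: ler_pM => //.
  - by rewrite !mulr_ge0// ltW// phi_gt0// mulr_gt0.
  - by rewrite addr_ge0// mulr_ge0// ltW.
  - by have : cm r * x <= cm r * T; [rewrite ler_wpM2l//; exact: ltW|lra].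
apply: (le_trans b0); apply: (le_trans Kf); rewrite mulr1.
rewrite (_ : K2 * A * (B * e) = K * (CT * A * B) * e * (1 + T)); last by rewrite /K2; ring.
by rewrite ler_peMr.
Qed.

(** Reciprocal of the Wronskian [2 tau r] of the two scaled solutions, with the sign that the side
    of integration requires. *)
Definition green_c (r : C) : C := sgd dir / (2 * tau s) * r^-1.

Lemma cm_sgd b : cm (sgd b : C) = 1. Proof. by case: b; rewrite /sgd ?cmN cm1. Qed.

Lemma cm_green_c r : cm (green_c r) = (2 * cm r)^-1.
Proof. by rewrite /green_c cmM cmM cm_sgd mul1r !cmV cmM cm_tau cm_nat mulr1 invfM. Qed.

(* Variation of constants for the unperturbed equation. *)
Definition green (p : I) (r : C) (x t : R) : C :=
  green_c r * (hankel_sol p.1 p.2 s r x * hankel_sol false p.2 (~~ s) r t - hankel_sol p.1 p.2 (~~ s) r x * hankel_sol false p.2 s r t).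

Definition weight (r : C) (p : I) (x : R) : R := x `^ a * dweight p.1 (cm r) x * expw s r x.

Lemma weight_ge0 r p x : X x -> 0 <= weight r p x.
Proof.
move=> [x0 _]; rewrite /weight !mulr_ge0 ?powR_ge0// /dweight; case: ifP => // _.
by rewrite divr_ge0 ?cm_ge0// ltW.
Qed.

Definition ker_const (r : R) := K2 ^+ 2 * (r `^ ga * r `^ ga / r).

Lemma ker_const_ge0 r : 0 <= r -> 0 <= ker_const r.
Proof. by move=> r0; rewrite mulr_ge0 ?sqr_ge0// divr_ge0// mulr_ge0 ?powR_ge0. Qed.

(** The second product carries the exponentials the wrong way round, [et / ex] in place of
    [ex / et]. On the chosen side [et <= ex], so it is dominated by the bound of the first. *)
Lemma green_bound r1 p r x t : quarter r1 r -> X x -> Dx x t ->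
  cm (green p r x t) <= ker_const (cm r) * (weight r p x * (t `^ a / expw s r t)).
Proof.
move=> Pr Xx Dt; have [Hr ir c1 _] := Pr; have Xt : X t by exact: DX (DxD Dt).
have Et := expw_causal Pr Dt.
have r0 : 0 < cm r by lra.
have f1 := hankel_sol_bound p.1 p.2 s Hr c1 Xx; have f2 := hankel_sol_bound p.1 p.2 (~~ s) Hr c1 Xx.
have g1 := hankel_sol_bound false p.2 s Hr c1 Xt; have g2 := hankel_sol_bound false p.2 (~~ s) Hr c1 Xt.
rewrite expwN in f2; rewrite expwN in g2; rewrite /dweight mulr1 in g1 g2; rewrite -/(dweight p.1 _ x) in f1 f2.
rewrite /green cmM cm_green_c /weight.
set A := cm r `^ ga in f1 f2 g1 g2; set W := x `^ a * dweight p.1 (cm r) x in f1 f2 *.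
set V := t `^ a in g1 g2 *; set ex := expw s r x in f1 f2 Et *; set et := expw s r t in g1 g2 Et *.
have ex0 : 0 < ex by exact: expw_gt0. have et0 : 0 < et by exact: expw_gt0.
have A0 : 0 <= A by exact: powR_ge0. have V0 : 0 <= V by exact: powR_ge0.
have W0 : 0 <= W.
  rewrite mulr_ge0 ?powR_ge0// /dweight; case: ifP => // _; rewrite divr_ge0 ?cm_ge0//.
  by have [x0 _] := Xx; exact: ltW.
have p1 := ler_pM (cm_ge0 _) (cm_ge0 _) f1 g2.
have p2 := ler_pM (cm_ge0 _) (cm_ge0 _) f2 g1.
have q2 : K2 * A * (W / ex) * (K2 * A * (V * et)) <= K2 * A * (W * ex) * (K2 * A * (V / et)).
  rewrite (_ : K2 * A * (W / ex) * _ = (K2 ^+ 2 * A ^+ 2 * W * V) * (et / ex)); last by ring.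
  rewrite (_ : K2 * A * (W * ex) * _ = (K2 ^+ 2 * A ^+ 2 * W * V) * (ex / et)); last by ring.
  have cc : 0 <= K2 ^+ 2 * A ^+ 2 * W * V.
    by apply: mulr_ge0 => //; apply: mulr_ge0 => //; apply: mulr_ge0; exact: sqr_ge0.
  have e1 : et / ex <= 1 by rewrite ler_pdivrMr// mul1r.
  have e2 : 1 <= ex / et by rewrite ler_pdivlMr// mul1r.
  by apply: ler_wpM2l => //; apply: le_trans e1 e2.
have := cmB (hankel_sol p.1 p.2 s r x * hankel_sol false p.2 (~~ s) r t) (hankel_sol p.1 p.2 (~~ s) r x * hankel_sol false p.2 s r t).
rewrite !cmM => hh; set Z := cm (_ - _) in hh *.
have hZ : Z <= 2 * (K2 * A * (W * ex) * (K2 * A * (V / et))).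
  apply: (le_trans hh); apply: (le_trans (lerD p1 (le_trans p2 q2))).
  by rewrite [leRHS]mulr_natl mulr2n.
rewrite ler_pdivrMl ?mulr_gt0//; apply: (le_trans hZ).
rewrite le_eqVlt; apply/orP; left; apply/eqP; rewrite /ker_const -/A; field.
by rewrite !gt_eqF.
Qed.

Definition qsum (t : R) : R := \sum_i \sum_j cm (toC (t `^ (1 - 2 * nu ord0)) * Q t i j).

Let qsum_ge0 t : 0 <= qsum t.
Proof. by apply: sumr_ge0 => i _; apply: sumr_ge0 => j _; exact: cm_ge0. Qed.

Lemma qsum_int : rint D qsum.
Proof. by apply: rint_sum => // i _; apply: rint_sum => // j _; exact: cint_norm. Qed.

(** One factor [t^a] comes from the Green function, the other from the weight of the unknown; their
    product is the power of [t] in the integrability hypothesis on [Q]. *)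
Lemma qsum_le t i j : 0 < t -> t `^ a * t `^ a * cm (Q t i j) <= qsum t.
Proof.
move=> t0; have -> : t `^ a * t `^ a = t `^ (1 - 2 * nu ord0).
  rewrite -powRD; last by rewrite (gt_eqF t0) implybT.
  by congr (_ `^ _); rewrite /a; field.
rewrite -(@cm_toC_ge0 _ (t `^ _)) ?powR_ge0// -cmM.
have q0 i' j' : 0 <= cm (toC (t `^ (1 - 2 * nu ord0)) * Q t i' j') by exact: cm_ge0.
rewrite /qsum (bigD1 i)//= (bigD1 j)//= -addrA lerDl addr_ge0 ?sumr_ge0// => i' _.
by apply: sumr_ge0.
Qed.

Let J := \int[mu]_(t in D) qsum t.
Let J0 : 0 <= J. Proof. by apply: Rintegral_ge0. Qed.

Lemma Q_meas i j : cmeas D (fun t => Q t i j).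
Proof.
have mp (k : R) : cmeas D (fun t => toC (t `^ k)).
  split; last exact: measurable_cst.
  exact: (measurable_funS measurableT (@subsetT _ D) (@measurable_powR R k)).
apply: cmeas_ext (cmeasM (mp (- (1 - 2 * nu ord0))) (cint_cmeas (Qint i j))) => t.
rewrite DE => /andP[t0 _]; rewrite mulrA -toCM -powRD.
  by rewrite addNr powRr0 toC1 mul1r.
by rewrite (gt_eqF t0) implybT.
Qed.

Lemma hankel_sol_gd b q sg r x : hplane r -> X x -> gd (@toC R) X (hankel_sol b q sg r) x
  (if b then (pot (toC (nu q ^+ 2 - 4^-1)) (toC x) - r ^+ 2) * hankel_sol false q sg r x else hankel_sol true q sg r x).
Proof.
move=> Hr [x0 xT]; have [ode _ _ _] := hH q.
have Hz := hplane_scale Hr x0; have [d0 d1] := ode sg _ Hz.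
have sub y : X y -> hplane (r * toC y) by move=> [y0 _]; exact: hplane_scale.
have dr : gd (@toC R) X (fun y => r * toC y) x (r * 1) by apply: gdZ; exact: gd_io.
have rn : r != 0 by have [] := Hr.
have xn : toC x != 0 by rewrite toC_eq0 gt_eqF.
case: b; rewrite /hankel_sol.
  apply: gd_eq (gdZ r (gd_comp sub dr d1)).
  by rewrite /pot; move: (toC x) xn => y yn; field; rewrite rn yn.
by apply: gd_eq (gd_comp sub dr d0); rewrite mulr1 mulrC.
Qed.

Lemma hankel_sol_meas b q sg r : hplane r -> cmeas D (hankel_sol b q sg r).
Proof.
move=> Hr; apply: gc_cmeas => // x Dx'.
by apply: (gc_sub DX); apply: gd_gc (hankel_sol_gd b q sg Hr (DX Dx')).
Qed.

(** The columns of the derivative components vanish because [Q] multiplies the solution, not its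
    derivative. *)
Definition green_ker (r : C) (p p' : I) (x t : R) : C :=
  if p'.1 then 0 else green p r x t * Q t p.2 p'.2.

(* The index (b, q) stands for the q-th component of the solution, or of its
   derivative if b. *)
Definition free_term (j : 'I_m.+1) (r : C) (p : I) (x : R) : C :=
  if p.2 == j then hankel_sol p.1 p.2 s r x else 0.

Let kv (k : R) (p' : I) (t : R) := if p'.1 then 0 else k * qsum t.

Let kv_int k p' x : rint (Dx x) (kv k p').
Proof.
rewrite /kv; case: p'.1; first by apply: integrable0.
by apply: rintZ => //; apply: rintS qsum_int.
Qed.

Let kv_sum k x : 0 <= k ->
  2 * \sum_p' \int[mu]_(t in Dx x) kv k p' t <= 2 * m.+1%:R * k * J.
Proof.
move=> k0; have iq : rint (Dx x) qsum by apply: rintS qsum_int.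
rewrite -!mulrA ler_wpM2l//.
apply: (@le_trans _ _ (\sum_(p' : I) (if p'.1 then 0 else k * J))).
  apply: ler_sum => p' _; rewrite /kv; case: p'.1; first by rewrite /Rintegral integral0.
  rewrite RintegralZl// ler_wpM2l// /J /Rintegral fine_le//.
  - exact: integrable_fin_num.
  - by apply: integrable_fin_num => //; exact: qsum_int.
  apply: ge0_subset_integral => //.
    by apply/measurable_EFinP; have /measurable_int/measurable_EFinP := qsum_int.
  by move=> t _; rewrite lee_fin.
rewrite (sum_bool_pair (fun p' : I => if p'.1 then 0 else k * J)) /=.
rewrite big1// add0r sumr_const card_ord -mulr_natl.
by rewrite le_eqVlt; apply/orP; left; apply/eqP; ring.
Qed.

Let ker_dom (A : C) k r i j x t : 0 <= k -> Dx x t ->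
  cm A <= k * (t `^ a / expw s r t) ->
  cm (A * Q t i j) * weight r (false, j) t <= k * qsum t.
Proof.
move=> k0 Dt hA; have /andP[t0 _] : 0 < t < T by rewrite -DE; exact: DxD Dt.
rewrite cmM /weight /= mulr1.
have h2 := ler_wpM2r (mulr_ge0 (cm_ge0 (Q t i j)) (mulr_ge0 (powR_ge0 t a) (expw_ge0 s r t))) hA.
rewrite -mulrA; apply: (le_trans h2).
have := expw_gt0 s r t; move: (qsum_le i j t0) (expw s r t) => hq e e0.
rewrite [leLHS](_ : _ = k * (t `^ a * t `^ a * cm (Q t i j))).
  by rewrite ler_wpM2l.
by field; rewrite gt_eqF.
Qed.

Lemma green_ker_meas r1 r p p' x : quarter r1 r -> cmeas (Dx x) (green_ker r p p' x).
Proof.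
move=> [Hr _ _ _]; rewrite /green_ker; case: p'.1; first exact: cmeas_cst.
apply: (cmeasS mD (@DxD x)); apply: cmeasM; last exact: Q_meas.
apply: cmeasZ; apply: cmeasB; apply: cmeasZ; exact: hankel_sol_meas.
Qed.

Lemma green_ker_kerbd r1 r : quarter r1 r -> kerbd X Dx (weight r) (2 * m.+1%:R * ker_const (cm r) * J) (green_ker r).
Proof.
move=> Pr; have [_ _ c1 _] := Pr; have k0 : 0 <= ker_const (cm r) by apply: ker_const_ge0; exact: cm_ge0.
have kv0 p x : X x -> 0 <= ker_const (cm r) * weight r p x by move=> Xx; rewrite mulr_ge0// weight_ge0.
exists (fun p p' x => kv (ker_const (cm r) * weight r p x) p'); split.
- by move=> p p' x Xx; exact: green_ker_meas Pr.
- move=> p [b j] x t Xx Dt; rewrite /green_ker /kv /=; case: b; first by rewrite cm0 mul0r.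
  apply: (ker_dom _ _ _ Dt); [exact: kv0|by rewrite -mulrA; exact: green_bound Pr Xx Dt].
- by move=> p p' x Xx; exact: kv_int.
- move=> p x Xx; apply: (le_trans (kv_sum _ (kv0 p x Xx))).
  by rewrite le_eqVlt; apply/orP; left; apply/eqP; move: (weight _ _ _) => w; ring.
Qed.

(** Origin of [beta]: the exponent [2 * ga - 1] is [-1] if [nu ord0 >= 1/2], and [- 2 * nu ord0]
    otherwise. *)
Lemma powga_beta r : 0 < r -> r `^ ga * r `^ ga / r = r `^ (- Num.min 1 (2 * nu ord0)).
Proof.
move=> r0; rewrite -[r^-1]powR_inv1 ?(ltW r0)// -!powRD; try by rewrite (gt_eqF r0) implybT.
congr (_ `^ _); rewrite /ga /a; have [a0|a0] := leP 0 (2^-1 - nu ord0).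
  by rewrite min_r; [field|lra].
by rewrite min_l; [ring|lra].
Qed.

Let psi (f : I -> R -> C) (q : 'I_m.+1) (t : R) := \sum_j Q t q j * f (false, j) t.

Let Fpsi_int r1 r f M q sg : quarter r1 r -> 0 <= M -> bnd X D (weight r) M f ->
  cintegrable D (fun t => hankel_sol false q sg r t * psi f q t).
Proof.
move=> Pr M0 [mf bf]; have [Hr _ c1 _] := Pr.
set B := K2 * cm r `^ ga.
have B0 : 0 <= B by apply: mulr_ge0; [exact: K20|exact: powR_ge0].
set e := expR (2 * (cm r * T)).
apply: (cint_dom mD _ (rintZ (m.+1%:R * (B * (M * e))) mD qsum_int)).
  apply: cmeasM; first exact: hankel_sol_meas.
  by apply: cmeas_sum => j _; apply: cmeasM; [exact: Q_meas|exact: mf].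
move=> t Dt; have Xt := DX Dt; have [t0 tT] := Xt.
have EEe : expw sg r t * expw s r t <= e.
  have hE sg' : expw sg' r t <= expR (cm r * T).
    have := eabs_le sg' (r * toC t) 0; rewrite subr0 /eabs mulr0 cexp0 cm1 mul1r => H.
    by apply: (le_trans H); rewrite ler_expR cm_scale// ler_wpM2l// cm_ge0.
  have := ler_pM (expw_ge0 sg r t) (expw_ge0 s r t) (hE sg) (hE s).
  by rewrite -expRD /e mulr2n mulrDl !mul1r.
rewrite cmM; have fb := hankel_sol_bound false q sg Hr c1 Xt; rewrite /dweight mulr1 -/B in fb.
have pb : cm (psi f q t) <= \sum_(j < m.+1) cm (Q t q j) * (M * (t `^ a * expw s r t)).
  apply: (le_trans (cm_sum _ _ _)); apply: ler_sum => j _; rewrite cmM ler_wpM2l ?cm_ge0//.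
  by have := bf (false, j) t Xt; rewrite /weight /dweight /= mulr1.
apply: (le_trans (ler_pM (cm_ge0 _) (cm_ge0 _) fb pb)).
rewrite mulr_sumr.
apply: (@le_trans _ _ (\sum_(j < m.+1) B * (M * e) * qsum t)); last first.
  by rewrite sumr_const card_ord -[X in X <= _]mulr_natl !mulrA.
apply: ler_sum => j _.
rewrite [leLHS](_ : _ = B * (M * (expw sg r t * expw s r t)) * (t `^ a * t `^ a * cm (Q t q j))); last by ring.
apply: ler_pM; last exact: qsum_le.
- apply: mulr_ge0 => //; apply: mulr_ge0 => //; apply: mulr_ge0; exact: expw_ge0.
- by apply: mulr_ge0; [apply: mulr_ge0; exact: powR_ge0|exact: cm_ge0].
- by rewrite ler_wpM2l// ler_wpM2l.
Qed.

Let al r f q := indef D dir (fun t => hankel_sol false q (~~ s) r t * psi f q t).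
Let be r f q := indef D dir (fun t => hankel_sol false q s r t * psi f q t).

(** The Green function is a sum of two products, which reduces the operator to two indefinite
    integrals per component; [vp_deriv], [indef_ae] and [indef_ac] apply to these. *)
Lemma yiopE r1 r f M p x : quarter r1 r -> 0 <= M -> bnd X D (weight r) M f -> X x ->
  iop Dx (green_ker r) f p x = green_c r * (hankel_sol p.1 p.2 s r x * al r f p.2 x - hankel_sol p.1 p.2 (~~ s) r x * be r f p.2 x).
Proof.
move=> Pr M0 bf Xx.
have i1 := cintS mD (mDx x) (@DxD x) (Fpsi_int p.2 (~~ s) Pr M0 bf).
have i2 := cintS mD (mDx x) (@DxD x) (Fpsi_int p.2 s Pr M0 bf).
have ik p' := iop_int mD mDx DxD DX p p' M0 (green_ker_kerbd Pr) bf Xx.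
rewrite /iop -CI_sum// /al /be /indef -/Dx -!CIZ// -CIB//; [|exact: cintZ|exact: cintZ].
rewrite -CIZ//; last by apply: cintB => //; exact: cintZ.
apply: CI_ext => t _.
rewrite sum_bool_pair /=.
rewrite big1 ?add0r => [|q _]; last by rewrite /green_ker mul0r.
rewrite (_ : green_c r * _ = green p r x t * psi f p.2 t); last by rewrite /green /hankel_sol /=; ring.
by rewrite /psi mulr_sumr; apply: eq_bigr => q _; rewrite /green_ker /= mulrA.
Qed.

Lemma yiop_meas r1 r f M : quarter r1 r -> 0 <= M -> bnd X D (weight r) M f ->
  forall p, cmeas D (iop Dx (green_ker r) f p).
Proof.
move=> Pr M0 bf p; have [Hr _ _ _] := Pr.
apply: (@cmeas_ext _ _ (fun x => green_c r * (hankel_sol p.1 p.2 s r x * al r f p.2 x - hankel_sol p.1 p.2 (~~ s) r x * be r f p.2 x))).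
  by move=> x Dx'; rewrite (yiopE p Pr M0 bf (DX Dx')).
apply: cmeasZ; apply: cmeasB; apply: cmeasM; try exact: hankel_sol_meas.
  exact: (indef_meas mD dir (Fpsi_int p.2 (~~ s) Pr M0 bf)).
exact: (indef_meas mD dir (Fpsi_int p.2 s Pr M0 bf)).
Qed.

Lemma free_term_bnd j r : hplane r -> 1 <= cm r -> bnd X D (weight r) (K2 * cm r `^ ga) (free_term j r).
Proof.
move=> Hr c1; split=> [p|p x Xx]; rewrite /free_term; case: (p.2 == j).
- exact: hankel_sol_meas.
- exact: cmeas_cst.
- exact: hankel_sol_bound.
- rewrite cm0; apply: mulr_ge0; last exact: weight_ge0.
  by apply: mulr_ge0; [exact: K20|exact: powR_ge0].
Qed.


(** This fixes how large [rho] must be for the contraction; the threshold depends neither on [s] nor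
    on [kap]. *)
Lemma small_exists : exists2 r1 : R, 1 <= r1 & forall r : R, r1 <= r ->
  2 * m.+1%:R * ker_const r * J <= 2^-1.
Proof.
set b := Num.min 1 (2 * nu ord0).
have b0 : 0 < b by rewrite lt_min ltr01 mulr_gt0.
pose c : R := 2 * m.+1%:R * K2 ^+ 2 * J.
have c0' : 0 <= c.
  apply: mulr_ge0; last exact: J0.
  by apply: mulr_ge0; [rewrite mulr_ge0|exact: sqr_ge0].
(* The product [c / (1 + 2 c)] stays below one half, also for [c = 0]. *)
have d0 : 0 < (1 + 2 * c)^-1 by rewrite invr_gt0; lra.
have [r1 r11 H] := powRN_small b0 d0.
exists r1 => // r rr; have r0 : 0 < r by lra.
rewrite /ker_const powga_beta// -/b (_ : _ * J = c * r `^ (- b)); last by rewrite /c; ring.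
apply: (le_trans (ler_wpM2l c0' (H r rr))).
by rewrite ler_pdivrMr; lra.
Qed.

Lemma sol_exists r1 : (forall r : R, r1 <= r -> 2 * m.+1%:R * ker_const r * J <= 2^-1) ->
  exists y : C -> 'I_m.+1 -> I -> R -> C, forall r j, quarter r1 r ->
    bnd X D (weight r) (2 * (K2 * cm r `^ ga)) (y r j) /\
    forall p x, X x -> y r j p x = free_term j r p x + iop Dx (green_ker r) (y r j) p x.
Proof.
move=> small.
have H (rj : C * 'I_m.+1) : exists y : I -> R -> C, quarter r1 rj.1 ->
    bnd X D (weight rj.1) (2 * (K2 * cm rj.1 `^ ga)) y /\
    forall p x, X x -> y p x = free_term rj.2 rj.1 p x + iop Dx (green_ker rj.1) y p x.
  case: rj => r j /=; have [Pr|nP] := pselect (quarter r1 r); last by exists (fun _ _ => 0).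
  have [Hr _ c1 rr] := Pr.
  have M0 : 0 <= K2 * cm r `^ ga by apply: mulr_ge0; [exact: K20|exact: powR_ge0].
  have vr p x : X x -> 0 <= weight r p x by exact: weight_ge0.
  have [|f bf ff] := fixpoint_exists mD mDx DxD DX vr
    (kerbd_le vr (small _ rr) (green_ker_kerbd Pr)) M0 (free_term_bnd j Hr c1); last by exists f.
  move=> f M bf; apply: (@yiop_meas r1 r f (Num.max M 0)) => //; first by rewrite le_max lexx orbT.
  by apply: (bnd_le vr) bf; rewrite le_max lexx.
have [y hy] := choice H.
by exists (fun r j => y (r, j)) => r j Pr; exact: (hy (r, j) Pr).
Qed.

Lemma hankel_sol_tay r0 : hplane r0 -> 1 <= cm r0 -> exists2 B : R, 0 <= B &
  forall (P : set C), (forall r, P r -> hplane r /\ cm (r - r0) <= 1 / 2) ->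
  forall b q sg x, X x ->
    tay P r0 (B * (x `^ a * dweight b (cm r0) x * expw sg r0 x)) (fun r => hankel_sol b q sg r x).
Proof.
move=> Hr0 c1.
have /choice[B hB] : forall q, exists B : R, 0 <= B /\
    forall (P : set C), (forall r, P r -> hplane r /\ cm (r - r0) <= 1 / 2) ->
    forall k sg x, (k <= 1)%N -> 0 < x -> x <= T ->
    tay P r0 (B * x `^ a / x ^+ k * expw sg r0 x) (fun r => hankel_dn (nu q) (h q) (h1 q) k sg (r * toC x)).
  by move=> q; have [B B0 hB] := hankel_dn_tay T0 (nule q) K0 (hH q) Hr0 c1; exists B.
have B0 q : 0 <= B q by have [] := hB q.
(* The derivative component has an extra factor [r], expanded by [tay_id];
   [6 * (cm r0 + 1) <= 12 * cm r0] as [cm r0 >= 1]. *)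
pose BB := 12 * \sum_q B q.
have Bq q : 12 * B q <= BB.
  by rewrite ler_wpM2l// (bigD1 q)//= lerDl sumr_ge0.
have BB0 : 0 <= BB by rewrite mulr_ge0// sumr_ge0.
exists BB => // P hP b q sg x [x0 xT]; have [_ H] := hB q.
have xa : 0 <= x `^ a by exact: powR_ge0.
have e0 : 0 <= expw sg r0 x by exact: expw_ge0.
case: b; rewrite /hankel_sol /dweight.
  have P1 r : P r -> cm (r - r0) <= 1 by move=> /hP[_ ?]; lra.
  apply: tay_le (tayM P1 (tay_id P r0) (H P hP 1%N sg x isT x0 xT)).
  have p0 : 0 <= x `^ a / x * expw sg r0 x by rewrite !mulr_ge0// invr_ge0 ltW.
  rewrite expr1 (_ : 6 * _ = 6 * (cm r0 + 1) * B q * (x `^ a / x * expw sg r0 x)); last by ring.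
  rewrite (_ : BB * _ = cm r0 * BB * (x `^ a / x * expw sg r0 x)); last by ring.
  rewrite ler_wpM2r//; have := ler_wpM2l (cm_ge0 r0) (Bq q).
  have := ler_wpM2r (B0 q) c1; lra.
apply: tay_le (H P hP 0%N sg x isT x0 xT).
rewrite expr0 divr1 mulr1 -mulrA ler_wpM2r ?mulr_ge0//.
by have := Bq q; have := B0 q; lra.
Qed.

Lemma green_tay r1 r0 : quarter r1 r0 -> exists2 B : R, 0 <= B &
  forall (P : set C), (forall r, P r -> quarter r1 r /\ cm (r - r0) <= 1 / 2) ->
  forall p x t, X x -> Dx x t ->
    tay P r0 (B * (weight r0 p x * (t `^ a / expw s r0 t))) (fun r => green p r x t).
Proof.
move=> P0; have [Hr0 _ c1 _] := P0; have [B B0 hB] := hankel_sol_tay Hr0 c1.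
(* Here [36 = 6 * (1/2) * (6 + 6)]: the product with [r^-1], a constant of modulus [1/2], and two
   products of unperturbed solutions. *)
exists (36 * B ^+ 2) => [|P hP p x t Xx Dt]; first by rewrite mulr_ge0// sqr_ge0.
have Xt : X t by exact: DX (DxD Dt).
have Et := expw_causal P0 Dt.
have hP' r : P r -> hplane r /\ cm (r - r0) <= 1 / 2 by move=> /hP[[]].
have P1 r : P r -> cm (r - r0) <= 1 by move=> /hP[_ ?]; lra.
have Pc r : P r -> 1 <= cm r by move=> /hP[[]].
have f1 := hB P hP' p.1 p.2 s x Xx; have f2 := hB P hP' p.1 p.2 (~~ s) x Xx.
have g1 := hB P hP' false p.2 s t Xt; have g2 := hB P hP' false p.2 (~~ s) t Xt.
rewrite expwN in f2; rewrite expwN in g2; rewrite /dweight mulr1 in g1 g2; rewrite -/(dweight p.1 _ x) in f1 f2.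
have ti := tayZ (sgd dir / (2 * tau s)) (tay_inv c1 Pc).
apply: tay_le (tayM P1 ti (tayB (tayM P1 f1 g2) (tayM P1 f2 g1))).
rewrite cmM cm_sgd mul1r cmV cmM cm_tau cm_nat !mulr1 /weight.
have W0 : 0 <= x `^ a * dweight p.1 (cm r0) x.
  rewrite mulr_ge0 ?powR_ge0// /dweight; case: ifP => // _; rewrite divr_ge0 ?cm_ge0//.
  by have [x0 _] := Xx; exact: ltW.
have V0 : 0 <= t `^ a by exact: powR_ge0.
have := expw_gt0 s r0 x; have := expw_gt0 s r0 t.
move: W0 V0 Et; move: (x `^ a * _) (t `^ a) (expw s r0 x) (expw s r0 t) => W V ex et W0 V0 Et et0 ex0.
have q : W / ex * (V * et) <= W * ex * (V / et).
  rewrite (_ : W / ex * _ = (W * V) * (et / ex)); last by ring.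
  rewrite (_ : W * ex * _ = (W * V) * (ex / et)); last by ring.
  have e1 : et / ex <= 1 by rewrite ler_pdivrMr// mul1r.
  have e2 : 1 <= ex / et by rewrite ler_pdivlMr// mul1r.
  by rewrite ler_wpM2l ?mulr_ge0// (le_trans e1).
rewrite (_ : 6 * _ = 18 * B ^+ 2 * (W * ex * (V / et)) + 18 * B ^+ 2 * (W / ex * (V * et))); last first.
  by field; rewrite !gt_eqF.
have B2 : 0 <= 18 * B ^+ 2 by rewrite mulr_ge0// sqr_ge0.
have := ler_wpM2l B2 q; lra.
Qed.

Lemma weight_ratio r r0 : hplane r0 -> 1 <= cm r0 -> 1 <= cm r -> cm (r - r0) <= 1 / 2 ->
  forall p x, X x -> weight r p x <= 2 * expR T * weight r0 p x.
Proof.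
move=> Hr0 c1 c2 rr p x [x0 xT]; rewrite /weight.
have hw : dweight p.1 (cm r) x <= 2 * dweight p.1 (cm r0) x.
  rewrite /dweight; case: p.1; last by lra.
  rewrite mulrA ler_pM2r ?invr_gt0//; have := cm_ge r r0; lra.
have hE : expw s r x <= expR T * expw s r0 x.
  have := eabs_le s (r * toC x) (r0 * toC x); rewrite -mulrBl cm_scale// => hh.
  apply: (le_trans hh); rewrite mulrC ler_wpM2r ?expw_ge0// ler_expR.
  have := ler_pM (cm_ge0 (r - r0)) (ltW x0) rr xT; lra.
have w0 b q : 0 <= dweight b (cm q) x by rewrite /dweight; case: b => //; rewrite divr_ge0 ?cm_ge0// ltW.
have h0 := ler_pM (w0 _ _) (expw_ge0 s r x) hw hE.
have := ler_wpM2l (powR_ge0 x a) h0.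
rewrite mulrA => hh; apply: (le_trans hh).
rewrite le_eqVlt; apply/orP; left; apply/eqP.
by move: (expR T) (expw _ _ _) (dweight _ _ _) (_ `^ _) => A1 A2 A3 A4; ring.
Qed.


Definition solves (r1 : R) (y : C -> 'I_m.+1 -> I -> R -> C) := forall r j, quarter r1 r ->
  bnd X D (weight r) (2 * (K2 * cm r `^ ga)) (y r j) /\
  forall p x, X x -> y r j p x = free_term j r p x + iop Dx (green_ker r) (y r j) p x.

(** An application of [fixpoint_deriv] to the points of [quarter] within [1/2] of [r0], everything
    being measured in the weight of [r0]. As [quarter] contains its boundary, [r0] may lie there. *)
Lemma sol_deriv r1 y : (forall r : R, r1 <= r -> 2 * m.+1%:R * ker_const r * J <= 2^-1) ->
  solves r1 y -> forall r0 j p x, quarter r1 r0 -> X x ->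
  exists L, gd id (quarter r1) (fun r => y r j p x) r0 L.
Proof.
move=> small hy r0 j p x P0 Xx; have [Hr0 _ c1 rr0] := P0.
have [BF BF0 hF] := hankel_sol_tay Hr0 c1; have [BG BG0 hG] := green_tay P0.
pose P' r := quarter r1 r /\ cm (r - r0) <= 1 / 2.
have hP' r : P' r -> hplane r /\ cm (r - r0) <= 1 / 2 by move=> [[]].
have vr q z : X z -> 0 <= weight r0 q z by exact: weight_ge0.
pose B := BF + 2 * m.+1%:R * BG * J.
have BGJ : 0 <= 2 * m.+1%:R * BG * J.
  by apply: mulr_ge0; [rewrite !mulr_ge0|exact: J0].
have ga0 : 0 <= ga by rewrite le_max lexx.
pose M := 2 * (K2 * (2 * cm r0) `^ ga).
have M0 : 0 <= M.
  by apply: mulr_ge0 => //; apply: mulr_ge0; [exact: K20|exact: powR_ge0].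
have e0 : 0 <= 2 * expR T by rewrite mulr_ge0// expR_ge0.
have ratio r : P' r -> forall q z, X z -> weight r q z <= 2 * expR T * weight r0 q z.
  by move=> [[_ _ c2 _] rr] q z; exact: weight_ratio.
have ratio' r : P' r -> forall q z, X z -> weight r0 q z <= 2 * expR T * weight r q z.
  by move=> [[Hr _ c2 _] rr] q z; apply: weight_ratio => //; rewrite cmBC.
have bf r : P' r -> bnd X D (weight r0) (M * (2 * expR T)) (y r j).
  move=> Pr'; have [Pr rr] := Pr'; have [_ _ c2 _] := Pr; have [[b1 b2] _] := hy r j Pr.
  split=> // q t Xt; apply: (le_trans (b2 q t Xt)); rewrite -[leRHS]mulrA; apply: ler_pM.
  - by apply: mulr_ge0 => //; apply: mulr_ge0; [exact: K20|exact: powR_ge0].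
  - exact: weight_ge0.
  - rewrite /M ler_wpM2l//; apply: ler_wpM2l; first exact: K20.
    apply: ge0_ler_powR => //; rewrite ?nnegrE ?mulr_ge0 ?cm_ge0//.
    by have := cm_ge r r0; lra.
  - exact: ratio.
suff [L hL] : exists L, gd id P' (fun r => y r j p x) r0 L.
  exists L; apply: (@gd_loc _ _ id P' (quarter r1) _ _ _ (1 / 2)) hL => // z Pz zr.
  by split=> //; exact: ltW.
apply: (@fixpoint_deriv _ _ X D Dx (weight r0) mD mDx DxD DX vr P' r0
   (M * (2 * expR T)) B green_ker (free_term j) (fun r => y r j)) => //.
- by apply: mulr_ge0.
- by apply: addr_ge0.
- by split=> //; rewrite subrr cm0.
- by move=> r [_ ?]; lra.
- exact: kerbd_le (small _ rr0) (green_ker_kerbd P0).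
- move=> r Pr'; have [Pr _] := Pr'.
  have k0 : 0 <= 2 * m.+1%:R * ker_const (cm r) * J.
    by apply: mulr_ge0; [rewrite mulr_ge0// ker_const_ge0// cm_ge0|exact: J0].
  have DxX z : Dx z `<=` X by move=> t /(@DxD z) /DX.
  by exists (2 * expR T * (2 * m.+1%:R * ker_const (cm r) * J) * (2 * expR T));
    apply: (kerbd_weight mDx DxX e0 k0 (ratio r Pr') (ratio' r Pr')); exact: green_ker_kerbd Pr.
(* First-order coefficients of the kernel exist for each choice of arguments separately; they are
   assembled into a function by choice. *)
- have H (w : (I * I) * (R * R)) : exists k1, X w.2.1 -> Dx w.2.1 w.2.2 ->
      cm k1 * weight r0 w.1.2 w.2.2 <= kv (BG * weight r0 w.1.1 w.2.1) w.1.2 w.2.2 /\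
      forall r, P' r -> cm (green_ker r w.1.1 w.1.2 w.2.1 w.2.2 - green_ker r0 w.1.1 w.1.2 w.2.1 w.2.2 -
        (r - r0) * k1) * weight r0 w.1.2 w.2.2 <= cm (r - r0) ^+ 2 * kv (BG * weight r0 w.1.1 w.2.1) w.1.2 w.2.2.
    case: w => [[q [b i]] [z t]] /=; rewrite /kv /green_ker /=; case: b.
      exists 0 => _ _; split; first by rewrite cm0 mul0r.
      by move=> r _; rewrite mulr0 !subr0 cm0 mul0r mulr0.
    have [Xz|nX] := pselect (X z); last by exists 0.
    have [Dt|nD] := pselect (Dx z t); last by exists 0.
    have [k1 [_ t1 t2]] := hG P' (fun r h => h) q z t Xz Dt.
    have Bv : 0 <= BG * weight r0 q z by rewrite mulr_ge0 ?weight_ge0.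
    exists (k1 * Q t q.2 i) => _ _; split.
      by apply: (ker_dom _ _ Bv Dt); rewrite -mulrA; exact: t1.
    move=> r Pr; rewrite (_ : _ - _ - _ = (green q r z t - green q r0 z t - (r - r0) * k1) * Q t q.2 i); last by ring.
    rewrite [leRHS]mulrA; apply: (ker_dom _ _ _ Dt); first by rewrite mulr_ge0// sqr_ge0.
    by rewrite -!mulrA [BG * _]mulrA; apply: (le_trans (t2 r Pr)); rewrite !mulrA.
  have [k1 hk1] := choice H.
  exists (fun q q' z t => k1 ((q, q'), (z, t))), (fun q q' z => kv (BG * weight r0 q z) q'); split.
  + by move=> q q' z t Xz Dt; have [] := hk1 ((q, q'), (z, t)) Xz Dt.
  + by move=> r q q' z t Pr Xz Dt; have [_ hh] := hk1 ((q, q'), (z, t)) Xz Dt; exact: hh.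
  + by move=> q q' z Xz; exact: kv_int.
  + move=> q z Xz; have v0' := weight_ge0 r0 q Xz.
    apply: (le_trans (kv_sum _ (mulr_ge0 BG0 v0'))).
    apply: (@le_trans _ _ (2 * m.+1%:R * BG * J * weight r0 q z)).
      by rewrite le_eqVlt; apply/orP; left; apply/eqP; move: (weight _ _ _) => w; ring.
    by rewrite ler_wpM2r// lerDr.
- have H (w : I * R) : exists g1, X w.2 -> cm g1 <= B * weight r0 w.1 w.2 /\
      forall r, P' r -> cm (free_term j r w.1 w.2 - free_term j r0 w.1 w.2 - (r - r0) * g1) <=
        cm (r - r0) ^+ 2 * (B * weight r0 w.1 w.2).
    case: w => [q z] /=; have [Xz|nX] := pselect (X z); last by exists 0.
    have BB : BF * weight r0 q z <= B * weight r0 q z by rewrite ler_wpM2r ?weight_ge0// lerDl.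
    have Bv : 0 <= B * weight r0 q z by apply: le_trans BB; rewrite mulr_ge0 ?weight_ge0.
    rewrite /free_term; case: (q.2 == j); last first.
      exists 0 => _; split; first by rewrite cm0.
      by move=> r _; rewrite mulr0 !subr0 cm0 mulr_ge0// sqr_ge0.
    have [g1 [_ t1 t2]] := hF P' hP' q.1 q.2 s z Xz.
    exists g1 => _; split; first exact: le_trans t1 BB.
    by move=> r Pr; apply: (le_trans (t2 r Pr)); rewrite ler_wpM2l// sqr_ge0.
  have [g1 hg1] := choice H.
  exists (fun q z => g1 (q, z)) => [q z Xz|r q z Pr Xz]; first by have [] := hg1 (q, z) Xz.
  by have [_ hh] := hg1 (q, z) Xz; exact: hh.
- by move=> r q z [Pr _] Xz; have [_ hh] := hy r j Pr; exact: hh.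
Qed.


Lemma hankel_wronskian (q : 'I_m.+1) (z : C) : hplane z ->
  h1 q s z * h q (~~ s) z - h1 q (~~ s) z * h q s z = 2 * tau s.
Proof.
move=> Hz; have [_ _ _ W] := hH q; have {}W := W z Hz; rewrite /tau /sgd.
by case: s => /=; [rewrite mul1r -[RHS]opprK -W|rewrite mulN1r mulrN -W]; ring.
Qed.

Let tau2 : 2 * tau s != 0 :> C.
Proof. by rewrite mulf_neq0 ?tau_neq0// pnatr_eq0. Qed.

Lemma sgd_sqr d : sgd d * sgd d = 1 :> C.
Proof. by case: d; rewrite /sgd ?mulrNN mulr1. Qed.

Lemma sol_form r1 y : solves r1 y -> forall r j p x, quarter r1 r -> X x ->
  y r j p x = free_term j r p x +
    green_c r * (hankel_sol p.1 p.2 s r x * al r (y r j) p.2 x - hankel_sol p.1 p.2 (~~ s) r x * be r (y r j) p.2 x).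
Proof.
move=> hy r j p x Pr Xx; have [bf ->//] := hy r j Pr.
have M0 : 0 <= 2 * (K2 * cm r `^ ga).
  by apply: mulr_ge0 => //; apply: mulr_ge0; [exact: K20|exact: powR_ge0].
by rewrite (yiopE p Pr M0 bf Xx).
Qed.

Lemma sol_int r1 y : solves r1 y -> forall r j q sg, quarter r1 r ->
  cintegrable D (fun t => hankel_sol false q sg r t * psi (y r j) q t).
Proof.
move=> hy r j q sg Pr; have [bf _] := hy r j Pr.
apply: (Fpsi_int q sg Pr _ bf).
by apply: mulr_ge0 => //; apply: mulr_ge0; [exact: K20|exact: powR_ge0].
Qed.

(** The component [true] is what variation of constants predicts for the derivative; [vp_deriv]
    confirms it at every point, the endpoint [T] included. *)
Lemma sol_dx0 r1 y : solves r1 y -> forall r j q x, quarter r1 r -> X x ->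
  gd (@toC R) X (y r j (false, q)) x (y r j (true, q) x).
Proof.
move=> hy r j q x Pr Xx; have [Hr _ _ _] := Pr.
have F sg := hankel_sol_gd false q sg Hr Xx.
apply: (@gd_ext _ _ (@toC R) X (fun x => free_term j r (false, q) x +
    green_c r * (hankel_sol false q s r x * al r (y r j) q x - hankel_sol false q (~~ s) r x * be r (y r j) q x))).
- by move=> z Xz; rewrite [RHS](sol_form hy j (false, q) Pr Xz).
- by rewrite [RHS](sol_form hy j (false, q) Pr Xx).
apply: gd_eq (esym (sol_form hy j (true, q) Pr Xx)) _.
apply: gdD.
  by rewrite /free_term /=; case: (q == j); [exact: F|exact: gd_cst].
apply: gdZ; apply: (vp_deriv mD dir DX Xx (F s) (F (~~ s))).
(* The two unperturbed solutions have no common zero, their Wronskian being [2 * tau s]. *)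
- have Hz := hplane_scale Hr Xx.1; rewrite /hankel_sol; have W := hankel_wronskian q Hz.
  have := cm_ge0 (h q s (r * toC x)); have := cm_ge0 (h q (~~ s) (r * toC x)).
  move=> h2; rewrite le_eqVlt => /orP[/eqP e1|?]; last exact: ltr_pwDl.
  move: h2; rewrite le_eqVlt => /orP[/eqP e2|?]; last by rewrite -e1 add0r.
  move: W; have /eqP := esym e1; have /eqP := esym e2; rewrite !cm_eq0 => /eqP -> /eqP ->.
  by rewrite !mulr0 subrr => /esym/eqP; rewrite (negbTE tau2).
- exact: sol_int hy _ _ _ _ Pr.
- exact: sol_int hy _ _ _ _ Pr.
Qed.

(** The indefinite integrals are differentiable almost everywhere only. There the derivatives of the
    unperturbed factors reproduce the singular potential, and those of the integrals combine to
    [psi]. *)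
Lemma sol_dx1_ae r1 y : solves r1 y -> forall r j, quarter r1 r ->
  {ae mu, forall x, D x -> forall q, gd (@toC R) X (y r j (true, q)) x
    ((pot (toC (nu q ^+ 2 - 4^-1)) (toC x) - r ^+ 2) * y r j (false, q) x + psi (y r j) q x)}.
Proof.
move=> hy r j Pr; have [Hr _ c1 _] := Pr.
have rn : r != 0 by have [] := Hr.
have ae q sg := indef_ae mD dir (sol_int hy j q sg Pr).
have {}ae : {ae mu, forall x, forall qs : 'I_m.+1 * bool, D x ->
    gd (@toC R) setT (indef D dir (fun t => hankel_sol false qs.1 qs.2 r t * psi (y r j) qs.1 t)) x
      (sgd dir * (hankel_sol false qs.1 qs.2 r x * psi (y r j) qs.1 x))}.
  have H (qs : 'I_m.+1 * bool) := ae qs.1 qs.2.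
  by apply: filter_forall => qs; exact: H.
apply: filterS ae => x H Dx' q; have Xx := DX Dx'.
have F sg := hankel_sol_gd true q sg Hr Xx.
have A := gd_sub (@subsetT _ X) (H (q, ~~ s) Dx'); have B := gd_sub (@subsetT _ X) (H (q, s) Dx').
rewrite /= in A B.
apply: (@gd_ext _ _ (@toC R) X (fun x => free_term j r (true, q) x +
    green_c r * (hankel_sol true q s r x * al r (y r j) q x - hankel_sol true q (~~ s) r x * be r (y r j) q x))).
- by move=> z Xz; rewrite [RHS](sol_form hy j (true, q) Pr Xz).
- by rewrite [RHS](sol_form hy j (true, q) Pr Xx).
have Y : gd (@toC R) X (free_term j r (true, q)) x
    ((pot (toC (nu q ^+ 2 - 4^-1)) (toC x) - r ^+ 2) * free_term j r (false, q) x).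
  by rewrite /free_term /=; case: (q == j); [exact: F|rewrite mulr0; exact: gd_cst].
apply: gd_eq (gdD Y (gdZ (green_c r) (gdB (gdM (F s) A) (gdM (F (~~ s)) B)))).
rewrite (sol_form hy j (false, q) Pr Xx) /=.
have W := hankel_wronskian q (hplane_scale Hr Xx.1).
(* The jump condition of the Green function: [psi] enters the second derivative with coefficient
   1. *)
have E : green_c r * (hankel_sol true q s r x * (sgd dir * hankel_sol false q (~~ s) r x) -
    hankel_sol true q (~~ s) r x * (sgd dir * hankel_sol false q s r x)) = 1.
  rewrite /hankel_sol (_ : _ - _ = sgd dir * r * (2 * tau s)); last by rewrite -W; ring.
  rewrite /green_c (_ : _ * _ = (sgd dir * sgd dir) * ((2 * tau s) / (2 * tau s)) * (r^-1 * r)); last by ring.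
  by rewrite sgd_sqr mulVf// divff// !mulr1.
rewrite /al /be -[X in _ = _ + X]mul1r -E /hankel_sol /=.
move: (pot _ _ - _) (psi _ _ _) (free_term _ _ _ _) (indef _ _ _ x) (indef _ _ _ x).
by move: (h q s (r * _)) (h q (~~ s) (r * _)) (h1 q s (r * _)) (h1 q (~~ s) (r * _))
  (green_c r) (sgd dir) => *; ring.
Qed.


Lemma pot_gc (om : C) x : X x -> gc (@toC R) X (fun t => pot om (toC t)) x.
Proof.
move=> [x0 _]; have xn : toC x != 0 by rewrite toC_eq0 gt_eqF.
have di : gd (@toC R) X (fun t => (toC t)^-1) x (- (toC x)^-2 * 1).
  by apply: (gd_comp (P := setT)) => //; [exact: gd_io|exact: gd_inv].
have := gd_gc (gdZ om (gdM di di)); apply: gc_ext => // [t _|]; rewrite /pot expr2 invfM//.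
Qed.

Lemma hankel_sol_ac b q sg r a' b' : hplane r -> 0 < a' -> b' <= T -> abs_continuous a' b' (hankel_sol b q sg r).
Proof.
move=> Hr a'0 b'T.
have sub : `[a', b'] `<=` X.
  by move=> t /=; rewrite in_itv/= => /andP[at_ tb]; split; [exact: lt_le_trans at_|exact: le_trans b'T].
have Xx x : a' <= x -> x <= b' -> X x by move=> ax xb; apply: sub; rewrite /= in_itv/= ax.
apply: (@ac_gd _ _ _ _ (fun x => if b then
   (pot (toC (nu q ^+ 2 - 4^-1)) (toC x) - r ^+ 2) * hankel_sol false q sg r x else hankel_sol true q sg r x)).
  by move=> x ax xb; apply: gd_sub sub _; exact: hankel_sol_gd Hr (Xx x ax xb).
move=> x ax xb; apply: gc_sub sub _; have Xx' := Xx x ax xb; case: b.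
  apply: gcM; last exact: gd_gc (hankel_sol_gd false q sg Hr Xx').
  by apply: gcB; [exact: pot_gc|exact: gc_cst].
exact: gd_gc (hankel_sol_gd true q sg Hr Xx').
Qed.

Lemma sol_ac r1 y : solves r1 y -> forall r j q a' b', quarter r1 r -> 0 < a' -> b' < T ->
  abs_continuous a' b' (y r j (true, q)).
Proof.
move=> hy r j q a' b' Pr a'0 b'T; have [Hr _ _ _] := Pr.
have Dab x : a' <= x -> x <= b' -> D x.
  by move=> ax xb; rewrite DE (lt_le_trans a'0 ax) (le_lt_trans xb b'T).
have F sg := hankel_sol_ac true q sg Hr a'0 (ltW b'T).
have A sg := indef_ac mD dir (sol_int hy j q sg Pr) Dab.
apply: (@ac_eq _ _ _ (fun x => free_term j r (true, q) x +
    green_c r * (hankel_sol true q s r x * al r (y r j) q x - hankel_sol true q (~~ s) r x * be r (y r j) q x))).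
  by move=> x ax xb; rewrite [RHS](sol_form hy j (true, q) Pr (DX (Dab x ax xb))).
apply: acD.
  by rewrite /free_term /=; case: (q == j); [exact: F|exact: ac_cst].
by apply: acZ; apply: acB; apply: acM; (try exact: F); exact: A.
Qed.

Let beta := Num.min 1 (2 * nu ord0).

(** For [|r| x >= 1] the factor of the Green function at [x] has its asymptotic size, without [phi].
    What remains is [r^ga] from the factor at [t], [r^ga] from the bound of the solution and
    [1 / r], together [r^(- beta)]. The free term deviates from the exponential by [K / (|r| x)],
    whence [K / x0] in the constant. *)
Lemma sol_asymp r1 y x0 : solves r1 y -> 0 < x0 -> exists Ka : R,
  forall r j (b : bool) q x, quarter r1 r -> x0 <= x -> x <= T -> 1 <= cm r * x ->
  cm (y r j (b, q) x - (if q == j then (tau s * r) ^+ b * cexp (tau s * (r * toC x)) else 0)) <=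
  Ka * cm r `^ (- beta) * (cm r ^+ b * expw s r x).
Proof.
move=> hy x00; pose Ca := 1 + K.
have Ca0 : 0 <= Ca by rewrite addr_ge0.
exists (K / x0 + 4 * m.+1%:R * Ca * K2 ^+ 2 * J) => r j b q x Pr x0x xT rx.
have [Hr _ c1 _] := Pr; have x_gt0 : 0 < x by exact: lt_le_trans x0x.
have Xx : X x by [].
have r0 : 0 < cm r by lra.
have Hz := hplane_scale Hr x_gt0; have cz : 1 <= cm (r * toC x) by rewrite cm_scale.
set e := expw s r x; have e0 : 0 < e by exact: expw_gt0.
have rb0 : 0 <= cm r ^+ b by rewrite exprn_ge0// cm_ge0.
have Kz : K / cm (r * toC x) <= K / (cm r * x0).
  by rewrite cm_scale// ler_wpM2l// lef_pV2 ?posrE ?mulr_gt0// ler_wpM2l// cm_ge0.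
have [bf hf] := hy r j Pr; have M0 : 0 <= 2 * (K2 * cm r `^ ga).
  by apply: mulr_ge0 => //; apply: mulr_ge0; [exact: K20|exact: powR_ge0].
have rbeta : (cm r)^-1 <= cm r `^ (- beta).
  rewrite -powR_inv1 ?cm_ge0// ler_powR// lerN2 /beta ge_min lexx//.
have part1 : cm (free_term j r (b, q) x -
    (if q == j then (tau s * r) ^+ b * cexp (tau s * (r * toC x)) else 0)) <=
    K / x0 * cm r `^ (- beta) * (cm r ^+ b * e).
  have K00 : 0 <= K / x0 by rewrite divr_ge0// ltW.
  rewrite /free_term /=; case: (q == j); last first.
    rewrite subrr cm0; apply: mulr_ge0; first by apply: mulr_ge0 => //; exact: powR_ge0.
    by apply: mulr_ge0 => //; exact: ltW.
  have [_ asy _ _] := hH q; have [a0 a1] := asy s _ Hz cz.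
  apply: (@le_trans _ _ (cm r ^+ b * (K / (cm r * x0) * e))).
    have Ke : K / cm (r * toC x) * eabs s (r * toC x) <= K / (cm r * x0) * e.
      by rewrite ler_wpM2r ?expw_ge0.
    case: b rb0 => rb0; rewrite /hankel_sol.
      rewrite expr1 (_ : _ - _ = r * (h1 q s (r * toC x) - tau s * cexp (tau s * (r * toC x)))); last by rewrite ?expr1; ring.
      by rewrite cmM ler_wpM2l ?cm_ge0// (le_trans a1).
    by rewrite !expr0 !mul1r (le_trans a0).
  rewrite (_ : cm r ^+ b * _ = K / x0 * (cm r)^-1 * (cm r ^+ b * e)); last first.
    by field; rewrite !gt_eqF.
  by rewrite ler_wpM2r ?mulr_ge0 ?expw_ge0// ler_wpM2l.
have hb sg : cm (hankel_sol b q sg r x) <= cm r ^+ b * (Ca * expw sg r x).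
  have [_ asy _ _] := hH q; have [a0 a1] := asy sg _ Hz cz.
  have Ke : K / cm (r * toC x) * eabs sg (r * toC x) <= K * expw sg r x.
    by rewrite ler_wpM2r ?expw_ge0// ler_piMr// invf_le1//; lra.
  have ex : eabs sg (r * toC x) = expw sg r x by [].
  case: b {part1 rb0}; rewrite /hankel_sol ?expr0 ?expr1 ?mul1r.
    rewrite cmM ler_wpM2l ?cm_ge0//.
    have := cm_ge (h1 q sg (r * toC x)) (tau sg * cexp (tau sg * (r * toC x))).
    rewrite cmM cm_tau mul1r -/(eabs sg (r * toC x)) ex /Ca mulrDl mul1r; rewrite ex in Ke a1; lra.
  have := cm_ge (h q sg (r * toC x)) (cexp (tau sg * (r * toC x))).
  rewrite -/(eabs sg (r * toC x)) ex /Ca mulrDl mul1r; rewrite ex in Ke a0; lra.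
pose k := Ca * K2 * (cm r `^ ga / cm r) * (cm r ^+ b * e).
have k0 : 0 <= k.
  apply: mulr_ge0; last by rewrite mulr_ge0// ltW.
  by apply: mulr_ge0; [apply: mulr_ge0 => //; exact: K20|rewrite divr_ge0 ?powR_ge0 ?cm_ge0].
have GGk t : Dx x t -> cm (green (b, q) r x t) <= k * (t `^ a / expw s r t).
  move=> Dt; have Xt : X t by exact: DX (DxD Dt).
  have Et := expw_causal Pr Dt.
  have f1 := hb s; have f2 := hb (~~ s); rewrite expwN -/e in f1 f2.
  have g1 := hankel_sol_bound false q s Hr c1 Xt; have g2 := hankel_sol_bound false q (~~ s) Hr c1 Xt.
  rewrite expwN in g2; rewrite /dweight mulr1 in g1 g2.
  rewrite /green cmM cm_green_c /k /=; rewrite -/e in Et.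
  have et0 := expw_gt0 s r t.
  move: (expw s r t) g1 g2 Et et0 => et g1 g2 Et et0.
  have p1 := ler_pM (cm_ge0 _) (cm_ge0 _) f1 g2.
  have p2 := ler_pM (cm_ge0 _) (cm_ge0 _) f2 g1.
  have A0 : 0 <= cm r `^ ga by exact: powR_ge0.
  have V0 : 0 <= t `^ a by exact: powR_ge0.
  have q2 : cm r ^+ b * (Ca / e) * (K2 * cm r `^ ga * (t `^ a * et)) <=
      cm r ^+ b * (Ca * e) * (K2 * cm r `^ ga * (t `^ a / et)).
    have cc : 0 <= cm r ^+ b * Ca * K2 * cm r `^ ga * t `^ a.
      by apply: mulr_ge0 => //; apply: mulr_ge0 => //; apply: mulr_ge0; [exact: mulr_ge0|exact: K20].
    rewrite [leLHS](_ : _ = cm r ^+ b * Ca * K2 * cm r `^ ga * t `^ a * (et / e)); last by ring.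
    rewrite [leRHS](_ : _ = cm r ^+ b * Ca * K2 * cm r `^ ga * t `^ a * (e / et)); last by ring.
    have e1 : et / e <= 1 by rewrite ler_pdivrMr// mul1r.
    have e2 : 1 <= e / et by rewrite ler_pdivlMr// mul1r.
    by apply: ler_wpM2l => //; apply: le_trans e1 e2.
  have hh := cmB (hankel_sol b q s r x * hankel_sol false q (~~ s) r t) (hankel_sol b q (~~ s) r x * hankel_sol false q s r t).
  rewrite !cmM in hh.
  rewrite ler_pdivrMl ?mulr_gt0//; apply: (le_trans hh).
  apply: (le_trans (lerD p1 (le_trans p2 q2))); rewrite -mulr2n -mulr_natl.
  rewrite le_eqVlt; apply/orP; left; apply/eqP; move: (cm r `^ ga) (t `^ a) (cm r ^+ b) => A V rb.
  by field; rewrite !gt_eqF.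
have part2 : cm (iop Dx (green_ker r) (y r j) (b, q) x) <=
    4 * m.+1%:R * Ca * K2 ^+ 2 * J * cm r `^ (- beta) * (cm r ^+ b * e).
  have := @iop_le_int _ _ X D Dx (weight r) mD mDx DxD DX (green_ker r) (kv k) _ (y r j) (b, q) x M0.
  move=> H; apply: (le_trans (H _ _ _ bf)).
  - by move=> p'; exact: green_ker_meas Pr.
  - move=> [b' i] t Dt; rewrite /green_ker /kv /=; case: b'; first by rewrite cm0 mul0r.
    by apply: (ker_dom _ _ k0 Dt); exact: GGk.
  - by move=> p'; exact: kv_int.
  apply: (le_trans (ler_wpM2l M0 (kv_sum x k0))).
  rewrite /beta -(powga_beta r0) le_eqVlt; apply/orP; left; apply/eqP; rewrite /k.
  move: (cm r `^ ga) (cm r ^+ b) => A rb; move: K2 J => k2 j2.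
  by field; rewrite !gt_eqF.
rewrite (hf (b, q) x Xx) addrAC; apply: (le_trans (cmD _ _)); apply: (le_trans (lerD part1 part2)).
by rewrite -!mulrDl.
Qed.

End Construct.

(** * Wronskians and completeness *)

Section FiniteMatrices.
Context {F : fieldType} {I : finType}.
Implicit Types (A M N : I -> I -> F).

Let mat A : 'M[F]_#|I| := \matrix_(i, j) A (enum_val i) (enum_val j).
Let col_of (c : I -> F) : 'cV[F]_#|I| := \col_i c (enum_val i).

Let sum_enum (f : I -> F) : \sum_(k < #|I|) f (enum_val k) = \sum_k f k.
Proof. by rewrite (reindex _ (onW_bij _ (@enum_val_bij I))). Qed.

Lemma injective_unit A : (forall c, (forall i, \sum_j A i j * c j = 0) -> forall j, c j = 0) ->
  mat A \in unitmx.
Proof.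
move=> inj; rewrite -unitmx_tr -row_free_unit; apply: inj_row_free => v vA.
have H := inj (fun j => v 0 (enum_rank j)); apply/rowP => j; rewrite mxE -(enum_valK j).
apply: H => i; transitivity ((v *m (mat A)^T) 0 (enum_rank i)); last by rewrite vA mxE.
rewrite mxE -sum_enum; apply: eq_bigr => k _; rewrite !mxE enum_rankK mulrC.
by congr (v _ _ * _); rewrite enum_valK.
Qed.

Lemma injective_surj A : (forall c, (forall i, \sum_j A i j * c j = 0) -> forall j, c j = 0) ->
  forall w : I -> F, exists c, forall i, \sum_j A i j * c j = w i.
Proof.
move=> /injective_unit uA w; pose c := invmx (mat A) *m col_of w.
exists (fun j => c (enum_rank j) 0) => i.
have H : mat A *m c = col_of w by rewrite mulmxA mulmxV// mul1mx.
transitivity (col_of w (enum_rank i) 0); last by rewrite mxE enum_rankK.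
rewrite -H mxE -sum_enum; apply: eq_bigr => k _.
by rewrite [mat A _ _]mxE enum_rankK enum_valK.
Qed.

(** Over a finite index set injectivity means invertibility, and if a product of square matrices is
    invertible, so is its left factor. *)
Lemma injective_mul M N : (forall c, (forall i, \sum_j (\sum_k M i k * N k j) * c j = 0) ->
    forall j, c j = 0) ->
  forall v, (forall i, \sum_k M i k * v k = 0) -> forall k, v k = 0.
Proof.
move=> /injective_unit; have -> : mat (fun i j => \sum_k M i k * N k j) = mat M *m mat N.
  apply/matrixP => i j; rewrite !mxE -sum_enum; apply: eq_bigr => k _; by rewrite !mxE.
rewrite unitmx_mul => /andP[uM _] v Mv k.
have H : mat M *m col_of v = 0.
  apply/colP => i; rewrite !mxE -[RHS](Mv (enum_val i)) -sum_enum.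
  by apply: eq_bigr => j _; rewrite !mxE.
have := mulKmx uM (col_of v); rewrite H mulmx0 => /colP/(_ (enum_rank k)).
by rewrite !mxE enum_rankK.
Qed.
End FiniteMatrices.

Section Wronskian.
Context {R : realType}.
Local Notation C := (Cplx R).
Local Notation mu := (@lebesgue_measure R).
Local Notation MR := (measurableTypeR R).
Variables (m : nat) (T : R) (V : 'I_m.+1 -> R -> C).
Local Notation J := ('I_m.+1).
Implicit Types (Q : R -> 'M[C]_m.+1) (f g : J -> R -> C).
Let D : set MR := `]0, T[%classic.

(* Solutions of f'' = (V + Q) f, with f1 = f'. *)
Definition solp Q f f1 := [/\ forall q x, D x -> gd (@toC R) D (f q) x (f1 q x),
  forall q a b, 0 < a -> a < b -> b < T -> abs_continuous a b (f1 q) &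
  {ae mu, forall x, D x -> forall q, gd (@toC R) D (f1 q) x
    (V q x * f q x + \sum_k Q x q k * f k x)}].

Definition wronskian f f1 g g1 (x : R) : C := \sum_q (g1 q x * f q x - g q x * f1 q x).

(** In the derivative [V] cancels componentwise, and the sums with [Q] and its transpose cancel
    after exchanging the order of summation. It vanishes almost everywhere, and [ac_const]
    concludes. *)
Lemma wronskian_const Q f f1 g g1 : solp Q f f1 -> solp (fun x => (Q x)^T) g g1 ->
  forall x y, D x -> D y -> wronskian f f1 g g1 x = wronskian f f1 g g1 y.
Proof.
move=> [df acf aef] [dg acg aeg].
suff H x y : x <= y -> D x -> D y -> wronskian f f1 g g1 y = wronskian f f1 g g1 x.
  move=> x y Dx Dy; have [xy|/ltW yx] := leP x y; first by rewrite (H x y).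
  by rewrite (H y x).
rewrite le_eqVlt => /orP[/eqP->//|xy] Dx Dy; have [x0 yT] : 0 < x /\ y < T.
  by move: Dx Dy; rewrite /D /= !in_itv/= => /andP[-> _] /andP[_ ->].
have sub : `[x, y] `<=` D.
  by move=> t; rewrite /D /= !in_itv/= => /andP[xt ty]; rewrite (lt_le_trans x0 xt) (le_lt_trans ty yT).
have Dt t : x <= t -> t <= y -> D t by move=> xt ty; apply: sub; rewrite /= in_itv/= xt.
have acf0 q : abs_continuous x y (f q).
  apply: (@ac_gd _ _ _ _ (f1 q)) => t xt ty; first exact: gd_sub sub (df q t (Dt t xt ty)).
  exact: ac_gc (acf q x y x0 xy yT) t xt ty.
have acg0 q : abs_continuous x y (g q).
  apply: (@ac_gd _ _ _ _ (g1 q)) => t xt ty; first exact: gd_sub sub (dg q t (Dt t xt ty)).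
  exact: ac_gc (acg q x y x0 xy yT) t xt ty.
apply: ac_const; first exact: ltW.
  by apply: ac_sum => q; apply: acB; apply: acM => //; [exact: acg|exact: acf].
apply: filterS (filterI aef aeg) => t [Hf Hg] xt ty; have D' := Dt t xt ty.
pose P q : C := \sum_k Q t k q * g k t * f q t; pose P' q : C := \sum_k Q t q k * f k t * g q t.
apply: (@gd_eq _ _ _ _ _ _ (\sum_q (P q - P' q))).
  by rewrite sumrB /P /P' exchange_big /= -sumrB big1// => q _; rewrite -sumrB big1// => k _; ring.
apply: gd_sum => q _.
have := gdB (gdM (Hg D' q) (df q t D')) (gdM (dg q t D') (Hf D' q)).
move/(gd_sub sub); apply: gd_eq.
rewrite /P /P' -!mulr_suml.
under eq_bigr do rewrite mxE.
by move: (\sum_k _) (\sum_k _) => A B; ring.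
Qed.

Lemma solp_lin Q (I : finType) (F F1 : I -> J -> R -> C) (c : I -> C) f f1 : solp Q f f1 ->
  (forall i, solp Q (F i) (F1 i)) ->
  solp Q (fun q x => f q x - \sum_i c i * F i q x) (fun q x => f1 q x - \sum_i c i * F1 i q x).
Proof.
move=> [d1 d2 d3] H; split.
- move=> q x Dx; apply: gdB; first exact: d1.
  by apply: gd_sum => i _; apply: gdZ; have [e1 _ _] := H i; exact: e1.
- move=> q a b a0 ab bT; apply: acB; first exact: d2.
  by apply: ac_sum => i; apply: acZ; have [_ e2 _] := H i; exact: e2.
have aeF : {ae mu, forall x, forall i, D x -> forall q, gd (@toC R) D (F1 i q) x
    (V q x * F i q x + \sum_k Q x q k * F i k x)}.
  by apply: filter_forall => i; have [_ _ e3] := H i; exact: e3.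
apply: filterS (filterI d3 aeF) => x [h1 h2] Dx q.
apply: gd_eq (gdB (h1 Dx q) (gd_sum (index_enum I) (fun i _ => gdZ (c i) (h2 i Dx q)))).
have E : \sum_k Q x q k * (f k x - \sum_i c i * F i k x) =
    \sum_k Q x q k * f k x - \sum_i c i * \sum_k Q x q k * F i k x.
  under eq_bigr do rewrite mulrBr mulr_sumr.
  rewrite sumrB exchange_big /=; congr (_ - _); apply: eq_bigr => i _.
  by rewrite mulr_sumr; apply: eq_bigr => k _; ring.
rewrite E; under [X in _ - X = _]eq_bigr do rewrite mulrDr.
rewrite big_split /= mulrBr mulr_sumr.
under [\sum_i V q x * _]eq_bigr do rewrite mulrCA.
by move: (\sum_i _ * (V q x * _)) (\sum_k _ * f k x) (\sum_i _ * \sum_k _) => A B B'; ring.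
Qed.

Local Notation I := (bool * J)%type.
Variables (Q : R -> 'M[C]_m.+1) (Y Y1 Z Z1 : I -> J -> R -> C) (x0 : R).
Hypothesis Dx0 : D x0.
Hypothesis HY : forall j, solp Q (Y j) (Y1 j).
Hypothesis HZ : forall i, solp (fun x => (Q x)^T) (Z i) (Z1 i).
Hypothesis W0 : forall c : I -> C,
  (forall i, \sum_j wronskian (Y j) (Y1 j) (Z i) (Z1 i) x0 * c j = 0) -> forall j, c j = 0.

Let Mat (i k : I) x : C := if k.1 then Z1 i k.2 x else - Z i k.2 x.
Let Phi (k j : I) x : C := if k.1 then Y j k.2 x else Y1 j k.2 x.

Let wronskian_mul i f f1 x : wronskian f f1 (Z i) (Z1 i) x = \sum_k Mat i k x * (if k.1 then f k.2 x else f1 k.2 x).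
Proof.
by rewrite sum_bool_pair /= -big_split; apply: eq_bigr => q _ /=; rewrite mulNr.
Qed.

(** A combination vanishing on the interval has zero derivative at [x0] as well, so its Wronskians
    with all [Z i] vanish there, and [W0] applies. *)
Lemma fund_indep (c : I -> C) : (forall x, D x -> forall q, \sum_j c j * Y j q x = 0) ->
  forall j, c j = 0.
Proof.
move=> H; have H1 q : \sum_j c j * Y1 j q x0 = 0.
  have g1 : gd (@toC R) D (fun x => \sum_j c j * Y j q x) x0 (\sum_j c j * Y1 j q x0).
    by apply: gd_sum => j _; apply: gdZ; have [d _ _] := HY j; exact: d.
  have g2 : gd (@toC R) D (fun x => \sum_j c j * Y j q x) x0 0.
    by apply: gd_ext (gd_cst _ D (0 : C) x0) => [t Dt|]; rewrite H.
  apply: (gd_unique _ g1 g2) => d d0.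
  have := Dx0; rewrite /D /= in_itv/= => /andP[x00 x0T].
  pose k := Num.min d (T - x0); have k0 : 0 < k by rewrite lt_min d0 subr_gt0.
  have [kd kT] : k <= d /\ k <= T - x0 by rewrite !ge_min !lexx orbT.
  exists (x0 + k / 2); rewrite -toCB addrAC subrr add0r cm_toC ger0_norm; last by lra.
  split; [|by lra|].
    by rewrite /D /= in_itv/=; apply/andP; split; lra.
  by apply/eqP => /toC_inj; lra.
apply: W0 => i; rewrite -[RHS](_ : \sum_k Mat i k x0 * (\sum_j c j * Phi k j x0) = 0).
  under eq_bigr do rewrite wronskian_mul mulr_suml.
  rewrite exchange_big /=; apply: eq_bigr => k _; rewrite mulr_sumr; apply: eq_bigr => j _.
  by rewrite -/(Phi k j x0); ring.
apply: big1 => -[b q] _; rewrite /Phi; case: b => /=; first by rewrite (H x0 Dx0) mulr0.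
by rewrite H1 mulr0.
Qed.

(** The coefficients are chosen so that [f] and the combination have equal Wronskians with all [Z i]
    at [x0], hence everywhere. The Wronskian matrix at [x] factors into the values and derivatives
    of [Z] and those of [Y]; being invertible, it makes the factor of [Z] invertible, and the
    difference vanishes at [x]. *)
Lemma fund_span f f1 : solp Q f f1 -> exists c : I -> C, forall x, D x -> forall q,
  f q x = \sum_j c j * Y j q x.
Proof.
move=> Hf.
have [c hc] := injective_surj W0 (fun i => wronskian f f1 (Z i) (Z1 i) x0).
exists c => x Dx q.
pose g q x := f q x - \sum_j c j * Y j q x; pose g1 q x := f1 q x - \sum_j c j * Y1 j q x.
have Hg : solp Q g g1 by exact: solp_lin.
have Wx i j : wronskian (Y j) (Y1 j) (Z i) (Z1 i) x = wronskian (Y j) (Y1 j) (Z i) (Z1 i) x0.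
  exact: wronskian_const (HY j) (HZ i) _ _ Dx Dx0.
have Wg i : wronskian g g1 (Z i) (Z1 i) x = 0.
  rewrite (wronskian_const Hg (HZ i) Dx Dx0) wronskian_mul.
  transitivity (wronskian f f1 (Z i) (Z1 i) x0 - \sum_j wronskian (Y j) (Y1 j) (Z i) (Z1 i) x0 * c j); last first.
    by rewrite hc subrr.
  under [X in _ = _ - X]eq_bigr do rewrite wronskian_mul mulr_suml.
  rewrite wronskian_mul exchange_big /= -sumrB; apply: eq_bigr => k _.
  have -> : (if k.1 then g k.2 x0 else g1 k.2 x0) =
      (if k.1 then f k.2 x0 else f1 k.2 x0) - \sum_j c j * Phi k j x0.
    by rewrite /g /g1 /Phi; case: k.1.
  rewrite mulrBr mulr_sumr; congr (_ - _); apply: eq_bigr => j _.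
  by rewrite -/(Phi k j x0); ring.
have inj : forall c, (forall i, \sum_j (\sum_k Mat i k x * Phi k j x) * c j = 0) ->
    forall j, c j = 0.
  move=> d hd; apply: W0 => i; rewrite -[RHS](hd i); apply: eq_bigr => j _.
  by rewrite -Wx wronskian_mul.
have := injective_mul inj (v := fun k => if k.1 then g k.2 x else g1 k.2 x).
move=> /(_ _ (true, q)) /= K; apply/eqP; rewrite -subr_eq0; apply/eqP; apply: K => i.
by rewrite -wronskian_mul.
Qed.

End Wronskian.

(** * Solutions of the perturbed equation and their Wronskians *)

Section Jost.
Context {R : realType}.
Local Notation C := (Cplx R).
Local Notation mu := (@lebesgue_measure R).
Local Notation MR := (measurableTypeR R).
Local Notation Re := complex.Re.
Local Notation Im := complex.Im.
Variables (m : nat) (T : R) (nu : 'I_m.+1 -> R).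
Local Notation J := 'I_m.+1.
Local Notation I := (bool * J)%type.
Implicit Types (Q : R -> 'M[C]_m.+1) (P : set C) (y : C -> J -> I -> R -> C).
Let X : set R := [set x | 0 < x /\ x <= T].
Let beta := Num.min 1 (2 * nu ord0).

(** An interface that hides the Hankel functions and all constants of the construction. In
    [y r j (b, q) x] the column is [j], the component [q], and [b] marks the derivative in [x]. *)
Definition jost Q (s : bool) P y := [/\
  forall r0 j p x, P r0 -> X x -> exists L, gd id P (fun r => y r j p x) r0 L,
  forall r j q x, P r -> X x -> gd (@toC R) X (y r j (false, q)) x (y r j (true, q) x),
  forall r j, P r ->
    solp T (fun q x => pot (toC (nu q ^+ 2 - 4^-1)) (toC x) - r ^+ 2) Q
      (fun q => y r j (false, q)) (fun q => y r j (true, q)) &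
  forall x0, 0 < x0 -> exists Ka : R, forall r j (b : bool) q x,
    P r -> x0 <= x -> x <= T -> 1 <= cm r * x ->
    cm (y r j (b, q) x - (if q == j then (tau s * r) ^+ b * cexp (tau s * (r * toC x)) else 0)) <=
    Ka * cm r `^ (- beta) * (cm r ^+ b * eabs s (r * toC x))].

Lemma hankel_spec_le (n K K' : R) (h h1 : bool -> C -> C) : K <= K' ->
  hankel_spec n K h h1 -> hankel_spec n K' h h1.
Proof.
move=> KK [h1' h2 h3 h4]; split=> //.
- move=> sg z Hz z1; have [a b] := h2 sg z Hz z1.
  have k : K / cm z * eabs sg z <= K' / cm z * eabs sg z.
    by rewrite ler_wpM2r ?(ltW (eabs_gt0 _ _))// ler_wpM2r// invr_ge0 cm_ge0.
  by split; [exact: le_trans a k|exact: le_trans b k].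
- move=> sg z Hz; have [a b] := h3 sg z Hz.
  have z0 : 0 < cm z by rewrite cm_gt0; have [] := Hz.
  have p0 : 0 <= phi n (cm z) by exact/ltW/phi_gt0.
  have e0 := ltW (eabs_gt0 sg z).
  by split; [apply: (le_trans a)|apply: (le_trans b)]; rewrite ?ler_wpM2r// addr_ge0// cm_ge0.
Qed.

Lemma jost_family_exists Q : 0 < T -> (forall q, 0 < nu q) -> (forall q, nu q <= nu ord0) ->
  (forall i j, cintegrable `]0, T[ (fun x => toC (x `^ (1 - 2 * nu ord0)) * Q x i j)) ->
  exists r1 : R, forall s kap, exists y, jost Q s (quarter kap r1) y.
Proof.
move=> T0 nu0 nule Qint.
have /choice[hh Hh] : forall q, exists hh : (bool -> C -> C) * (bool -> C -> C) * R,
    0 <= hh.2 /\ hankel_spec (nu q) hh.2 hh.1.1 hh.1.2.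
  by move=> q; have [h [h1 [K K0 H]]] := hankel_pack (nu0 q); exists ((h, h1), K).
pose h q := (hh q).1.1; pose h1 q := (hh q).1.2; pose K := \sum_q (hh q).2.
have K0 : 0 <= K by apply: sumr_ge0 => q _; have [] := Hh q.
have hH q : hankel_spec (nu q) K (h q) (h1 q).
  apply: hankel_spec_le (Hh q).2; rewrite /K (bigD1 q)//= lerDl sumr_ge0// => q' _.
  by have [] := Hh q'.
have [r1 r11 small] := small_exists T Q K nu0.
exists r1 => s kap.
have [y hy] := sol_exists T0 nule Qint K0 hH s kap small.
exists y; split.
- by move=> r0 j p x Pr Xx; exact: (sol_deriv T0 nule Qint K0 hH small hy).
- by move=> r j q x Pr Xx; exact: (sol_dx0 T0 nule Qint K0 hH hy).
- move=> r j Pr; split.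
  + move=> q x Dx; apply: (@gd_sub _ _ _ X).
      by move=> t /=; rewrite in_itv/= => /andP[t0 /ltW].
    apply: (sol_dx0 T0 nule Qint K0 hH hy) => //.
    by move: Dx; rewrite /= in_itv/= => /andP[t0 /ltW].
  + by move=> q a b a0 _ bT; exact: (sol_ac T0 nule Qint K0 hH hy).
  + apply: filterS (sol_dx1_ae T0 nule Qint K0 hH hy j Pr) => x H Dx q.
    apply: (@gd_sub _ _ _ X); last exact: H.
    by move=> t /=; rewrite in_itv/= => /andP[t0 /ltW].
- by move=> x0 x00; have [Ka hK] := sol_asymp T0 nule Qint K0 hH hy x00; exists Ka.
Qed.

Lemma jost_sub Q s P P' y : P' `<=` P -> jost Q s P y -> jost Q s P' y.
Proof.
move=> PP [a b c d]; split.
- by move=> r0 j p x /PP Pr Xx; have [L hL] := a r0 j p x Pr Xx; exists L; exact: gd_sub PP hL.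
- by move=> r j q x /PP; exact: b.
- by move=> r j /PP; exact: c.
- by move=> x0 /d[Ka hK]; exists Ka => r j bb q x /PP; exact: hK.
Qed.

(** In the limit matrix [tau k.1 - tau l.1] is nonzero, of modulus 2, only for opposite signs. Row
    [(~~ t, j)] therefore isolates [c (t, j)]. Summing the resulting inequalities gives
    [2 * S <= eps * N * S], with [N] the number of indices, so [S = 0]. *)
Lemma almost_antidiag (A : I -> I -> C) (eps : R) :
  (forall k l : I, cm (A k l - (if k.2 == l.2 then tau k.1 - tau l.1 else 0)) <= eps) ->
  eps * #|{: I}|%:R < 2 ->
  forall c : I -> C, (forall k, \sum_l A k l * c l = 0) -> forall l, c l = 0.
Proof.
move=> hA eN c Hc; pose S := \sum_l cm (c l).
have row l : 2 * cm (c l) <= eps * S.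
  case: l => t j.
  have E : \sum_l (if j == l.2 then tau (~~ t) - tau l.1 else 0) * c l =
      (tau (~~ t) - tau t) * c (t, j).
    rewrite (bigD1 (t, j))//= eqxx big1 ?addr0// => -[t' j'] /= ne.
    have [jj|_] := eqVneq j j'; last by rewrite mul0r.
    move: ne; rewrite -jj; case: t; case: t' => //=; rewrite ?eqxx ?subrr ?mul0r//.
  have tt (b : bool) : cm (tau (~~ b) - tau b : C) = 2.
    have c2 : cm (imunit + imunit : C) = 2.
      by rewrite -[X in cm X]mulr2n -[X in cm X]mulr_natl cmM cm_imunit cm_nat mulr1.
    by rewrite /tau /sgd; case: b => /=; rewrite ?mulN1r ?mul1r ?opprK -?opprD ?cmN.
  have E' : \sum_l (if j == l.2 then tau (~~ t) - tau l.1 else 0) * c l =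
      \sum_l ((if j == l.2 then tau (~~ t) - tau l.1 else 0) - A (~~ t, j) l) * c l.
    by under [RHS]eq_bigr do rewrite mulrBl; rewrite sumrB Hc subr0.
  rewrite -(tt t) -cmM -E E'.
  apply: (le_trans (cm_sum _ _ _)); rewrite mulr_sumr; apply: ler_sum => l _.
  by rewrite cmM ler_wpM2r ?cm_ge0// cmBC; exact: (hA (~~ t, j) l).
have S0 : 0 <= S by apply: sumr_ge0 => l _; exact: cm_ge0.
have SS : 2 * S <= eps * #|{: I}|%:R * S.
  rewrite mulr_sumr; apply: (le_trans (ler_sum _ (fun l _ => row l))).
  by rewrite sumr_const -[leLHS]mulr_natl mulrA [_%:R * eps]mulrC.
have {}S0 : S = 0.
  apply/eqP; move: S0; rewrite le_eqVlt => /orP[/eqP <-//|S0].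
  by have := ltr_pM2r S0 (eps * #|{: I}|%:R) 2; rewrite eN ltNge SS.
move=> l; apply/eqP; rewrite -cm_eq0; apply/eqP/le_anti; rewrite cm_ge0 andbT -S0.
by rewrite /S (bigD1 l)//= lerDl sumr_ge0// => l' _; exact: cm_ge0.
Qed.


Lemma mul_close (w u a b : C) (eta : R) : cm (w - a) <= eta -> cm (u - b) <= eta ->
  cm a <= 1 -> cm b <= 1 -> eta <= 1 -> cm (w * u - a * b) <= 3 * eta.
Proof.
move=> wa ub a1 b1 e1; rewrite (_ : _ - _ = (w - a) * u + a * (u - b)); last by ring.
have e0 : 0 <= eta := le_trans (cm_ge0 _) wa.
have u2 : cm u <= 2 by have := cm_ge u b; lra.
apply: (le_trans (cmD _ _)); rewrite !cmM.
have := ler_pM (cm_ge0 _) (cm_ge0 _) wa u2.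
have := ler_pM (cm_ge0 _) (cm_ge0 _) a1 ub; lra.
Qed.

(** Dividing each solution by its exponential, and each derivative also by [r], leaves quantities
    within [eta = O(|r|^(- beta))] of constants. The exponentials and [r] become nonzero row and
    column factors of the Wronskian matrix and do not affect injectivity. *)
Lemma jost_wronskian Q P (y z : bool -> C -> J -> I -> R -> C) :
  0 < T -> 0 < nu ord0 -> (forall r, P r -> 1 <= cm r) ->
  (forall s, jost Q s P (y s)) -> (forall s, jost (fun x => (Q x)^T) s P (z s)) ->
  exists r2 : R, forall r, P r -> r2 <= cm r -> forall c : I -> C,
    (forall k, \sum_l wronskian (fun q => y l.1 r l.2 (false, q)) (fun q => y l.1 r l.2 (true, q))
       (fun q => z k.1 r k.2 (false, q)) (fun q => z k.1 r k.2 (true, q)) (T / 2) * c l = 0) ->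
    forall l, c l = 0.
Proof.
move=> T0 nu0 P1 Hy Hz; pose x := T / 2.
have x0 : 0 < x by rewrite divr_gt0.
have xT : x <= T by rewrite /x; lra.
have b0 : 0 < beta by rewrite lt_min ltr01 mulr_gt0.
have [A A0 HA] : exists2 A : R, 0 < A & forall r, P r -> 1 <= cm r * x -> forall (Y : bool),
    forall (b : bool) l q,
    let y := if Y then y else z in
    cm (y l.1 r l.2 (b, q) x - (if q == l.2 then (tau l.1 * r) ^+ b * cexp (tau l.1 * (r * toC x)) else 0)) <=
    A * cm r `^ (- beta) * (cm r ^+ b * eabs l.1 (r * toC x)).
  have /choice[Ka hK] : forall sY : bool * bool, exists Ka : R, forall r j (b : bool) q,
      P r -> 1 <= cm r * x ->
      cm ((if sY.2 then y else z) sY.1 r j (b, q) x -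
        (if q == j then (tau sY.1 * r) ^+ b * cexp (tau sY.1 * (r * toC x)) else 0)) <=
      Ka * cm r `^ (- beta) * (cm r ^+ b * eabs sY.1 (r * toC x)).
    move=> [s Y] /=; have [Q' [_ _ _ /(_ x x0)[Ka hK]]] : exists Q', jost Q' s P ((if Y then y else z) s).
      by case: Y; eexists; [exact: Hy|exact: Hz].
    by exists Ka => r j b q Pr rx; exact: hK.
  exists (1 + \sum_sY `|Ka sY|); first by rewrite ltr_pwDl// sumr_ge0.
  move=> r Pr rx Y b [s j] q /=; apply: (le_trans (hK (s, Y) r j b q Pr rx)) => /=.
  rewrite ler_wpM2r ?mulr_ge0 ?exprn_ge0 ?cm_ge0 ?(ltW (eabs_gt0 _ _))//.
  rewrite ler_wpM2r ?powR_ge0// (bigD1 (s, Y))//= addrCA.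
  apply: (le_trans (ler_norm _)); rewrite lerDl addr_ge0// sumr_ge0//.
(* Each component contributes two products, each off by at most [3 * eta], so an entry is off by
   [6 * m.+1%:R * eta]; the choice of [d] makes [N] times this at most 1. *)
pose N := #|{: I}|; pose d : R := (6 * m.+1%:R * N.+1%:R)^-1.
have d0 : 0 < d by rewrite invr_gt0 !mulr_gt0// ltr0n.
have [r2 r21 Hr2] := powRN_small b0 (divr_gt0 d0 A0).
exists (Num.max r2 (x^-1)) => r Pr; rewrite ge_max => /andP[rr2 rx].
have r1 := P1 r Pr; have r0 : 0 < cm r by lra.
have {}rx : 1 <= cm r * x by rewrite -ler_pdivrMr// mul1r.
pose eta := A * cm r `^ (- beta).
have eta_d : eta <= d by rewrite /eta mulrC -ler_pdivlMr// Hr2.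
have eta0 : 0 <= eta by rewrite mulr_ge0 ?powR_ge0// ltW.
have m1 : 1 <= m.+1%:R :> R by rewrite ler1n.
have N1 : 1 <= N.+1%:R :> R by rewrite ler1n.
have mN : 1 <= m.+1%:R * N.+1%:R :> R by have := ler_pM ler01 ler01 m1 N1; rewrite mulr1.
have eta1 : eta <= 1.
  have D1 : 1 <= 6 * m.+1%:R * N.+1%:R :> R by rewrite -mulrA; lra.
  by apply: (le_trans eta_d); rewrite /d invf_le1//; lra.
have rn : r != 0 by rewrite -cm_gt0.
pose e s := cexp (tau s * (r * toC x)).
have en s : e s != 0 by exact: cexp_neq0.
pose sc Y b (l : I) q : C := (if Y then y else z) l.1 r l.2 (b, q) x / (r ^+ nat_of_bool b * e l.1).
pose ap b (l : I) q : C := if q == l.2 then tau l.1 ^+ nat_of_bool b else 0.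
have ap1 b l q : cm (ap b l q) <= 1.
  by rewrite /ap; case: ifP => _; rewrite ?cm0// cmX cm_tau expr1n.
have sc_ap Y b l q : cm (sc Y b l q - ap b l q) <= eta.
  have rbn : r ^+ nat_of_bool b * e l.1 != 0 by rewrite mulf_neq0// expf_neq0.
  have := HA r Pr rx Y b l q => /=.
  rewrite (_ : _ - _ = (r ^+ b * e l.1) * (sc Y b l q - ap b l q)); last first.
    rewrite /sc mulrBr [X in _ = X - _]mulrC divfK//; congr (_ - _); rewrite /ap; case: ifP => _; last by rewrite mulr0.
    by rewrite exprMn -/(e l.1); ring.
  rewrite cmM cmM cmX -/eta -/(eabs l.1 _) -/(e l.1) mulrC.
  by rewrite ler_pM2r// mulr_gt0 ?exprn_gt0// cm_gt0 cexp_neq0.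
pose M (k l : I) : C := \sum_q (sc false true k q * sc true false l q - sc false false k q * sc true true l q).
have wrM : forall k l : I, wronskian (fun q => y l.1 r l.2 (false, q)) (fun q => y l.1 r l.2 (true, q))
       (fun q => z k.1 r k.2 (false, q)) (fun q => z k.1 r k.2 (true, q)) x = r * e k.1 * (M k l * e l.1).
  move=> k l; rewrite /wronskian /M mulr_suml mulr_sumr; apply: eq_bigr => q _; rewrite /sc /=.
  by field; rewrite rn !en.
have Mclose k l : cm (M k l - (if k.2 == l.2 then tau k.1 - tau l.1 else 0)) <= 6 * m.+1%:R * eta.
  have E : (if k.2 == l.2 then tau k.1 - tau l.1 else 0) =
      \sum_q (ap true k q * ap false l q - ap false k q * ap true l q).
    rewrite (bigD1 k.2)//= /ap !eqxx big1 ?addr0 => [|q /negbTE ->]; last by rewrite !mul0r subrr.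
    by rewrite expr0 !expr1; case: ifP => _; rewrite ?mulr0 ?mulr1 ?mul1r ?subrr.
  rewrite E /M -sumrB; apply: (le_trans (cm_sum _ _ _)).
  apply: (@le_trans _ _ (\sum_(q < m.+1) 6 * eta)); last first.
    by rewrite sumr_const card_ord -[leLHS]mulr_natl mulrCA mulrA.
  apply: ler_sum => q _.
  have p1 := mul_close (sc_ap false true k q) (sc_ap true false l q) (ap1 _ _ _) (ap1 _ _ _) eta1.
  have p2 := mul_close (sc_ap false false k q) (sc_ap true true l q) (ap1 _ _ _) (ap1 _ _ _) eta1.
  rewrite (_ : _ - _ - _ = (sc false true k q * sc true false l q - ap true k q * ap false l q) -
    (sc false false k q * sc true true l q - ap false k q * ap true l q)); last by ring.
  apply: (le_trans (cmB _ _)); lra.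
have small : 6 * m.+1%:R * eta * #|{: I}|%:R < 2.
  have h : 6 * m.+1%:R * eta * N.+1%:R <= 1.
    have h := ler_wpM2l (ltW (_ : 0 < 6 * m.+1%:R * N.+1%:R :> R)) eta_d.
    rewrite mulrAC; apply: (le_trans (h _)); first by rewrite !mulr_gt0// ltr0n.
    by rewrite /d divff// !mulf_neq0// pnatr_eq0.
  apply: (@le_lt_trans _ _ 1); last by lra.
  apply: le_trans h; apply: ler_wpM2l; last by rewrite ler_nat.
  by apply: mulr_ge0; [apply: mulr_ge0|exact: eta0].
move=> c Hc; have := almost_antidiag Mclose small (c := fun l => e l.1 * c l).
move=> H l; have /(_ l)/eqP : forall l, e l.1 * c l = 0.
  apply: H => k; apply: (mulfI (x := r * e k.1)); first by rewrite mulf_neq0.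
  rewrite mulr0 -[RHS](Hc k) mulr_sumr; apply: eq_bigr => l' _.
  by rewrite wrM; ring.
by rewrite mulf_eq0 (negbTE (en _)) => /eqP.
Qed.

End Jost.

(** * Sectors, matrices of solutions and the final statement *)

Section Assembly.
Context {R : realType}.
Local Notation C := (Cplx R).
Local Notation mu := (@lebesgue_measure R).
Local Notation MR := (measurableTypeR R).
Local Notation Re := complex.Re.
Local Notation Im := complex.Im.

Lemma sectorP (k0 : int) (rhos : R) (z : C) : 0 <= rhos -> k0 = 0 \/ k0 = -1 ->
  sector k0 rhos z ->
  [/\ 0 < Re z, if k0 == 0 then 0 < Im z else Im z < 0 & rhos < cm z].
Proof.
move=> r0 hk [r [t [rr tt ->]]]; have r_gt0 : 0 < r by exact: le_lt_trans rr.
have cmr : cm (toC r * (cos t +i* sin t)) = r.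
  have H : cm (toC r * (cos t +i* sin t)) ^+ 2 = r ^+ 2.
    by rewrite cm_sqr ReCZ ImCZ /= !exprMn -mulrDr cos2Dsin2 mulr1.
  by apply/eqP; rewrite -(eqrXn2 (n := 2)) ?cm_ge0 ?ltW// H.
have p0 : 0 < pi :> R by exact: pi_gt0.
rewrite cmr ReCZ ImCZ /=; case: hk tt => -> /= /andP[]; rewrite ?mul0r ?add0r ?mul1r ?addNr ?mulN1r ?mul0r => t1 t2.
  split=> //; rewrite mulr_gt0//; first by apply: cos_gt0_pihalf; apply/andP; split; lra.
  by apply: sin_gt0_pi; apply/andP; split; lra.
split=> //; first by rewrite mulr_gt0//; apply: cos_gt0_pihalf; apply/andP; split; lra.
rewrite -[t]opprK sinN mulrN oppr_lt0 mulr_gt0//.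
by apply: sin_gt0_pi; apply/andP; split; lra.
Qed.

(** Only weak inequalities survive the closure, and these are the ones that define [quarter];
    [rhos >= 1] keeps 0 away. *)
Lemma closure_sector (k0 : int) (rhos r1 : R) (z : C) : 1 <= rhos -> r1 <= rhos ->
  k0 = 0 \/ k0 = -1 -> closure (sector k0 rhos) z -> quarter (k0 == 0) r1 z /\ rhos <= cm z.
Proof.
move=> rhos1 r1r hk cz; have rhos0 : 0 <= rhos by lra.
have near_ e : 0 < e -> exists2 w, sector k0 rhos w & cm (z - w) <= e.
  move=> e0; have /cz[w [sw /= wz]] : nbhs z [set w | cm (z - w) <= e].
    by apply/nearCP; exists e => // w wz /=; rewrite cmBC ltW.
  by exists w.
have cmz : rhos <= cm z.
  apply/ler_addgt0Pr => e /near_[w /(sectorP rhos0 hk)[_ _ w1] zw].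
  by have := cm_ge w z; rewrite cmBC; lra.
split=> //; split; [split| | |]; [|by rewrite -cm_gt0; lra| |lra|lra].
  apply/ler_addgt0Pr => e /near_[w /(sectorP rhos0 hk)[w0 _ _] zw].
  by have := cm_Re (z - w); rewrite ReCD ReCN ler_norml => /andP[]; lra.
case: hk cz near_ => -> _ near_ /=; apply/ler_addgt0Pr => e /near_[w /(sectorP rhos0) hw zw].
  have [//|_ /= w0 _] := hw; first by left.
  by have := cm_Im (z - w); rewrite ImCD ImCN ler_norml => /andP[]; lra.
have [//|_ /= w0 _] := hw; first by right.
by have := cm_Im (z - w); rewrite ImCD ImCN ler_norml => /andP[]; lra.
Qed.

Lemma sector_nbhs (k0 : int) (rhos r1 : R) (z : C) : 1 <= rhos -> r1 <= rhos ->
  k0 = 0 \/ k0 = -1 -> sector k0 rhos z ->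
  exists2 d : R, 0 < d & forall w, cm (w - z) < d -> quarter (k0 == 0) r1 w.
Proof.
move=> rhos1 r1r hk /(sectorP (le_trans ler01 rhos1) hk)[z1 z2 z3].
have im0 : 0 < `|Im z|.
  by rewrite normr_gt0; move: z2; case: ifP => _ z2; apply/eqP => h; rewrite h ltxx in z2.
exists (Num.min (cm z - rhos) (Num.min (Re z) `|Im z|)).
  by rewrite !lt_min subr_gt0 z3 z1.
move=> w; rewrite !lt_min => /and3P[w1 w2 w3].
have cw : rhos < cm w by have := cm_ge z w; rewrite cmBC; lra.
have := cm_Re (w - z); have := cm_Im (w - z).
rewrite ReCD ReCN ImCD ImCN !ler_norml => /andP[i1 i2] /andP[e1 e2].
split; [split| | |]; [lra|by rewrite -cm_gt0; lra| |lra|lra].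
move: z2 w3; case: (k0 == 0) => z2 /=.
  by rewrite (ger0_norm (ltW z2)); lra.
by rewrite (ler0_norm (ltW z2)); lra.
Qed.

Section Solutions.
Variables (m : nat) (T : R) (nu : 'I_m.+1 -> R) (Q : R -> 'M[C]_m.+1) (rho : C).
Let omega : 'M[C]_m.+1 := diag_mx (\row_q toC (nu q ^+ 2 - 4^-1)).
Let V (q : 'I_m.+1) (x : R) : C := pot (toC (nu q ^+ 2 - 4^-1)) (toC x) - rho ^+ 2.

Lemma rhs_entry (x : R) (u : 'cV[C]_m.+1) q :
  ((toC (x ^- 2) *: omega + Q x) *m u) q 0 - (rho ^+ 2 *: u) q 0 =
  V q x * u q 0 + \sum_k Q x q k * u k 0.
Proof.
rewrite mulmxDl -scalemxAl /omega mul_diag_mx !mxE /V /pot toCV toCX.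
by move: (\sum_k _) (toC x ^+ 2) (toC (nu q ^+ 2 - 4^-1)) => A B D; ring.
Qed.

Lemma solp_is_solution (u u1 : R -> 'cV[C]_m.+1) :
  solp T V Q (fun q x => u x q 0) (fun q x => u1 x q 0) -> is_solution T omega Q (rho ^+ 2) u.
Proof.
move=> [d ac ae]; exists u1; split.
- by move=> x Dx; apply: gd_xderiv => q j; rewrite ord1; exact: d.
- by move=> a b a0 ab bT q; exact: ac.
move: ae => [N [mN N0 sN]]; exists N; split=> // x nP; apply: sN => H; apply: nP => Dx.
exists (\col_q (V q x * u x q 0 + \sum_k Q x q k * u x k 0)).
  by apply: gd_xderiv => q j; rewrite ord1 mxE; exact: H.
apply/colP => q; rewrite mxE [X in X + _]mxE [X in - X]mxE -rhs_entry.
by move: (_ q 0) (_ q 0) => A B; ring.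
Qed.

Lemma is_solution_solp (u : R -> 'cV[C]_m.+1) : is_solution T omega Q (rho ^+ 2) u ->
  exists u1, solp T V Q (fun q x => u x q 0) u1.
Proof.
move=> [u1 [d ac ae]]; exists (fun q x => u1 x q 0); split.
- by move=> q x Dx; exact: (xderiv_gd (d x Dx) q 0).
- by move=> q a b a0 ab bT; exact: ac.
move: ae => [N [mN N0 sN]]; exists N; split=> // x nP; apply: sN => H; apply: nP => Dx q; have [ddu dd e] := H Dx.
apply: gd_eq (xderiv_gd dd q 0); rewrite -rhs_entry.
by have := congr1 (fun M : 'cV_m.+1 => M q 0) e; rewrite mxE [X in X + _]mxE => <-; ring.
Qed.
End Solutions.

Lemma mx_norm_le (m : nat) (E : 'M[C]_m.+1) (k : R) : (forall i j, cm (E i j) <= k) ->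
  `|E| <= toC k.
Proof.
move=> H; have [E0|/mx_norm_neq0[[i j] /= e]] := eqVneq (mx_norm E) 0.
  rewrite [leLHS]E0 -toC0 toC_le; exact: le_trans (cm_ge0 _) (H ord0 ord0).
by rewrite [leLHS]e cmE toC_le.
Qed.

Lemma jost_asymptotics (m : nat) (T : R) (nu : 'I_m.+1 -> R) Q s P
  (y : C -> 'I_m.+1 -> bool * 'I_m.+1 -> R -> C) (D : set C) (k : nat) :
  jost T nu Q s P y -> D `<=` P -> (k <= 1)%N ->
  exp_asymptotics T (Num.min 1 (2 * nu ord0)) D (tau s)
    (fun r x rho => \matrix_(q, j) y rho j (r == 1%N, q) x) k.
Proof.
move=> [_ _ _ asy] DP k1 x0; rewrite in_itv/= => /andP[x00 x0T].
have [Ka hK] := asy x0 x00; exists Ka, 1 => x rho; rewrite in_itv/= => /andP[x0x xT] Drho rx r1.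
have Prho := DP _ Drho.
have x_gt0 : 0 < x by exact: lt_le_trans x0x.
have rx1 : 1 <= cm rho * x.
  by move: rx; rewrite cmE -toC1 toC_le cmM cm_toC_ge0// ltW.
have rho1 : 1 <= cm rho by move: r1; rewrite cmE toC_le.
have rn : rho != 0 by rewrite -cm_gt0; lra.
pose A : C := (tau s * rho) ^+ k * cexp (tau s * rho * toC x).
have An : A != 0 by rewrite mulf_neq0 ?cexp_neq0// expf_neq0// mulf_neq0 ?tau_neq0.
pose Y : 'M[C]_m.+1 := \matrix_(q, j) y rho j (k == 1%N, q) x.
(* The remainder is what the formula dictates; its bound is the entrywise estimate divided by the
   modulus of [A]. *)
exists (A^-1 *: Y - 1%:M); split; first by rewrite addrC subrK scalerA divff// scale1r.
apply: mx_norm_le => q j; rewrite !mxE.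
have := hK rho j (k == 1%N) q x Prho x0x xT rx1.
have kb : nat_of_bool (k == 1%N) = k by case: k k1 {A An Y} => [|[]].
rewrite kb [tau s * (rho * _)]mulrA.
rewrite (_ : _ - _ = A * (A^-1 * y rho j (k == 1%N, q) x - (q == j)%:R)); last first.
  by rewrite mulrBr mulVKf//; case: (q == j); rewrite ?mulr1// mulr0.
rewrite cmM [X in X * _ <= _](_ : _ = cm rho ^+ k * eabs s (rho * toC x)); last first.
  by rewrite /A cmM cmX cmM cm_tau mul1r /eabs mulrA.
rewrite [leRHS]mulrC ler_pM2l// mulr_gt0 ?eabs_gt0// exprn_gt0//; lra.
Qed.

End Assembly.

Theorem theorem1 (R : realType) (m : nat) (T : R) (nu : 'I_m.+1 -> R)
    (Q : R -> 'M[Cplx R]_m.+1) (T_gt0 : 0 < T)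
    (nu_noninc : forall p q : 'I_m.+1, (p <= q)%N -> nu q <= nu p)
    (nu_gt0 : forall q, 0 < nu q)
    (nu_notnat : forall q (n : nat), nu q != n%:R)
    (Q_int : forall i j, cintegrable `]0, T[
       (fun x => toC (x `^ (1 - 2 * nu ord0)) * Q x i j)) :
  let omega : 'M[Cplx R]_m.+1 :=
    diag_mx (\row_q toC (nu q ^+ 2 - 4^-1)) in
  let beta : R := Num.min 1 (2 * nu ord0) in
  exists2 rho0 : R, 0 < rho0 &
  forall rhos : R, rho0 <= rhos ->
  forall k0 : int, k0 = 0 \/ k0 = -1 ->
  let Omega := sector k0 rhos in
  exists Y1 Y2 : nat -> R -> Cplx R -> 'M[Cplx R]_m.+1,
  [/\ (* Y_k 1 is the x-derivative of Y_k 0 *)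
      forall (rho : Cplx R) (x : R), closure Omega rho -> x \in `]0, T] ->
        xderiv `]0, T] (fun t => Y1 0%N t rho) x (Y1 1%N x rho) /\
        xderiv `]0, T] (fun t => Y2 0%N t rho) x (Y2 1%N x rho),
      forall rho : Cplx R, closure Omega rho ->
        fundamental_system T omega Q (rho ^+ 2)
          (fun x => row_mx (Y1 0%N x rho) (Y2 0%N x rho)),
      (* (i_1) *)
      forall (x : R) (r : nat) (i j : 'I_m.+1), x \in `]0, T[ -> (r <= 1)%N ->
        [/\ analytic_on Omega (fun rho => Y1 r x rho i j),
            analytic_on Omega (fun rho => Y2 r x rho i j),
            {within closure Omega, continuous (fun rho => Y1 r x rho i j)} &
            {within closure Omega, continuous (fun rho => Y2 r x rho i j)}] &
      (* (i_2) *)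
      forall r : nat, (r <= 1)%N ->
        exp_asymptotics T beta (closure Omega) imunit Y1 r /\
        exp_asymptotics T beta (closure Omega) (- imunit) Y2 r].
Proof.
move=> omega beta.
have nule q : nu q <= nu ord0 by exact: nu_noninc.
have [rA HA] := jost_family_exists T_gt0 nu_gt0 nule Q_int.
(* The transposed potential satisfies the same hypothesis; its solutions serve to form
   Wronskians. *)
have QT_int i j : cintegrable `]0, T[ (fun x => toC (x `^ (1 - 2 * nu ord0)) * (Q x)^T i j).
  by have := Q_int j i; congr cintegrable; apply/funext => x; rewrite mxE.
have [rB HB] := jost_family_exists T_gt0 nu_gt0 nule QT_int.
pose r1 := Num.max rA rB.
have sub kap r' : r' <= r1 -> quarter kap r1 `<=` (quarter kap r' : set (Cplx R)).
  by move=> rr z [h1 h2 h3 h4]; split=> //; exact: le_trans h4.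
have [rA1 rB1] : rA <= r1 /\ rB <= r1 by rewrite !le_max !lexx orbT.
have /choice[y hy] : forall ks : bool * bool, exists y, jost T nu Q ks.2 (quarter ks.1 r1) y.
  by move=> [kap s]; have [y yP] := HA s kap; exists y; exact: jost_sub (sub kap _ rA1) yP.
have /choice[z hz] : forall ks : bool * bool, exists z,
    jost T nu (fun x => (Q x)^T) ks.2 (quarter ks.1 r1) z.
  by move=> [kap s]; have [z zP] := HB s kap; exists z; exact: jost_sub (sub kap _ rB1) zP.
have P1 kap r : quarter kap r1 r -> 1 <= cm r by move=> [].
(* The threshold for invertible Wronskians depends on the quarter plane; the final radius exceeds
   both values. *)
have /choice[r2 hr2] := fun kap => jost_wronskian T_gt0 (nu_gt0 ord0) (@P1 kap)
  (fun s => hy (kap, s)) (fun s => hz (kap, s)).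
exists (Num.max 1 (Num.max r1 (Num.max (r2 true) (r2 false)))); first by rewrite lt_max ltr01.
move=> rhos; rewrite !ge_max => /and4P[rhos1 rAB rt rf] k0 hk Omega.
have r1r : r1 <= rhos by rewrite ge_max.
pose kap := k0 == 0.
have OP : closure Omega `<=` quarter kap r1.
  by move=> rho /(closure_sector rhos1 r1r hk)[].
have Or2 rho : closure Omega rho -> r2 kap <= cm rho.
  move=> /(closure_sector rhos1 r1r hk)[_]; apply: le_trans.
  by case: (kap).
(* Solution number [j] becomes column [j]; [s = true] gives [Y1], with exponent [imunit], and
   [s = false] gives [Y2]. *)
pose Y s r x rho : 'M[Cplx R]_m.+1 := \matrix_(q, j) y (kap, s) rho j (r == 1%N, q) x.
exists (Y true), (Y false); split.
- move=> rho x /OP Prho xT.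
  have H s : xderiv `]0, T] (fun t => Y s 0%N t rho) x (Y s 1%N x rho).
    have [_ dx _ _] := hy (kap, s); apply: gd_xderiv => q j; rewrite /Y mxE.
    apply: (@gd_ext _ _ (@toC R) _ (y (kap, s) rho j (false, q))); [by move=> t _; rewrite mxE|by rewrite mxE|].
    have Xx : 0 < x /\ x <= T by move: xT; rewrite in_itv/= => /andP.
    by apply: gd_sub (dx rho j q x Prho Xx) => t /=; rewrite in_itv/= => /andP.
  by split.
- move=> rho cl; have Prho := OP _ cl.
  pose F (l : bool * 'I_m.+1) q := y (kap, l.1) rho l.2 (false, q).
  pose F1 (l : bool * 'I_m.+1) q := y (kap, l.1) rho l.2 (true, q).
  have Dx : `]0, T[%classic (T / 2) by rewrite /= in_itv/=; apply/andP; split; lra.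
  have sF l : solp T (fun q x => pot (toC (nu q ^+ 2 - 4^-1)) (toC x) - rho ^+ 2) Q (F l) (F1 l).
    by have [_ _ so _] := hy (kap, l.1); exact: so.
  have sG l : solp T (fun q x => pot (toC (nu q ^+ 2 - 4^-1)) (toC x) - rho ^+ 2)
      (fun x => (Q x)^T) (fun q => z (kap, l.1) rho l.2 (false, q)) (fun q => z (kap, l.1) rho l.2 (true, q)).
    by have [_ _ so _] := hz (kap, l.1); exact: so.
  have W0 := hr2 kap rho Prho (Or2 rho cl).
  (* Coefficients of the block row are re-indexed by sign and column, the index type of the
     Wronskian lemmas. *)
  have rowE (c : 'cV[Cplx R]_(m.+1 + m.+1)) x q :
      (row_mx (Y true 0%N x rho) (Y false 0%N x rho) *m c) q 0 =
      \sum_l (if l.1 then usubmx c l.2 0 else dsubmx c l.2 0) * F l q x.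
    rewrite -{1}[c]vsubmxK mul_row_col mxE sum_bool_pair /=.
    by congr (_ + _); rewrite mxE; apply: eq_bigr => j _; rewrite mxE mulrC.
  split.
  + move=> j; have [j' ->|j' ->] := split_ordP j; rewrite /omega.
      apply: (@solp_is_solution _ _ _ _ _ _ _ (fun x => \col_q F1 (true, j') q x)).
      have := sF (true, j'); congr (solp _ _ _ _ _); apply/funext => q; apply/funext => x.
        by rewrite colKl !mxE.
      by rewrite mxE.
    apply: (@solp_is_solution _ _ _ _ _ _ _ (fun x => \col_q F1 (false, j') q x)).
    have := sF (false, j'); congr (solp _ _ _ _ _); apply/funext => q; apply/funext => x.
      by rewrite colKr !mxE.
    by rewrite mxE.
  + move=> c Hc.
    have := fund_indep Dx sF W0 (c := fun l => if l.1 then usubmx c l.2 0 else dsubmx c l.2 0).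
    move=> H; have {}H : forall l, (if l.1 then usubmx c l.2 0 else dsubmx c l.2 0) = 0.
      by apply: H => x Dx' q; rewrite -rowE Hc// mxE.
    rewrite -[c]vsubmxK; apply/colP => i; have [j ->|j ->] := split_ordP i; rewrite ?col_mxEu ?col_mxEd [RHS]mxE ?ord1.
      exact: (H (true, j)).
    exact: (H (false, j)).
  + move=> u /is_solution_solp[u1 su].
    have [c hc] := fund_span Dx sF sG W0 su.
    exists (col_mx (\col_j c (true, j)) (\col_j c (false, j))) => x Dx'.
    apply/colP => q; rewrite (hc x Dx') rowE col_mxKu col_mxKd.
    by apply: eq_bigr => -[[] j] _; rewrite /= mxE.
- move=> x r i j xT r1'.
  have Xx : 0 < x /\ x <= T by move: xT; rewrite in_itv/= => /andP[-> /ltW].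
  have H s rho : quarter kap r1 rho -> exists L, gd id (quarter kap r1) (fun rho => Y s r x rho i j) rho L.
    move=> Pr; have [an _ _ _] := hy (kap, s); have [L hL] := an rho j (r == 1%N, i) x Pr Xx.
    by exists L; apply: gd_ext hL => [w _|]; rewrite mxE.
  have ana s : analytic_on Omega (fun rho => Y s r x rho i j).
    move=> rho Or; have [d d0 hd] := sector_nbhs rhos1 r1r hk Or.
    have Pr : quarter kap r1 rho by apply: hd; rewrite subrr cm0.
    by have [L hL] := H s rho Pr; apply: gd_derivable hL; exists d.
  have con s : {within closure Omega, continuous (fun rho => Y s r x rho i j)}.
    apply: gc_within_continuous => rho cl; apply: (gc_sub OP).
    by have [L hL] := H s rho (OP _ cl); exact: gd_gc hL.
  by split.
- move=> r r1'; have tt : tau true = imunit :> Cplx R by rewrite /tau /sgd mul1r.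
  have tf : tau false = - imunit :> Cplx R by rewrite /tau /sgd mulN1r.
  rewrite -{1}tt -tf; split.
    exact: jost_asymptotics (hy (kap, true)) OP r1'.
  exact: jost_asymptotics (hy (kap, false)) OP r1'.
Qed.
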